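(* Let $K$ be a field with $\mathrm{char}\,K\neq 2$ and let $\mathbb{G}$ be an algebraic supergroup over $K$. Consider the conditions: (a) $\mathbb{G}/\mathcal{Z}(\mathbb{G})_m$ is unipotent; (b) $\mathbb{G}$ fits into a central extension $1 \to F \to \mathbb{G} \to \mathbb{U} \to 1$ of a unipotent supergroup $\mathbb{U}$ by an algebraic group $F$ of multiplicative type; (c) $\mathbb{G}$ is nilpotent; (d) $\mathbb{G}_{ev}$ is nilpotent, and $\mathcal{Z}(\mathbb{G}_{ev})_m \subset \mathrm{Ker}\, \rho$, where $\rho : \mathbb{G}_{ev}\to \mathsf{GL}(V)$ is the linear representation associated with the right $\mathbb{G}_{ev}$-module $V=\mathrm{Lie}(\mathbb{G})_1$. Then (a) $\Rightarrow$ (b) $\Rightarrow$ (c) $\Rightarrow$ (d). If in addition $\mathbb{G}$ is connected, then the conditions (a)–(d) are equivalent to each other.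
   Context: ''Super'' means $\mathbb{Z}_2$-graded. $\mathsf{SAlg}_K$ is the category of super-commutative superalgebras over $K$. An affine supergroup $\mathbb{G}$ is a representable group-valued functor on $\mathsf{SAlg}_K$, represented by a super-commutative Hopf superalgebra $K[\mathbb{G}]$; it is an algebraic supergroup if $K[\mathbb{G}]$ is finitely generated. Affine groups (group schemes) $G$ are regarded as affine supergroups $R\mapsto G(R_0)$. $\mathbb{G}_{ev}$ is the affine group represented by $K[\mathbb{G}]/(K[\mathbb{G}]_1)$; it is a closed super-subgroup of $\mathbb{G}$. For a normal closed super-subgroup $\mathbb{N}$, $\mathbb{G}/\mathbb{N}$ is represented by the unique Hopf super-subalgebra $B\subset K[\mathbb{G}]$ with $K[\mathbb{G}]/B^+K[\mathbb{G}]=K[\mathbb{N}]$, $B^+=\mathrm{Ker}\,\varepsilon_B$. An affine supergroup is unipotent if its only simple supermodules are the trivial one-dimensional ones (on $K$, in either parity); equivalently, the coradical of the coalgebra $K[\mathbb{G}]$ is $K$. $\mathbb{G}$ is connected if $\mathbb{G}_{ev}$ is connected (equivalently, the largest finite-dimensional separable subalgebra of $K[\mathbb{G}]$ is $K$). The center $\mathcal{Z}(\mathbb{G})$ is the closed super-subgroup such that $\mathcal{Z}(\mathbb{G})(R)$ consists of the elements of $\mathbb{G}(R)$ whose image in $\mathbb{G}(S)$ is central for every morphism $R\to S$ in $\mathsf{SAlg}_K$. A closed super-subgroup $\mathbb{H}$ is central if $\mathbb{H}(R)$ is central in $\mathbb{G}(R)$ for all $R$; an extension is central if its kernel is. Define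 $\mathcal{Z}^1\mathbb{G}=\mathcal{Z}(\mathbb{G})$ and $\mathcal{Z}^r\mathbb{G}/\mathcal{Z}^{r-1}\mathbb{G}=\mathcal{Z}(\mathbb{G}/\mathcal{Z}^{r-1}\mathbb{G})$ for $r>1$; $\mathbb{G}$ is nilpotent if $\mathcal{Z}^r\mathbb{G}=\mathbb{G}$ for some $r$. An algebraic group is of multiplicative type if it becomes diagonalizable after base extension to the algebraic closure of $K$. Every abelian algebraic supergroup $\mathbb{H}$ includes a unique closed super-subgroup $F$ such that $F$ is an algebraic group of multiplicative type and $\mathbb{H}/F$ is unipotent; this $F$ is denoted $\mathbb{H}_m$. $\mathrm{Lie}(\mathbb{G})$ is the Lie superalgebra of $\mathbb{G}$, with canonical pairing $\langle\ ,\ \rangle:\mathrm{Lie}(\mathbb{G})\times K[\mathbb{G}]\to K$. The right $\mathbb{G}_{ev}$-module structure on $V=\mathrm{Lie}(\mathbb{G})_1$ (odd component) is determined by $\langle v^{\gamma}, a \rangle = \gamma^{-1}(\overline{a}_{(1)}) \langle v, a_{(2)}\rangle \gamma(\overline{a}_{(3)})$ for $v\in V$, $\gamma\in \mathbb{G}_{ev}(R)$ ($R$ a commutative algebra), $a\in K[\mathbb{G}]$, where $a\mapsto\overline{a}$ is the quotient map $K[\mathbb{G}]\to K[\mathbb{G}_{ev}]$ and Sweedler notation is used. *)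

(* Defs.v *)
From HB Require Import structures.
From mathcomp Require Import all_boot all_algebra generic_quotient.
From mathcomp Require Import boolp.

Set Implicit Arguments.
Unset Strict Implicit.
Unset Printing Implicit Defensive.

Import GRing.Theory.
Local Open Scope ring_scope.
Local Open Scope quotient_scope.

(* Tensor products of (possibly infinite-dimensional) K-vector spaces: finite  *)
(* formal sums of pairs, modulo agreement under every bilinear map.  The       *)
(* representative repr x : seq (U * V) of a tensor x is a Sweedler-style       *)
(* decomposition of x as a sum of pure tensors.                                *)

Fact linear_fun0 (K : fieldType) (U V : lmodType K) (f : U -> V) :
  linear f -> f 0 = 0.
Proof.
move=> lf; have : f (0 *: 0) = 0 *: f 0 by exact: (scalable_linear lf).
by rewrite !scale0r.
Qed.

Section Tensor.
Variables (K : fieldType) (U V : lmodType K).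

Definition bilin (W : lmodType K) (b : U -> V -> W) : Prop :=
  (forall v, linear (b^~ v)) /\ (forall u, linear (b u)).

Definition teval (W : lmodType K) (b : U -> V -> W) (s : seq (U * V)) : W :=
  \sum_(p <- s) b p.1 p.2.

Definition teq (s t : seq (U * V)) : bool :=
  `[< forall (W : lmodType K) (b : U -> V -> W), bilin b -> teval b s = teval b t >].

Fact teq_refl : reflexive teq.
Proof. by move=> s; apply/asboolP. Qed.

Fact teq_sym : symmetric teq.
Proof.
by move=> s t; apply/asboolP/asboolP => e W b /(e W b) ->.
Qed.

Fact teq_trans : transitive teq.
Proof.
move=> t s r /asboolP e1 /asboolP e2; apply/asboolP => W b bb.
by rewrite e1 // e2.
Qed.

Canonical teq_equiv := EquivRel teq teq_refl teq_sym teq_trans.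

Definition tens : Type := {eq_quot teq_equiv}.
HB.instance Definition _ := Choice.on tens.
HB.instance Definition _ := EqQuotient.on tens.

Definition tens_of (s : seq (U * V)) : tens := \pi_tens s.

Definition tlift (W : lmodType K) (b : U -> V -> W) (x : tens) : W :=
  teval b (repr x).

Definition pure (u : U) (v : V) : tens := tens_of [:: (u, v)].

Lemma tlift_of (W : lmodType K) (b : U -> V -> W) s :
  bilin b -> tlift b (tens_of s) = teval b s.
Proof.
move=> bb; have : tens_of (repr (tens_of s)) = tens_of s by rewrite /tens_of reprK.
by move=> /eqmodP /asboolP /(_ W b bb).
Qed.

Lemma tens_eqP (x y : tens) :
  (forall (W : lmodType K) (b : U -> V -> W), bilin b -> tlift b x = tlift b y) ->
  x = y.
Proof.
move=> e; rewrite -[x]reprK -[y]reprK; apply/eqmodP/asboolP => W b bb.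
exact: e.
Qed.

Definition tens_zero : tens := tens_of [::].
Definition tens_opp (x : tens) := tens_of [seq (- p.1, p.2) | p <- repr x].
Definition tens_add (x y : tens) := tens_of (repr x ++ repr y).
Definition tens_scale (c : K) (x : tens) :=
  tens_of [seq (c *: p.1, p.2) | p <- repr x].

Section Eval.
Variables (W : lmodType K) (b : U -> V -> W) (bb : bilin b).

Fact bilinZl c u v : b (c *: u) v = c *: b u v.
Proof. exact: (scalable_linear (bb.1 v)). Qed.

Fact bilinNl u v : b (- u) v = - b u v.
Proof. by rewrite -scaleN1r bilinZl scaleN1r. Qed.

Fact tlift_zero : tlift b tens_zero = 0.
Proof. by rewrite tlift_of // /teval big_nil. Qed.

Fact tlift_opp x : tlift b (tens_opp x) = - tlift b x.
Proof.
rewrite tlift_of // /teval big_map -sumrN.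
by apply: eq_bigr => p _; rewrite bilinNl.
Qed.

Fact tlift_add x y : tlift b (tens_add x y) = tlift b x + tlift b y.
Proof. by rewrite tlift_of // /teval big_cat. Qed.

Fact tlift_scale c x : tlift b (tens_scale c x) = c *: tlift b x.
Proof.
rewrite tlift_of // /teval big_map scaler_sumr.
by apply: eq_bigr => p _; rewrite bilinZl.
Qed.

End Eval.

Let tE := (tlift_zero, tlift_opp, tlift_add, tlift_scale).

Fact tens_addA : associative tens_add.
Proof. by move=> x y z; apply: tens_eqP => W b bb; rewrite !tE // addrA. Qed.
Fact tens_addC : commutative tens_add.
Proof. by move=> x y; apply: tens_eqP => W b bb; rewrite !tE // addrC. Qed.
Fact tens_add0 : left_id tens_zero tens_add.
Proof. by move=> x; apply: tens_eqP => W b bb; rewrite !tE // add0r. Qed.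
Fact tens_addN : left_inverse tens_zero tens_opp tens_add.
Proof. by move=> x; apply: tens_eqP => W b bb; rewrite !tE // addNr. Qed.

HB.instance Definition _ :=
  GRing.isZmodule.Build tens tens_addA tens_addC tens_add0 tens_addN.

Fact tens_scaleA c d x : tens_scale c (tens_scale d x) = tens_scale (c * d) x.
Proof. by apply: tens_eqP => W b bb; rewrite !tE // scalerA. Qed.
Fact tens_scale1 : left_id 1 tens_scale.
Proof. by move=> x; apply: tens_eqP => W b bb; rewrite !tE // scale1r. Qed.
Fact tens_scaleDr : right_distributive tens_scale +%R.
Proof. by move=> c x y; apply: tens_eqP => W b bb; rewrite !tE // scalerDr. Qed.
Fact tens_scaleDl x : {morph tens_scale^~ x : c d / c + d}.
Proof. by move=> c d; apply: tens_eqP => W b bb; rewrite !tE // scalerDl. Qed.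

HB.instance Definition _ := GRing.Zmodule_isLmodule.Build K tens
  tens_scaleA tens_scale1 tens_scaleDr tens_scaleDl.

Lemma tlift_linear (W : lmodType K) (b : U -> V -> W) :
  bilin b -> linear (tlift b).
Proof. by move=> bb c x y; rewrite tlift_add // tlift_scale. Qed.

Lemma tlift_pure (W : lmodType K) (b : U -> V -> W) u v :
  bilin b -> tlift b (pure u v) = b u v.
Proof. by move=> bb; rewrite tlift_of // /teval big_seq1. Qed.

Lemma pure_bilin : bilin pure.
Proof.
split=> [v c u u'|u c v v']; apply: tens_eqP => W b bb.
- by rewrite tlift_linear // !tlift_pure // bb.1.
- by rewrite tlift_linear // !tlift_pure // bb.2.
Qed.

Lemma tlift_id (x : tens) : tlift pure x = x.
Proof.
apply: tens_eqP => W b bb.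
suff e s : tlift b (teval pure s) = teval b s by exact: e.
elim: s => [|p s IH]; first by rewrite /teval !big_nil tlift_zero.
by rewrite /teval !big_cons tlift_add //; move: IH; rewrite /teval => ->; rewrite tlift_pure.
Qed.

Lemma tens_sumE (x : tens) : x = \sum_(p <- repr x) pure p.1 p.2.
Proof. by rewrite -{1}(tlift_id x). Qed.

Lemma tens_ext (W : lmodType K) (f g : tens -> W) :
  linear f -> linear g -> (forall u v, f (pure u v) = g (pure u v)) -> f =1 g.
Proof.
move=> lf lg e x; rewrite (tens_sumE x).
have f0 : f 0 = 0 by exact: linear_fun0.
have g0 : g 0 = 0 by exact: linear_fun0.
elim: (repr x) => [|p s IH]; first by rewrite big_nil f0 g0.
by rewrite big_cons -[pure _ _]scale1r lf lg IH e.
Qed.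

End Tensor.

Notation "u \ot v" := (pure u v) (at level 40, left associativity) : ring_scope.

Definition tmap (K : fieldType) (U V U' V' : lmodType K) (f : U -> U') (g : V -> V')
    (x : tens U V) : tens U' V' :=
  tlift (fun u v => f u \ot g v) x.

Fact tmap_bilin (K : fieldType) (U V U' V' : lmodType K) (f : U -> U') (g : V -> V') :
  linear f -> linear g -> bilin (fun u v => f u \ot g v).
Proof.
move=> lf lg; split=> [v c u u'|u c v v'].
- by rewrite lf (pure_bilin U' V').1.
- by rewrite lg (pure_bilin U' V').2.
Qed.

Fact tmap_comp (K : fieldType) (U V U1 V1 U2 V2 : lmodType K)
    (f : U -> U1) (g : V -> V1) (f' : U1 -> U2) (g' : V1 -> V2) :
  linear f -> linear g -> linear f' -> linear g' ->
  tmap f' g' \o tmap f g =1 tmap (f' \o f) (g' \o g).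
Proof.
move=> lf lg lf' lg'.
have lff : linear (f' \o f) by move=> c u v /=; rewrite lf lf'.
have lgg : linear (g' \o g) by move=> c u v /=; rewrite lg lg'.
have l1 := tlift_linear (tmap_bilin lf lg).
have l2 := tlift_linear (tmap_bilin lf' lg').
have l3 := tlift_linear (tmap_bilin lff lgg).
apply: tens_ext => [c x y|//|u v]; first by rewrite /tmap /= l1 l2.
by rewrite /tmap /= !tlift_pure //; exact: tmap_bilin.
Qed.

(* Superspaces.  A Z/2-grading is given by the two projections                 *)
(* hcomp false, hcomp true onto the even and the odd component.                *)

HB.mixin Record isSuperSpace (K : fieldType) V of GRing.Lmodule K V := {
  hcomp : bool -> V -> V;
  hcomp_linear : forall i, linear (hcomp i);
  hcomp_hcomp : forall i j v, hcomp i (hcomp j v) = if i == j then hcomp j v else 0;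
  hcomp_sum : forall v, hcomp false v + hcomp true v = v
}.

#[short(type="superSpaceType")]
HB.structure Definition SuperSpace (K : fieldType) :=
  {V of GRing.Lmodule K V & isSuperSpace K V}.

Section TensorSuper.
Variables (K : fieldType) (U V : superSpaceType K).

Definition tens_hcomp (i : bool) (x : tens U V) : tens U V :=
  tlift (fun u v => hcomp false u \ot hcomp i v + hcomp true u \ot hcomp (~~ i) v) x.

Fact tens_hcomp_bilin i : bilin
  (fun (u : U) (v : V) => hcomp false u \ot hcomp i v + hcomp true u \ot hcomp (~~ i) v).
Proof.
split=> [v c u u'|u c v v'].
- rewrite !hcomp_linear !(pure_bilin U V).1 scalerDr.
  by rewrite addrACA.
- rewrite !hcomp_linear !(pure_bilin U V).2 scalerDr.
  by rewrite addrACA.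
Qed.

Fact tens_hcomp_linear i : linear (tens_hcomp i).
Proof. exact: tlift_linear (tens_hcomp_bilin i). Qed.

Fact pure0l (v : V) : (0 : U) \ot v = 0.
Proof. exact: linear_fun0 ((pure_bilin U V).1 v). Qed.

Fact pure0r (u : U) : u \ot (0 : V) = 0.
Proof. exact: linear_fun0 ((pure_bilin U V).2 u). Qed.

Fact tens_hcomp_pure i u v : tens_hcomp i (u \ot v) =
  hcomp false u \ot hcomp i v + hcomp true u \ot hcomp (~~ i) v.
Proof. exact: tlift_pure (tens_hcomp_bilin i). Qed.

Fact tens_hcompD i x y : tens_hcomp i (x + y) = tens_hcomp i x + tens_hcomp i y.
Proof. by rewrite -[x]scale1r tens_hcomp_linear !scale1r. Qed.

Fact tens_hcomp_hcomp i j x :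
  tens_hcomp i (tens_hcomp j x) = if i == j then tens_hcomp j x else 0.
Proof.
move: x; apply: tens_ext => [c x y|c x y|u v].
- by rewrite !tens_hcomp_linear.
- by case: ifP; rewrite ?tens_hcomp_linear // scaler0 addr0.
rewrite !tens_hcomp_pure tens_hcompD !tens_hcomp_pure !hcomp_hcomp.
by case: i; case: j; rewrite /= ?pure0l ?pure0r ?addr0 ?add0r.
Qed.

Fact tens_hcomp_sum x : tens_hcomp false x + tens_hcomp true x = x.
Proof.
move: x; apply: tens_ext => [c x y|c x y|u v] //.
- by rewrite !tens_hcomp_linear scalerDr addrACA.
rewrite !tens_hcomp_pure /= addrACA [X in _ + X]addrC.
have linD (w : U) (x y : V) : w \ot x + w \ot y = w \ot (x + y).
  by rewrite -[x in RHS]scale1r (pure_bilin U V).2 scale1r.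
rewrite !linD !hcomp_sum.
have -> : hcomp false u \ot v + hcomp true u \ot v
    = (hcomp false u + hcomp true u) \ot v.
  by rewrite -[X in (X + _) \ot _]scale1r (pure_bilin U V).1 scale1r.
by rewrite hcomp_sum.
Qed.

HB.instance Definition _ := isSuperSpace.Build K (tens U V)
  tens_hcomp_linear tens_hcomp_hcomp tens_hcomp_sum.

End TensorSuper.

(* The objects of SAlg_K: super-commutative superalgebras.  As algType, these  *)
(* exclude the zero algebra, at which every supergroup takes the value 1.      *)

HB.mixin Record isSuperComAlgebra (K : fieldType) A
    of SuperSpace K A & GRing.Algebra K A := {
  hcomp1 : hcomp false (1 : A) = 1;
  hcompM : forall i j (a b : A),
    hcomp (i (+) j) (hcomp i a * hcomp j b) = hcomp i a * hcomp j b;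
  supercomm : forall i j (a b : A),
    hcomp i a * hcomp j b = (-1) ^+ (i && j) * (hcomp j b * hcomp i a)
}.

#[short(type="superAlgType")]
HB.structure Definition SuperComAlgebra (K : fieldType) :=
  {A of SuperSpace K A & GRing.Algebra K A & isSuperComAlgebra K A}.

Record superhom (K : fieldType) (A R : superAlgType K) := SuperHom {
  shom :> {lrmorphism A -> R};
  shom_even : forall i a, shom (hcomp i a) = hcomp i (shom a)
}.

Fact superhom_comp_even (K : fieldType) (A B C : superAlgType K)
    (g : superhom B C) (f : superhom A B) i a :
  (g \o f) (hcomp i a) = hcomp i ((g \o f) a).
Proof. by rewrite /= !shom_even. Qed.

Definition superhom_comp (K : fieldType) (A B C : superAlgType K)
    (g : superhom B C) (f : superhom A B) : superhom A C :=
  @SuperHom _ _ _ (g \o f : {lrmorphism A -> C}) (superhom_comp_even g f).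

Definition purely_even (K : fieldType) (V : superSpaceType K) : Prop :=
  forall v : V, hcomp true v = 0.

(* The product (a \ot b)(c \ot d) = (-1)^(|b||c|) ac \ot bd of A \ot A.        *)
Definition tmul (K : fieldType) (A : superAlgType K) (x y : tens A A) : tens A A :=
  tlift (fun a b : A => tlift (fun c d : A =>
    \sum_(i : bool) \sum_(j : bool)
      (-1) ^+ (i && j) *: ((a * hcomp j c) \ot (hcomp i b * d))) y) x.

(* Affine supergroups.  An affine supergroup G is given by its coordinate      *)
(* algebra, a super-commutative Hopf superalgebra; the elements of the         *)
(* carrier are those of K[G], and superhom G R is G(R).                        *)

HB.mixin Record isSuperHopf (K : fieldType) A of SuperComAlgebra K A := {
  comul : A -> tens A A;
  counit : A -> K;
  antipode : A -> A;
  comul_linear : linear comul;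
  counit_linear : scalar counit;
  antipode_linear : linear antipode;
  comul_even : forall i (a : A), comul (hcomp i a) = hcomp i (comul a);
  counit_even : forall a : A, counit (hcomp true a) = 0;
  antipode_even : forall i (a : A), antipode (hcomp i a) = hcomp i (antipode a);
  comul1 : comul 1 = 1 \ot 1;
  comulM : forall a b : A, comul (a * b) = tmul (comul a) (comul b);
  counit1 : counit 1 = 1;
  counitM : forall a b : A, counit (a * b) = counit a * counit b;
  comulA : forall a : A,
    tlift (fun x c => tlift (fun u v => u \ot (v \ot c)) (comul x)) (comul a)
    = tlift (fun x y => x \ot comul y) (comul a);
  counitl : forall a : A, tlift (fun x y => counit x *: y) (comul a) = a;
  counitr : forall a : A, tlift (fun x y => counit y *: x) (comul a) = a;
  antipodel : forall a : A, tlift (fun x y => antipode x * y) (comul a) = counit a *: 1;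
  antipoder : forall a : A, tlift (fun x y => x * antipode y) (comul a) = counit a *: 1
}.

#[short(type="supergroupType")]
HB.structure Definition SuperHopf (K : fieldType) :=
  {A of SuperComAlgebra K A & isSuperHopf K A}.

(* Group law of G(R): (f g)(a) = f(a_(1)) g(a_(2)); the inverse of g in G(R)   *)
(* is g \o antipode.                                                           *)
Definition conv (K : fieldType) (G : supergroupType K) (R : superAlgType K)
    (f g : G -> R) (a : G) : R :=
  tlift (fun x y : G => f x * g y) (comul a).

Definition hopf_hom (K : fieldType) (A B : supergroupType K) (f : superhom A B) : Prop :=
  (forall a, comul (f a) = tmap f f (comul a)) /\
  (forall a, counit (f a) = counit a).

Definition algebraic (K : fieldType) (G : supergroupType K) : Prop :=
  exists s : seq G, forall P : G -> Prop,
    (forall a, a \in s -> P a) -> P 1 ->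
    (forall a b, P a -> P b -> P (a + b)) ->
    (forall a b, P a -> P b -> P (a * b)) ->
    (forall c a, P a -> P (c *: a)) ->
    forall a, P a.

Record closedSub (K : fieldType) (G : supergroupType K) := ClosedSub {
  csub :> supergroupType K;
  cres : superhom G csub;
  cres_hopf : hopf_hom cres;
  cres_surj : forall b : csub, exists a : G, cres a = b
}.
Arguments cres {K G} c.

Section SubTrans.
Variables (K : fieldType) (G : supergroupType K) (H : closedSub G) (N : closedSub H).

Let r := superhom_comp (cres N) (cres H).

Fact sub_trans_hopf : hopf_hom r.
Proof.
split=> a /=; last by rewrite (cres_hopf N).2 (cres_hopf H).2.
rewrite (cres_hopf N).1 (cres_hopf H).1.
by apply: tmap_comp => c x y; rewrite linearP.
Qed.

Fact sub_trans_surj (b : N) : exists a : G, r a = b.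
Proof.
have [h <-] := cres_surj b; have [a <-] := cres_surj h.
by exists a.
Qed.

Definition sub_trans : closedSub G := ClosedSub sub_trans_hopf sub_trans_surj.
End SubTrans.

(* f : K[G] -> R, seen as an element of G(R), lies in the subgroup N(R).       *)
Definition pt_in (K : fieldType) (G : supergroupType K) (N : closedSub G)
    (R : superAlgType K) (f : G -> R) : Prop :=
  exists n : superhom N R, forall a, f a = n (cres N a).

Definition central_pt (K : fieldType) (G : supergroupType K)
    (R : superAlgType K) (g : superhom G R) : Prop :=
  forall (S : superAlgType K) (f : superhom R S) (h : superhom G S) (a : G),
    conv (f \o g) h a = conv h (f \o g) a.

Definition is_center (K : fieldType) (G : supergroupType K) (Z : closedSub G) : Prop :=
  forall (R : superAlgType K) (g : superhom G R), pt_in Z g <-> central_pt g.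

Definition central_sub (K : fieldType) (G : supergroupType K) (N : closedSub G) : Prop :=
  forall (R : superAlgType K) (n g : superhom G R), pt_in N n ->
    forall a, conv n g a = conv g n a.

Definition normal_sub (K : fieldType) (G : supergroupType K) (N : closedSub G) : Prop :=
  forall (R : superAlgType K) (n g : superhom G R), pt_in N n ->
    pt_in N (conv (conv g n) (g \o antipode)).

(* The quotient G/N: a Hopf super-subalgebra B of K[G], embedded by qinc, with *)
(* K[G]/B^+K[G] = K[N].                                                        *)
Record quotBy (K : fieldType) (G : supergroupType K) (N : closedSub G) := QuotBy {
  qgrp :> supergroupType K;
  qinc : superhom qgrp G;
  qinc_hopf : hopf_hom qinc;
  qinc_inj : injective qinc;
  qinc_normal : normal_sub N;
  qinc_ker : forall a : G, cres N a = 0 <->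
    exists s : seq (qgrp * G),
      (forall p, p \in s -> counit p.1 = 0) /\ a = \sum_(p <- s) qinc p.1 * p.2
}.
Arguments qinc {K G N} q.

Definition sub_le (K : fieldType) (G : supergroupType K) (N M : closedSub G) : Prop :=
  forall a, cres M a = 0 -> cres N a = 0.

(* upper_center r M : M = Z^r G.  In the second rule, M/N is the closed        *)
(* super-subgroup of Q = G/N whose coordinate algebra is the image of K[Q] in  *)
(* K[M]; it is required to be the center C of Q.                               *)
Inductive upper_center (K : fieldType) (G : supergroupType K) :
    nat -> closedSub G -> Prop :=
| upper_center1 (Z : closedSub G) : is_center Z -> upper_center 1 Z
| upper_centerS (r : nat) (N M : closedSub G) (Q : quotBy N) (C : closedSub Q) :
    upper_center r N -> is_center C -> sub_le N M ->
    (forall q : Q, cres M (qinc Q q) = 0 <-> cres C q = 0) ->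
    upper_center r.+1 M.

Definition nilpotent (K : fieldType) (G : supergroupType K) : Prop :=
  exists (r : nat) (Z : closedSub G), upper_center r Z /\ injective (cres Z).

(* E = G_ev: the kernel of K[G] -> K[E] is the ideal (K[G]_1).                 *)
Definition is_even_part (K : fieldType) (G : supergroupType K) (E : closedSub G) : Prop :=
  forall a : G, cres E a = 0 <->
    exists s : seq (G * G), a = \sum_(p <- s) p.1 * hcomp true p.2.

Definition prime_ideal (A : nzRingType) (P : A -> Prop) : Prop :=
  [/\ P 0, (forall a b, P a -> P b -> P (a + b)), (forall a b, P b -> P (a * b)),
      ~ P 1 & (forall a b, P (a * b) -> P a \/ P b)].

Definition in_zero_locus (A : nzRingType) (S P : A -> Prop) : Prop :=
  forall a, S a -> P a.

(* Spec A is a connected topological space (A commutative): if the closed      *)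
(* sets V(S) and V(T) are disjoint and cover Spec A, one of them is Spec A.    *)
Definition spec_connected (A : nzRingType) : Prop :=
  forall S T : A -> Prop,
    (forall P, prime_ideal P -> in_zero_locus S P \/ in_zero_locus T P) ->
    (forall P, prime_ideal P -> ~ (in_zero_locus S P /\ in_zero_locus T P)) ->
    (forall P, prime_ideal P -> in_zero_locus S P) \/
    (forall P, prime_ideal P -> in_zero_locus T P).

Definition connected (K : fieldType) (G : supergroupType K) : Prop :=
  exists E : closedSub G, is_even_part E /\ spec_connected E.

(* G-supermodules are right K[G]-supercomodules.                               *)
Record supermodule (K : fieldType) (G : supergroupType K) := SuperModule {
  sm_space :> superSpaceType K;
  coact : sm_space -> tens sm_space G;
  coact_linear : linear coact;
  coact_even : forall i m, coact (hcomp i m) = hcomp i (coact m);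
  coactA : forall m,
    tlift (fun x c => tlift (fun u v => u \ot (v \ot c)) (coact x)) (coact m)
    = tmap id comul (coact m);
  coact1 : forall m, tlift (fun x c => counit c *: x) (coact m) = m
}.

Definition is_subsupermodule (K : fieldType) (G : supergroupType K)
    (M : supermodule G) (P : M -> Prop) : Prop :=
  [/\ P 0, (forall c x y, P x -> P y -> P (c *: x + y)),
      (forall i x, P x -> P (hcomp i x)) &
      (forall x, P x -> exists s : seq (M * G),
         (forall p, p \in s -> P p.1) /\ coact x = \sum_(p <- s) p.1 \ot p.2)].

Definition simple_supermodule (K : fieldType) (G : supergroupType K)
    (M : supermodule G) : Prop :=
  (exists m : M, m != 0) /\
  (forall P : M -> Prop, is_subsupermodule P ->
     (forall m, P m -> m = 0) \/ (forall m, P m)).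

(* One-dimensional (hence purely even or purely odd), with trivial coaction.   *)
Definition trivial_1dim (K : fieldType) (G : supergroupType K)
    (M : supermodule G) : Prop :=
  (exists2 e : M, e != 0 & forall m, exists c : K, m = c *: e) /\
  (forall m : M, coact m = m \ot 1).

Definition unipotent (K : fieldType) (G : supergroupType K) : Prop :=
  forall M : supermodule G, simple_supermodule M -> trivial_1dim M.

Definition algebraic_closure (K L : fieldType) (iota : {rmorphism K -> L}) : Prop :=
  GRing.closed_field_axiom L /\ forall x : L, algebraicOver iota x.

(* j exhibits the L-Hopf superalgebra B as L \ot_K A; the last conjunct is the *)
(* universal property of extension of scalars.                                 *)
Definition base_extension (K L : fieldType) (iota : {rmorphism K -> L})
    (A : supergroupType K) (B : supergroupType L) (j : {rmorphism A -> B}) : Prop :=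
  [/\ (forall c a, j (c *: a) = iota c *: j a),
      (forall i a, j (hcomp i a) = hcomp i (j a)),
      (forall a, comul (j a) = \sum_(p <- repr (comul a)) j p.1 \ot j p.2),
      (forall a, counit (j a) = iota (counit a)) &
      (forall (W : lmodType L) (f : A -> W),
         (forall c a b, f (c *: a + b) = iota c *: f a + f b) ->
         exists2 h : {linear B -> W}, (forall a, h (j a) = f a) &
           forall h' : {linear B -> W}, (forall a, h' (j a) = f a) -> h' =1 h)].

Definition grouplike (K : fieldType) (G : supergroupType K) (g : G) : Prop :=
  comul g = g \ot g /\ counit g = 1.

Definition diagonalizable (K : fieldType) (G : supergroupType K) : Prop :=
  forall a : G, exists s : seq (K * G),
    (forall p, p \in s -> grouplike p.2) /\ a = \sum_(p <- s) p.1 *: p.2.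

(* F is an algebraic group that becomes diagonalizable over L.                 *)
Definition mult_type (K L : fieldType) (iota : {rmorphism K -> L})
    (F : supergroupType K) : Prop :=
  [/\ purely_even F, algebraic F &
      exists (B : supergroupType L) (j : {rmorphism F -> B}),
        base_extension iota j /\ diagonalizable B].

(* F = H_m, for H abelian.                                                     *)
Definition is_mult_part (K L : fieldType) (iota : {rmorphism K -> L})
    (H : supergroupType K) (F : closedSub H) : Prop :=
  mult_type iota F /\ exists Q : quotBy F, unipotent Q.

(* The odd component of Lie(G): odd counit-derivations.  The sign              *)
(* (-1)^(|v||a|) of the super Leibniz rule may be dropped, as the counit       *)
(* vanishes on odd elements.                                                   *)
Definition lie_odd (K : fieldType) (G : supergroupType K) (v : G -> K) : Prop :=
  [/\ scalar v, (forall a, v (hcomp false a) = 0) &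
      (forall a b, v (a * b) = v a * counit b + counit a * v b)].

(* <v^g, a> = g^-1(a_(1)) <v, a_(2)> g(a_(3)), for g in E(R), E = G_ev.        *)
Definition ad_pairing (K : fieldType) (G : supergroupType K) (E : closedSub G)
    (R : superAlgType K) (g : superhom E R) (v : G -> K) (a : G) : R :=
  tlift (fun x y : G => tlift (fun u w : G =>
    v u *: (g (antipode (cres E x)) * g (cres E w))) (comul y)) (comul a).

(* g in (Ker rho)(R): v^g = v \ot 1 in V \ot R for all v, where V \ot R embeds *)
(* into Hom_K(K[G], R) through the pairing.                                    *)
Definition in_ker_rho (K : fieldType) (G : supergroupType K) (E : closedSub G)
    (R : superAlgType K) (g : superhom E R) : Prop :=
  forall v : G -> K, lie_odd v -> forall a : G, ad_pairing g v a = v a *: 1.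

Definition sub_ker_rho (K : fieldType) (G : supergroupType K) (E : closedSub G)
    (F : closedSub E) : Prop :=
  forall (R : superAlgType K) (g : superhom E R),
    purely_even R -> pt_in F g -> in_ker_rho g.

Section Conditions.
Variables (K L : fieldType) (iota : {rmorphism K -> L}) (G : supergroupType K).

Definition cond_a : Prop :=
  exists (Z : closedSub G) (F : closedSub Z),
    [/\ is_center Z, is_mult_part iota F &
        exists Q : quotBy (sub_trans F), unipotent Q].

Definition cond_b : Prop :=
  exists (F : closedSub G) (U : quotBy F),
    [/\ mult_type iota F, central_sub F & unipotent U].

Definition cond_c : Prop := nilpotent G.

Definition cond_d : Prop :=
  exists E : closedSub G,
    [/\ is_even_part E, nilpotent E &
        exists (Z : closedSub E) (F : closedSub Z),
          [/\ is_center Z, is_mult_part iota F & sub_ker_rho (sub_trans F)]].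

End Conditions.

(* Main.v *)
Require Import Defs.
From HB Require Import structures.
From mathcomp Require Import all_boot all_algebra generic_quotient.
From mathcomp Require Import boolp classical_sets ring.

Set Implicit Arguments.
Unset Strict Implicit.
Unset Printing Implicit Defensive.

Import GRing.Theory.
Local Open Scope ring_scope.
Local Open Scope quotient_scope.

(** Two notions carry the proof. A function on a supergroup is conilpotent ([conil]) if finitely
    many contractions of its coproduct by functionals vanishing at 1 annihilate it. A supergroup is
    unipotent exactly when all its functions are conilpotent ([unipotent_conil], [conil_unipotent]),
    while on a group of multiplicative type only the scalars are ([mult_conil]). Hence a unipotent
    action of a group of multiplicative type is trivial, and this rigidity is used again and again.

    Nilpotency is handled by commutator chains ([nil_chain]): sets of functions Y_0, ..., Y_r whose
    zero loci satisfy [V(Y_(j+1)), G] inside V(Y_j), with V(Y_0) trivial. By [upper_center_chain]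
    and [nil_chain_nilpotent] they amount to the upper central series. The comparison rests on two
    consequences of faithful flatness, proved directly for a Hopf super-subalgebra B of a noetherian
    K[G]: the intersection of M with B^+ K[G] is B^+ M ([ff_ideal]), and functions that are
    invariant modulo B^+ K[G] lie in B ([ff_coset]).

    (a) => (b): a super-subgroup of the center is central. (b) => (c): K[G] is noetherian
    ([hilbert_basis]), so the ideal of F is generated by finitely many functions, which involve
    finitely many functions on U, all in one stage of the conilpotency filtration of K[U]. A
    commutator gains one stage ([pcomm_conil]), so the stages form a chain. (c) => (d): restricted
    to E = G_ev, the chain shows that E is nilpotent. It also shows that conjugation is unipotent on
    the cotangent space K[G]^+ / (K[G]^+)^2 ([chX_filt]). The group Z(E)_m exists by a Jordan
    decomposition over the algebraic closure ([grouplike_decomp], [mult_part_exists]); it acts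
    trivially on this space, hence on V ([ad_trivial]).

    Now let G be connected, assume (d) and put F = Z(E)_m. First, E/F is unipotent
    ([mult_coinv_conil]): nilpotency makes the adjoint action on K[E]/m^k unipotent, m being the
    augmentation ideal, and connectedness makes the intersection of the m^k vanish ([krull]), which
    gives the unipotency of E/Z(E); that of Z(E)/F is part of the definition of F. Second, F is
    central in G ([stepA]): it acts trivially on K[E] and on V, and odd derivations detect the
    powers of the ideal I generated by the odd functions ([dagger]), so F acts unipotently on all
    I^k / I^(k+1); as I is nilpotent, it acts unipotently on K[G], hence trivially. Third, G/F is
    unipotent ([engel]): in a nonzero module E fixes a nonzero vector, and the odd derivations,
    which anticommute and have square zero on E-fixed vectors, are made to annihilate one, one
    derivation at a time. Finally, averaging over F ([integrals], [ker_mult]) shows that F is the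
    kernel of G -> G/F. The functions on G/F, restricted to Z(G), show that Z(G)/F is unipotent as
    well; so F = Z(G)_m and (a) holds. *)

Definition mklin (K : fieldType) (U V : lmodType K) (f : U -> V) (hf : linear f) :
  {linear U -> V} := HB.pack f (GRing.isLinear.Build K U V *:%R f hf).

Definition mkscal (K : fieldType) (U : lmodType K) (f : U -> K) (hf : scalar f) :
  {scalar U} := HB.pack f (GRing.isLinear.Build K U K *%R f hf).

(** * Linear algebra: subspaces, spans and separation by functionals *)

Definition subspace (K : fieldType) (V : lmodType K) (P : V -> Prop) : Prop :=
  P 0 /\ forall c x y, P x -> P y -> P (c *: x + y).

Section Subspaces.
Variables (K : fieldType) (V : lmodType K).
Implicit Types (P Q : V -> Prop).

Lemma subspaceD P x y : subspace P -> P x -> P y -> P (x + y).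
Proof. by move=> [_ h] px py; rewrite -[x]scale1r; apply: h. Qed.

Lemma subspaceZ P c x : subspace P -> P x -> P (c *: x).
Proof. by move=> [h0 h] px; rewrite -[c *: x]addr0; apply: h. Qed.

Lemma subspaceN P x : subspace P -> P x -> P (- x).
Proof. by move=> h px; rewrite -scaleN1r; apply: subspaceZ. Qed.

Lemma subspaceB P x y : subspace P -> P x -> P y -> P (x - y).
Proof. by move=> h px py; apply: subspaceD => //; apply: subspaceN. Qed.

Lemma subspaceBr P x y : subspace P -> P y -> P (x - y) -> P x.
Proof. by move=> h py pxy; rewrite -(subrK y x); apply: subspaceD. Qed.

Lemma subspace_sum P (I : Type) (r : seq I) (D : pred I) (F : I -> V) : subspace P ->
  (forall i, D i -> P (F i)) -> P (\sum_(i <- r | D i) F i).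
Proof.
move=> h hF; elim/big_ind: _ => //; first exact: h.1.
by move=> x y; apply: subspaceD.
Qed.

Lemma subspace_sum_seq P (I : eqType) (r : seq I) (F : I -> V) : subspace P ->
  (forall i, i \in r -> P (F i)) -> P (\sum_(i <- r) F i).
Proof. by move=> h hF; rewrite big_seq; apply: subspace_sum. Qed.

Definition spn P (s : seq V) (x : V) : Prop :=
  exists p (c : nat -> K), P p /\ x = p + \sum_(i < size s) c i *: s`_i.

Lemma spn_subspace P s : subspace P -> subspace (spn P s).
Proof.
move=> h; split.
  exists 0, (fun=> 0); split; first exact: h.1.
  by rewrite big1 ?addr0 // => i _; rewrite scale0r.
move=> c x y [p [a [pp ->]]] [q [b [pq ->]]].
exists (c *: p + q), (fun i => c * a i + b i); split; first exact: h.2.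
rewrite scalerDr addrACA; congr (_ + _).
rewrite scaler_sumr -big_split; apply: eq_bigr => i _.
by rewrite /= scalerDl scalerA.
Qed.

Lemma spn_nil P x : subspace P -> spn P [::] x <-> P x.
Proof.
move=> h; split=> [[p [c [pp ->]]]|px]; first by rewrite big_ord0 addr0.
by exists x, (fun=> 0); rewrite big_ord0 addr0.
Qed.

Lemma spn_cons P y s x : spn P (y :: s) x <-> exists c, spn P s (x - c *: y).
Proof.
split=> [[p [c [pp ->]]]|[c [p [a [pp e]]]]].
  exists (c 0%N), p, (fun i => c i.+1); split=> //.
  by rewrite big_ord_recl /= addrCA [LHS]addrC addKr.
exists p, (fun i => if i is j.+1 then a j else c); split=> //.
by rewrite big_ord_recl /= addrCA -e addrC subrK.
Qed.

Lemma spn_in P s x : subspace P -> x \in s -> spn P s x.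
Proof.
move=> h; elim: s => //= y s IH; rewrite inE => /orP[/eqP ->|/IH e].
  by apply/spn_cons; exists 1; rewrite scale1r subrr; case: (spn_subspace s h).
by apply/spn_cons; exists 0; rewrite scale0r subr0.
Qed.

Lemma spn_base P s x : P x -> spn P s x.
Proof.
move=> px; exists x, (fun=> 0); split=> //.
by rewrite big1 ?addr0 // => i _; rewrite scale0r.
Qed.

Lemma spn_le P Q s x : subspace Q -> (forall x, P x -> Q x) ->
  (forall y, y \in s -> Q y) -> spn P s x -> Q x.
Proof.
move=> hQ pq sq [p [c [pp ->]]]; apply: subspaceD => //; first exact: pq.
by apply: subspace_sum => // i _; apply: subspaceZ => //; apply/sq/mem_nth.
Qed.

(* Extends to P a subspace that avoids v and is maximal with this property. *)
Lemma separation P v : subspace P -> ~ P v ->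
  exists f : {scalar V}, (forall x, P x -> f x = 0) /\ f v = 1.
Proof.
move=> hP nPv.
pose good (A : set V) := A = set0 \/ [/\ subspace A, P `<=` A & ~ A v]%classic.
have [F Fgood Ftot|M [Mgood Mmax]] := @Zorn_bigcup V good.
  have [[A [FA /eqP/set0P [a Aa]]]|h] :=
      pselect (exists A, F A /\ A <> set0); last first.
    left; apply/seteqP; split=> // x [A FA Ax].
    by case: h; exists A; split=> // A0; rewrite A0 in Ax.
  have gF B : F B -> B <> set0 -> [/\ subspace B, P `<=` B & ~ B v]%classic.
    by move=> /Fgood [] // ->.
  have [sA PA nAv] : [/\ subspace A, P `<=` A & ~ A v]%classic.
    by apply: gF => // A0; rewrite A0 in Aa.
  right; split.
  - split; first by exists A => //; exact: sA.1.
    move=> c x y [B FB Bx] [C FC Cy].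
    have [sB _ _] : [/\ subspace B, P `<=` B & ~ B v]%classic.
      by apply: gF => // B0; rewrite B0 in Bx.
    have [sC _ _] : [/\ subspace C, P `<=` C & ~ C v]%classic.
      by apply: gF => // C0; rewrite C0 in Cy.
    case: (Ftot B C FB FC) => BC.
      by exists C => //; apply: sC.2 => //; apply: BC.
    by exists B => //; apply: sB.2 => //; apply: BC.
  - by move=> x Px; exists A => //; apply: PA.
  - move=> [B FB Bv]; have [_ _] : [/\ subspace B, P `<=` B & ~ B v]%classic.
      by apply: gF => // B0; rewrite B0 in Bv.
    by [].
have [M0|[sM PM nMv]] := Mgood.
  exfalso; apply: (Mmax P); last by right; split.
  rewrite M0; split; first by move=> x [].
  by move=> /(_ 0 hP.1).
have dec x : exists c, M (x - c *: v).
  have [Mx|nMx] := pselect (M x); first by exists 0; rewrite scale0r subr0.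
  pose N := [set y | spn M [:: x] y]%classic.
  have sN : subspace N by exact: spn_subspace.
  have : spn M [:: x] v.
    apply: contrapT => nNv; apply: (Mmax N).
      split; first by move=> y My; exact: spn_base.
      by move=> /(_ x) h; apply: nMx; apply: h; apply: spn_in => //; rewrite inE.
    by right; split=> // y Py; apply/spn_base/PM.
  move=> /spn_cons[c /(spn_nil _ sM) Mc].
  have c0 : c != 0 by apply/eqP => c0; rewrite c0 scale0r subr0 in Mc.
  exists c^-1; rewrite -[X in M X]opprK opprB; apply: subspaceN => //.
  rewrite -[x in X in M X](scalerK c0) -scalerBr; exact: subspaceZ.
pose f x := projT1 (cid (dec x)).
have fP x : M (x - f x *: v) by rewrite /f; case: cid.
have fu x c : M (x - c *: v) -> f x = c.
  move=> Mc; apply/eqP/contraT; rewrite -subr_eq0 => d0; exfalso; apply: nMv.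
  rewrite -[v](scalerK d0); apply: subspaceZ => //.
  rewrite scalerBl -[X in M X]opprK; apply: subspaceN => //.
  by rewrite opprB -(subrKA x) -opprB addrC; apply: subspaceB.
have lf : scalar f.
  move=> a x y; apply: fu.
  rewrite scalerDl opprD -scalerA addrACA -scalerBr.
  exact: sM.2.
exists (mkscal lf); split=> [x Px|] /=; apply: fu.
  by rewrite scale0r subr0; apply: PM.
by rewrite scale1r subrr; exact: sM.1.
Qed.

Lemma separation0 v : v != 0 -> exists f : {scalar V}, f v = 1.
Proof.
move=> v0; have [||f [_ fv]] := @separation (fun x => x = 0) v; last by exists f.
- by split=> // c x y -> ->; rewrite scaler0 addr0.
- exact/eqP.
Qed.

(** Every subspace is an intersection of hyperplanes. Membership is from here on tested against the
    functionals that vanish on the subspace. *)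
Lemma subspace_dual P x : subspace P ->
  (forall f : {scalar V}, (forall y, P y -> f y = 0) -> f x = 0) -> P x.
Proof.
move=> hP h; apply: contrapT => nPx; have [f [fP fx]] := separation hP nPx.
by move: (h f fP) => /eqP; rewrite fx oner_eq0.
Qed.

Lemma dual_eq x y : (forall f : {scalar V}, f x = f y) -> x = y.
Proof.
move=> h; apply/eqP; rewrite -subr_eq0; apply/contraT => /separation0 [f].
by rewrite linearB /= h subrr => /esym/eqP; rewrite oner_eq0.
Qed.

(** A substitute for dimension: the length of a spanning list modulo [P]. Induct on the list, adding
    its head [x] to both [P] and [S]. If [x] lies in [S], it joins the generators; otherwise the
    generators found are moved into [S] by multiples of [x], and the list has lost an entry, so
    equal lengths force [S] to be everything. *)
Lemma subspace_span P S t : subspace P -> subspace S ->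
  (forall x, P x -> S x) -> (forall x, S x -> spn P t x) ->
  exists t', [/\ (size t' <= size t)%N, (forall x, S x <-> spn P t' x) &
     size t' = size t -> forall x, spn P t x -> S x].
Proof.
elim: t P S => [|x t IH] P S hP hS PS Sspan.
  exists [::]; split=> // [y|_ y]; last by move=> /spn_nil - /(_ hP); apply: PS.
  split=> [/Sspan //|]; by move=> /spn_nil - /(_ hP); apply: PS.
pose P1 := spn P [:: x]; have hP1 : subspace P1 by exact: spn_subspace.
pose S1 := spn S [:: x]; have hS1 : subspace S1 by exact: spn_subspace.
have PS1 y : P1 y -> S1 y.
  by move=> /spn_cons[c /(spn_nil _ hP)/PS h]; apply/spn_cons; exists c; apply/spn_nil.
have S1span y : S1 y -> spn P1 t y.
  move=> /spn_cons[c /(spn_nil _ hS)/Sspan/spn_cons[d [p [a [pp e]]]]].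
  exists (p + (c + d) *: x), a; split.
    by apply/spn_cons; exists (c + d); apply/spn_nil => //; rewrite addrK.
  by rewrite addrAC -e -[y - _ - _]addrA -opprD scalerDl subrK.
have [t' [st' S1E eqt']] := IH _ _ hP1 hS1 PS1 S1span.
have [Sx|nSx] := pselect (S x).
  have SE y : S y <-> spn P (x :: t') y.
    have -> : S y <-> S1 y.
      split=> [Sy|/spn_cons[c /(spn_nil _ hS) Sy]]; first exact: spn_base.
      by apply: subspaceBr Sy => //; apply: subspaceZ.
    rewrite S1E spn_cons; split.
      move=> [p [a [/spn_cons[c /(spn_nil _ hP) pc] ->]]].
      by exists c, (p - c *: x), a; split=> //; rewrite addrAC.
    move=> [c [p [a [pp e]]]]; exists (p + c *: x), a; split.
      by apply/spn_cons; exists c; apply/spn_nil => //; rewrite addrK.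
    by rewrite addrAC -e subrK.
  exists (x :: t'); split=> //= -[/eqt' h] y ySp.
  have : S1 y.
    apply: h; move: ySp; rewrite spn_cons => -[c [p [a [pp e]]]].
    exists (p + c *: x), a; split.
      by apply/spn_cons; exists c; apply/spn_nil => //; rewrite addrK.
    by rewrite addrAC -e subrK.
  by move=> /spn_cons[c /(spn_nil _ hS) Sy]; apply: subspaceBr Sy => //; apply: subspaceZ.
have adj y : exists c, y \in t' -> S (y - c *: x).
  have [yt|] := boolP (y \in t'); last by exists 0.
  have /spn_cons[c /(spn_nil _ hS) h] : S1 y by apply/S1E/spn_in.
  by exists c.
have [c cP] := choice adj.
pose t2 := [seq y - c y *: x | y <- t'].
have t2S y : y \in t2 -> S y by move=> /mapP[z zt ->]; apply: cP.
have st2 : size t2 = size t' by rewrite size_map.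
exists t2; split; first by rewrite st2 /= ltnW.
  move=> y; split=> [Sy|]; last exact: spn_le.
  have /S1E [p [a [/spn_cons[d /(spn_nil _ hP) Pd] e]]] : S1 y by exact: spn_base.
  have e2 : \sum_(i < size t') a i *: t'`_i =
     \sum_(i < size t2) a i *: t2`_i + (\sum_(i < size t') a i * c t'`_i) *: x.
    rewrite st2 scaler_suml -big_split; apply: eq_bigr => i _ /=.
    by rewrite (nth_map 0) // scalerBr scalerA subrK.
  pose q := d + \sum_(i < size t') a i * c t'`_i.
  have e3 : y = (p - d *: x) + \sum_(i < size t2) a i *: t2`_i + q *: x.
    by rewrite e e2 /q scalerDl addrACA subrK.
  (* The coefficient [q] of [x] must vanish: every other term lies in [S], and [x] does not. *)
  suff q0 : q = 0 by exists (p - d *: x), a; rewrite {1}e3 q0 scale0r addr0.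
  apply/eqP/contraT => q0; exfalso; apply: nSx; rewrite -[x](scalerK q0).
  apply: subspaceZ => //.
  have -> : q *: x = y - ((p - d *: x) + \sum_(i < size t2) a i *: t2`_i).
    by rewrite {1}e3 addrAC subrr add0r.
  apply: subspaceB => //; apply: subspaceD => //; first exact: PS.
  by apply: subspace_sum => // i _; apply: subspaceZ => //; apply: t2S; exact: mem_nth.
by move=> e; move: st'; rewrite -st2 e /= ltnn.
Qed.

End Subspaces.

(** Separate the image of [Ker f] from the image of a vector where [f] takes the value 1. *)
Lemma scalar_extend (K : fieldType) (U V : lmodType K) (i : {linear U -> V})
    (f : {scalar U}) : injective i -> exists g : {scalar V}, forall u, g (i u) = f u.
Proof.
move=> inji.
have [[u fu]|h] := pselect (exists u, f u <> 0); last first.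
  have l0 : scalar (fun _ : V => 0 : K) by move=> c x y; rewrite mulr0 addr0.
  exists (mkscal l0) => u /=; apply/esym; apply: contrapT => n; by case: h; exists u.
pose P y := exists2 x, f x = 0 & y = i x.
have hP : subspace P.
  split; first by exists 0; rewrite linear0.
  move=> c _ _ [x fx ->] [y fy ->]; exists (c *: x + y); last by rewrite linearP.
  by rewrite linearP /= fx fy mulr0 addr0.
pose u1 := (f u)^-1 *: u.
have fu1 : f u1 = 1 by rewrite linearZ /= mulVf //; apply/eqP.
have nP : ~ P (i u1).
  by move=> [x fx /inji e]; move: fu1; rewrite e fx => /esym/eqP; rewrite oner_eq0.
have [g [gP gv]] := separation hP nP.
exists g => w.
have : g (i (w - f w *: u1)) = 0.
  by apply: gP; eexists; last by []; rewrite linearB linearZ /= fu1 mulr1 subrr.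
rewrite (linearB i) (linearB g) (linearZ_LR i) /= scalarZ gv mulr1 => /eqP.
by rewrite subr_eq0 => /eqP.
Qed.

(** * Tensors and their contractions by functionals *)

Section TensorKit.
Variables (K : fieldType).

Section Two.
Variables (U V : lmodType K).

Lemma pureDl (u u' : U) (v : V) : (u + u') \ot v = u \ot v + u' \ot v.
Proof. by rewrite -{1}[u]scale1r (pure_bilin U V).1 scale1r. Qed.
Lemma pureDr (u : U) (v v' : V) : u \ot (v + v') = u \ot v + u \ot v'.
Proof. by rewrite -{1}[v]scale1r (pure_bilin U V).2 scale1r. Qed.
Lemma pureZl c (u : U) (v : V) : (c *: u) \ot v = c *: (u \ot v).
Proof. exact: (scalable_linear ((pure_bilin U V).1 v)). Qed.
Lemma pureZr c (u : U) (v : V) : u \ot (c *: v) = c *: (u \ot v).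
Proof. exact: (scalable_linear ((pure_bilin U V).2 u)). Qed.
Lemma pure0l (v : V) : (0 : U) \ot v = 0.
Proof. by rewrite -(scale0r (0 : U)) pureZl scale0r. Qed.
Lemma pure0r (u : U) : u \ot (0 : V) = 0.
Proof. by rewrite -(scale0r (0 : V)) pureZr scale0r. Qed.
Lemma pureNr (u : U) (v : V) : u \ot (- v) = - (u \ot v).
Proof. by rewrite -scaleN1r pureZr scaleN1r. Qed.
Lemma pureBr (u : U) (v v' : V) : u \ot (v - v') = u \ot v - u \ot v'.
Proof. by rewrite pureDr pureNr. Qed.
Lemma pure_suml (I : Type) (r : seq I) (D : pred I) (F : I -> U) (v : V) :
  (\sum_(i <- r | D i) F i) \ot v = \sum_(i <- r | D i) F i \ot v.
Proof. by elim/big_rec2: _ => [|i x y _ <-]; rewrite ?pure0l ?pureDl. Qed.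
Lemma pure_sumr (I : Type) (r : seq I) (D : pred I) (u : U) (F : I -> V) :
  u \ot (\sum_(i <- r | D i) F i) = \sum_(i <- r | D i) u \ot F i.
Proof. by elim/big_rec2: _ => [|i x y _ <-]; rewrite ?pure0r ?pureDr. Qed.

Lemma tens_ind (P : tens U V -> Prop) :
  P 0 -> (forall u v x, P x -> P (u \ot v + x)) -> forall x, P x.
Proof.
move=> P0 PD x; rewrite (tens_sumE x); elim: (repr x) => [|p s IH].
  by rewrite big_nil.
by rewrite big_cons; apply: PD.
Qed.

Lemma tensP (W : lmodType K) (f g : {linear tens U V -> W}) :
  (forall u v, f (u \ot v) = g (u \ot v)) -> f =1 g.
Proof.
move=> h; elim/tens_ind => [|u v x IH]; first by rewrite !linear0.
by rewrite !linearD h IH.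
Qed.

Lemma tlift_sum (W : lmodType K) (b : U -> V -> W) (hb : bilin b) (s : seq (U * V)) :
  tlift b (\sum_(p <- s) p.1 \ot p.2) = \sum_(p <- s) b p.1 p.2.
Proof.
elim: s => [|p s IH]; rewrite ?big_nil ?big_cons.
  exact: (linear_fun0 (tlift_linear hb)).
by rewrite tlift_add // tlift_pure // IH.
Qed.

Lemma tlift_comp (W W' : lmodType K) (f : {linear W -> W'}) (b : U -> V -> W) x :
  f (tlift b x) = tlift (fun u v => f (b u v)) x.
Proof. by rewrite /tlift /teval linear_sum. Qed.

Lemma eq_tlift (W : lmodType K) (b b' : U -> V -> W) x :
  (forall u v, b u v = b' u v) -> tlift b x = tlift b' x.
Proof. by move=> e; apply: eq_bigr => p _; rewrite e. Qed.

Lemma bilinP (W : lmodType K) (b : U -> V -> W) :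
  (forall v, linear (b^~ v)) -> (forall u, linear (b u)) -> bilin b.
Proof. by split. Qed.

(** Contraction of the right leg by a functional; [cl] contracts the left leg. Contractions replace
    bases: they detect equality of tensors ([tens_crP]) and membership in a product of subspaces
    ([tens_memlr]). *)
Definition cr (f : V -> K) (x : tens U V) : U := tlift (fun u v => f v *: u) x.
Definition cl (f : U -> K) (x : tens U V) : V := tlift (fun u v => f u *: v) x.

Lemma cr_bilin (f : {scalar V}) : bilin (fun (u : U) (v : V) => f v *: u).
Proof.
split=> [v c x y|u c x y]; first by rewrite scalerDr !scalerA mulrC.
by rewrite linearP scalerDl scalerA.
Qed.
Lemma cl_bilin (f : {scalar U}) : bilin (fun (u : U) (v : V) => f u *: v).
Proof.
split=> [v c x y|u c x y]; last by rewrite scalerDr !scalerA mulrC.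
by rewrite linearP scalerDl scalerA.
Qed.
HB.instance Definition _ (f : {scalar V}) :=
  GRing.isLinear.Build K (tens U V) U *:%R (cr f) (tlift_linear (cr_bilin f)).
HB.instance Definition _ (f : {scalar U}) :=
  GRing.isLinear.Build K (tens U V) V *:%R (cl f) (tlift_linear (cl_bilin f)).
Lemma cr_pure (f : {scalar V}) (u : U) (v : V) : cr f (u \ot v) = f v *: u.
Proof. by rewrite /cr tlift_pure //; exact: cr_bilin. Qed.
Lemma cl_pure (f : {scalar U}) (u : U) (v : V) : cl f (u \ot v) = f u *: v.
Proof. by rewrite /cl tlift_pure //; exact: cl_bilin. Qed.
(** Both sides pair the tensor with f \ot g. This exchange turns statements on right contractions
    into statements on left ones. *)
Lemma cl_cr (f : {scalar U}) (g : {scalar V}) x : f (cr g x) = g (cl f x).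
Proof.
elim/tens_ind: x => [|u v x IH]; first by rewrite !linear0.
by rewrite !linearD /= IH cr_pure cl_pure !linearZ /= mulrC.
Qed.

End Two.

Section Mem.
Variables (U V : lmodType K).

(** Induct on the number of terms. If the first right leg depends linearly on the others, the term
    is absorbed into them. Otherwise a functional is 1 on it and 0 on the others, and the
    contraction by this functional puts its left leg into [P]. *)
Lemma tens_mem2 (P : U -> Prop) (Q : V -> Prop) (s : seq (U * V)) :
  subspace P -> subspace Q -> (forall p, p \in s -> Q p.2) ->
  (forall f : {scalar V}, P (cr f (\sum_(p <- s) p.1 \ot p.2))) ->
  exists2 t : seq (U * V), (forall p, p \in t -> P p.1 /\ Q p.2) &
    \sum_(p <- s) p.1 \ot p.2 = \sum_(p <- t) p.1 \ot p.2.
Proof.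
move=> hP hQ; have [n] := ubnP (size s); elim: n s => // n IH [|[u v] s] /= sn sQ sP.
  by exists [::].
pose Z := spn (fun x : V => x = 0) [seq p.2 | p <- s].
have h0 : subspace (fun x : V => x = 0) by split=> // c x y -> ->; rewrite scaler0 addr0.
have [/= [z [c [-> e]]]|nZ] := pselect (Z v).
  pose t := [seq ((s`_i).1 + c i *: u, (s`_i).2) | i <- iota 0 (size s)].
  have e2 : \sum_(p <- (u, v) :: s) p.1 \ot p.2 = \sum_(p <- t) p.1 \ot p.2.
    rewrite big_cons big_map /= e add0r size_map pure_sumr.
    have -> : iota 0 (size s) = index_iota 0 (size s) by rewrite /index_iota subn0.
    rewrite (big_nth 0) !big_mkord.
    rewrite -big_split; apply: eq_bigr => i _ /=.
    by rewrite (nth_map 0) // pureDl pureZl pureZr addrC.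
  rewrite e2; apply: IH.
  - by rewrite size_map size_iota.
  - move=> p /mapP[i]; rewrite mem_iota add0n => /= si -> /=; apply: sQ.
    by rewrite inE mem_nth ?orbT.
  - by move=> f; rewrite -e2.
have [f [f0 fv]] := separation (spn_subspace _ h0) nZ.
have Pu : P u.
  have := sP f; rewrite big_cons linearD /= cr_pure fv scale1r linear_sum /=.
  rewrite big_seq big1 ?addr0 // => p ps.
  by rewrite cr_pure f0 ?scale0r //; apply: spn_in => //; apply: map_f.
have [||g|t tP e] := IH s.
- by [].
- by move=> p ps; apply: sQ; rewrite inE ps orbT.
- have := sP g; rewrite big_cons linearD /= cr_pure => h.
  have -> : cr g (\sum_(p <- s) p.1 \ot p.2) =
     (g v *: u + cr g (\sum_(p <- s) p.1 \ot p.2)) - g v *: u by rewrite addrAC subrr add0r.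
  by apply: subspaceB => //; apply: subspaceZ.
exists ((u, v) :: t); last by rewrite !big_cons e.
move=> p; rewrite inE => /orP[/eqP ->|/tP //]; split=> //.
by apply: (sQ (u, v)); rewrite mem_head.
Qed.

Lemma tens_meml (P : U -> Prop) (x : tens U V) : subspace P ->
  (forall f : {scalar V}, P (cr f x)) ->
  exists2 t : seq (U * V), (forall p, p \in t -> P p.1) & x = \sum_(p <- t) p.1 \ot p.2.
Proof.
move=> hP; rewrite (tens_sumE x) => h.
have [||t tP e] := @tens_mem2 P (fun=> True) (repr x) hP _ _ h => //.
by exists t => // p /tP [].
Qed.

End Mem.

Section Swap.
Variables (U V : lmodType K).

Definition tsw (x : tens U V) : tens V U := tlift (fun u v => v \ot u) x.
Lemma tsw_bilin : bilin (fun (u : U) (v : V) => v \ot u).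
Proof. by split=> [v c x y|u c x y]; rewrite ?pureDr ?pureZr ?pureDl ?pureZl. Qed.
HB.instance Definition _ := GRing.isLinear.Build K (tens U V) (tens V U) *:%R tsw
  (tlift_linear tsw_bilin).
Lemma tsw_pure u v : tsw (u \ot v) = v \ot u.
Proof. by rewrite /tsw tlift_pure //; exact: tsw_bilin. Qed.
Lemma cr_tsw (f : {scalar U}) x : cr f (tsw x) = cl f x.
Proof.
elim/tens_ind: x => [|u v x IH]; rewrite ?linear0 // !linearD /= IH.
by rewrite tsw_pure cr_pure cl_pure.
Qed.
End Swap.

Lemma tswK (U V : lmodType K) (x : tens U V) : tsw (tsw x) = x.
Proof.
elim/tens_ind: x => [|u v x IH]; rewrite ?linear0 // !linearD /= IH.
by rewrite !tsw_pure.
Qed.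

Section Mem'.
Variables (U V : lmodType K).

Lemma tens_cr0 (x : tens U V) : (forall f : {scalar V}, cr f x = 0) -> x = 0.
Proof.
move=> h; have [|t t0 ->] := @tens_meml _ _ (fun u => u = 0) x _ h.
  by split=> // c u v -> ->; rewrite scaler0 addr0.
by rewrite big_seq big1 // => p /t0 ->; rewrite pure0l.
Qed.

Lemma tens_cl0 (x : tens U V) : (forall f : {scalar U}, cl f x = 0) -> x = 0.
Proof.
move=> h; apply: tens_cr0 => g; apply: dual_eq => f.
by rewrite cl_cr h !linear0.
Qed.

Lemma tens_crP (x y : tens U V) : (forall f : {scalar V}, cr f x = cr f y) -> x = y.
Proof.
move=> h; apply/eqP; rewrite -subr_eq0; apply/eqP/tens_cr0 => f.
by rewrite linearB /= h subrr.
Qed.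

Lemma tens_clP (x y : tens U V) : (forall f : {scalar U}, cl f x = cl f y) -> x = y.
Proof.
move=> h; apply/eqP; rewrite -subr_eq0; apply/eqP/tens_cl0 => f.
by rewrite linearB /= h subrr.
Qed.

Lemma tens_memr (Q : V -> Prop) (x : tens U V) : subspace Q ->
  (forall f : {scalar U}, Q (cl f x)) ->
  exists2 t : seq (U * V), (forall p, p \in t -> Q p.2) & x = \sum_(p <- t) p.1 \ot p.2.
Proof.
move=> hQ xQ; have [|t tQ e] := @tens_meml _ _ Q (tsw x) hQ.
  by move=> f; rewrite cr_tsw.
exists [seq (p.2, p.1) | p <- t]; first by move=> p /mapP[q /tQ ? ->].
rewrite -(tswK x) e linear_sum big_map; apply: eq_bigr => p _.
by rewrite /= tsw_pure.
Qed.

(** First the right legs are brought into [Q]; [tens_mem2] then moves the left legs into [P] while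
    staying in [Q]. *)
Lemma tens_memlr (P : U -> Prop) (Q : V -> Prop) (x : tens U V) :
  subspace P -> subspace Q ->
  (forall f : {scalar V}, P (cr f x)) -> (forall f : {scalar U}, Q (cl f x)) ->
  exists2 t : seq (U * V), (forall p, p \in t -> P p.1 /\ Q p.2) &
     x = \sum_(p <- t) p.1 \ot p.2.
Proof.
move=> hP hQ xP xQ.
have [s sQ e] := tens_memr hQ xQ.
by move: xP; rewrite e => xP; exact: tens_mem2.
Qed.

End Mem'.
End TensorKit.

HB.instance Definition _ (K : fieldType) (V : superSpaceType K) (i : bool) :=
  GRing.isLinear.Build K V V *:%R (hcomp i) (hcomp_linear i).

(** * Homogeneous elements and sign rules *)

Section Homog.
Variables (K : fieldType).

Definition homog (V : superSpaceType K) (i : bool) (v : V) : Prop := hcomp i v = v.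

Lemma homog_hcomp (V : superSpaceType K) i (v : V) : homog i (hcomp i v).
Proof. by rewrite /homog hcomp_hcomp eqxx. Qed.

Lemma homog_neq (V : superSpaceType K) i j (v : V) : homog i v -> i != j -> hcomp j v = 0.
Proof. by move=> <- /negPf ij; rewrite hcomp_hcomp eq_sym ij. Qed.

Lemma hcomp_sum' (V : superSpaceType K) i (v : V) : hcomp i v + hcomp (~~ i) v = v.
Proof. by case: i => /=; rewrite ?[hcomp true _ + _]addrC hcomp_sum. Qed.

Lemma homogM (A : superAlgType K) i j (a b : A) :
  homog i a -> homog j b -> homog (i (+) j) (a * b).
Proof. by move=> <- <-; rewrite /homog hcompM. Qed.

Lemma homogC (A : superAlgType K) i j (a b : A) :
  homog i a -> homog j b -> a * b = (-1) ^+ (i && j) * (b * a).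
Proof. by move=> <- <-; rewrite -supercomm. Qed.

Lemma hcompMl (A : superAlgType K) i j (a b : A) : homog i a ->
  hcomp j (a * b) = a * hcomp (i (+) j) b.
Proof.
move=> ha; rewrite -{1}(hcomp_sum' (i (+) j) b) mulrDr linearD /=.
have h1 : homog j (a * hcomp (i (+) j) b).
  by have := homogM ha (homog_hcomp (i (+) j) b); rewrite addbA addbb.
have h2 : homog (~~ j) (a * hcomp (~~ (i (+) j)) b).
  have := homogM ha (homog_hcomp (~~ (i (+) j)) b).
  by rewrite -[~~ (i (+) j)]addbT !addbA addbb addbT.
by rewrite h1 (homog_neq h2) ?addr0 //; case: (j).
Qed.

Lemma hcompMr (A : superAlgType K) i j (a b : A) : homog j b ->
  hcomp i (a * b) = hcomp (i (+) j) a * b.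
Proof.
move=> hb; rewrite -{1}(hcomp_sum' (i (+) j) a) mulrDl linearD /=.
have h1 : homog i (hcomp (i (+) j) a * b).
  by have := homogM (homog_hcomp (i (+) j) a) hb; rewrite -addbA addbb addbF.
have h2 : homog (~~ i) (hcomp (~~ (i (+) j)) a * b).
  have := homogM (homog_hcomp (~~ (i (+) j)) a) hb.
  by rewrite -[~~ (i (+) j)]addTb -!addbA addbb addbF addTb.
by rewrite h1 (homog_neq h2) ?addr0 //; case: (i).
Qed.

Lemma homog1 (A : superAlgType K) : homog false (1 : A).
Proof. exact: hcomp1. Qed.

Lemma signZ (A : superAlgType K) (b : bool) (a : A) : (-1) ^+ b * a = (-1) ^+ b *: a.
Proof. by rewrite -mulr_algl -in_algE rmorphXn rmorphN1. Qed.

Lemma homogZC (A : superAlgType K) i j (a b : A) :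
  homog i a -> homog j b -> a * b = (-1) ^+ (i && j) *: (b * a).
Proof. by move=> ha hb; rewrite (homogC ha hb) signZ. Qed.

(** A pure tensor is the sum of four with homogeneous legs, so sign rules need checking only
    there. *)
Lemma tens_hind (U V : superSpaceType K) (P : tens U V -> Prop) :
  P 0 -> (forall i j u v x, homog i u -> homog j v -> P x -> P (u \ot v + x)) ->
  forall x, P x.
Proof.
move=> P0 PD; apply: tens_ind => // u v x Px.
rewrite -(hcomp_sum u) -(hcomp_sum v) !pureDl !pureDr -!addrA.
by do 4 (apply: (PD); [exact: homog_hcomp|exact: homog_hcomp|]).
Qed.

Lemma hcomp_pure (U V : superSpaceType K) i (u : U) (v : V) :
  hcomp i (u \ot v) = hcomp false u \ot hcomp i v + hcomp true u \ot hcomp (~~ i) v.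
Proof. exact: tens_hcomp_pure. Qed.

Lemma homog_pure (U V : superSpaceType K) i j (u : U) (v : V) :
  homog i u -> homog j v -> homog (i (+) j) (u \ot v).
Proof.
rewrite /homog hcomp_pure => <- <-; rewrite !hcomp_hcomp.
by case: i; case: j; rewrite /= ?pure0l ?pure0r ?addr0 ?add0r.
Qed.

End Homog.

(** * The superalgebra structure of a tensor product *)

Section SMul.
Variables (K : fieldType) (A B : superAlgType K).

(** The sign rule of [tmul] for two different factors. For equal factors it is convertible to
    [tmul], so the Hopf axioms become statements about the ring product. *)
Definition smul (x y : tens A B) : tens A B :=
  tlift (fun a b => tlift (fun c d =>
    \sum_(i : bool) \sum_(j : bool)
      (-1) ^+ (i && j) *: ((a * hcomp j c) \ot (hcomp i b * d))) y) x.

Let smul0 (a : A) (b : B) (c : A) (d : B) : tens A B :=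
  \sum_(i : bool) \sum_(j : bool)
      (-1) ^+ (i && j) *: ((a * hcomp j c) \ot (hcomp i b * d)).

Let smul0_bl a b : bilin (smul0 a b).
Proof.
split=> [d k c c'|c k d d'].
- rewrite /smul0 scaler_sumr -big_split; apply: eq_bigr => i _ /=.
  rewrite scaler_sumr -big_split; apply: eq_bigr => j _ /=.
  by rewrite linearP mulrDr -scalerAr pureDl pureZl scalerDr !scalerA mulrC.
- rewrite /smul0 scaler_sumr -big_split; apply: eq_bigr => i _ /=.
  rewrite scaler_sumr -big_split; apply: eq_bigr => j _ /=.
  by rewrite mulrDr -scalerAr pureDr pureZr scalerDr !scalerA mulrC.
Qed.

Let smul0_br y : bilin (fun a b => tlift (smul0 a b) y).
Proof.
split=> [b k a a'|a k b b']; elim/tens_ind: y => [|c d y IH].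
- by rewrite !(linear_fun0 (tlift_linear (smul0_bl _ _))) scaler0 addr0.
- rewrite !tlift_add ?IH ?tlift_pure; try exact: smul0_bl.
  rewrite !scalerDr addrACA; congr (_ + _).
  rewrite /smul0 scaler_sumr -big_split; apply: eq_bigr => i _ /=.
  rewrite scaler_sumr -big_split; apply: eq_bigr => j _ /=.
  by rewrite mulrDl -scalerAl pureDl pureZl scalerDr !scalerA mulrC.
- by rewrite !(linear_fun0 (tlift_linear (smul0_bl _ _))) scaler0 addr0.
- rewrite !tlift_add ?IH ?tlift_pure; try exact: smul0_bl.
  rewrite !scalerDr addrACA; congr (_ + _).
  rewrite /smul0 scaler_sumr -big_split; apply: eq_bigr => i _ /=.
  rewrite scaler_sumr -big_split; apply: eq_bigr => j _ /=.
  by rewrite linearP mulrDl -scalerAl pureDr pureZr scalerDr !scalerA mulrC.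
Qed.

Lemma smul_linl y : linear (smul^~ y).
Proof. exact: tlift_linear (smul0_br y). Qed.

Lemma smul_linr x : linear (smul x).
Proof.
elim/tens_ind: x => [|a b x IH] k y y'.
  by rewrite !(linear_fun0 (smul_linl _)) scaler0 addr0.
have e z : smul (a \ot b + x) z = tlift (smul0 a b) z + smul x z.
  by rewrite -[a \ot b]scale1r smul_linl scale1r /smul tlift_pure //; exact: smul0_br.
by rewrite !e IH (tlift_linear (smul0_bl a b)) scalerDr addrACA.
Qed.

Lemma smul_pure a b c d : smul (a \ot b) (c \ot d) =
  \sum_(i : bool) \sum_(j : bool) (-1) ^+ (i && j) *: ((a * hcomp j c) \ot (hcomp i b * d)).
Proof.
rewrite /smul tlift_pure; last exact: smul0_br.
by rewrite tlift_pure //; exact: smul0_bl.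
Qed.

Lemma smul_hom i j a b c d : homog i b -> homog j c ->
  smul (a \ot b) (c \ot d) = (-1) ^+ (i && j) *: ((a * c) \ot (b * d)).
Proof.
move=> hb hc; rewrite smul_pure (bigD1 i) //= (bigD1 j) //= hb hc.
rewrite [X in _ + X + _]big1 => [|k kj]; last first.
  by rewrite (homog_neq hc) 1?eq_sym // mulr0 pure0l scaler0.
rewrite big1 ?addr0 // => k ki; rewrite big1 // => l _.
by rewrite (homog_neq hb) 1?eq_sym // mul0r pure0r scaler0.
Qed.

Lemma smulDl : left_distributive smul +%R.
Proof. by move=> x y z; rewrite -[x]scale1r smul_linl !scale1r. Qed.
Lemma smulDr : right_distributive smul +%R.
Proof. by move=> z x y; rewrite -[x]scale1r smul_linr !scale1r. Qed.
Lemma smulZl k x y : k *: smul x y = smul (k *: x) y.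
Proof. by rewrite (scalable_linear (smul_linl y)). Qed.
Lemma smulZr k x y : k *: smul x y = smul x (k *: y).
Proof. by rewrite (scalable_linear (smul_linr x)). Qed.
Lemma smul0l y : smul 0 y = 0. Proof. exact: linear_fun0 (smul_linl y). Qed.
Lemma smul0r y : smul y 0 = 0. Proof. exact: linear_fun0 (smul_linr y). Qed.

Lemma smul1l : left_id (1 \ot 1) smul.
Proof.
elim/tens_hind => [|i j u v x hu hv IH]; first by rewrite smul0r.
by rewrite smulDr IH (smul_hom _ _ (homog1 _) hu) /= !mul1r scale1r.
Qed.

Lemma smul1r : right_id (1 \ot 1) smul.
Proof.
elim/tens_hind => [|i j u v x hu hv IH]; first by rewrite smul0l.
by rewrite smulDl IH (smul_hom _ _ hv (homog1 _)) andbF !mulr1 scale1r.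
Qed.

Lemma smulA : associative smul.
Proof.
elim/tens_hind => [|i j a b x ha hb IH] y z; first by rewrite !smul0l.
rewrite !smulDl -IH; congr (_ + _).
elim/tens_hind: y z => [|k l c d y hc hd IHy] z; first by rewrite !(smul0l, smul0r).
rewrite !(smulDl, smulDr) IHy; congr (_ + _).
elim/tens_hind: z => [|m n e f z he hf IHz]; first by rewrite !(smul0l, smul0r).
rewrite !smulDr IHz; congr (_ + _).
rewrite (smul_hom _ _ hd he) (smul_hom _ _ hb hc) -smulZl -smulZr.
rewrite (smul_hom _ _ hb (homogM hc he)) (smul_hom _ _ (homogM hb hd) he).
rewrite !scalerA -!signr_addb !mulrA; congr (_ ^+ _ *: _).
by case: (j); case: (k); case: (l); case: (m).
Qed.

Lemma smul_neq0 : (1 \ot 1 : tens A B) != 0.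
Proof.
have [f f1] := separation0 (oner_neq0 A).
have [g g1] := separation0 (oner_neq0 B).
apply/eqP => /(congr1 (cr g)); rewrite cr_pure g1 scale1r linear0 => /eqP.
by rewrite oner_eq0.
Qed.

HB.instance Definition _ := GRing.Zmodule_isNzRing.Build (tens A B)
  smulA smul1l smul1r smulDl smulDr smul_neq0.
HB.instance Definition _ := GRing.Lmodule_isLalgebra.Build K (tens A B) smulZl.
HB.instance Definition _ := GRing.Lalgebra_isAlgebra.Build K (tens A B) smulZr.

Lemma tensM_hom i j (a : A) (b : B) (c : A) (d : B) : homog i b -> homog j c ->
  (a \ot b) * (c \ot d) = (-1) ^+ (i && j) *: ((a * c) \ot (b * d)).
Proof. exact: smul_hom. Qed.

Lemma tens_one : (1 : tens A B) = 1 \ot 1. Proof. by []. Qed.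

Fact tens_hcomp1 : hcomp false (1 : tens A B) = 1.
Proof. exact: (homog_pure (homog1 A) (homog1 B)). Qed.

Lemma homog_tens_ind i (P : tens A B -> Prop) : P 0 ->
  (forall j u v x, homog j u -> homog (i (+) j) v -> P x -> P (u \ot v + x)) ->
  forall x, homog i x -> P x.
Proof.
move=> P0 PD x <-; elim/tens_ind: x => [|u v x IH]; first by rewrite linear0.
rewrite linearD /= hcomp_pure -addrA; apply: (PD); first exact: homog_hcomp.
  by rewrite addbF; exact: homog_hcomp.
apply: (PD) => //; first exact: homog_hcomp.
by rewrite addbT; exact: homog_hcomp.
Qed.

Lemma homog0 (V : superSpaceType K) i : homog i (0 : V).
Proof. by rewrite /homog linear0. Qed.
Lemma homogD (V : superSpaceType K) i (x y : V) : homog i x -> homog i y -> homog i (x + y).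
Proof. by rewrite /homog => hx hy; rewrite linearD /= hx hy. Qed.
Lemma homogZ (V : superSpaceType K) i c (x : V) : homog i x -> homog i (c *: x).
Proof. by rewrite /homog => hx; rewrite linearZ /= hx. Qed.

Fact tens_homogM i j (x y : tens A B) : homog i x -> homog j y -> homog (i (+) j) (x * y).
Proof.
move=> hx; move: y; apply: homog_tens_ind => [|k c d y hc hd IH].
  by rewrite mulr0; exact: homog0.
rewrite mulrDr; apply: homogD => // {IH}; move: x hx.
apply: homog_tens_ind => [|l a b x ha hb IH]; first by rewrite mul0r; exact: homog0.
rewrite mulrDl; apply: homogD => //; rewrite (tensM_hom _ _ hb hc).
apply: homogZ; have := homog_pure (homogM ha hc) (homogM hb hd).
have -> // : l (+) k (+) (i (+) l (+) (j (+) k)) = i (+) j.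
by case: (i); case: (j); case: (k); case: (l).
Qed.

Fact tens_hcompM i j (x y : tens A B) :
  hcomp (i (+) j) (hcomp i x * hcomp j y) = hcomp i x * hcomp j y.
Proof. by apply: tens_homogM; exact: homog_hcomp. Qed.

Fact tens_supercomm i j (x y : tens A B) :
  hcomp i x * hcomp j y = (-1) ^+ (i && j) * (hcomp j y * hcomp i x).
Proof.
have sg (z : tens A B) b : (-1) ^+ b * z = (-1) ^+ b *: z.
  by rewrite -mulr_algl -in_algE rmorphXn rmorphN1.
rewrite sg; move: (homog_hcomp j y); move: (hcomp j y); apply: homog_tens_ind.
  by rewrite mulr0 mul0r scaler0.
move=> k c d {}y hc hd IH; rewrite mulrDr mulrDl scalerDr {}IH; congr (_ + _).
move: (homog_hcomp i x); move: (hcomp i x); apply: homog_tens_ind.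
  by rewrite mulr0 mul0r scaler0.
move=> l a b {}x ha hb IH; rewrite mulrDr mulrDl scalerDr {}IH; congr (_ + _).
rewrite (tensM_hom _ _ hb hc) (tensM_hom _ _ hd ha) (homogZC ha hc) (homogZC hb hd).
rewrite !(pureZl, pureZr) !scalerA -!signr_addb; congr (_ ^+ _ *: _).
by case: (i); case: (j); case: (k); case: (l).
Qed.

HB.instance Definition _ := isSuperComAlgebra.Build K (tens A B)
  tens_hcomp1 tens_hcompM tens_supercomm.

End SMul.

Lemma tmulE (K : fieldType) (A : superAlgType K) (x y : tens A A) : tmul x y = x * y.
Proof. by []. Qed.

(** * Morphisms of superalgebras and the universal property of the tensor product *)

Section Superhoms.
Variables (K : fieldType).

Section Build.
Variables (A R : superAlgType K) (f : A -> R) (lf : linear f) (f1 : f 1 = 1)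
  (fM : forall a b, f (a * b) = f a * f b) (fe : forall i a, f (hcomp i a) = hcomp i (f a)).

Definition mklr : {lrmorphism A -> R} :=
  HB.pack f (GRing.isLinear.Build K A R *:%R f lf)
            (GRing.isMonoidMorphism.Build A R f (f1, fM)).

Definition mkshom : superhom A R := @SuperHom K A R mklr fe.

Lemma mkshomE a : mkshom a = f a. Proof. by []. Qed.
End Build.

(** Extensionality and proof irrelevance. Points of G(R) become equal as records, so that group
    identities can be used for rewriting. *)
Lemma shomP (A R : superAlgType K) (f g : superhom A R) : f =1 g -> f = g.
Proof.
move=> e; case: f g e => [f fe] [g ge] /= e.
have efg : f = g.
  case: f {fe} e => f cf /=; case: g {ge} => g cg /= e.
  have ee : f = g by apply/funext.
  case: g / ee cg {e} => cg; congr GRing.LRMorphism.Pack.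
  case: cf => [[a]] [b] [c]; case: cg => [[a']] [b'] [c'].
  by rewrite (Prop_irrelevance a a') (Prop_irrelevance b b') (Prop_irrelevance c c').
by case: g / efg ge {e} => ge; rewrite (Prop_irrelevance fe ge).
Qed.

Lemma shom_homog (A R : superAlgType K) (f : superhom A R) i a :
  homog i a -> homog i (f a).
Proof. by rewrite /homog -shom_even => ->. Qed.

Fact idS_even (A : superAlgType K) i (a : A) : idfun (hcomp i a) = hcomp i (idfun a).
Proof. by []. Qed.
Definition idS (A : superAlgType K) : superhom A A :=
  @SuperHom K A A (idfun : {lrmorphism A -> A}) (@idS_even A).

Lemma superhom_compA (A B C D : superAlgType K) (h : superhom C D) (g : superhom B C)
    (f : superhom A B) :
  superhom_comp h (superhom_comp g f) = superhom_comp (superhom_comp h g) f.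
Proof. exact: shomP. Qed.

Lemma tliftMr (U V : lmodType K) (R : algType K) (b : U -> V -> R) x r :
  tlift b x * r = tlift (fun u v => b u v * r) x.
Proof. by rewrite /tlift /teval mulr_suml. Qed.

Lemma tliftMl (U V : lmodType K) (R : algType K) (b : U -> V -> R) x r :
  r * tlift b x = tlift (fun u v => r * b u v) x.
Proof. by rewrite /tlift /teval mulr_sumr. Qed.

Lemma pure_tliftl (U V W W' : lmodType K) (b : U -> V -> W) x (r : W') :
  tlift b x \ot r = tlift (fun u v => b u v \ot r) x.
Proof. by rewrite /tlift /teval pure_suml. Qed.

Lemma tlift_lin (U V W W' : lmodType K) (f : W -> W') (lf : linear f)
    (b : U -> V -> W) x : f (tlift b x) = tlift (fun u v => f (b u v)) x.
Proof. by rewrite -[f]/(mklin lf : _ -> _) tlift_comp. Qed.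

Lemma shom_tlift (U V : lmodType K) (A R : superAlgType K) (f : superhom A R)
    (b : U -> V -> A) x : f (tlift b x) = tlift (fun u v => f (b u v)) x.
Proof. by rewrite /tlift /teval linear_sum. Qed.

Section Incl.
Variables (A B : superAlgType K).

Fact in1_linear : linear (fun a : A => a \ot (1 : B)).
Proof. by move=> c x y; rewrite pureDl pureZl. Qed.
Fact in1M (a b : A) : (a * b) \ot (1 : B) = (a \ot 1) * (b \ot 1).
Proof.
rewrite -(hcomp_sum b) mulrDr !pureDl mulrDr.
by rewrite !(tensM_hom _ _ (homog1 _) (homog_hcomp _ _)) /= !scale1r mulr1.
Qed.
Fact in1_even i (a : A) : hcomp i a \ot (1 : B) = hcomp i (a \ot 1).
Proof.
rewrite hcomp_pure; case: i; rewrite ?homog1 ?(homog_neq (homog1 _)) //= ?pure0r.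
  by rewrite add0r.
by rewrite addr0.
Qed.
Definition in1 : superhom A (tens A B) := mkshom in1_linear erefl in1M in1_even.

Fact in2_linear : linear (fun b : B => (1 : A) \ot b).
Proof. by move=> c x y; rewrite pureDr pureZr. Qed.
Fact in2M (a b : B) : (1 : A) \ot (a * b) = (1 \ot a) * (1 \ot b).
Proof.
rewrite -(hcomp_sum a) mulrDl !pureDr mulrDl.
by rewrite !(tensM_hom _ _ (homog_hcomp _ _) (homog1 _)) ?andbF /= !scale1r mulr1.
Qed.
Fact in2_even i (a : B) : (1 : A) \ot hcomp i a = hcomp i (1 \ot a).
Proof. by rewrite hcomp_pure homog1 (homog_neq (homog1 _)) // pure0l addr0. Qed.
Definition in2 : superhom B (tens A B) := mkshom in2_linear erefl in2M in2_even.

Lemma in1E a : in1 a = a \ot 1. Proof. by []. Qed.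
Lemma in2E a : in2 a = 1 \ot a. Proof. by []. Qed.

Lemma tensM_in12 (a : A) (b : B) : (a \ot 1) * (1 \ot b) = a \ot b.
Proof. by rewrite (tensM_hom _ _ (homog1 _) (homog1 _)) mulr1 mul1r scale1r. Qed.

Lemma tensMl1 (a a' : A) (b : B) : (a' \ot 1) * (a \ot b) = (a' * a) \ot b.
Proof. by rewrite -[a \ot b]tensM_in12 mulrA -in1M tensM_in12. Qed.

Lemma tensMr1 (a : A) (b b' : B) : (a \ot b) * (1 \ot b') = a \ot (b * b').
Proof. by rewrite -[a \ot b]tensM_in12 -mulrA -in2M tensM_in12. Qed.

End Incl.

Section Pairing.
Variables (A B R : superAlgType K).

Lemma mul_bilin (f : {linear A -> R}) (g : {linear B -> R}) :
  bilin (fun a b => f a * g b).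
Proof.
split=> [v c x y|u c x y]; first by rewrite linearP mulrDl -scalerAl.
by rewrite linearP mulrDr -scalerAr.
Qed.

Variables (f : superhom A R) (g : superhom B R).

Definition sprod0 (x : tens A B) : R := tlift (fun a b => f a * g b) x.

Lemma sprod0_pure a b : sprod0 (a \ot b) = f a * g b.
Proof. by rewrite /sprod0 tlift_pure //; exact: mul_bilin. Qed.
Fact sprod0_linear : linear sprod0.
Proof. exact: tlift_linear (mul_bilin f g). Qed.
Fact sprod0_1 : sprod0 1 = 1.
Proof. by rewrite tens_one sprod0_pure !rmorph1 mulr1. Qed.
HB.instance Definition _ := GRing.isLinear.Build K _ _ *:%R sprod0 sprod0_linear.
Fact sprod0_M x y : sprod0 (x * y) = sprod0 x * sprod0 y.
Proof.
elim/tens_hind: x => [|i j a b x ha hb IH]; first by rewrite mul0r !linear0 mul0r.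
rewrite mulrDl !linearD /= mulrDl IH; congr (_ + _).
elim/tens_hind: y {IH} => [|k l c d y hc hd IH]; first by rewrite mulr0 !linear0 mulr0.
rewrite mulrDr !linearD /= mulrDr IH; congr (_ + _).
rewrite (tensM_hom _ _ hb hc) linearZ /= !sprod0_pure !rmorphM -!mulrA.
rewrite [g b * (f c * _)]mulrA (homogZC (shom_homog g hb) (shom_homog f hc)).
by rewrite -scalerAl -scalerAr !mulrA.
Qed.
Fact sprod0_even i x : sprod0 (hcomp i x) = hcomp i (sprod0 x).
Proof.
elim/tens_hind: x => [|k j a b x ha hb IH]; first by rewrite !linear0.
rewrite !linearD /= IH sprod0_pure; congr (_ + _).
have h1 := homog_pure ha hb; have h2 := homogM (shom_homog f ha) (shom_homog g hb).
have [<-|ne] := eqVneq (k (+) j) i; first by rewrite h1 sprod0_pure h2.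
by rewrite (homog_neq h1) // (homog_neq h2) // linear0.
Qed.
(** [tens A B] is the coproduct of A and B in SAlg_K, with injections [in1] and [in2]. This provides
    generic pairs of points, at which functorial statements are verified. *)
Definition sprod : superhom (tens A B) R :=
  mkshom sprod0_linear sprod0_1 sprod0_M sprod0_even.

Lemma sprodE x : sprod x = tlift (fun a b => f a * g b) x. Proof. by []. Qed.
Lemma sprod_pure a b : sprod (a \ot b) = f a * g b. Proof. exact: sprod0_pure. Qed.
Lemma sprod_in1 : superhom_comp sprod (in1 A B) = f.
Proof. by apply: shomP => a /=; rewrite sprod0_pure rmorph1 mulr1. Qed.
Lemma sprod_in2 : superhom_comp sprod (in2 A B) = g.
Proof. by apply: shomP => a /=; rewrite sprod0_pure rmorph1 mul1r. Qed.

End Pairing.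

Lemma sprod_unique (A B R : superAlgType K) (h h' : superhom (tens A B) R) :
  superhom_comp h (in1 A B) = superhom_comp h' (in1 A B) ->
  superhom_comp h (in2 A B) = superhom_comp h' (in2 A B) -> h = h'.
Proof.
move=> e1 e2; apply: shomP; apply: tensP => u v.
rewrite -tensM_in12 !rmorphM.
move: e1 e2 => /(congr1 (fun k => shom k u)) /= -> /(congr1 (fun k => shom k v)) /= ->.
by [].
Qed.

(* f \ot g *)
Definition stens (A B C D : superAlgType K) (f : superhom A C) (g : superhom B D) :
  superhom (tens A B) (tens C D) := sprod (superhom_comp (in1 C D) f) (superhom_comp (in2 C D) g).

Lemma stens_pure (A B C D : superAlgType K) (f : superhom A C) (g : superhom B D) a b :
  stens f g (a \ot b) = f a \ot g b.
Proof. by rewrite sprod_pure /= tensM_in12. Qed.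

End Superhoms.

HB.instance Definition _ (K : fieldType) (G : supergroupType K) :=
  GRing.isLinear.Build K G (tens G G) *:%R comul comul_linear.
HB.instance Definition _ (K : fieldType) (G : supergroupType K) :=
  GRing.isLinear.Build K G K *%R counit counit_linear.
HB.instance Definition _ (K : fieldType) (G : supergroupType K) :=
  GRing.isLinear.Build K G G *:%R antipode antipode_linear.

(** * The group of points of a supergroup *)

Section Points.
Variables (K : fieldType) (G : supergroupType K).

Definition comulS : superhom G (tens G G) :=
  mkshom comul_linear comul1 (@comulM K G) (@comul_even K G).
Lemma comulSE a : comulS a = comul a. Proof. by []. Qed.

Section Unit.
Variable (R : superAlgType K).
Definition punit0 (a : G) : R := counit a *: 1.
Fact punit0_linear : linear punit0.
Proof. by move=> c x y; rewrite /punit0 linearP scalerDl scalerA. Qed.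
Fact punit0_1 : punit0 1 = 1. Proof. by rewrite /punit0 counit1 scale1r. Qed.
Fact punit0_M a b : punit0 (a * b) = punit0 a * punit0 b.
Proof. by rewrite /punit0 counitM -scalerAl mul1r scalerA. Qed.
Lemma counit_hcomp i (a : G) : counit (hcomp i a) = if i then 0 else counit a.
Proof.
case: i; first exact: counit_even.
by rewrite -{2}(hcomp_sum a) linearD /= counit_even addr0.
Qed.
Fact punit0_even i a : punit0 (hcomp i a) = hcomp i (punit0 a).
Proof.
rewrite /punit0 counit_hcomp linearZ /=; case: i; last by rewrite homog1.
by rewrite (homog_neq (homog1 _)) // scale0r scaler0.
Qed.
Definition punit : superhom G R := mkshom punit0_linear punit0_1 punit0_M punit0_even.
End Unit.

Lemma punitE R a : punit R a = counit a *: 1. Proof. by []. Qed.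

(** The convolution [conv] packaged as a morphism, hence as a point that can be multiplied and
    specialized further. *)
Definition pmul (R : superAlgType K) (f g : superhom G R) : superhom G R :=
  superhom_comp (sprod f g) comulS.

Lemma pmulE (R : superAlgType K) (f g : superhom G R) a : pmul f g a = conv f g a.
Proof. by []. Qed.

Lemma pmul1l (R : superAlgType K) (f : superhom G R) : pmul (punit R) f = f.
Proof.
apply: shomP => a; rewrite pmulE /conv -[in RHS](counitl a) shom_tlift.
by apply: eq_tlift => u v; rewrite linearZ_LR punitE -scalerAl mul1r.
Qed.

Lemma pmul1r (R : superAlgType K) (f : superhom G R) : pmul f (punit R) = f.
Proof.
apply: shomP => a; rewrite pmulE /conv -[in RHS](counitr a) shom_tlift.
by apply: eq_tlift => u v; rewrite linearZ_LR punitE -scalerAr mulr1.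
Qed.

Lemma pmulA (R : superAlgType K) (f g h : superhom G R) :
  pmul f (pmul g h) = pmul (pmul f g) h.
Proof.
apply: shomP => a.
have := congr1 (sprod f (sprod g h)) (comulA a).
rewrite !shom_tlift => e; rewrite -[RHS]/(tlift (fun x y => pmul f g x * h y) (comul a)).
rewrite -[LHS]/(tlift (fun x y => f x * pmul g h y) (comul a)).
transitivity (tlift (fun u v => sprod f (sprod g h) (u \ot comul v)) (comul a)).
  by apply: eq_tlift => u v; rewrite sprod_pure.
rewrite -e; apply: eq_tlift => u v.
rewrite shom_tlift -[pmul f g u]/(tlift (fun x y => f x * g y) (comul u)).
rewrite tliftMr.
by apply: eq_tlift => x y; rewrite !sprod_pure mulrA.
Qed.

Lemma pmul_comp (R S : superAlgType K) (h : superhom R S) (f g : superhom G R) :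
  superhom_comp h (pmul f g) = pmul (superhom_comp h f) (superhom_comp h g).
Proof.
apply: shomP => a; rewrite -[LHS]/(h (tlift _ _)) shom_tlift.
by apply: eq_tlift => u v; rewrite rmorphM.
Qed.

Lemma punit_comp (R S : superAlgType K) (h : superhom R S) :
  superhom_comp h (punit R) = punit S.
Proof. by apply: shomP => a; rewrite /= linearZ /= rmorph1. Qed.

(** The comultiplication is the product of the two generic points. Identities between coproducts
    thus become identities in the group G(K[G] \ot K[G]). *)
Lemma comul_pmul : comulS = pmul (in1 G G) (in2 G G).
Proof.
apply: shomP => a; rewrite -[LHS](tlift_id (comul a)); apply: eq_tlift => u v.
by rewrite in1E in2E tensM_in12.
Qed.

(* a \ot r |-> a_1 \ot a_2 r is a bijective superalgebra map whose inverse     *)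
(* involves the antipode.                                                      *)
Let th : superhom (tens G G) (tens G G) := sprod comulS (in2 G G).
Let ph a : tens G G := tlift (fun x y => x \ot antipode y) (comul a).
Let th' (x : tens G G) : tens G G := tlift (fun a r => ph a * (1 \ot r)) x.

Let lant : {linear G -> G} := antipode.

Let ph_linear : linear ph.
Proof.
have b : bilin (fun x y : G => x \ot antipode y).
  split=> [v c x y|u c x y]; first by rewrite pureDl pureZl.
  by rewrite linearP pureDr pureZr.
by move=> c x y; rewrite /ph linearP; apply: (tlift_linear b).
Qed.

Let th'_bilin : bilin (fun a r => ph a * (1 \ot r)).
Proof.
split=> [v c x y|u c x y]; first by rewrite ph_linear mulrDl scalerAl.
by rewrite pureDr pureZr mulrDr scalerAr.
Qed.

Let th'L : {linear tens G G -> tens G G} := mklin (tlift_linear th'_bilin).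

Let thE a r : th (a \ot r) = tlift (fun x y => x \ot (y * r)) (comul a).
Proof.
rewrite sprod_pure /= -[comul a in LHS]tlift_id.
rewrite tliftMr.
by apply: eq_tlift => u v; rewrite tensMr1.
Qed.

Let th'E a r : th' (a \ot r) = tlift (fun x y => x \ot (antipode y * r)) (comul a).
Proof.
rewrite /th' tlift_pure; last exact: th'_bilin.
rewrite /ph tliftMr.
by apply: eq_tlift => u v; rewrite tensMr1.
Qed.

Let bil2 (f g : {linear G -> G}) r : bilin (fun x c => f x * (g c * r)).
Proof.
split=> [v c x y|u c x y]; first by rewrite linearP mulrDl scalerAl.
by rewrite linearP mulrDl mulrDr -scalerAl -scalerAr.
Qed.

(* Contracts the last two legs of the iterated coproduct of a to f(a_2) g(a_3) r. *)
Let three (f g : {linear G -> G}) a r :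
  tlift (fun x c => tlift (fun u v => u \ot (f v * (g c * r))) (comul x)) (comul a) =
  tlift (fun x y => x \ot tlift (fun v c => f v * (g c * r)) (comul y)) (comul a).
Proof.
have b1 : bilin (fun (x : G) (y : tens G G) => x \ot tlift (fun v c => f v * (g c * r)) y).
  split=> [v c x y|u c x y]; first by rewrite pureDl pureZl.
  by rewrite (tlift_linear (bil2 f g r)) pureDr pureZr.
pose F := tlift (fun (x : G) (y : tens G G) => x \ot tlift (fun v c => f v * (g c * r)) y).
have lF : linear F := tlift_linear b1.
have := congr1 F (comulA a); rewrite !(tlift_lin lF) => e.
transitivity (tlift (fun x c => F (tlift (fun u v => u \ot (v \ot c)) (comul x))) (comul a)).
  apply: eq_tlift => x c; rewrite (tlift_lin lF); apply: eq_tlift => u v.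
  by rewrite /F tlift_pure // tlift_pure //; exact: bil2.
rewrite e; apply: eq_tlift => u v.
by rewrite /F tlift_pure.
Qed.

Let idl : {linear G -> G} := idfun.

Let thK x : th' (th x) = x.
Proof.
apply: (@tensP _ _ _ _ [the {linear _ -> _} of th'L \o th] [the {linear _ -> _} of idfun]).
move=> a r; rewrite -[LHS]/(th' (th (a \ot r))) thE.
rewrite (tlift_lin (f := th') (tlift_linear th'_bilin)).
transitivity (tlift (fun x c => tlift (fun u v => u \ot (lant v * (idl c * r))) (comul x))
  (comul a)); first by apply: eq_tlift => u v; rewrite th'E.
rewrite three -[X in _ = X]/(a \ot r) -[in RHS](counitr a) pure_tliftl.
apply: eq_tlift => u v; rewrite pureZl -pureZr; congr (_ \ot _).
rewrite -[in RHS](mul1r r) scalerAl -antipodel tliftMr.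
by apply: eq_tlift => p q; rewrite mulrA.
Qed.

Let thK' x : th (th' x) = x.
Proof.
apply: (@tensP _ _ _ _ [the {linear _ -> _} of th \o th'L] [the {linear _ -> _} of idfun]).
move=> a r; rewrite -[LHS]/(th (th' (a \ot r))) th'E shom_tlift.
transitivity (tlift (fun x c => tlift (fun u v => u \ot (idl v * (lant c * r))) (comul x))
  (comul a)); first by apply: eq_tlift => u v; rewrite thE.
rewrite three -[X in _ = X]/(a \ot r) -[in RHS](counitr a) pure_tliftl.
apply: eq_tlift => u v; rewrite pureZl -pureZr; congr (_ \ot _).
rewrite -[in RHS](mul1r r) scalerAl -antipoder tliftMr.
by apply: eq_tlift => p q; rewrite mulrA.
Qed.

Let th'M x y : th' (x * y) = th' x * th' y.
Proof. by rewrite -{1}(thK' x) -{1}(thK' y) -rmorphM thK. Qed.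

Let antE a : antipode a = sprod (punit G) (idS G) (th' (in1 G G a)).
Proof.
rewrite in1E th'E shom_tlift -[a in LHS](counitl a).
rewrite (tlift_lin antipode_linear); apply: eq_tlift => u v.
by rewrite sprod_pure mulr1 linearZ_LR punitE -scalerAl mul1r.
Qed.

(** The inverse of the multiplicative bijection [th] is multiplicative, and the antipode is read off
    from it. Hence the antipode is a point, and G(R) is a group. *)
Lemma antipodeM (a b : G) : antipode (a * b) = antipode a * antipode b.
Proof. by rewrite !antE rmorphM th'M rmorphM. Qed.

Lemma antipode1 : antipode (1 : G) = 1.
Proof. by rewrite antE rmorph1 -(rmorph1 th) thK rmorph1. Qed.

Definition antS : superhom G G :=
  mkshom antipode_linear antipode1 antipodeM (@antipode_even K G).

Definition pinv (R : superAlgType K) (f : superhom G R) : superhom G R :=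
  superhom_comp f antS.

Lemma pmulVl (R : superAlgType K) (f : superhom G R) : pmul (pinv f) f = punit R.
Proof.
apply: shomP => a; have := congr1 f (antipodel a).
rewrite linearZ_LR rmorph1 punitE => <-; rewrite tlift_comp.
by apply: eq_tlift => u v; rewrite rmorphM.
Qed.

Lemma pmulVr (R : superAlgType K) (f : superhom G R) : pmul f (pinv f) = punit R.
Proof.
apply: shomP => a; have := congr1 f (antipoder a).
rewrite linearZ_LR rmorph1 punitE => <-; rewrite tlift_comp.
by apply: eq_tlift => u v; rewrite rmorphM.
Qed.

Lemma pinv_comp (R S : superAlgType K) (h : superhom R S) (f : superhom G R) :
  superhom_comp h (pinv f) = pinv (superhom_comp h f).
Proof. exact: shomP. Qed.

Lemma pmulKl (R : superAlgType K) (f g : superhom G R) : pmul (pinv f) (pmul f g) = g.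
Proof. by rewrite pmulA pmulVl pmul1l. Qed.
Lemma pmulKVl (R : superAlgType K) (f g : superhom G R) : pmul f (pmul (pinv f) g) = g.
Proof. by rewrite pmulA pmulVr pmul1l. Qed.
Lemma pmul_injl (R : superAlgType K) (f g h : superhom G R) : pmul f g = pmul f h -> g = h.
Proof. by move=> e; rewrite -(pmulKl f g) e pmulKl. Qed.
Lemma pmulKr (R : superAlgType K) (f g : superhom G R) : pmul (pmul f g) (pinv g) = f.
Proof. by rewrite -pmulA pmulVr pmul1r. Qed.
Lemma pinv_uniq (R : superAlgType K) (f g : superhom G R) : pmul f g = punit R -> g = pinv f.
Proof. by move=> e; apply: (pmul_injl (f := f)); rewrite e pmulVr. Qed.
Lemma pinvK (R : superAlgType K) (f : superhom G R) : pinv (pinv f) = f.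
Proof. by apply/esym/pinv_uniq/pmulVl. Qed.
Lemma pinv1 (R : superAlgType K) : pinv (punit R) = punit R.
Proof. by apply/esym/pinv_uniq/pmul1l. Qed.
Lemma pinvM (R : superAlgType K) (f g : superhom G R) :
  pinv (pmul f g) = pmul (pinv g) (pinv f).
Proof. by apply/esym/pinv_uniq; rewrite -pmulA pmulKVl pmulVr. Qed.

(** The identity of K[G] is a point of G(K[G]), and inverting it twice returns it. *)
Lemma antipodeK (a : G) : antipode (antipode a) = a.
Proof. by have := congr1 (fun f => shom f a) (pinvK (idS G)). Qed.

End Points.

(** * Homomorphisms of supergroups *)

Section HopfHom.
Variables (K : fieldType) (A B : supergroupType K) (f : superhom A B) (hf : hopf_hom f).

Lemma hopf_pmul (R : superAlgType K) (g h : superhom B R) :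
  superhom_comp (pmul g h) f = pmul (superhom_comp g f) (superhom_comp h f).
Proof.
apply: shomP => a; rewrite -[LHS]/(sprod g h (comul (f a))) hf.1 /tmap shom_tlift.
by apply: eq_tlift => u v; rewrite sprod_pure.
Qed.

Lemma hopf_punit (R : superAlgType K) : superhom_comp (punit B R) f = punit A R.
Proof. by apply: shomP => a; rewrite /= -[LHS]/(punit B R (f a)) !punitE hf.2. Qed.

Lemma hopf_pinv (R : superAlgType K) (g : superhom B R) :
  superhom_comp (pinv g) f = pinv (superhom_comp g f).
Proof. by apply: pinv_uniq; rewrite -hopf_pmul pmulVr hopf_punit. Qed.

Lemma hopf_antipode a : f (antipode a) = antipode (f a).
Proof. by have := congr1 (fun g => shom g a) (hopf_pinv (idS B)). Qed.

End HopfHom.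

Lemma hopf_comp (K : fieldType) (A B C : supergroupType K) (g : superhom B C)
    (f : superhom A B) : hopf_hom g -> hopf_hom f -> hopf_hom (superhom_comp g f).
Proof.
move=> hg hf; split=> a /=; last by rewrite hg.2 hf.2.
rewrite hg.1 hf.1; apply: tmap_comp; exact: linearP.
Qed.

Section TMap.
Variables (K : fieldType) (U V U' V' : lmodType K).
Variables (f : {linear U -> U'}) (g : {linear V -> V'}).

Lemma tmap_linear : linear (tmap f g).
Proof. by apply: tlift_linear; apply: tmap_bilin; exact: linearP. Qed.
HB.instance Definition _ := GRing.isLinear.Build K _ _ *:%R (tmap f g) tmap_linear.
Lemma tmap_pure u v : tmap f g (u \ot v) = f u \ot g v.
Proof. by rewrite /tmap tlift_pure //; apply: tmap_bilin; exact: linearP. Qed.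
Lemma cr_tmap (h : {scalar V'}) (h' : {scalar V}) x : (forall v, h' v = h (g v)) ->
  cr h (tmap f g x) = f (cr h' x).
Proof.
move=> e; elim/tens_ind: x => [|u v x IH]; first by rewrite !linear0.
by rewrite !linearD /= IH tmap_pure !cr_pure linearZ_LR e.
Qed.
Lemma cl_tmap (h : {scalar U'}) (h' : {scalar U}) x : (forall v, h' v = h (f v)) ->
  cl h (tmap f g x) = g (cl h' x).
Proof.
move=> e; elim/tens_ind: x => [|u v x IH]; first by rewrite !linear0.
by rewrite !linearD /= IH tmap_pure !cl_pure linearZ_LR e.
Qed.
Lemma tlift_tmap (W : lmodType K) (b : U' -> V' -> W) x : bilin b ->
  tlift b (tmap f g x) = tlift (fun u v => b (f u) (g v)) x.
Proof.
move=> hb; rewrite /tmap (tlift_lin (tlift_linear hb)).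
by apply: eq_tlift => u v; rewrite tlift_pure.
Qed.
(** A functional on the second factor extends along [g], so the contractions of the image determine
    those of the tensor, [f] being injective. *)
Lemma tmap_inj : injective f -> injective g -> injective (tmap f g).
Proof.
move=> fi gi x y e; apply: tens_crP => h; apply: fi.
have [h1 h1E] := scalar_extend h gi.
by rewrite -!(cr_tmap (h := h1)) ?e // => v; rewrite h1E.
Qed.
End TMap.

Lemma scalar_comp_proof (K : fieldType) (U V : lmodType K) (f : {linear U -> V})
  (h : {scalar V}) : scalar (h \o f).
Proof. by move=> c x y; rewrite /= !linearP. Qed.
Definition scomp (K : fieldType) (U V : lmodType K) (h : {scalar V}) (f : {linear U -> V}) :
  {scalar U} := mkscal (scalar_comp_proof f h).

Lemma stensE (K : fieldType) (A B C D : superAlgType K) (f : superhom A C)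
  (g : superhom B D) x : stens f g x = tmap f g x.
Proof.
apply: (@tensP _ _ _ _ (stens f g) [the {linear _ -> _} of tmap f g]) => u v.
by rewrite -[LHS]/(stens f g (u \ot v)) stens_pure -[RHS]/(tmap f g (u \ot v)) tmap_pure.
Qed.

Section Bilins.
Variables (K : fieldType).
Lemma bilin_comp (U V U' V' W : lmodType K) (b : U' -> V' -> W) (f : {linear U -> U'})
  (g : {linear V -> V'}) : bilin b -> bilin (fun u v => b (f u) (g v)).
Proof.
move=> hb; split=> [v c x y|u c x y]; first by rewrite linearP hb.1.
by rewrite linearP hb.2.
Qed.
Lemma pure3_bilin (U V W : lmodType K) (w : W) : bilin (fun (u : U) (v : V) => u \ot (v \ot w)).
Proof.
split=> [v c x y|u c x y]; first by rewrite pureDl pureZl.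
by rewrite pureDl pureZl pureDr pureZr.
Qed.
Lemma coassl_bilin (U V W X : lmodType K) (f : {linear U -> tens V W}) :
  bilin (fun (x : U) (c : X) => tlift (fun u v => u \ot (v \ot c)) (f x)).
Proof.
split=> [v c x y|u c x y].
  by rewrite linearP (tlift_linear (pure3_bilin _ _ _)).
rewrite /tlift /teval scaler_sumr -big_split; apply: eq_bigr => p _ /=.
by rewrite !pureDr !pureZr.
Qed.
Lemma coassr_bilin (U V W X : lmodType K) (f : {linear U -> tens V W}) :
  bilin (fun (x : X) (y : U) => x \ot f y).
Proof.
split=> [v c x y|u c x y]; first by rewrite pureDl pureZl.
by rewrite linearP pureDr pureZr.
Qed.
Lemma scale_bilinl (U V : lmodType K) (f : {scalar U}) : bilin (fun (x : U) (y : V) => f x *: y).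
Proof. exact: cl_bilin. Qed.
End Bilins.

(** * Quotients by super-ideals and by Hopf ideals *)

Record superideal (K : fieldType) (A : superAlgType K) := SuperIdeal {
  sid :> A -> Prop;
  sid_sub : subspace sid;
  sid_mul : forall a x, sid x -> sid (a * x);
  sid_hcomp : forall i x, sid x -> sid (hcomp i x);
  sid_proper : ~ sid 1
}.

Section Quot.
Variables (K : fieldType) (A : superAlgType K) (I : superideal A).

(** Super-commutativity moves homogeneous components of [a] to the left, up to sign. *)
Lemma sid_mulr a x : I x -> I (x * a).
Proof.
move=> Ix; rewrite -(hcomp_sum x) -(hcomp_sum a) mulrDl !mulrDr.
have h i j : I (hcomp i x * hcomp j a).
  rewrite supercomm signZ; apply: subspaceZ (sid_sub I) _.
  by apply: sid_mul; apply: sid_hcomp.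
by do 2 (apply: subspaceD (sid_sub I) _ _ => //); apply: subspaceD (sid_sub I) _ _ => //.
Qed.

Definition squot_rel (x y : A) : bool := `[< I (x - y) >].
Fact squot_refl : reflexive squot_rel.
Proof. by move=> x; apply/asboolP; rewrite subrr; exact: (sid_sub I).1. Qed.
Fact squot_sym : symmetric squot_rel.
Proof.
by move=> x y; apply/asboolP/asboolP => h; rewrite -opprB; apply: subspaceN (sid_sub I) _.
Qed.
Fact squot_trans : transitive squot_rel.
Proof.
move=> y x z /asboolP xy /asboolP yz; apply/asboolP.
by rewrite -(subrKA y); apply: subspaceD (sid_sub I) _ _.
Qed.
Canonical squot_equiv := EquivRel squot_rel squot_refl squot_sym squot_trans.
Definition squot : Type := {eq_quot squot_equiv}.
HB.instance Definition _ := Choice.on squot.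
HB.instance Definition _ := EqQuotient.on squot.

Definition qpi (x : A) : squot := \pi_squot x.
Lemma qpi_eq x y : qpi x = qpi y <-> I (x - y).
Proof. by split=> [/eqmodP/asboolP|h]; last by apply/eqmodP/asboolP. Qed.
Lemma qpi_repr (x : squot) : qpi (repr x) = x. Proof. exact: reprK. Qed.
Lemma repr_qpi x : I (repr (qpi x) - x). Proof. by apply/qpi_eq; rewrite qpi_repr. Qed.

Definition qadd (x y : squot) := qpi (repr x + repr y).
Definition qopp (x : squot) := qpi (- repr x).
Definition qscale c (x : squot) := qpi (c *: repr x).
Definition qmul (x y : squot) := qpi (repr x * repr y).
Definition qhcomp i (x : squot) := qpi (hcomp i (repr x)).

Lemma qaddE x y : qadd (qpi x) (qpi y) = qpi (x + y).
Proof.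
apply/qpi_eq; rewrite opprD addrACA.
by apply: subspaceD (sid_sub I) _ _; exact: repr_qpi.
Qed.
Lemma qoppE x : qopp (qpi x) = qpi (- x).
Proof. by apply/qpi_eq; rewrite -opprD; apply: subspaceN (sid_sub I) _; exact: repr_qpi. Qed.
Lemma qscaleE c x : qscale c (qpi x) = qpi (c *: x).
Proof. by apply/qpi_eq; rewrite -scalerBr; apply: subspaceZ (sid_sub I) _; exact: repr_qpi. Qed.
Lemma qmulE x y : qmul (qpi x) (qpi y) = qpi (x * y).
Proof.
apply/qpi_eq; rewrite -(subrKA (repr (qpi x) * y)) -mulrBr -mulrBl.
apply: subspaceD (sid_sub I) _ _; first by apply: sid_mul; exact: repr_qpi.
by apply: sid_mulr; exact: repr_qpi.
Qed.
Lemma qhcompE i x : qhcomp i (qpi x) = qpi (hcomp i x).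
Proof. by apply/qpi_eq; rewrite -linearB; apply: sid_hcomp; exact: repr_qpi. Qed.

Lemma qpiW (P : squot -> Prop) : (forall a, P (qpi a)) -> forall x, P x.
Proof. by move=> h x; rewrite -(qpi_repr x). Qed.

Let E := (qaddE, qoppE, qscaleE, qmulE, qhcompE).

Fact qaddA : associative qadd.
Proof. by do 3 elim/qpiW => ?; rewrite !E addrA. Qed.
Fact qaddC : commutative qadd.
Proof. by do 2 elim/qpiW => ?; rewrite !E addrC. Qed.
Fact qadd0 : left_id (qpi 0) qadd.
Proof. by elim/qpiW => ?; rewrite !E add0r. Qed.
Fact qaddN : left_inverse (qpi 0) qopp qadd.
Proof. by elim/qpiW => ?; rewrite !E addNr. Qed.
HB.instance Definition _ := GRing.isZmodule.Build squot qaddA qaddC qadd0 qaddN.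

Lemma qpiD x y : qpi x + qpi y = qpi (x + y). Proof. exact: qaddE. Qed.

Fact qmulA : associative qmul.
Proof. by do 3 elim/qpiW => ?; rewrite !E mulrA. Qed.
Fact qmul1l : left_id (qpi 1) qmul.
Proof. by elim/qpiW => ?; rewrite !E mul1r. Qed.
Fact qmul1r : right_id (qpi 1) qmul.
Proof. by elim/qpiW => ?; rewrite !E mulr1. Qed.
Fact qmulDl : left_distributive qmul +%R.
Proof. by do 3 elim/qpiW => ?; rewrite !(qpiD, E) mulrDl. Qed.
Fact qmulDr : right_distributive qmul +%R.
Proof. by do 3 elim/qpiW => ?; rewrite !(qpiD, E) mulrDr. Qed.
Fact q1_neq0 : qpi 1 != 0.
Proof. by apply/eqP => /qpi_eq; rewrite subr0; exact: sid_proper. Qed.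
HB.instance Definition _ := GRing.Zmodule_isNzRing.Build squot
  qmulA qmul1l qmul1r qmulDl qmulDr q1_neq0.

Fact qscaleA c d x : qscale c (qscale d x) = qscale (c * d) x.
Proof. by move: x; elim/qpiW => ?; rewrite !E scalerA. Qed.
Fact qscale1 : left_id 1 qscale.
Proof. by elim/qpiW => ?; rewrite !E scale1r. Qed.
Fact qscaleDr : right_distributive qscale +%R.
Proof. by move=> c; do 2 elim/qpiW => ?; rewrite !(qpiD, E) scalerDr. Qed.
Fact qscaleDl x : {morph qscale^~ x : c d / c + d}.
Proof. by move=> c d; move: x; elim/qpiW => ?; rewrite !(qpiD, E) scalerDl. Qed.
HB.instance Definition _ := GRing.Zmodule_isLmodule.Build K squot
  qscaleA qscale1 qscaleDr qscaleDl.
Lemma qpiZ c x : c *: qpi x = qpi (c *: x). Proof. exact: qscaleE. Qed.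
Lemma qpiM x y : qpi x * qpi y = qpi (x * y). Proof. exact: qmulE. Qed.
Fact qscaleAl c (x y : squot) : c *: (x * y) = (c *: x) * y.
Proof. by move: x y; do 2 elim/qpiW => ?; rewrite !(qpiM, qpiZ) scalerAl. Qed.
HB.instance Definition _ := GRing.Lmodule_isLalgebra.Build K squot qscaleAl.
Fact qscaleAr c (x y : squot) : c *: (x * y) = x * (c *: y).
Proof. by move: x y; do 2 elim/qpiW => ?; rewrite !(qpiM, qpiZ) scalerAr. Qed.
HB.instance Definition _ := GRing.Lalgebra_isAlgebra.Build K squot qscaleAr.

Fact qhcomp_linear i : linear (qhcomp i).
Proof.
move=> c; elim/qpiW => x; elim/qpiW => y.
by rewrite [qhcomp i (qpi x)]qhcompE [qhcomp i (qpi y)]qhcompE !(qpiZ, qpiD) qhcompE linearP.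
Qed.
Fact qhcomp_hcomp i j x : qhcomp i (qhcomp j x) = if i == j then qhcomp j x else 0.
Proof. by move: x; elim/qpiW => ?; rewrite !E hcomp_hcomp; case: ifP. Qed.
Fact qhcomp_sum x : qhcomp false x + qhcomp true x = x.
Proof. by move: x; elim/qpiW => ?; rewrite !E qpiD hcomp_sum. Qed.
HB.instance Definition _ := isSuperSpace.Build K squot qhcomp_linear qhcomp_hcomp qhcomp_sum.
Lemma qpiH i x : hcomp i (qpi x) = qpi (hcomp i x). Proof. exact: qhcompE. Qed.
Fact qhcomp1 : hcomp false (1 : squot) = 1.
Proof. by rewrite qpiH hcomp1. Qed.
Fact qhcompM i j (a b : squot) : hcomp (i (+) j) (hcomp i a * hcomp j b) = hcomp i a * hcomp j b.
Proof. by move: a b; do 2 elim/qpiW => ?; rewrite !(qpiH, qpiM) hcompM. Qed.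
Fact qsupercomm i j (a b : squot) :
  hcomp i a * hcomp j b = (-1) ^+ (i && j) * (hcomp j b * hcomp i a).
Proof.
have -> (z : squot) : (-1) ^+ (i && j) * z = (-1) ^+ (i && j) *: z.
  by rewrite -mulr_algl -in_algE rmorphXn rmorphN1.
by move: a b; do 2 elim/qpiW => ?; rewrite !(qpiH, qpiM, qpiZ) supercomm signZ.
Qed.
HB.instance Definition _ := isSuperComAlgebra.Build K squot qhcomp1 qhcompM qsupercomm.

Fact qpi_linear : linear qpi. Proof. by move=> c x y; rewrite qpiZ qpiD. Qed.
Fact qpi_mul x y : qpi (x * y) = qpi x * qpi y. Proof. by rewrite qpiM. Qed.
Fact qpi_even i x : qpi (hcomp i x) = hcomp i (qpi x). Proof. by rewrite qpiH. Qed.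
Definition spi : superhom A squot := mkshom qpi_linear erefl qpi_mul qpi_even.

Lemma spi0 x : spi x = 0 <-> I x.
Proof. by rewrite -[x in I x]subr0; exact: (qpi_eq x 0). Qed.
Lemma spi_surj (x : squot) : exists a, spi a = x.
Proof. by exists (repr x); exact: qpi_repr. Qed.

End Quot.

Lemma superhom_lift (K : fieldType) (A B R : superAlgType K) (p : superhom A B)
    (f : superhom A R) : (forall b, exists a, p a = b) ->
  (forall a, p a = 0 -> f a = 0) -> exists g : superhom B R, superhom_comp g p = f.
Proof.
move=> /choice[s sP] h.
have fs a : f (s (p a)) = f a.
  by apply/eqP; rewrite -subr_eq0 -linearB; apply/eqP/h; rewrite linearB /= sP subrr.
have l : linear (f \o s).
  by move=> c x y /=; rewrite -linearP -[RHS]fs (linearP p) /= !sP.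
have f1 : (f \o s) 1 = 1 by rewrite /= -(rmorph1 p) fs rmorph1.
have fM a b : (f \o s) (a * b) = (f \o s) a * (f \o s) b.
  by rewrite /= -rmorphM -[RHS]fs (rmorphM p) /= !sP.
have fe i a : (f \o s) (hcomp i a) = hcomp i ((f \o s) a).
  by rewrite /= -shom_even -[RHS]fs (shom_even p) sP.
by exists (mkshom l f1 fM fe); apply: shomP => a /=; rewrite fs.
Qed.

(** The coideal condition, that the coproduct of I lies in I \ot A + A \ot I, is expressed as
    vanishing in the tensor square of the quotient. *)
Record hopfideal (K : fieldType) (G : supergroupType K) := HopfIdeal {
  hid :> superideal G;
  hid_counit : forall x, hid x -> counit x = 0;
  hid_comul : forall x, hid x -> stens (spi hid) (spi hid) (comul x) = 0;
  hid_antipode : forall x, hid x -> hid (antipode x)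
}.

Section HQuot.
Variables (K : fieldType) (G : supergroupType K) (I : hopfideal G).
Notation Q := (squot I).
Let p : superhom G Q := spi I.

Definition hq_comul (x : Q) : tens Q Q := stens p p (comul (repr x)).
Definition hq_counit (x : Q) : K := counit (repr x).
Definition hq_antipode (x : Q) : Q := p (antipode (repr x)).

Lemma hq_comulE a : hq_comul (p a) = tmap p p (comul a).
Proof.
rewrite -stensE; apply/eqP; rewrite -subr_eq0 -!linearB; apply/eqP.
by apply: (hid_comul (h := I)); exact: repr_qpi.
Qed.
Lemma hq_counitE a : hq_counit (p a) = counit a.
Proof.
by apply/eqP; rewrite -subr_eq0 -linearB; apply/eqP/(hid_counit (h := I))/repr_qpi.
Qed.
Lemma hq_antipodeE a : hq_antipode (p a) = p (antipode a).
Proof.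
apply/eqP; rewrite -subr_eq0 -!linearB; apply/eqP/spi0/(hid_antipode (h := I)).
exact: repr_qpi.
Qed.

Lemma pW (P : Q -> Prop) : (forall a, P (p a)) -> forall x, P x.
Proof. exact: qpiW. Qed.

Fact hq_comul_linear : linear hq_comul.
Proof.
by move=> c; do 2 elim/pW => ?; rewrite -linearP !hq_comulE !linearP.
Qed.
Fact hq_counit_linear : scalar hq_counit.
Proof. by move=> c; do 2 elim/pW => ?; rewrite -linearP !hq_counitE !linearP. Qed.
Fact hq_antipode_linear : linear hq_antipode.
Proof. by move=> c; do 2 elim/pW => ?; rewrite -linearP !hq_antipodeE !linearP. Qed.
Fact hq_comul_even i a : hq_comul (hcomp i a) = hcomp i (hq_comul a).
Proof.
move: a; elim/pW => a.
by rewrite -(shom_even p) !hq_comulE comul_even -!stensE -shom_even.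
Qed.
Fact hq_counit_even a : hq_counit (hcomp true a) = 0.
Proof. by move: a; elim/pW => a; rewrite -(shom_even p) hq_counitE counit_even. Qed.
Fact hq_antipode_even i a : hq_antipode (hcomp i a) = hcomp i (hq_antipode a).
Proof.
by move: a; elim/pW => a; rewrite -(shom_even p) !hq_antipodeE antipode_even shom_even.
Qed.
Fact hq_comul1 : hq_comul 1 = 1 \ot 1.
Proof. by rewrite -(rmorph1 p) hq_comulE comul1 tmap_pure. Qed.
Fact hq_comulM a b : hq_comul (a * b) = tmul (hq_comul a) (hq_comul b).
Proof.
move: a b; do 2 elim/pW => ?.
by rewrite tmulE -(rmorphM p) !hq_comulE comulM -!stensE -rmorphM.
Qed.
Fact hq_counit1 : hq_counit 1 = 1.
Proof. by rewrite -(rmorph1 p) hq_counitE counit1. Qed.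
Fact hq_counitM a b : hq_counit (a * b) = hq_counit a * hq_counit b.
Proof. by move: a b; do 2 elim/pW => ?; rewrite -(rmorphM p) !hq_counitE counitM. Qed.
Fact hq_comulA a :
  tlift (fun x c => tlift (fun u v => u \ot (v \ot c)) (hq_comul x)) (hq_comul a)
  = tlift (fun x y => x \ot hq_comul y) (hq_comul a).
Proof.
move: a; elim/pW => a; rewrite hq_comulE.
rewrite tlift_tmap; last exact: (coassl_bilin _ (mklin hq_comul_linear)).
rewrite tlift_tmap; last exact: (coassr_bilin _ (mklin hq_comul_linear)).
pose T := tmap p (tmap p p); have lT : linear T by exact: tmap_linear.
have := congr1 T (comulA a); rewrite !(tlift_lin lT) => e.
transitivity (tlift (fun x c => T (tlift (fun u v => u \ot (v \ot c)) (comul x))) (comul a)).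
  apply: eq_tlift => x c; rewrite hq_comulE tlift_tmap; last exact: pure3_bilin.
  by rewrite (tlift_lin lT); apply: eq_tlift => u v; rewrite /T tmap_pure -[X in _ = _ \ot X]/(tmap p p (v \ot c)) tmap_pure.
rewrite e; apply: eq_tlift => u v.
by rewrite /T tmap_pure -[X in _ \ot X = _]/(tmap p p (comul v)) hq_comulE.
Qed.
Fact hq_counitl a : tlift (fun x y => hq_counit x *: y) (hq_comul a) = a.
Proof.
move: a; elim/pW => a; rewrite hq_comulE tlift_tmap; last first.
  exact: (scale_bilinl _ (mkscal hq_counit_linear)).
rewrite -[in RHS](counitl a) shom_tlift.
by apply: eq_tlift => u v; rewrite hq_counitE linearZ_LR.
Qed.
Fact hq_counitr a : tlift (fun x y => hq_counit y *: x) (hq_comul a) = a.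
Proof.
move: a; elim/pW => a; rewrite hq_comulE tlift_tmap; last first.
  exact: (cr_bilin _ (mkscal hq_counit_linear)).
rewrite -[in RHS](counitr a) shom_tlift.
by apply: eq_tlift => u v; rewrite hq_counitE linearZ_LR.
Qed.
Fact hq_antipodel a : tlift (fun x y => hq_antipode x * y) (hq_comul a) = hq_counit a *: 1.
Proof.
move: a; elim/pW => a; rewrite hq_comulE tlift_tmap; last first.
  exact: (mul_bilin (mklin hq_antipode_linear) idfun).
rewrite hq_counitE -(rmorph1 p) -linearZ_LR -antipodel -[RHS]/(p (tlift _ _)) shom_tlift.
by apply: eq_tlift => u v; rewrite hq_antipodeE rmorphM.
Qed.
Fact hq_antipoder a : tlift (fun x y => x * hq_antipode y) (hq_comul a) = hq_counit a *: 1.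
Proof.
move: a; elim/pW => a; rewrite hq_comulE tlift_tmap; last first.
  exact: (mul_bilin idfun (mklin hq_antipode_linear)).
rewrite hq_counitE -(rmorph1 p) -linearZ_LR -antipoder -[RHS]/(p (tlift _ _)) shom_tlift.
by apply: eq_tlift => u v; rewrite hq_antipodeE rmorphM.
Qed.

HB.instance Definition _ := isSuperHopf.Build K Q hq_comul_linear hq_counit_linear
  hq_antipode_linear hq_comul_even hq_counit_even hq_antipode_even hq_comul1 hq_comulM
  hq_counit1 hq_counitM hq_comulA hq_counitl hq_counitr hq_antipodel hq_antipoder.

Fact hq_hopf : hopf_hom (spi I : superhom G Q).
Proof. by split=> a; [exact: hq_comulE|exact: hq_counitE]. Qed.

Definition hquot : closedSub G := @ClosedSub K G Q (spi I) hq_hopf (@spi_surj K G I).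

Lemma hquot0 a : cres hquot a = 0 <-> I a. Proof. exact: spi0. Qed.

End HQuot.

(** * Hopf super-subalgebras *)

Record subhopf (K : fieldType) (G : supergroupType K) := SubHopf {
  shp :> G -> Prop;
  shp_sub : subspace shp;
  shp1 : shp 1;
  shpM : forall a b, shp a -> shp b -> shp (a * b);
  shp_hcomp : forall i a, shp a -> shp (hcomp i a);
  shp_cr : forall (f : {scalar G}) a, shp a -> shp (cr f (comul a));
  shp_cl : forall (f : {scalar G}) a, shp a -> shp (cl f (comul a));
  shp_antipode : forall a, shp a -> shp (antipode a)
}.

Section SubHopfType.
Variables (K : fieldType) (G : supergroupType K) (S : subhopf G).

Definition shpred : {pred G} := fun x => `[< S x >].
Fact shpred_closed : subalg_closed shpred.
Proof.
split=> [|c x y|x y]; first exact/asboolP/shp1.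
  by move=> /asboolP Sx /asboolP Sy; apply/asboolP; apply: (shp_sub S).2.
by move=> /asboolP Sx /asboolP Sy; apply/asboolP; apply: shpM.
Qed.
HB.instance Definition _ := GRing.isSubalgClosed.Build K G shpred shpred_closed.
Definition subT := {x : G | x \in shpred}.
HB.instance Definition _ := SubChoice.on subT.
HB.instance Definition _ := [SubChoice_isSubAlgebra of subT by <:].

Lemma subTP (b : subT) : S (val b). Proof. exact/asboolP/(valP b). Qed.
Lemma subT_ex a : S a -> exists b : subT, val b = a.
Proof. by move=> /asboolP Sa; exists (Sub a Sa); rewrite SubK. Qed.

Lemma valE c (x y : subT) : val (c *: x + y) = c *: val x + val y.
Proof. by rewrite linearP. Qed.

Lemma valM (x y : subT) : val (x * y) = val x * val y. Proof. by []. Qed.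
Lemma valZ c (x : subT) : val (c *: x) = c *: val x. Proof. by []. Qed.

Definition sthcomp i (b : subT) : subT :=
  projT1 (cid (subT_ex (shp_hcomp i (subTP b)))).
Lemma sthcompE i b : val (sthcomp i b) = hcomp i (val b).
Proof. by rewrite /sthcomp; case: cid. Qed.
Fact sthcomp_linear i : linear (sthcomp i).
Proof.
move=> c x y; apply: val_inj; rewrite sthcompE !valE !linearP /= !sthcompE.
by [].
Qed.
Fact sthcomp_hcomp i j v : sthcomp i (sthcomp j v) = if i == j then sthcomp j v else 0.
Proof.
by apply: val_inj; rewrite !sthcompE hcomp_hcomp; case: ifP; rewrite ?sthcompE ?linear0.
Qed.
Fact sthcomp_sum v : sthcomp false v + sthcomp true v = v.
Proof. by apply: val_inj; rewrite linearD /= !sthcompE hcomp_sum. Qed.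
HB.instance Definition _ := isSuperSpace.Build K subT sthcomp_linear sthcomp_hcomp sthcomp_sum.
Lemma val_hcomp i (b : subT) : val (hcomp i b) = hcomp i (val b).
Proof. exact: sthcompE. Qed.
Fact sthcomp1 : hcomp false (1 : subT) = 1.
Proof. by apply: val_inj; rewrite val_hcomp /= hcomp1. Qed.
Fact sthcompM i j (a b : subT) : hcomp (i (+) j) (hcomp i a * hcomp j b) = hcomp i a * hcomp j b.
Proof. by apply: val_inj; rewrite !(val_hcomp, valM) hcompM. Qed.
Fact stsupercomm i j (a b : subT) :
  hcomp i a * hcomp j b = (-1) ^+ (i && j) * (hcomp j b * hcomp i a).
Proof.
have -> (z : subT) : (-1) ^+ (i && j) * z = (-1) ^+ (i && j) *: z.
  by rewrite -mulr_algl -in_algE rmorphXn rmorphN1.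
by apply: val_inj; rewrite valZ !valM !val_hcomp supercomm signZ.
Qed.
HB.instance Definition _ := isSuperComAlgebra.Build K subT sthcomp1 sthcompM stsupercomm.

Definition vS : superhom subT G := mkshom (f := val : subT -> G) valE erefl valM val_hcomp.

Lemma vSD c x y : vS (c *: x + y) = c *: vS x + vS y. Proof. exact: valE. Qed.
Lemma vS_inj : injective vS. Proof. exact: val_inj. Qed.
Lemma vSP b : S (vS b). Proof. exact: subTP. Qed.
Lemma vS_ex a : S a -> exists b : subT, vS b = a. Proof. exact: subT_ex. Qed.

Let vv_inj : injective (tmap vS vS).
Proof. by apply: tmap_inj; exact: vS_inj. Qed.

(** Stability under all contractions puts the coproduct into S \ot S by [tens_memlr]; this is why
    [subhopf] speaks of contractions. The preimage is unique, [tmap vS vS] being injective, and the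
    Hopf axioms are pulled back from G along this injection. *)
Lemma st_comul_ex (b : subT) : exists y : tens subT subT, tmap vS vS y = comul (vS b).
Proof.
have [||f|f|t tS ->] := @tens_memlr _ _ _ S S (comul (vS b)); try exact: shp_sub.
- by apply: shp_cr; exact: vSP.
- by apply: shp_cl; exact: vSP.
have [h hE] : exists h : G -> subT, forall a, S a -> vS (h a) = a.
  have ex a : exists b : subT, S a -> vS b = a.
    have [/vS_ex [c <-]|] := pselect (S a); first by exists c.
    by exists 0.
  by have [h hE] := choice ex; exists h.
exists (\sum_(p <- t) h p.1 \ot h p.2); rewrite linear_sum big_seq [RHS]big_seq.
apply: eq_bigr => p /tS [S1 S2].
by rewrite -[LHS]/(tmap vS vS (h p.1 \ot h p.2)) tmap_pure; congr (_ \ot _); exact: hE.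
Qed.

Definition st_comul (b : subT) : tens subT subT := projT1 (cid (st_comul_ex b)).
Lemma st_comulE b : tmap vS vS (st_comul b) = comul (vS b).
Proof. by rewrite /st_comul; case: cid. Qed.
Definition st_counit (b : subT) : K := counit (vS b).
Definition st_antipode (b : subT) : subT :=
  projT1 (cid (vS_ex (shp_antipode (vSP b)))).
Lemma st_antipodeE b : vS (st_antipode b) = antipode (vS b).
Proof. by rewrite /st_antipode; case: cid. Qed.

Fact st_comul_linear : linear st_comul.
Proof. by move=> c x y; apply: vv_inj; rewrite linearP /= !st_comulE !linearP. Qed.
Fact st_counit_linear : scalar st_counit.
Proof. by move=> c x y; rewrite /st_counit !linearP. Qed.
Fact st_antipode_linear : linear st_antipode.
Proof. by move=> c x y; apply: vS_inj; rewrite [RHS]vSD !st_antipodeE vSD linearP. Qed.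
Fact st_comul_even i b : st_comul (hcomp i b) = hcomp i (st_comul b).
Proof.
apply: vv_inj.
by rewrite st_comulE shom_even comul_even -!stensE shom_even stensE st_comulE.
Qed.
Fact st_counit_even b : st_counit (hcomp true b) = 0.
Proof. by rewrite /st_counit shom_even counit_even. Qed.
Fact st_antipode_even i b : st_antipode (hcomp i b) = hcomp i (st_antipode b).
Proof. by apply: vS_inj; rewrite st_antipodeE !shom_even st_antipodeE antipode_even. Qed.
Fact st_comul1 : st_comul 1 = 1 \ot 1.
Proof. by apply: vv_inj; rewrite st_comulE rmorph1 comul1 tmap_pure /=. Qed.
Fact st_comulM a b : st_comul (a * b) = tmul (st_comul a) (st_comul b).
Proof.
apply: vv_inj.
rewrite st_comulE rmorphM comulM !tmulE -!st_comulE -!stensE.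
exact/esym/rmorphM.
Qed.
Fact st_counit1 : st_counit 1 = 1. Proof. by rewrite /st_counit rmorph1 counit1. Qed.
Fact st_counitM a b : st_counit (a * b) = st_counit a * st_counit b.
Proof. by rewrite /st_counit rmorphM counitM. Qed.
Fact st_comulA a :
  tlift (fun x c => tlift (fun u v => u \ot (v \ot c)) (st_comul x)) (st_comul a)
  = tlift (fun x y => x \ot st_comul y) (st_comul a).
Proof.
pose T := tmap vS (tmap vS vS).
have lT : linear T by exact: tmap_linear.
have Ti : injective T by apply: tmap_inj; [exact: vS_inj|exact: vv_inj].
apply: Ti; rewrite !(tlift_lin lT).
have := comulA (vS a); rewrite -st_comulE tlift_tmap; last exact: coassl_bilin.
rewrite tlift_tmap; last exact: coassr_bilin.
move=> e; transitivity (tlift (fun u v => tlift (fun u0 v0 => u0 \ot (v0 \ot vS v))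
    (comul (vS u))) (st_comul a)).
  apply: eq_tlift => x c; rewrite (tlift_lin lT) -st_comulE tlift_tmap; last exact: pure3_bilin.
  apply: eq_tlift => u v; rewrite /T tmap_pure.
  by rewrite -[X in _ \ot X = _]/(tmap vS vS (v \ot c)) tmap_pure.
rewrite e; apply: eq_tlift => u v; rewrite /T tmap_pure.
by rewrite -[X in _ = _ \ot X]/(tmap vS vS (st_comul v)) st_comulE.
Qed.
Fact st_counitl a : tlift (fun x y => st_counit x *: y) (st_comul a) = a.
Proof.
apply: vS_inj; rewrite -[in RHS](counitl (vS a)) -st_comulE tlift_tmap; last exact: scale_bilinl.
by rewrite shom_tlift; apply: eq_tlift => u v; rewrite linearZ_LR.
Qed.
Fact st_counitr a : tlift (fun x y => st_counit y *: x) (st_comul a) = a.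
Proof.
apply: vS_inj; rewrite -[in RHS](counitr (vS a)) -st_comulE tlift_tmap; last exact: cr_bilin.
by rewrite shom_tlift; apply: eq_tlift => u v; rewrite linearZ_LR.
Qed.
Fact st_antipodel a : tlift (fun x y => st_antipode x * y) (st_comul a) = st_counit a *: 1.
Proof.
apply: vS_inj; rewrite linearZ_LR rmorph1 -antipodel -st_comulE tlift_tmap; last first.
  exact: (mul_bilin (mklin antipode_linear) idfun).
by rewrite shom_tlift; apply: eq_tlift => u v; rewrite rmorphM -[RHS]/(_ * _) -st_antipodeE.
Qed.
Fact st_antipoder a : tlift (fun x y => x * st_antipode y) (st_comul a) = st_counit a *: 1.
Proof.
apply: vS_inj; rewrite linearZ_LR rmorph1 -antipoder -st_comulE tlift_tmap; last first.
  exact: (mul_bilin idfun (mklin antipode_linear)).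
by rewrite shom_tlift; apply: eq_tlift => u v; rewrite rmorphM -[RHS]/(_ * _) -st_antipodeE.
Qed.
HB.instance Definition _ := isSuperHopf.Build K subT st_comul_linear st_counit_linear
  st_antipode_linear st_comul_even st_counit_even st_antipode_even st_comul1 st_comulM
  st_counit1 st_counitM st_comulA st_counitl st_counitr st_antipodel st_antipoder.

Definition sinc : superhom (subT : supergroupType K) G := vS.
Fact sinc_hopf : hopf_hom sinc.
Proof. by split=> a //; rewrite -st_comulE. Qed.
Lemma sinc_inj : injective sinc. Proof. exact: val_inj. Qed.
Lemma sincP b : S (sinc b). Proof. exact: subTP. Qed.
Lemma sinc_ex a : S a -> exists b, sinc b = a. Proof. exact: subT_ex. Qed.

End SubHopfType.

(** * Closed super-subgroups cut out by equations; kernels *)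

Section ClosedOfFunctor.
Variables (K : fieldType) (G : supergroupType K).

Definition idgen (X : G -> Prop) (a : G) : Prop :=
  exists s : seq (G * G), (forall p, p \in s -> X p.2) /\ a = \sum_(p <- s) p.1 * p.2.

Lemma idgen_sub X : subspace (idgen X).
Proof.
split; first by exists [::]; rewrite big_nil.
move=> c x y [s [sX ->]] [t [tX ->]]; exists ([seq (c *: p.1, p.2) | p <- s] ++ t); split.
  by move=> p; rewrite mem_cat => /orP[/mapP[q /sX ? ->]|/tX].
rewrite big_cat big_map scaler_sumr; congr (_ + _).
by apply: eq_bigr => p _; rewrite scalerAl.
Qed.
Lemma idgen_mul X a x : idgen X x -> idgen X (a * x).
Proof.
move=> [s [sX ->]]; exists [seq (a * p.1, p.2) | p <- s]; split.
  by move=> p /mapP[q /sX ? ->].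
by rewrite big_map mulr_sumr; apply: eq_bigr => p _; rewrite mulrA.
Qed.
Lemma idgen_in (X : G -> Prop) x : X x -> idgen X x.
Proof.
move=> Xx; exists [:: (1, x)]; rewrite big_seq1 mul1r; split=> // p.
by rewrite inE => /eqP ->.
Qed.
Lemma idgen_le (X : G -> Prop) (I : G -> Prop) : subspace I ->
  (forall a x, I x -> I (a * x)) -> (forall x, X x -> I x) -> forall a, idgen X a -> I a.
Proof.
move=> hI hm h a [s [sX ->]]; apply: subspace_sum_seq => // p /sX /h; exact: hm.
Qed.
Lemma idgen_hcomp X : (forall i x, X x -> idgen X (hcomp i x)) ->
  forall i x, idgen X x -> idgen X (hcomp i x).
Proof.
move=> h i x [s [sX ->]]; rewrite linear_sum; apply: subspace_sum_seq; first exact: idgen_sub.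
move=> p /sX Xp /=; rewrite -(hcomp_sum p.1) mulrDl linearD /=.
rewrite !(hcompMl _ _ (homog_hcomp _ _)).
by apply: subspaceD; [exact: idgen_sub| |]; apply: idgen_mul; apply: h.
Qed.

Definition kills (R : superAlgType K) (g : superhom G R) (X : G -> Prop) : Prop :=
  forall x, X x -> g x = 0.

Lemma kills_idgen R (g : superhom G R) X : kills g X -> kills g (idgen X).
Proof.
move=> h x [s [sX ->]]; rewrite linear_sum big_seq big1 // => p /sX Xp /=.
by rewrite rmorphM /= (h _ Xp) mulr0.
Qed.

Variable (X : G -> Prop).
Hypothesis Xh : forall i x, X x -> idgen X (hcomp i x).
Hypothesis X1 : forall x, X x -> counit x = 0.
Hypothesis XM : forall R (g h : superhom G R), kills g X -> kills h X -> kills (pmul g h) X.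
Hypothesis XV : forall R (g : superhom G R), kills g X -> kills (pinv g) X.

Let I : G -> Prop := idgen X.
Let I1 x : I x -> counit x = 0.
Proof.
move=> [s [sX ->]]; rewrite linear_sum big_seq big1 // => p /sX Xp.
by rewrite -[LHS]/(counit (p.1 * p.2)) counitM (X1 Xp) mulr0.
Qed.
Let nI1 : ~ I 1.
Proof. by move=> /I1 /eqP; rewrite counit1 oner_eq0. Qed.
Let SI : superideal G :=
  SuperIdeal (idgen_sub X) (@idgen_mul X) (fun i x => @idgen_hcomp X Xh i x) nI1.
Let kp : kills (spi SI) X.
Proof. by move=> x Xx; apply/spi0; exact: idgen_in. Qed.

(** The product of the two generic points of the quotient kills [X], because each of them does; read
    on functions, this is the coideal condition. *)
Let Icomul x : SI x -> stens (spi SI) (spi SI) (comul x) = 0.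
Proof.
rewrite -comulSE comul_pmul -[LHS]/(superhom_comp (stens (spi SI) (spi SI))
  (pmul (in1 G G) (in2 G G)) x).
rewrite pmul_comp /stens sprod_in1 sprod_in2; move: x; apply: kills_idgen; apply: XM.
  by move=> y Xy /=; rewrite -[LHS]/(in1 (squot SI) (squot SI) (spi SI y)) kp // linear0.
by move=> y Xy /=; rewrite -[LHS]/(in2 (squot SI) (squot SI) (spi SI y)) kp // linear0.
Qed.
Let Iant x : SI x -> SI (antipode x).
Proof. by move=> Ix; apply/spi0; exact: (kills_idgen (XV kp) Ix). Qed.

Let HI : hopfideal G := @HopfIdeal K G SI I1 Icomul Iant.

(** When the points that kill [X] form subgroups, functorially, the ideal generated by [X] is a Hopf
    ideal, and these are the points of its quotient. Kernels, centers and even parts are obtained in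
    this way. *)
Lemma closed_of_functor : exists N : closedSub G,
  (forall a, cres N a = 0 <-> idgen X a) /\
  (forall R (g : superhom G R), pt_in N g <-> kills g X).
Proof.
exists (hquot HI); have e a : cres (hquot HI) a = 0 <-> idgen X a by exact: hquot0.
split=> // R g; split.
  by move=> [n nE] x Xx; rewrite nE (e x).2 ?linear0 //; exact: idgen_in.
move=> /kills_idgen kg; have [||n nE] := @superhom_lift K G (hquot HI) R (cres (hquot HI)) g.
- exact: cres_surj.
- by move=> a /e /kg.
by exists n => a; rewrite -nE.
Qed.

End ClosedOfFunctor.

Lemma pt_inP (K : fieldType) (G : supergroupType K) (N : closedSub G) R (g : superhom G R) :
  pt_in N g <-> kills g (fun a => cres N a = 0).
Proof.
split; first by move=> [n nE] x x0; rewrite nE x0 linear0.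
move=> kg; have [n nE] := superhom_lift (@cres_surj _ _ N) kg.
by exists n => a; rewrite -nE.
Qed.

Lemma pt_in_cres (K : fieldType) (G : supergroupType K) (N : closedSub G) R
  (f : superhom N R) : pt_in N (superhom_comp f (cres N)).
Proof. by exists f. Qed.

Section Kernels.
Variables (K : fieldType) (G Q : supergroupType K) (i : superhom Q G) (hi : hopf_hom i).

Definition augim (x : G) : Prop := exists2 q, counit q = 0 & x = i q.

Lemma kills_augim R (g : superhom G R) :
  kills g augim <-> superhom_comp g i = punit Q R.
Proof.
split=> [kg|e x [q q0 ->]]; last first.
  by rewrite -[LHS]/(superhom_comp g i q) e punitE q0 scale0r.
apply: shomP => q; rewrite punitE; pose gi := superhom_comp g i.
have : gi (q - counit q *: 1) = 0.
  apply: kg; exists (q - counit q *: 1) => //.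
  by rewrite linearB scalarZ /= counit1 mulr1 subrr.
by rewrite linearB linearZ_LR rmorph1 => /eqP; rewrite subr_eq0 => /eqP.
Qed.

Lemma augim_hcomp j x : augim x -> augim (hcomp j x).
Proof.
move=> [q q0 ->]; exists (hcomp j q); last by rewrite shom_even.
by rewrite counit_hcomp q0; case: j.
Qed.

Lemma ker_sub : exists N : closedSub G,
  (forall a, cres N a = 0 <-> idgen augim a) /\
  (forall R (g : superhom G R), pt_in N g <-> superhom_comp g i = punit Q R).
Proof.
have [||R g h|R g|N [N0 NP]] := @closed_of_functor K G augim.
- by move=> j x /augim_hcomp - /(_ j) /idgen_in.
- by move=> x [q q0 ->]; rewrite hi.2.
- by rewrite !kills_augim hopf_pmul // => -> ->; rewrite pmul1l.
- by rewrite !kills_augim hopf_pinv // => ->; rewrite pinv1.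
by exists N; split=> // R g; rewrite NP kills_augim.
Qed.

(** Super-commutativity exchanges the two factors; this reconciles the generated ideal with the form
    demanded by [qinc_ker]. *)
Lemma idgen_augim a : idgen augim a <->
  exists s : seq (Q * G), (forall p, p \in s -> counit p.1 = 0) /\ a = \sum_(p <- s) i p.1 * p.2.
Proof.
pose J a := exists s : seq (Q * G),
  (forall p, p \in s -> counit p.1 = 0) /\ a = \sum_(p <- s) i p.1 * p.2.
have sJ : subspace J.
  split; first by exists [::]; rewrite big_nil.
  move=> c x y [s [s0 ->]] [t [t0 ->]]; exists ([seq (c *: p.1, p.2) | p <- s] ++ t); split.
    move=> p; rewrite mem_cat => /orP[/mapP[q /s0 q0 ->]|/t0 //].
    by rewrite scalarZ /= q0 mulr0.
  rewrite big_cat big_map scaler_sumr; congr (_ + _).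
  by apply: eq_bigr => p _; rewrite linearZ_LR scalerAl.
rewrite -/(J a); split.
  move=> [s [sX ->]]; apply: subspace_sum_seq => // -[x y] /sX /= [q q0 ->].
  rewrite -(hcomp_sum x) -(hcomp_sum q) linearD mulrDl !mulrDr /= !shom_even.
  have h j k : J (hcomp j x * hcomp k (i q)).
    rewrite supercomm signZ; apply: subspaceZ => //.
    exists [:: (hcomp k q, hcomp j x)]; rewrite big_seq1 shom_even; split=> // p.
    by rewrite inE => /eqP ->; rewrite counit_hcomp q0; case: k.
  by apply: subspaceD => //; apply: subspaceD => //.
move=> [s [s0 ->]]; apply: subspace_sum_seq; first exact: idgen_sub.
move=> [q x] /s0 /= q0; rewrite -(hcomp_sum x) -(hcomp_sum q) linearD mulrDl !mulrDr /= !shom_even.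
have h j k : idgen augim (hcomp j (i q) * hcomp k x).
  rewrite supercomm signZ; apply: subspaceZ; first exact: idgen_sub.
  by apply: idgen_mul; apply: idgen_in; apply: augim_hcomp; exists q.
have sI := idgen_sub augim.
by apply: subspaceD => //; apply: subspaceD => //.
Qed.

Hypothesis ij : injective i.

Section Quotient.
Variable N : closedSub G.
Hypothesis N0 : forall a, cres N a = 0 <-> idgen augim a.

Lemma ker_sub_pt R (g : superhom G R) : pt_in N g <-> superhom_comp g i = punit Q R.
Proof.
rewrite pt_inP -kills_augim; split=> [kg x Xx|/kills_idgen kg x /N0 /kg //].
by apply/kg/N0/idgen_in.
Qed.

Lemma ker_sub_normal : normal_sub N.
Proof.
move=> R n g /ker_sub_pt hn.
suff : pt_in N (pmul (pmul g n) (pinv g)) by [].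
by apply/ker_sub_pt; rewrite !hopf_pmul // hn pmul1r hopf_pinv // pmulVr.
Qed.

Lemma ker_sub_ker a : cres N a = 0 <-> exists s : seq (Q * G),
  (forall p, p \in s -> counit p.1 = 0) /\ a = \sum_(p <- s) i p.1 * p.2.
Proof. by rewrite N0; exact: idgen_augim. Qed.

Definition ker_quot : quotBy N := QuotBy hi ij ker_sub_normal ker_sub_ker.
End Quotient.

End Kernels.

Lemma stens_in1 (K : fieldType) (A B C D : superAlgType K) (f : superhom A C)
  (g : superhom B D) : superhom_comp (stens f g) (in1 A B) = superhom_comp (in1 C D) f.
Proof. exact: sprod_in1. Qed.
Lemma stens_in2 (K : fieldType) (A B C D : superAlgType K) (f : superhom A C)
  (g : superhom B D) : superhom_comp (stens f g) (in2 A B) = superhom_comp (in2 C D) g.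
Proof. exact: sprod_in2. Qed.
Lemma superhom_comp1 (K : fieldType) (A B : superAlgType K) (f : superhom A B) :
  superhom_comp f (idS A) = f.
Proof. exact: shomP. Qed.
Lemma superhom_comp1l (K : fieldType) (A B : superAlgType K) (f : superhom A B) :
  superhom_comp (idS B) f = f.
Proof. exact: shomP. Qed.

Section HcompContract.
Variables (K : fieldType) (U V : superSpaceType K).

(** Split the functional by parity: its even part preserves the degree of the left leg, its odd part
    shifts it. *)
Lemma hcomp_cr i (f : {scalar V}) (x : tens U V) :
  hcomp i (cr f x) = cr (scomp f (hcomp false : {linear V -> V})) (hcomp i x)
    + cr (scomp f (hcomp true : {linear V -> V})) (hcomp (~~ i) x).
Proof.
elim/tens_hind: x => [|j k u v x hu hv IH]; first by rewrite !linear0 addr0.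
rewrite !linearD /= IH addrACA; congr (_ + _).
have h := homog_pure hu hv; rewrite cr_pure linearZ_LR.
have [e|ne] := eqVneq (j (+) k) i.
  have h2 : homog i (u \ot v) by rewrite -e.
  rewrite h2 (homog_neq h2) ?linear0 ?addr0 ?cr_pure /=; last by case: (i).
  case: k hv e {h h2} => hv e.
    rewrite (homog_neq hu); last by rewrite -e addbT; case: (j).
    by rewrite scaler0 (homog_neq hv) // linear0 scale0r.
  by move: e; rewrite addbF => <-; rewrite hu hv.
have h2 : homog (~~ i) (u \ot v) by case: (i) (j (+) k) ne h => -[].
rewrite h2 (homog_neq h2) ?linear0 ?add0r ?cr_pure /=; last by case: (i).
case: k hv ne {h h2} => hv ne; last first.
  rewrite (homog_neq hu); last by rewrite addbF in ne.
  by rewrite scaler0 (homog_neq hv) // linear0 scale0r.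
have -> : i = j by move: ne; rewrite addbT; case: (i); case: (j).
by rewrite hu hv.
Qed.

Lemma hcomp_cl i (f : {scalar U}) (x : tens U V) :
  exists f0 f1 : {scalar U}, hcomp i (cl f x) = cl f0 (hcomp i x) + cl f1 (hcomp (~~ i) x).
Proof.
exists (scomp f (hcomp false : {linear U -> U})), (scomp f (hcomp true : {linear U -> U})).
elim/tens_hind: x => [|j k u v x hu hv IH]; first by rewrite !linear0 addr0.
rewrite !linearD /= IH addrACA; congr (_ + _).
have h := homog_pure hu hv; rewrite cl_pure linearZ_LR.
have [e|ne] := eqVneq (j (+) k) i.
  have h2 : homog i (u \ot v) by rewrite -e.
  rewrite h2 (homog_neq h2) ?linear0 ?addr0 ?cl_pure /=; last by case: (i).
  case: j hu e {h h2} => hu e.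
    rewrite (homog_neq hv); last by rewrite -e addTb; case: (k).
    by rewrite scaler0 (homog_neq hu) // linear0 scale0r.
  by move: e; rewrite addFb => <-; rewrite hu hv.
have h2 : homog (~~ i) (u \ot v) by case: (i) (j (+) k) ne h => -[].
rewrite h2 (homog_neq h2) ?linear0 ?add0r ?cl_pure /=; last by case: (i).
case: j hu ne {h h2} => hu ne; last first.
  rewrite (homog_neq hv); last by rewrite addFb in ne.
  by rewrite scaler0 (homog_neq hu) // linear0 scale0r.
have -> : i = k by move: ne; rewrite addTb; case: (i); case: (k).
by rewrite hu hv.
Qed.

End HcompContract.

(** * Existence of the center *)

Section Center.
Variables (K : fieldType) (G : supergroupType K).

Lemma central_ptP (R : superAlgType K) (g : superhom G R) :
  central_pt g <-> forall (S : superAlgType K) (f : superhom R S) (h : superhom G S),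
    pmul (superhom_comp f g) h = pmul h (superhom_comp f g).
Proof.
split=> e S f h; first by apply: shomP => a; exact: e.
by move=> a; have := congr1 (fun k => shom k a) (e S f h).
Qed.

(** The generic point of G over R \ot K[G] specializes to every point over every R-algebra, so
    commuting with it is enough. *)
Lemma central_pt_generic (R : superAlgType K) (g : superhom G R) :
  central_pt g <-> pmul (superhom_comp (in1 R G) g) (in2 R G)
    = pmul (in2 R G) (superhom_comp (in1 R G) g).
Proof.
rewrite central_ptP; split=> [|e S f h]; first exact.
have := congr1 (superhom_comp (sprod f h)) e.
by rewrite !pmul_comp superhom_compA sprod_in1 sprod_in2.
Qed.

(** The function a(xy) - a(yx) of two points. Its contractions in y ([cgen]) are the equations in x
    that define the center. *)
Definition cdiff (a : G) : tens G G :=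
  pmul (in1 G G) (in2 G G) a - pmul (in2 G G) (in1 G G) a.

Definition cgen (x : G) : Prop := exists (f : {scalar G}) a, x = cr f (cdiff a).

Lemma kills_cgen (R : superAlgType K) (g : superhom G R) : kills g cgen <-> central_pt g.
Proof.
rewrite central_pt_generic.
have e a : tmap g (idS G) (cdiff a) = pmul (superhom_comp (in1 R G) g) (in2 R G) a
    - pmul (in2 R G) (superhom_comp (in1 R G) g) a.
  have := stens_in2 g (idS G); rewrite superhom_comp1 => <-.
  by rewrite -(stens_in1 g (idS G)) -!pmul_comp -stensE /cdiff linearB.
split=> [kg|hg x [f [a ->]]].
  apply: shomP => a; apply/eqP; rewrite -subr_eq0 -e; apply/eqP/tens_cr0 => f.
  by rewrite (cr_tmap _ (h' := f)) //; apply: kg; exists f, a.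
rewrite -(cr_tmap g (g := idS G) (h := f)) //.
by rewrite -[tmap _ _ _]/(tmap g (idS G) (cdiff a)) e hg subrr linear0.
Qed.

Lemma cgen_hcomp i x : cgen x -> idgen cgen (hcomp i x).
Proof.
move=> [f [a ->]]; rewrite hcomp_cr.
have e j : hcomp j (cdiff a) = cdiff (hcomp j a).
  by rewrite /cdiff linearB !shom_even.
rewrite !e; apply: subspaceD; first exact: idgen_sub.
  by apply: idgen_in; do 2 eexists.
by apply: idgen_in; do 2 eexists.
Qed.

Lemma central_punit (R : superAlgType K) : central_pt (punit G R).
Proof. by apply/central_ptP => S f h; rewrite punit_comp pmul1l pmul1r. Qed.

Lemma central_pmul (R : superAlgType K) (g h : superhom G R) :
  central_pt g -> central_pt h -> central_pt (pmul g h).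
Proof.
rewrite !central_ptP => eg eh S f k.
by rewrite pmul_comp -pmulA eh pmulA eg pmulA.
Qed.

Lemma central_pinv (R : superAlgType K) (g : superhom G R) :
  central_pt g -> central_pt (pinv g).
Proof.
rewrite !central_ptP => eg S f k; rewrite pinv_comp.
apply: (pmul_injl (f := superhom_comp f g)).
by rewrite pmulKVl pmulA eg -pmulA pmulVr pmul1r.
Qed.

Theorem center_exists : exists Z : closedSub G, is_center Z.
Proof.
have [||R g h|R g|Z [_ ZP]] := @closed_of_functor K G cgen.
- exact: cgen_hcomp.
- move=> x cx; have /kills_cgen /(_ x cx) := @central_punit G.
  rewrite punitE => /(congr1 counit).
  by rewrite scalarZ /= counit1 mulr1 linear0.
- by rewrite !kills_cgen; exact: central_pmul.
- by rewrite !kills_cgen; exact: central_pinv.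
by exists Z => R g; rewrite ZP kills_cgen.
Qed.

Lemma center_central (Z : closedSub G) : is_center Z -> central_sub Z.
Proof.
move=> hZ R n g /hZ /central_ptP /(_ R (idS R) g) e a.
have -> : n = superhom_comp (idS R) n by exact: shomP.
exact: (congr1 (fun k => shom k a) e).
Qed.

Lemma central_subP (N : closedSub G) (R : superAlgType K) (n g : superhom G R) :
  central_sub N -> pt_in N n -> pmul n g = pmul g n.
Proof. by move=> hN hn; apply: shomP => a; apply: hN. Qed.

Lemma central_sub_pt (N : closedSub G) (R : superAlgType K) (n : superhom G R) :
  central_sub N -> pt_in N n -> central_pt n.
Proof.
move=> hN [m nE]; apply/central_ptP => S f h; apply: (central_subP _ hN).
by exists (superhom_comp f m) => a /=; rewrite nE.
Qed.

End Center.

(** * Functions invariant under a central super-subgroup *)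

Section Coinv.
Variables (K : fieldType) (G : supergroupType K) (N : closedSub G) (cN : central_sub N).

(** The function a(gn) of g in G and n in N. Thus [coinv] is invariance under right translation by
    N, and [coinv_sub] is the candidate for K[G/N]. *)
Definition cou : superhom G (tens G N) := pmul (in1 G N) (superhom_comp (in2 G N) (cres N)).
Definition coinv (a : G) : Prop := cou a = a \ot 1.

Let T2 := tens G (tens G N).
Let x1 : superhom G T2 := in1 G (tens G N).
Let x2 : superhom G T2 := superhom_comp (in2 G (tens G N)) (in1 G N).
Let x3 : superhom N T2 := superhom_comp (in2 G (tens G N)) (in2 G N).

Lemma coinv_cl (f : {scalar G}) a : coinv a -> coinv (cl f (comul a)).
Proof.
move=> ha.
have e1 : superhom_comp (stens (idS G) cou) (comulS G) =
    superhom_comp (sprod (pmul x1 x2) x3) cou.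
  rewrite comul_pmul pmul_comp stens_in1 stens_in2 superhom_comp1 /cou !pmul_comp pmulA.
  by rewrite [in RHS]superhom_compA sprod_in1 sprod_in2 superhom_compA.
have e2 : superhom_comp (stens (idS G) (in1 G N)) (comulS G) =
    superhom_comp (sprod (pmul x1 x2) x3) (in1 G N).
  by rewrite comul_pmul pmul_comp stens_in1 stens_in2 superhom_comp1 sprod_in1.
have : stens (idS G) cou (comul a) = stens (idS G) (in1 G N) (comul a).
  have e1a : stens (idS G) cou (comul a) = sprod (pmul x1 x2) x3 (cou a).
    exact: (congr1 (fun k => shom k a) e1).
  by rewrite e1a ha; exact: (esym (congr1 (fun k => shom k a) e2)).
rewrite !stensE => /(congr1 (cl f)).
by rewrite !(cl_tmap _ (h := f) (h' := f)).
Qed.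

Let T3 := tens (tens G N) G.
Let y1 : superhom G T3 := superhom_comp (in1 (tens G N) G) (in1 G N).
Let y2 : superhom G T3 := in2 (tens G N) G.
Let y3 : superhom N T3 := superhom_comp (in1 (tens G N) G) (in2 G N).

(** Centrality enters here: a(g n h) = a(g h n). *)
Lemma coinv_cr (f : {scalar G}) a : coinv a -> coinv (cr f (comul a)).
Proof.
move=> ha.
have e1 : superhom_comp (stens cou (idS G)) (comulS G) =
    superhom_comp (sprod (pmul y1 y2) y3) cou.
  rewrite comul_pmul pmul_comp stens_in1 stens_in2 superhom_comp1 /cou !pmul_comp.
  rewrite [in RHS]superhom_compA sprod_in1 sprod_in2 superhom_compA -!pmulA.
  by congr (pmul _ _); apply: (central_subP _ cN); exact: pt_in_cres.
have e2 : superhom_comp (stens (in1 G N) (idS G)) (comulS G) =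
    superhom_comp (sprod (pmul y1 y2) y3) (in1 G N).
  by rewrite comul_pmul pmul_comp stens_in1 stens_in2 superhom_comp1 sprod_in1.
have : stens cou (idS G) (comul a) = stens (in1 G N) (idS G) (comul a).
  have e1a : stens cou (idS G) (comul a) = sprod (pmul y1 y2) y3 (cou a).
    exact: (congr1 (fun k => shom k a) e1).
  by rewrite e1a ha; exact: (esym (congr1 (fun k => shom k a) e2)).
rewrite !stensE => /(congr1 (cr f)).
by rewrite !(cr_tmap _ (h := f) (h' := f)).
Qed.

(** By centrality (gn)^-1 = g^-1 n^-1, so an invariant function stays invariant after inversion. *)
Lemma coinv_antipode a : coinv a -> coinv (antipode a).
Proof.
move=> ha; rewrite /coinv -[LHS]/(pinv cou a).
pose w := sprod (pinv (in1 G N)) (pinv (in2 G N)).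
have -> : pinv cou = superhom_comp w cou.
  rewrite /cou pmul_comp superhom_compA sprod_in1 sprod_in2 pinvM.
  rewrite -(hopf_pinv (cres_hopf N)).
  by apply: (central_subP _ cN); exact: pt_in_cres.
rewrite -[LHS]/(w (cou a)) ha.
by rewrite -[LHS]/(superhom_comp w (in1 G N) a) sprod_in1.
Qed.

Lemma coinv_subspace : subspace coinv.
Proof.
split; first by rewrite /coinv linear0 pure0l.
move=> c x y hx hy; rewrite /coinv linearP -[LHS]/(c *: cou x + cou y) hx hy.
by rewrite pureDl pureZl.
Qed.

Lemma coinv1 : coinv 1. Proof. exact: rmorph1. Qed.
Lemma coinvM a b : coinv a -> coinv b -> coinv (a * b).
Proof.
by move=> ha hb; rewrite /coinv rmorphM -[LHS]/(cou a * cou b) ha hb in1M.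
Qed.
Lemma coinv_hcomp i a : coinv a -> coinv (hcomp i a).
Proof. by rewrite /coinv shom_even => ->; rewrite in1_even. Qed.

Definition coinv_sub : subhopf G := SubHopf coinv_subspace coinv1 coinvM coinv_hcomp
  coinv_cr coinv_cl coinv_antipode.

Lemma coinv_cres a : coinv a -> cres N a = counit a *: 1.
Proof.
move=> /(congr1 (sprod (punit G N) (idS N))); rewrite sprod_pure -[LHS]/(superhom_comp
  (sprod (punit G N) (idS N)) cou a).
rewrite /cou pmul_comp superhom_compA sprod_in1 sprod_in2 pmul1l -[LHS]/(cres N a) => ->.
by rewrite punitE -[idS N 1]/(1 : N) mulr1.
Qed.

Lemma coinv_in_ker x : idgen (augim (sinc coinv_sub)) x -> cres N x = 0.
Proof.
move: x; apply: kills_idgen => x [q q0 ->].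
by rewrite (coinv_cres (sincP q)) -(sinc_hopf coinv_sub).2 in q0 *; rewrite q0 scale0r.
Qed.

End Coinv.

(** * The adjoint coaction and the quotient by the center *)

Section Adjoint.
Variables (K : fieldType) (G : supergroupType K).

(* g |-> x^-1 g x, as a coaction of G on its coordinate algebra. *)
Definition pconj (R : superAlgType K) (x g : superhom G R) : superhom G R :=
  pmul (pmul (pinv g) x) g.
Definition ad : superhom G (tens G G) := pconj (in1 G G) (in2 G G).

Lemma pconj_comp (R S : superAlgType K) (f : superhom R S) (x g : superhom G R) :
  superhom_comp f (pconj x g) = pconj (superhom_comp f x) (superhom_comp f g).
Proof. by rewrite /pconj !pmul_comp pinv_comp. Qed.

Lemma pconjM (R : superAlgType K) (x g h : superhom G R) :
  pconj x (pmul g h) = pconj (pconj x g) h.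
Proof. by rewrite /pconj pinvM !pmulA. Qed.

Lemma pconj1 (R : superAlgType K) (x : superhom G R) : pconj x (punit G R) = x.
Proof. by rewrite /pconj pinv1 pmul1l pmul1r. Qed.

Lemma pconj_fix (R : superAlgType K) (x g : superhom G R) :
  pmul x g = pmul g x -> pconj x g = x.
Proof. by rewrite /pconj -pmulA => ->; rewrite pmulKl. Qed.

Lemma pconj_fixV (R : superAlgType K) (x g : superhom G R) :
  pconj x g = x -> pmul x g = pmul g x.
Proof. by rewrite /pconj => {2}<-; rewrite -pmulA pmulKVl. Qed.

Lemma ad_id (R : superAlgType K) (n : superhom G R) :
  superhom_comp (stens (idS G) n) ad = pconj (in1 G R) (superhom_comp (in2 G R) n).
Proof. by rewrite pconj_comp stens_in1 stens_in2 superhom_comp1. Qed.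

Variables (N : closedSub G) (cN : central_sub N).

(** Conjugation by gn equals conjugation by g when n is central, so its coefficients, as functions
    of g, are N-invariant. *)
Lemma ad_coinv (f : {scalar G}) a : coinv N (cl f (ad a)).
Proof.
have : stens (idS G) (cou N) (ad a) = stens (idS G) (in1 G N) (ad a).
  rewrite -[LHS]/(superhom_comp (stens (idS G) (cou N)) ad a).
  rewrite -[RHS]/(superhom_comp (stens (idS G) (in1 G N)) ad a) !ad_id.
  rewrite /cou pmul_comp superhom_compA pconjM pconj_fix //.
  apply/esym; apply: (central_subP _ cN).
  exact: pt_in_cres.
rewrite !stensE => /(congr1 (cl f)).
by rewrite !(cl_tmap _ (h := f) (h' := f)).
Qed.

End Adjoint.

(** If [n] cannot be told from the unit by the coefficients of the adjoint coaction, conjugation by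
    [n] fixes the generic point, so [n] commutes with every point. *)
Lemma trivial_coinv_central (K : fieldType) (G : supergroupType K) (S : G -> Prop)
    (R : superAlgType K) (n : superhom G R) :
  (forall (f : {scalar G}) a, S (cl f (ad G a))) ->
  (forall a, S a -> n a = counit a *: 1) -> central_pt n.
Proof.
move=> hS hn.
have e : pconj (in1 G R) (superhom_comp (in2 G R) n) = in1 G R.
  rewrite -[RHS](pconj1 (in1 G R)) -(punit_comp _ (in2 G R)) -!ad_id; apply: shomP => a /=.
  rewrite -[LHS]/(stens (idS G) n (ad G a)) -[RHS]/(stens (idS G) (punit G R) (ad G a)).
  rewrite !stensE; apply: tens_clP => f; rewrite !(cl_tmap _ (h := f) (h' := f)) //.
  by rewrite -[LHS]/(n _) hn //; exact: hS.
apply/central_ptP => T f h.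
have := congr1 (superhom_comp (sprod h f)) (pconj_fixV e).
by rewrite !pmul_comp superhom_compA sprod_in1 sprod_in2 => ->.
Qed.

Section CenterQuot.
Variables (K : fieldType) (G : supergroupType K) (Z : closedSub G) (hZ : is_center Z).
Let cZ := center_central hZ.

(** Let N be the subgroup defined by the ideal on the right. Its points are trivial on all
    Z-invariant functions, in particular on the coefficients of conjugation ([ad_coinv]); hence they
    are central and N lies in Z. So the Z-invariant functions represent G/Z. *)
Lemma center_ker a : cres Z a = 0 <-> idgen (augim (sinc (coinv_sub cZ))) a.
Proof.
split; last exact: coinv_in_ker.
have [N [N0 NP]] := ker_sub (sinc_hopf (coinv_sub cZ)).
have : pt_in Z (cres N).
  apply/hZ; apply: (@trivial_coinv_central K G (coinv Z)).
    exact: ad_coinv.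
  move=> b /(sinc_ex (S := coinv_sub cZ)) [q <-].
  have /NP e : pt_in N (cres N) by exists (idS N).
  by rewrite -[LHS]/(superhom_comp (cres N) (sinc (coinv_sub cZ)) q) e punitE
     (sinc_hopf _).2.
by move=> /pt_inP h /h /N0.
Qed.

Definition center_quot : quotBy Z :=
  ker_quot (sinc_hopf (coinv_sub cZ)) (@sinc_inj _ _ _) center_ker.

End CenterQuot.

(** * Hilbert's basis theorem for superalgebras *)

Section Noether.
Variables (K : fieldType) (A : superAlgType K).
Implicit Types (S J I : A -> Prop) (s t : seq A).

Definition lgen S s (y : A) : Prop :=
  exists t : seq (A * A), (forall p, p \in t -> S p.1 /\ p.2 \in s) /\
    y = \sum_(p <- t) p.1 * p.2.

Definition ssub S : Prop :=
  [/\ subspace S, S 1, (forall a b, S a -> S b -> S (a * b)) &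
      (forall i a, S a -> S (hcomp i a))].

Definition sideal S J : Prop :=
  [/\ subspace J, (forall x, J x -> S x), (forall a x, S a -> J x -> J (a * x)) &
      (forall i a, J a -> J (hcomp i a))].

Definition noeth_on S : Prop := forall J, sideal S J ->
  exists2 s, (forall x, x \in s -> J x) & (forall x, J x -> lgen S s x).

Definition noeth : Prop := noeth_on (fun=> True).

Lemma lgen_sub S s : ssub S -> subspace (lgen S s).
Proof.
move=> [hS S1 SM SH]; split; first by exists [::]; rewrite big_nil.
move=> c x y [t [tS ->]] [t' [tS' ->]].
exists ([seq (c *: p.1, p.2) | p <- t] ++ t'); split.
  move=> p; rewrite mem_cat => /orP[/mapP[q /tS [? ?] ->]|/tS' //].
  by split=> //; apply: subspaceZ.
rewrite big_cat big_map scaler_sumr; congr (_ + _).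
by apply: eq_bigr => p _; rewrite scalerAl.
Qed.

Lemma lgen_mul S s a x : ssub S -> S a -> lgen S s x -> lgen S s (a * x).
Proof.
move=> [hS S1 SM SH] Sa [t [tS ->]]; exists [seq (a * p.1, p.2) | p <- t]; split.
  by move=> p /mapP[q /tS [? ?] ->]; split=> //; apply: SM.
by rewrite big_map mulr_sumr; apply: eq_bigr => p _; rewrite mulrA.
Qed.

Lemma lgen_in S s x : ssub S -> x \in s -> lgen S s x.
Proof.
move=> [hS S1 SM SH] xs; exists [:: (1, x)]; rewrite big_seq1 mul1r; split=> // p.
by rewrite inE => /eqP ->.
Qed.

Lemma scalar_ssub : ssub (fun a : A => exists c : K, a = c *: 1).
Proof.
split.
- split; first by exists 0; rewrite scale0r.
  by move=> c _ _ [a ->] [b ->]; exists (c * a + b); rewrite scalerDl scalerA.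
- by exists 1; rewrite scale1r.
- by move=> _ _ [a ->] [b ->]; exists (a * b); rewrite -scalerAl mul1r scalerA.
- move=> i _ [a ->]; rewrite linearZ_LR /=.
  case: i; last by exists a; rewrite hcomp1.
  by exists 0; rewrite (homog_neq (homog1 _)) // scaler0 scale0r.
Qed.

Lemma scalar_noeth : noeth_on (fun a : A => exists c : K, a = c *: 1).
Proof.
move=> J [hJ JS JM _]; have [J1|nJ1] := pselect (J 1).
  exists [:: 1]; first by move=> x; rewrite inE => /eqP ->.
  move=> x /JS [c ->]; exists [:: (c *: 1, 1)]; rewrite big_seq1 mulr1; split=> // p.
  by rewrite inE => /eqP -> /=; rewrite inE eqxx; split=> //; exists c.
exists [::] => // x Jx; have [c e] := JS x Jx; exists [::]; rewrite big_nil; split=> //.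
rewrite e; have [->|c0] := eqVneq c 0; first by rewrite scale0r.
by case: nJ1; rewrite -[1](scalerK c0) -e; apply: subspaceZ.
Qed.

Section Adjoin.
Variables (S : A -> Prop) (hS : ssub S) (nS : noeth_on S) (x : A) (d : bool) (hx : homog d x).

(** The sign automorphism with x c = tw(c) x: adjoining a homogeneous [x] behaves like a skew
    polynomial extension. *)
Definition tw (c : A) : A := hcomp false c + (-1) ^+ d *: hcomp true c.

Lemma mulx_tw c : x * c = tw c * x.
Proof.
rewrite -{1}(hcomp_sum c) mulrDr mulrDl; congr (_ + _).
  by rewrite (homogZC hx (homog_hcomp _ _)) andbF scale1r.
by rewrite (homogZC hx (homog_hcomp _ _)) andbT scalerAl.
Qed.

Lemma S_tw c : S c -> S (tw c).
Proof.
case: hS => sS _ _ SH Sc; apply: subspaceD => //; first exact: SH.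
by apply: subspaceZ => //; apply: SH.
Qed.

Definition adn n (y : A) : Prop :=
  exists c : nat -> A, (forall i, S (c i)) /\ y = \sum_(i < n) c i * x ^+ i.
Definition adj (y : A) : Prop := exists n, adn n y.

Lemma adn_sub n : subspace (adn n).
Proof.
have [sS _ _ _] := hS; split.
  by exists (fun=> 0); split=> [_|]; [exact: sS.1|rewrite big1 // => i _; rewrite mul0r].
move=> c _ _ [a [Sa ->]] [b [Sb ->]]; exists (fun i => c *: a i + b i); split.
  by move=> i; apply: sS.2.
rewrite scaler_sumr -big_split; apply: eq_bigr => i _.
by rewrite /= mulrDl scalerAl.
Qed.

Lemma adn_mono m n y : (m <= n)%N -> adn m y -> adn n y.
Proof.
have [sS _ _ _] := hS; move=> mn [c [Sc ->]].
exists (fun i => if (i < m)%N then c i else 0); split.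
  by move=> i; case: ifP => // _; exact: sS.1.
rewrite (big_ord_widen_cond n xpredT (fun i => c i * x ^+ i)) //=.
rewrite big_mkcond; apply: eq_bigr => i _; case: ifP => //; by rewrite mul0r.
Qed.

Lemma adn_mono1 a n : S a -> adn n.+1 (a * x ^+ n).
Proof.
have [sS _ _ _] := hS; move=> Sa; exists (fun i => if i == n then a else 0); split.
  by move=> i; case: ifP => // _; exact: sS.1.
rewrite big_ord_recr /= eqxx big1 ?add0r // => i _.
by rewrite (ltn_eqF (ltn_ord i)) mul0r.
Qed.

Lemma adn_Sl n a y : S a -> adn n y -> adn n (a * y).
Proof.
have [sS _ SM _] := hS; move=> Sa [c [Sc ->]]; exists (fun i => a * c i); split.
  by move=> i; apply: SM.
by rewrite mulr_sumr; apply: eq_bigr => i _; rewrite mulrA.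
Qed.

Lemma adn_xl n y : adn n y -> adn n.+1 (x * y).
Proof.
have [sS _ _ _] := hS; move=> [c [Sc ->]].
rewrite mulr_sumr; apply: subspace_sum; first exact: adn_sub.
move=> i _; rewrite mulrA mulx_tw -mulrA -exprS.
by apply: (adn_mono _ (adn_mono1 _ (S_tw (Sc i)))); rewrite ltnS.
Qed.

Lemma adn_xr n y : adn n y -> adn n.+1 (y * x).
Proof.
move=> [c [Sc ->]]; rewrite mulr_suml; apply: subspace_sum; first exact: adn_sub.
move=> i _; rewrite -mulrA -exprSr.
by apply: (adn_mono _ (adn_mono1 _ (Sc i))); rewrite ltnS.
Qed.

Lemma homogX i : homog (d && odd i) (x ^+ i).
Proof.
elim: i => [|i IH]; first by rewrite andbF; exact: homog1.
by rewrite exprS /=; have := homogM hx IH; case: (d) => //=; rewrite addTb.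
Qed.

Lemma adn_hcomp n i y : adn n y -> adn n (hcomp i y).
Proof.
have [sS _ _ SH] := hS; move=> [c [Sc ->]]; rewrite linear_sum.
exists (fun k => hcomp (i (+) (d && odd k)) (c k)); split; first by move=> k; apply: SH.
by apply: eq_bigr => k _; rewrite /= (hcompMr _ _ (homogX k)).
Qed.

Lemma adj_S a : S a -> adj a.
Proof. by move=> Sa; exists 1%N; have := adn_mono1 0 Sa; rewrite expr0 mulr1. Qed.

Lemma adj_ssub : ssub adj.
Proof.
have [sS S1 SM SH] := hS; have adjD : subspace adj.
  split; first by exists 0%N; exact: (adn_sub 0).1.
  move=> c y z [m hy] [n hz]; exists (maxn m n); apply: (adn_sub _).2.
    by apply: adn_mono hy; exact: leq_maxl.
  by apply: adn_mono hz; exact: leq_maxr.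
split=> //; first exact: adj_S.
  move=> _ z [m [c [Sc ->]]] hz; rewrite mulr_suml; apply: subspace_sum => // i _.
  rewrite -mulrA; have [n hn] : adj (x ^+ i * z).
    elim: {c Sc} (i : nat) => [|j [n hn]]; first by rewrite mul1r.
    by exists n.+1; rewrite exprS -mulrA; exact: adn_xl.
  by exists n; apply: adn_Sl.
by move=> i y [n hn]; exists n; apply: adn_hcomp.
Qed.

Lemma adj_x : adj x.
Proof. by have [_ S1 _ _] := hS; exists 2%N; have := adn_mono1 1 S1; rewrite mul1r expr1. Qed.

Section Ideal.
Variables (J : A -> Prop) (hJ : sideal adj J).

(** Since [x] may satisfy relations, an element has no well-defined leading coefficient; [lead n]
    collects all coefficients of x^n that occur in some expression of degree at most n. *)
Definition lead n a := S a /\ exists y, J y /\ adn n (y - a * x ^+ n).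

Lemma J_xr y : J y -> J (y * x).
Proof.
have [sJ _ JM JH] := hJ; move=> Jy; rewrite -(hcomp_sum y) mulrDl.
apply: subspaceD => //; rewrite (homogZC (homog_hcomp _ _) hx); apply: subspaceZ => //;
  by apply: JM; [exact: adj_x|exact: JH].
Qed.

Lemma lead_ideal n : sideal S (lead n).
Proof.
have [sS S1 SM SH] := hS; have [sJ JS JM JH] := hJ; split.
- split; first split; [exact: sS.1| |].
    by exists 0; rewrite mul0r subr0; split; [exact: sJ.1|exact: (adn_sub n).1].
  move=> c a b [Sa [y [Jy hy]]] [Sb [z [Jz hz]]]; split; first exact: sS.2.
  exists (c *: y + z); split; first exact: sJ.2.
  rewrite mulrDl opprD addrACA -scalerAl -scalerBr.
  exact: (adn_sub n).2.
- by move=> a [].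
- move=> a b Sa [Sb [y [Jy hy]]]; split; first exact: SM.
  exists (a * y); rewrite -mulrA -mulrBr; split; last exact: adn_Sl.
  by apply: JM => //; apply: adj_S.
- move=> i a [Sa [y [Jy hy]]]; split; first exact: SH.
  exists (hcomp (i (+) (d && odd n)) y); split; first exact: JH.
  have := adn_hcomp (i (+) (d && odd n)) hy.
  by rewrite linearB /= (hcompMr _ _ (homogX n)) -addbA addbb addbF.
Qed.

Lemma lead_mono m n a : (m <= n)%N -> lead m a -> lead n a.
Proof.
move=> /subnK <-; elim: (n - m)%N => // k IH /IH [Sa [y [Jy hy]]]; split=> //.
exists (y * x); split; first exact: J_xr.
by rewrite addSn exprSr mulrA -mulrBl; apply: adn_xr.
Qed.

(** Hilbert's argument. The leading coefficients in all degrees form an ideal of [S], generated in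
    some degree N; lifts of generators in the degrees up to N, together with one more list for all
    higher degrees, generate [J] by descent on the degree. *)
Lemma adjoin_noeth_ideal :
  exists2 s, (forall y, y \in s -> J y) & (forall y, J y -> lgen adj s y).
Proof.
have [sS S1 SM SH] := hS; have [sJ JS JM JH] := hJ; have hA := adj_ssub.
pose L a := exists n, lead n a.
have hL : sideal S L.
  split.
  - split; first by exists 0%N; case: (lead_ideal 0) => -[].
    move=> c a b [m ha] [n hb]; exists (maxn m n); case: (lead_ideal (maxn m n)) => sL _ _ _.
    apply: sL.2; first by apply: lead_mono ha; exact: leq_maxl.
    by apply: lead_mono hb; exact: leq_maxr.
  - by move=> a [n []].
  - by move=> a b Sa [n hb]; exists n; case: (lead_ideal n) => _ _ h _; apply: h.
  - by move=> i a [n ha]; exists n; case: (lead_ideal n) => _ _ _; apply.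
have [s0 s0L s0gen] := nS hL.
have [N s0N] : exists N, forall a, a \in s0 -> lead N a.
  elim: s0 s0L {s0gen} => [|a s IH] sL; first by exists 0%N.
  have [|N hN] := IH; first by move=> b bs; apply: sL; rewrite inE bs orbT.
  have [m hm] := sL a (mem_head _ _); exists (maxn m N) => b; rewrite inE => /orP[/eqP ->|/hN hb].
    by apply: lead_mono hm; exact: leq_maxl.
  by apply: lead_mono hb; exact: leq_maxr.
(* Beyond N the generators of the ideal of all leading coefficients are used; [minn n N] is the
   degree in which they are lifted. *)
have ls n : exists s, (forall a, a \in s -> lead (minn n N) a) /\
    forall a, lead n a -> lgen S s a.
  have [nN|Nn] := leqP n N.
    by have [s h1 h2] := nS (lead_ideal n); exists s.
  by exists s0; split=> // a ha; apply: s0gen; exists n.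
have [s sP] := choice ls.
have Yex n a : exists y, lead n a -> J y /\ adn n (y - a * x ^+ n).
  have [[Sa [y hy]]|h] := pselect (lead n a); last by exists 0.
  by exists y.
have [Y YP] : exists Y : nat -> A -> A, forall n a, lead n a ->
    J (Y n a) /\ adn n (Y n a - a * x ^+ n).
  by exists (fun n a => projT1 (cid (Yex n a))) => n a; case: cid.
(* Homogeneous components are taken so that powers of [x] can be moved past the lifts. *)
pose lifts n := [seq hcomp false (Y (minn n N) a) | a <- s n] ++
  [seq hcomp true (Y (minn n N) a) | a <- s n].
pose T := flatten [seq lifts n | n <- iota 0 N.+1] ++ lifts N.+1.
have TJ y : y \in T -> J y.
  have lJ n z : z \in lifts n -> J z.
    by rewrite mem_cat => /orP[] /mapP[a /(sP n).1 /YP [? _] ->]; apply: JH.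
  rewrite mem_cat => /orP[/flattenP[l /mapP[n _ ->]]|]; exact: lJ.
exists T => // y Jy; have [n] := JS y Jy; elim: n y Jy => [|n IH] y Jy.
  by move=> [c [_ ->]]; rewrite big_ord0; exact: (lgen_sub T hA).1.
move=> [c [Sc e]].
have hl : lead n (c n).
  split=> //; exists y; split=> //; exists c; split=> //.
  by rewrite e big_ord_recr /= addrK.
have sk : exists n', [/\ (minn n' N <= n)%N, (forall z, z \in lifts n' -> z \in T) &
    forall a, lead n a -> lgen S (s n') a].
  have [nN|Nn] := leqP n N.
    exists n; split; [exact: geq_minl| |exact: (sP n).2].
    move=> z hz; rewrite mem_cat; apply/orP; left; apply/flattenP; exists (lifts n) => //.
    by apply: map_f; rewrite mem_iota add0n ltnS.
  exists N.+1; split; first by rewrite (minn_idPr _) // ltnW.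
    by move=> z hz; rewrite mem_cat hz orbT.
  move=> a ha; have : L a by exists n.
  move=> La; have : lead N a.
    have [sL _ LM _] := lead_ideal N.
    have [t [tS ->]] := s0gen a La; apply: subspace_sum_seq => // p /tS [Sp ps].
    by apply: LM => //; apply: s0N.
  by move=> /(lead_mono (leqnSn N)); apply: (sP N.+1).2.
have [n' [n'n n'T n'gen]] := sk; set m := minn n' N in n'n.
have [t [tS ec]] := n'gen _ hl.
(* A combination of lifts with the leading term of [y]; subtracting it lowers the degree. *)
pose z := \sum_(p <- t) p.1 * (Y m p.2 * x ^+ (n - m)).
have tl p : p \in t -> S p.1 /\ lead m p.2 by move=> /tS [? /(sP n').1].
have Jx w i : J w -> J (w * x ^+ i).
  by elim: i => [|i IHi] Jw; rewrite ?mulr1 // exprSr mulrA; apply: J_xr; apply: IHi.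
have Jz : J z.
  apply: subspace_sum_seq => // p /tl [Sp /YP [Jp _]].
  by apply: JM; [exact: adj_S|exact: Jx].
have Tz : lgen adj T z.
  apply: subspace_sum_seq; first exact: lgen_sub.
  move=> p pt; have [Sp ps] := tS p pt.
  apply: lgen_mul => //; first exact: adj_S.
  rewrite -(hcomp_sum (Y m p.2)) mulrDl; apply: subspaceD; first exact: lgen_sub.
    rewrite (homogZC (homog_hcomp _ _) (homogX _)); apply: subspaceZ; first exact: lgen_sub.
    apply: lgen_mul => //; last first.
      by apply: lgen_in => //; apply: n'T; rewrite mem_cat; apply/orP; left; apply/mapP; exists p.2.
    by exists (n - m).+1; have := adn_mono1 (n - m) S1; rewrite mul1r.
  rewrite (homogZC (homog_hcomp _ _) (homogX _)); apply: subspaceZ; first exact: lgen_sub.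
  apply: lgen_mul => //; last first.
    by apply: lgen_in => //; apply: n'T; rewrite mem_cat; apply/orP; right; apply/mapP; exists p.2.
  by exists (n - m).+1; have := adn_mono1 (n - m) S1; rewrite mul1r.
rewrite -(subrK z y); apply: subspaceD => //; first exact: lgen_sub.
apply: IH; first exact: subspaceB.
have -> : y - z = \sum_(i < n) c i * x ^+ i -
   \sum_(p <- t) p.1 * ((Y m p.2 - p.2 * x ^+ m) * x ^+ (n - m)).
  rewrite e big_ord_recr /= {1}ec mulr_suml /z -!addrA; congr (_ + _).
  rewrite -!sumrN -big_split; apply: eq_bigr => p _ /=.
  rewrite mulrBl mulrBr opprB -!mulrA -exprD subnKC //.
apply: subspaceB; first exact: adn_sub.
  by exists c.
apply: subspace_sum_seq; first exact: adn_sub.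
move=> p /tl [Sp /YP [_ hp]]; apply: adn_Sl => //.
rewrite -{1}(subnK n'n); elim: (n - m)%N => [|j IHj]; first by rewrite mulr1.
by rewrite exprSr mulrA addSn; apply: adn_xr.
Qed.
End Ideal.

Lemma adjoin_noeth : noeth_on adj.
Proof. exact: adjoin_noeth_ideal. Qed.

End Adjoin.

(** Without a maximal member there is a strictly increasing chain in [F]; its union is finitely
    generated, so it is reached at a finite stage, a contradiction. *)
Lemma noeth_max (F : (A -> Prop) -> Prop) : noeth ->
  (forall I, F I -> sideal (fun=> True) I) -> (exists I, F I) ->
  exists2 M, F M & forall I, F I -> (forall x, M x -> I x) -> forall x, I x -> M x.
Proof.
move=> nA FI [I0 FI0]; apply: contrapT => nomax.
have next (M : {I | F I}) : exists N : {I | F I},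
    (forall x, sval M x -> sval N x) /\ ~ (forall x, sval N x -> sval M x).
  apply: contrapT => h; apply: nomax; exists (sval M); first exact: (proj2_sig M).
  move=> I hI MI; apply: contrapT => h2; apply: h.
  by exists (exist _ I hI).
have [f fP] := choice next.
pose g n := iter n f (exist _ I0 FI0).
have gmono m n : (m <= n)%N -> forall x, sval (g m) x -> sval (g n) x.
  move=> /subnK <-; elim: (n - m)%N => // k IH x /IH; exact: (fP _).1.
pose U x := exists n, sval (g n) x.
have sg n : sideal (fun=> True) (sval (g n)) by apply/FI/(proj2_sig (g n)).
have hU : sideal (fun=> True) U.
  split=> //.
  - split; first by exists 0%N; case: (sg 0%N) => -[].
    move=> c x y [m hm] [n hn]; exists (maxn m n); case: (sg (maxn m n)) => sgs _ _ _.
    apply: sgs.2; first by apply: gmono hm; exact: leq_maxl.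
    by apply: gmono hn; exact: leq_maxr.
  - by move=> a x _ [n hn]; exists n; case: (sg n) => _ _ h _; apply: h.
  - by move=> i a [n hn]; exists n; case: (sg n) => _ _ _; apply.
have [s sU sgen] := nA U hU.
have [N hN] : exists N, forall x, x \in s -> sval (g N) x.
  elim: s sU {sgen} => [|a s IH] sU; first by exists 0%N.
  have [|N hN] := IH; first by move=> b bs; apply: sU; rewrite inE bs orbT.
  have [m hm] := sU a (mem_head _ _); exists (maxn m N) => b; rewrite inE => /orP[/eqP ->|/hN hb].
    by apply: gmono hm; exact: leq_maxl.
  by apply: gmono hb; exact: leq_maxr.
apply: (fP (g N)).2 => x hx.
have [t [tS ->]] := sgen x (ex_intro _ N.+1 hx).
have [sgs _ gM _] := sg N; apply: subspace_sum_seq => // p /tS [_ ps].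
by apply: gM => //; apply: hN.
Qed.

End Noether.

(** Starting from the scalars, adjoin the even and then the odd component of each generator. *)
Theorem hilbert_basis (K : fieldType) (G : supergroupType K) : algebraic G -> noeth G.
Proof.
move=> [s sgen].
have [S [hS nS sS]] : exists S : G -> Prop, [/\ ssub S, noeth_on S & forall a, a \in s -> S a].
  elim: {sgen} s => [|a s [S [hS nS sS]]].
    exists (fun a : G => exists c : K, a = c *: 1); split=> //.
      exact: scalar_ssub.
    exact: scalar_noeth.
  pose x0 := hcomp false a; pose x1 := hcomp true a.
  have h0 : homog false x0 by exact: homog_hcomp.
  have h1 : homog true x1 by exact: homog_hcomp.
  have hS0 := adj_ssub hS h0.
  exists (adj (adj S x0) x1); split.
  - exact (adj_ssub hS0 h1).
  - by apply: adjoin_noeth h1 => //; apply: adjoin_noeth h0.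
  - move=> b; rewrite inE => /orP[/eqP ->|bs]; last by do 2 (apply: adj_S => //); exact: sS.
    have [sD _ _ _] := adj_ssub hS0 h1.
    rewrite -(hcomp_sum a); apply: subspaceD => //; last exact: adj_x.
    by apply: adj_S => //; apply: adj_x.
have [sS' S1 SM _] := hS.
have all a : S a.
  apply: sgen => //; first by move=> *; apply: subspaceD.
  by move=> *; apply: subspaceZ.
move=> J [sJ _ JM JH]; have [|t tJ tgen] := nS J.
  by split=> // b x _; apply: JM.
by exists t => // x /tgen [l [lS ->]]; exists l; split=> // p /lS [].
Qed.

(** * Odd elements in characteristic different from 2; partial linear maps *)

Section OddSquare.
Variables (K : fieldType) (hK : 2%N \notin [pchar K]).

Lemma two_neq0 : (2%:R : K) != 0.
Proof. by move: hK; rewrite inE /=. Qed.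

Lemma eq_opp0 (V : lmodType K) (x : V) : x = - x -> x = 0.
Proof.
move=> e; apply/eqP; have : 2%:R *: x == 0.
  by rewrite scaler_nat mulr2n {2}e subrr.
by rewrite scaler_eq0 (negPf two_neq0).
Qed.

Lemma odd_sq (A : superAlgType K) (a : A) : homog true a -> a * a = 0.
Proof. by move=> h; apply: eq_opp0; rewrite {1}(homogC h h) /= expr1 mulN1r. Qed.
End OddSquare.

Lemma evenC (K : fieldType) (A : superAlgType K) (r a : A) : homog false r -> r * a = a * r.
Proof.
move=> hr; rewrite -(hcomp_sum a) mulrDr mulrDl.
by rewrite !(homogZC hr (homog_hcomp _ _)) /= !scale1r.
Qed.

Lemma cl_mull (K : fieldType) (A B : superAlgType K) (f g : {scalar A}) (s : A) (y : tens A B) :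
  (forall u, g u = f (s * u)) -> cl f ((s \ot 1) * y) = cl g y.
Proof.
move=> e; elim/tens_ind: y => [|u v y IH]; first by rewrite mulr0 !linear0.
by rewrite mulrDr !linearD /= IH tensMl1 !cl_pure e.
Qed.

Lemma mulsc_proof (K : fieldType) (A : algType K) (f : {scalar A}) (s : A) :
  scalar (fun u => f (s * u)).
Proof. by move=> c x y; rewrite mulrDr -scalerAr linearP. Qed.
Definition mulsc (K : fieldType) (A : algType K) (f : {scalar A}) (s : A) : {scalar A} :=
  mkscal (mulsc_proof f s).

(** A partial linear map is only evaluated at finitely many vectors; a total linear map with these
    values is built by adding one vector at a time. *)
Lemma lin_agree (K : fieldType) (V W : lmodType K) (P : V -> Prop) (h : V -> W) (s : seq V) :
  subspace P -> (forall c x y, P x -> P y -> h (c *: x + y) = c *: h x + h y) ->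
  (forall x, x \in s -> P x) -> exists H : {linear V -> W}, forall x, x \in s -> H x = h x.
Proof.
move=> hP hh; have h0 : h 0 = 0.
  have := hh (-1) 0 0 hP.1 hP.1; by rewrite scaler0 addr0 scaleN1r addNr.
elim: s => [|u s IH] sP.
  have l : linear (fun _ : V => 0 : W) by move=> c x y; rewrite scaler0 addr0.
  by exists (mklin l).
have [|H HE] := IH; first by move=> x xs; apply: sP; rewrite inE xs orbT.
have hz : subspace (fun x : V => x = 0) by split=> // c x y -> ->; rewrite scaler0 addr0.
have [[z [c [-> e]]]|nS] := pselect (spn (fun x => x = 0) s u).
  exists H => x; rewrite inE => /orP[/eqP ->|/HE //].
  rewrite e add0r linear_sum /=.
  have {e} : forall x, x \in s -> P x by move=> y ys; apply: sP; rewrite inE ys orbT.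
  elim: s c HE {IH sP} => [|y s IHs] c HE sP; first by rewrite !big_ord0 h0.
  rewrite !big_ord_recl /= hh; last 2 first.
  - by apply: sP; rewrite mem_head.
  - apply: subspace_sum => // i _; apply: subspaceZ => //; apply: sP.
    by rewrite inE; apply/orP; right; apply: (mem_nth 0 (ltn_ord i)).
  rewrite linearZ_LR HE ?mem_head // (IHs (fun i => c i.+1)) // => y' ys.
    by apply: HE; rewrite inE ys orbT.
  by apply: sP; rewrite inE ys orbT.
have [f [f0 f1]] := separation (spn_subspace _ hz) nS.
have l : linear (fun x => H x + f x *: (h u - H u)).
  move: (h u - H u) => w c x y.
  by rewrite !linearP /= scalerDl scalerDr !scalerA addrACA.
exists (mklin l) => x; rewrite inE => /orP[/eqP ->|xs] /=; first by rewrite f1 scale1r addrC subrK.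
by rewrite f0 ?scale0r ?addr0 ?HE //; exact: spn_in.
Qed.

(** * Direct substitutes for faithful flatness over a Hopf super-subalgebra *)

Section FF.
Variables (K : fieldType) (hK : 2%N \notin [pchar K]) (G : supergroupType K) (nG : noeth G).
Variable B : subhopf G.

Definition evB (r : G) : Prop := B r /\ homog false r.

Lemma evB1 : evB 1. Proof. by split; [exact: shp1|exact: homog1]. Qed.
Lemma evBM r s : evB r -> evB s -> evB (r * s).
Proof. by move=> [Br hr] [Bs hs]; split; [exact: shpM|exact: homogM hr hs]. Qed.
Lemma evBZ c : evB (c *: 1).
Proof.
split; first by apply: subspaceZ; [exact: shp_sub|exact: shp1].
by apply: homogZ; exact: homog1.
Qed.
Lemma evBN r : evB r -> evB (- r).
Proof.
move=> [Br hr]; split; first by apply: subspaceN => //; exact: shp_sub.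
by rewrite -scaleN1r; apply: homogZ.
Qed.
Lemma evBD r s : evB r -> evB s -> evB (r + s).
Proof.
move=> [Br hr] [Bs hs]; split; last exact: homogD.
by apply: subspaceD => //; exact: shp_sub.
Qed.

(* An element of B whose annihilator is maximal; its annihilator in B is then  *)
(* a prime ideal that contains all odd elements.                               *)
Lemma assoc_elt : exists (d : bool) (sg : G), [/\ homog d sg, B sg, sg != 0,
  (forall b, B b -> homog true b -> b * sg = 0) &
  (forall r s, evB r -> evB s -> r * sg <> 0 -> s * sg <> 0 -> r * s * sg <> 0)].
Proof.
pose F (I : G -> Prop) := exists d sg, [/\ homog d sg, B sg, sg != 0 &
  forall a, I a <-> a * sg = 0].
have [||M [d [sg [hd Bs s0 ME]]] Mmax] := noeth_max (F := F) nG.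
- move=> I [d [sg [hd Bs s0 IE]]]; split=> //.
  + split; first by apply/IE; rewrite mul0r.
    move=> c x y /IE hx /IE hy; apply/IE.
    by rewrite mulrDl -scalerAl hx hy scaler0 addr0.
  + by move=> a x _ /IE hx; apply/IE; rewrite -mulrA hx mulr0.
  + move=> i a /IE ha; apply/IE.
    have := hcompMr (i (+) d) a hd; rewrite ha linear0 -addbA addbb addbF.
    by move=> <-.
- exists (fun a => a * 1 = 0), false, 1; split=> //; [exact: homog1|exact: shp1|exact: oner_neq0].
have Ann e b a : B b -> homog e b -> b * sg <> 0 -> a * (b * sg) = 0 -> a * sg = 0.
  move=> Bb hb bs abs; apply/ME; apply: (Mmax (fun a => a * (b * sg) = 0)) => //.
    exists (e (+) d), (b * sg); split=> //; [exact: homogM|exact: shpM|exact/eqP].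
  move=> x /ME xs; rewrite -(hcomp_sum x).
  have xi i : hcomp i x * sg = 0.
    by have := hcompMr (i (+) d) x hd; rewrite xs linear0 -addbA addbb addbF => <-.
  rewrite mulrDl !mulrA !(homogZC (homog_hcomp _ _) hb) -!scalerAl -!mulrA !xi.
  by rewrite !mulr0 !scaler0 addr0.
exists d, sg; split=> //.
  (* If b sg were nonzero, maximality would make its annihilator that of sg; but b kills b sg, as
     b^2 = 0. *)
  move=> b Bb hb; apply: contrapT => bs; apply: (bs); apply: (Ann _ b) => //; first exact: hb.
  by rewrite mulrA odd_sq // mul0r.
move=> r s [Br hr] [Bs' hs] rs ss rss; apply: rs; apply: (Ann false s) => //.
by rewrite mulrA.
Qed.

Section Fixed.
Variables (d : bool) (sg : G) (hd : homog d sg) (Bsg : B sg) (sg0 : sg != 0).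
Hypothesis oddB : forall b, B b -> homog true b -> b * sg = 0.
Hypothesis dom : forall r s, evB r -> evB s -> r * sg <> 0 -> s * sg <> 0 -> r * s * sg <> 0.

(** The module sg K[G]: odd elements of B act on it by zero, and even ones through the domain B_0 /
    Ann(sg). *)
Definition insg z := exists w, z = sg * w.

Lemma insg_odd b z : B b -> homog true b -> insg z -> b * z = 0.
Proof. by move=> Bb hb [w ->]; rewrite mulrA oddB // mul0r. Qed.
Lemma insg_oddr b z : B b -> homog true b -> insg z -> z * b = 0.
Proof.
move=> Bb hb [w ->]; rewrite -mulrA -(hcomp_sum w) mulrDl.
rewrite !(homogZC (homog_hcomp _ _) hb) mulrDr -!scalerAr !mulrA (homogZC hd hb) oddB //.
by rewrite scaler0 !mul0r !scaler0 addr0.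
Qed.
Lemma insgr z w : insg z -> insg (z * w).
Proof. by move=> [v ->]; exists (v * w); rewrite mulrA. Qed.
Lemma insgl r z : evB r -> insg z -> insg (r * z).
Proof. by move=> [_ hr] [v ->]; exists (r * v); rewrite !mulrA (evenC sg hr). Qed.
Lemma insg0 : insg 0. Proof. by exists 0; rewrite mulr0. Qed.
Lemma insgD z w : insg z -> insg w -> insg (z + w).
Proof. by move=> [a ->] [b ->]; exists (a + b); rewrite mulrDr. Qed.

(** A map that is linear over the even part of B but is defined only on a submodule [P] of sg
    K[G]. *)
Definition plin (P : G -> Prop) (h : G -> G) : Prop :=
  [/\ P 0, (forall r p q, evB r -> P p -> P q -> P (r * p + q) /\ h (r * p + q) = r * h p + h q),
     (forall p, P p -> insg p) & (forall p, P p -> insg (h p))].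

Section PlinTheory.
Variables (P : G -> Prop) (h : G -> G) (hP : plin P h).
Lemma plin0 : h 0 = 0.
Proof.
case: hP => P0 PL _ _; have := (PL 1 0 0 evB1 P0 P0).2.
by rewrite !mul1r addr0 => e; apply: (addrI (h 0)); rewrite addr0 -e.
Qed.
Lemma plinZ r p : evB r -> P p -> P (r * p) /\ h (r * p) = r * h p.
Proof. by case: hP => P0 PL _ _ hr Pp; have := PL r p 0 hr Pp P0; rewrite !addr0 plin0 addr0. Qed.
Lemma plinB p q : P p -> P q -> P (p - q) /\ h (p - q) = h p - h q.
Proof.
case: hP => P0 PL _ _ Pp Pq; have := PL (-1) q p (evBN evB1) Pq Pp.
by rewrite !mulN1r ![- _ + _]addrC.
Qed.
Lemma plin_sub : subspace P.
Proof.
by case: hP => P0 PL _ _; split=> // c x y Px Py; have := (PL _ x y (evBZ c) Px Py).1; rewrite mulr_algl.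
Qed.
Lemma plin_lin c x y : P x -> P y -> h (c *: x + y) = c *: h x + h y.
Proof. by case: hP => P0 PL _ _ Px Py; have := (PL _ x y (evBZ c) Px Py).2; rewrite !mulr_algl. Qed.
End PlinTheory.

(** The element [s] is a denominator: the extension is s h on [P] and sends [v] to [w]. The last
    hypothesis is the compatibility of the two prescriptions where they overlap. *)
Lemma plin_ext P h v s w : plin P h -> insg v -> evB s -> insg w ->
  (forall r, evB r -> P (r * v) -> s * h (r * v) = r * w) ->
  exists P' h', [/\ plin P' h', (forall p, P p -> P' p /\ h' p = s * h p), P' v & h' v = w].
Proof.
move=> hP hv hs hw hc; have [P0 PL Pi hi] := hP.
pose P' y := exists pr : G * G, [/\ P pr.1, evB pr.2 & y = pr.1 + pr.2 * v].
have prx y : exists pr : G * G, P' y -> [/\ P pr.1, evB pr.2 & y = pr.1 + pr.2 * v].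
  by have [[pr ?]|?] := pselect (P' y); [exists pr|exists (0, 0)].
have [pr prP] := choice prx.
pose h' y := s * h (pr y).1 + (pr y).2 * w.
have key p r : P p -> evB r -> h' (p + r * v) = s * h p + r * w.
  move=> Pp hr; have [|] := prP (p + r * v); first by exists (p, r).
  rewrite /h'; case: (pr _) => p' r' /= Pp' hr' e.
  have e2 : (r - r') * v = p' - p.
    by rewrite mulrBl; apply: (addrI p); rewrite addrA e addrK [RHS]addrC subrK.
  have hrr : evB (r - r') by apply: evBD => //; apply: evBN.
  have := hc _ hrr; rewrite e2 => /(_ (plinB hP Pp' Pp).1).
  rewrite (plinB hP Pp' Pp).2 mulrBr mulrBl => e3.
  by rewrite -(subrK (s * h p) (s * h p')) e3 addrAC subrK addrC.
exists P', h'; split.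
- split.
  + by exists (0, 0); rewrite mul0r addr0; split=> //; have := evBZ 0; rewrite scale0r.
  + move=> r _ _ hr [[p a] [/= Pp ha ->]] [[q b] [/= Pq hb ->]].
    have e : r * (p + a * v) + (q + b * v) = (r * p + q) + (r * a + b) * v.
      by rewrite mulrDr mulrDl addrACA mulrA.
    have hab : evB (r * a + b) by apply: evBD => //; apply: evBM.
    have [Prp hrp] := PL r p q hr Pp Pq.
    split; first by rewrite e; exists (r * p + q, r * a + b).
    rewrite e !key // hrp !mulrDr mulrDl addrACA !mulrA; congr (_ + _ + _).
    by rewrite (evenC s hr.2).
  + by move=> _ [[p a] [/= /Pi Pp ha ->]]; apply: insgD => //; apply: insgl.
  + move=> _ [[p a] [/= Pp ha ->]]; rewrite key //.
    by apply: insgD; apply: insgl => //; apply: hi.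
- move=> p Pp; have e : p = p + 0 * v by rewrite mul0r addr0.
  have h0 : evB 0 by have := evBZ 0; rewrite scale0r.
  split; first by rewrite e; exists (p, 0).
  by rewrite {1}e key // mul0r addr0.
- by exists (0, 1); rewrite add0r mul1r; split=> //; exact: evB1.
- have e : v = 0 + 1 * v by rewrite mul1r add0r.
  by rewrite {1}e key ?mul1r ?(plin0 hP) ?mulr0 ?add0r //; exact: evB1.
Qed.

(** Extension of linear maps over the fraction field of B_0 / Ann(sg), with denominators cleared. If
    some r v lies in [P] with r sg nonzero, the value at [v] is forced up to the denominator r;
    otherwise 0 is an admissible value. *)
Lemma plin_ext1 P h v : plin P h -> insg v -> exists s P' h',
  [/\ evB s, s * sg <> 0, plin P' h', (forall p, P p -> P' p /\ h' p = s * h p) & P' v].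
Proof.
move=> hP hv; have [P0 PL Pi hi] := hP.
have [[r [hr Prv rs]]|h0] := pselect (exists r, [/\ evB r, P (r * v) & r * sg <> 0]).
  have [||P' [h' [hP' e Pv _]]] := plin_ext (s := r) (w := h (r * v)) hP hv hr; last by exists r, P', h'.
    exact: hi.
  move=> a ha Pav; have [_ <-] := plinZ hP hr Pav; have [_ <-] := plinZ hP ha Prv.
  by rewrite !mulrA (evenC a hr.2).
have [|r hr Prv|P' [h' [hP' e Pv _]]] := plin_ext (s := 1) (w := 0) hP hv evB1.
- exact: insg0.
- have rs : r * sg = 0 by apply: contrapT => rs; apply: h0; exists r.
  have -> : r * v = 0 by case: hv => w ->; rewrite mulrA rs mul0r.
  by rewrite (plin0 hP) !mulr0.
exists 1, P', h'; split=> //; first exact: evB1.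
by rewrite mul1r; apply/eqP.
Qed.

Lemma plin_exts P h (vs : seq G) : plin P h -> exists s P' h',
  [/\ evB s, s * sg <> 0, plin P' h', (forall p, P p -> P' p /\ h' p = s * h p) &
      forall v, v \in vs -> P' (sg * v)].
Proof.
elim: vs P h => [|v vs IH] P h hP.
  exists 1, P, h; split=> //; [exact: evB1|by rewrite mul1r; apply/eqP|].
  by move=> p Pp; rewrite mul1r.
have [|s [P' [h' [hs ss hP' e Pv]]]] := plin_ext1 (v := sg * v) hP; first by exists v.
have [s' [P2 [h2 [hs' ss' hP2 e2 Pvs]]]] := IH _ _ hP'.
exists (s' * s), P2, h2; split=> //; [exact: evBM|exact: dom| |].
  by move=> p /e [/e2 [? ->] ->]; rewrite mulrA.
by move=> w; rewrite inE => /orP[/eqP ->|/Pvs //]; exact: (e2 _ Pv).1.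
Qed.

Definition Psi (H : {linear G -> G}) (y : tens G G) : G :=
  tlift (fun u c => H (sg * u) * c) y.

Lemma Psi_bilin (H : {linear G -> G}) : bilin (fun u c => H (sg * u) * c).
Proof.
split=> [v c x y|u c x y].
  by rewrite mulrDr -scalerAr linearP mulrDl -scalerAl.
by rewrite mulrDr -scalerAr.
Qed.
HB.instance Definition _ H := GRing.isLinear.Build K _ _ *:%R (Psi H) (tlift_linear (Psi_bilin H)).
Lemma Psi_pure H u c : Psi H (u \ot c) = H (sg * u) * c.
Proof. by rewrite /Psi tlift_pure //; exact: Psi_bilin. Qed.

Section Kill.
Variable rho : superhom G (tens G G).
Hypothesis rhoB : forall b, B b -> exists2 t : seq (G * G),
  (forall p, p \in t -> B p.1 /\ B p.2) & rho b = \sum_(p <- t) p.1 \ot p.2.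
Hypothesis rhom : superhom_comp (sprod (idS G) (idS G)) rho = punit G G.

(** If [H] were B-linear, [Psi] would factor through the tensor product over B, where [rho b]
    becomes the product of its legs, that is, the counit of b, which is 0. Since only partial linear
    maps extend, the lists [V] and [W] record the finitely many vectors at which linearity is
    used. *)
Lemma Psi_kill (u b a : G) : B b -> counit b = 0 -> exists V : seq G,
  forall P h, plin P h -> (forall v, v \in V -> P (sg * v)) ->
  exists2 W : seq G, (forall w, w \in W -> P w) &
    forall H : {linear G -> G}, (forall w, w \in W -> H w = h w) ->
      Psi H ((u \ot 1) * rho b * rho a) = 0.
Proof.
move=> Bb b0; have [tb tB eb] := rhoB Bb; set ta := repr (rho a).
exists (flatten [seq [:: u * hcomp false p.1; u * hcomp true p.1] | p <- ta]).
move=> P h hP PV; have [P0 PL Pi hi] := hP.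
have Pp p k : p \in ta -> P (sg * (u * hcomp k p.1)).
  move=> pt; apply: PV; apply/flattenP.
  exists [:: u * hcomp false p.1; u * hcomp true p.1]; first exact: map_f.
  by case: k; rewrite !inE eqxx ?orbT.
pose wt k (q p : G * G) := sg * (u * (hcomp false q.1 * hcomp k p.1)).
pose W := flatten [seq [seq wt false q p | p <- ta] ++ [seq wt true q p | p <- ta] | q <- tb].
have wtE k q p : q \in tb -> p \in ta ->
    P (wt k q p) /\ h (wt k q p) = hcomp false q.1 * h (sg * (u * hcomp k p.1)).
  move=> /tB [B1 _] pt; have hr : evB (hcomp false q.1).
    by split; [exact: shp_hcomp|exact: homog_hcomp].
  have -> : wt k q p = hcomp false q.1 * (sg * (u * hcomp k p.1)).
    by rewrite /wt !mulrA (evenC sg hr.2) -!mulrA; congr (_ * _); rewrite !mulrA (evenC u hr.2).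
  by apply: plinZ => //; apply: Pp.
exists W.
  by move=> w /flattenP[l /mapP[q qt ->]]; rewrite mem_cat => /orP[] /mapP[p pt ->];
     apply: (wtE _ q p _ _).1.
move=> H HW.
have HWk k q p : q \in tb -> p \in ta -> H (wt k q p) = h (wt k q p).
  move=> qt pt; apply: HW; apply/flattenP.
  exists ([seq wt false q p | p <- ta] ++ [seq wt true q p | p <- ta]).
    by apply/mapP; exists q.
  by rewrite mem_cat; case: k; apply/orP; [right|left]; apply/mapP; exists p.
pose z k (p : G * G) := h (sg * (u * hcomp k p.1)) * p.2.
have zi k p : p \in ta -> insg (z k p) by move=> pt; apply: insgr; apply: hi; apply: Pp.
have term q p : q \in tb -> p \in ta ->
    Psi H ((u \ot 1) * (q.1 \ot q.2) * (p.1 \ot p.2)) = q.1 * q.2 * (z false p + z true p).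
  move=> qt pt; have [B1 B2] := tB q qt.
  have sub k : Psi H ((u \ot 1) * (q.1 \ot q.2) * (hcomp k p.1 \ot p.2)) = q.1 * q.2 * z k p.
    have hk := homog_hcomp k p.1.
    have E j : Psi H ((u \ot 1) * (q.1 \ot hcomp j q.2) * (hcomp k p.1 \ot p.2)) =
        (-1) ^+ (j && k) *: (hcomp false q.1 * h (sg * (u * hcomp k p.1)) * (hcomp j q.2 * p.2)).
      rewrite -mulrA (tensM_hom _ _ (homog_hcomp j q.2) hk) -scalerAr tensMl1 linearZ_LR -[X in _ *: X = _]/(Psi H (_ \ot _)) Psi_pure.
      congr (_ *: (_ * _)); rewrite -(wtE k q p qt pt).2 -HWk //; congr (H _).
      rewrite -[in LHS](hcomp_sum q.1) mulrDl !mulrDr /wt [X in _ + X](_ : _ = 0) ?addr0 //.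
      have z0 : sg * u * hcomp true q.1 = 0.
        by apply: insg_oddr; [exact: shp_hcomp|exact: homog_hcomp|exists u].
      by rewrite !mulrA z0 mul0r.
    rewrite -{1}(hcomp_sum q.2) pureDr mulrDr mulrDl linearD /= !E /=.
    rewrite [X in _ + X](_ : _ = 0) ?addr0 ?scale1r; last first.
      have z0 : h (sg * (u * hcomp k p.1)) * hcomp true q.2 = 0.
        by apply: insg_oddr; [exact: shp_hcomp|exact: homog_hcomp|apply: hi; apply: Pp].
      by rewrite [_ * (hcomp true q.2 * _)]mulrA -[_ * _ * hcomp true q.2]mulrA z0
        mulr0 mul0r scaler0.
    have h2 : evB (hcomp false q.2) by split; [exact: shp_hcomp|exact: homog_hcomp].
    have -> : hcomp false q.1 * h (sg * (u * hcomp k p.1)) * (hcomp false q.2 * p.2) =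
        hcomp false q.1 * (hcomp false q.2 * z k p).
      by rewrite /z -!mulrA; congr (_ * _); rewrite !mulrA (evenC _ h2.2).
    rewrite -mulrA -{2}(hcomp_sum q.2) mulrDl.
    have -> : hcomp true q.2 * z k p = 0.
      by apply: insg_odd; [exact: shp_hcomp|exact: homog_hcomp|exact: zi].
    rewrite addr0 -[q.1 in RHS](hcomp_sum q.1) mulrDl.
    have -> : hcomp true q.1 * (hcomp false q.2 * z k p) = 0.
      by apply: insg_odd; [exact: shp_hcomp|exact: homog_hcomp|apply: insgl => //; apply: zi].
    by rewrite addr0.
  by rewrite -{1}(hcomp_sum p.1) pureDl mulrDr linearD /= !sub mulrDr.
rewrite eb [rho a](tens_sumE (rho a)) -/ta [(u \ot 1) * _]mulr_sumr mulr_suml linear_sum.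
transitivity (\sum_(q <- tb) q.1 * q.2 * \sum_(p <- ta) (z false p + z true p)).
  rewrite big_seq [RHS]big_seq; apply: eq_bigr => q qt.
  transitivity (Psi H (\sum_(p <- ta) (u \ot 1) * (q.1 \ot q.2) * (p.1 \ot p.2))).
    congr (tlift _ _); exact: mulr_sumr.
  rewrite linear_sum mulr_sumr big_seq [RHS]big_seq.
  by apply: eq_bigr => p pt /=; apply: term.
rewrite -mulr_suml; have := congr1 (fun f => shom f b) rhom.
rewrite punitE b0 scale0r -[LHS]/(sprod (idS G) (idS G) (rho b)) eb linear_sum /=.
have -> : \sum_(p <- tb) sprod0 (idS G) (idS G) (p.1 \ot p.2) = \sum_(p <- tb) p.1 * p.2.
  by apply: eq_bigr => p _; exact: (sprod_pure (idS G) (idS G)).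
by move=> ->; rewrite mul0r.
Qed.

Lemma Psi_kills (T : seq (G * (G * G))) :
  (forall x, x \in T -> B x.2.1 /\ counit x.2.1 = 0) -> exists V : seq G,
  forall P h, plin P h -> (forall v, v \in V -> P (sg * v)) ->
  exists2 W : seq G, (forall w, w \in W -> P w) &
    forall H : {linear G -> G}, (forall w, w \in W -> H w = h w) ->
      forall x, x \in T -> Psi H ((x.1 \ot 1) * rho x.2.1 * rho x.2.2) = 0.
Proof.
elim: T => [|[u [b a]] T IH] hT; first by exists [::] => P h _ _; exists [::].
have [|V VP] := IH; first by move=> x xT; apply: hT; rewrite inE xT orbT.
have [Bb b0] := hT (u, (b, a)) (mem_head _ _).
have [V' VP'] := Psi_kill u a Bb b0.
exists (V' ++ V) => P h hP PV.
have [|W WP WE] := VP P h hP; first by move=> v vV; apply: PV; rewrite mem_cat vV orbT.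
have [|W' WP' WE'] := VP' P h hP; first by move=> v vV; apply: PV; rewrite mem_cat vV.
exists (W' ++ W) => [w|H HW x]; first by rewrite mem_cat => /orP[/WP'|/WP].
rewrite inE => /orP[/eqP ->|xT].
  by apply: WE' => w wW; apply: HW; rewrite mem_cat wW.
by apply: WE => // w wW; apply: HW; rewrite mem_cat wW orbT.
Qed.

End Kill.

End Fixed.
End FF.

Lemma tens_mulr_sum (K : fieldType) (A B : superAlgType K) (I : Type) (s : seq I)
    (x y : tens A B) (F : I -> tens A B) :
  y = \sum_(i <- s) F i -> x * y = \sum_(i <- s) x * F i.
Proof. by move=> ->; exact: mulr_sumr. Qed.
Lemma tens_mull_sum (K : fieldType) (A B : superAlgType K) (I : Type) (s : seq I)
    (x y : tens A B) (F : I -> tens A B) :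
  y = \sum_(i <- s) F i -> y * x = \sum_(i <- s) F i * x.
Proof. by move=> ->; exact: mulr_suml. Qed.

Section Bgen.
Variables (K : fieldType) (G : supergroupType K) (B : subhopf G).

(** The product B^+ M of the augmentation ideal of B with M. *)
Definition bgen (M : G -> Prop) (x : G) : Prop := exists t : seq (G * G),
  (forall p, p \in t -> [/\ B p.1, counit p.1 = 0 & M p.2]) /\ x = \sum_(p <- t) p.1 * p.2.

Lemma bgen_sub M : subspace (bgen M).
Proof.
split; first by exists [::]; rewrite big_nil.
move=> c x y [t [tM ->]] [t' [tM' ->]].
exists ([seq (c *: p.1, p.2) | p <- t] ++ t'); split.
  move=> p; rewrite mem_cat => /orP[/mapP[q /tM [? e ?] ->]|/tM' //]; split=> //=.
    by apply: subspaceZ => //; exact: shp_sub.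
  by rewrite scalarZ /= e mulr0.
rewrite big_cat big_map scaler_sumr; congr (_ + _); apply: eq_bigr => p _ /=.
by rewrite scalerAl.
Qed.

Lemma bgen1 M b m : B b -> counit b = 0 -> M m -> bgen M (b * m).
Proof. by move=> Bb b0 Mm; exists [:: (b, m)]; rewrite big_seq1; split=> // p; rewrite inE => /eqP ->. Qed.

Lemma bgen_hcomp M i x : subspace M -> (forall i m, M m -> M (hcomp i m)) ->
  bgen M x -> bgen M (hcomp i x).
Proof.
move=> hM MH [t [tM ->]]; rewrite linear_sum; apply: subspace_sum_seq; first exact: bgen_sub.
move=> p /tM [Bp p0 Mp]; rewrite -(hcomp_sum p.1) mulrDl linearD /=.
rewrite !(hcompMl _ _ (homog_hcomp _ _)); apply: subspaceD; first exact: bgen_sub.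
  by apply: bgen1; [exact: shp_hcomp|rewrite counit_hcomp|apply: MH].
by apply: bgen1; [exact: shp_hcomp|rewrite counit_hcomp|apply: MH].
Qed.

Lemma shp_comul b : B b -> exists2 t : seq (G * G),
  (forall p, p \in t -> B p.1 /\ B p.2) & comul b = \sum_(p <- t) p.1 \ot p.2.
Proof.
move=> Bb; apply: tens_memlr; [exact: shp_sub|exact: shp_sub| |] => f.
  exact: shp_cr.
exact: shp_cl.
Qed.

Lemma counit_aug b : B b -> B (b - counit b *: 1) /\ counit (b - counit b *: 1) = 0.
Proof.
move=> Bb; split; last by rewrite linearB scalarZ /= counit1 mulr1 subrr.
apply: subspaceB => //; first exact: shp_sub.
by apply: subspaceZ; [exact: shp_sub|exact: shp1].
Qed.

Section Theta.
Variables (M : G -> Prop) (hM : subspace M) (MH : forall i m, M m -> M (hcomp i m)).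
Hypothesis Mcr : forall (f : {scalar G}) m, M m -> M (cr f (comul m)).
Variables (lam : {scalar G}) (lam0 : forall x, bgen M x -> lam x = 0).

Lemma lame_proof (e : bool) : scalar (fun y => lam (hcomp false y) + (-1) ^+ e * lam (hcomp true y)).
Proof.
move=> c x y; rewrite !linearP /= !mulrDr !mulrA.
by rewrite [_ * c]mulrC addrACA.
Qed.
(** [lam] twisted by the parity automorphism when [e] is odd. It compensates the sign that arises
    when a factor of parity [e] passes the first leg of the coproduct of m. *)
Definition lame (e : bool) : {scalar G} := mkscal (lame_proof e).

Lemma lame_homog e k m : homog k m -> lame e m = (-1) ^+ (e && k) * lam m.
Proof.
move=> hm; rewrite /lame /=; case: k hm => hm.
  by rewrite (homog_neq (j := false) hm) // hm linear0 add0r andbT.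
by rewrite (homog_neq (j := true) hm) // hm linear0 mulr0 addr0 andbF mul1r.
Qed.

(** Since [lam] vanishes on B^+ M, lam(b_1 m_1) = counit(b_1) lam(m_1). So m |-> lam(m_1) m_2
    commutes with multiplication by B. *)
Lemma theta_lemma e b m : homog e b -> B b -> M m ->
  cl (lame e) (comul (b * m)) = b * cl lam (comul m).
Proof.
move=> hb Bb Mm.
have [t tM em] := tens_meml hM (fun f => Mcr f Mm).
have [tb tB eb] := shp_comul Bb.
rewrite comulM tmulE (tens_mulr_sum _ em) em !linear_sum mulr_sumr big_seq [RHS]big_seq.
apply: eq_bigr => p pt /=.
rewrite -(hcomp_sum p.1) !pureDl !mulrDr [cl (lame e) _]linearD [cl lam _]linearD mulrDr.
suff main k : cl (lame e) (comul b * (hcomp k p.1 \ot p.2)) =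
    b * cl lam (hcomp k p.1 \ot p.2) by congr (_ + _); exact: main.
set m1 := hcomp k p.1; set m2 := p.2.
have hm1 : homog k m1 := homog_hcomp _ _.
have Mm1 : M m1 by apply: MH; apply: tM.
have eb' : comul b = \sum_(q <- tb) (hcomp false q.1 \ot hcomp e q.2
      + hcomp true q.1 \ot hcomp (~~ e) q.2).
  rewrite -[in LHS]hb comul_even eb linear_sum; apply: eq_bigr => q _.
  exact: hcomp_pure.
rewrite cl_pure -{2}(counitl b) -/(cl counit (comul b)) (tens_mull_sum _ eb') eb' !linear_sum mulr_suml.
rewrite big_seq [RHS]big_seq; apply: eq_bigr => q /tB [Bq _].
have L1 x y : cl (lame e) (x + y) = cl (lame e) x + cl (lame e) y by exact: linearD.
have L2 (x y : tens G G) : cl counit (x + y) = cl counit x + cl counit y by exact: (linearD (cl (counit : {scalar G}) : {linear tens G G -> G})).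
have L3 c x : cl (lame e) (c *: x) = c *: cl (lame e) x by exact: linearZ.
have L4 (x y : G) : cl counit (x \ot y) = counit x *: y by exact: (cl_pure (counit : {scalar G})).
set a := hcomp false q.1 \ot _; set a' := hcomp true q.1 \ot _.
transitivity (cl (lame e) ((a + a') * (m1 \ot m2))); first by [].
transitivity (cl counit (a + a') * (lam m1 *: m2)); last by [].
rewrite mulrDl L1 L2 !L4 !counit_hcomp scale0r addr0.
have red j : lame e (hcomp j q.1 * m1) = counit (hcomp j q.1) * lame e m1.
  have Bj : B (hcomp j q.1) by exact: shp_hcomp.
  apply/eqP; rewrite -subr_eq0 -[X in _ - X]scalarZ -linearB.
  rewrite -[counit _ *: m1]mulr_algl -mulrBl; apply/eqP.
  have h : bgen M ((hcomp j q.1 - counit (hcomp j q.1) *: 1) * m1).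
    by have [? ?] := counit_aug Bj; apply: bgen1.
  have h' i := lam0 (bgen_hcomp i hM MH h).
  by rewrite /lame /= !h' mulr0 addr0.
rewrite !(tensM_hom _ _ (homog_hcomp _ _) hm1) !L3 !cl_pure !red !counit_hcomp.
rewrite mul0r scale0r scaler0 !addr0 (lame_homog _ hm1) !scalerA.
rewrite -scalerAl -scalerAr scalerA; congr (_ *: _).
rewrite mulrCA; congr (_ * _); rewrite mulrA.
by rewrite -signr_addb addbb mul1r.
Qed.

(** The sum lam(x_1) x_2 S(x_3) collapses by the antipode axiom. *)
Lemma theta_S x :
  tlift (fun u v => cl lam (comul u) * antipode v) (comul x) = lam x *: 1.
Proof.
pose mS : {linear tens G G -> G} := mklin (tlift_linear (mul_bilin idfun (mklin antipode_linear : {linear G -> G}))).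
pose L : {linear tens G (tens G G) -> G} := mS \o (cl lam : {linear _ -> _}).
have mSE y : mS y = tlift (fun u v => u * antipode v) y by [].
have mSp u v : mS (u \ot v) = u * antipode v.
  by rewrite mSE tlift_pure //; exact: (mul_bilin idfun (mklin antipode_linear : {linear G -> G})).
have LE u w : L (u \ot w) = lam u *: mS w.
  by transitivity (mS (cl lam (u \ot w))); rewrite // cl_pure linearZ_LR.
have e := congr1 L (comulA x).
rewrite !(tlift_comp L) in e.
transitivity (tlift (fun u v => L (tlift (fun a b => a \ot (b \ot v)) (comul u))) (comul x)).
  apply: eq_tlift => u v; rewrite (tlift_comp L) tliftMr; apply: eq_tlift => a b.
  by rewrite LE mSp -scalerAl.
rewrite e.
transitivity (tlift (fun u v => (lam u * counit v) *: (1 : G)) (comul x)).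
  by apply: eq_tlift => u v; rewrite LE mSE antipoder scalerA.
have lF : linear (fun y => lam y *: (1 : G)) by move=> c y z; rewrite linearP scalerDl scalerA.
pose F : {linear G -> G} := mklin lF.
transitivity (F (tlift (fun u v => counit v *: u) (comul x))); last by rewrite counitr.
by rewrite tlift_comp; apply: eq_tlift => u v; rewrite /F /= scalarZ /= mulrC.
Qed.

End Theta.
End Bgen.

Section Coassoc.
Variables (K : fieldType) (G : supergroupType K).
Implicit Types (f g : {scalar G}) (x : G).

Lemma comulA_apply (W : lmodType K) (L : {linear tens G (tens G G) -> W}) x :
  tlift (fun u c => L (tlift (fun a b => a \ot (b \ot c)) (comul u))) (comul x) =
  tlift (fun u v => L (u \ot comul v)) (comul x).
Proof. by have := congr1 L (comulA x); rewrite !(tlift_comp L). Qed.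

(** The convolution product of the dual algebra; successive contractions compose by it ([cl_cl],
    [cr_cr]). *)
Definition cfun g f : {scalar G} := scomp f (cl g \o comul : {linear G -> G}).

Lemma scal_lin (V : lmodType K) f (c : V) : linear (fun x => f x *: c).
Proof. by move=> k x y; rewrite linearP scalerDl scalerA. Qed.

Lemma cfunE (V : lmodType K) g f x (c : V) :
  cfun g f x *: c = tlift (fun u v => (g u * f v) *: c) (comul x).
Proof.
rewrite -[LHS]/((mklin (scal_lin f c)) (tlift _ _)) tlift_comp.
by apply: eq_tlift => u v; rewrite /= scalarZ.
Qed.
Lemma cfunE' g f x : cfun g f x = g (cr f (comul x)).
Proof. exact: (esym (cl_cr g f (comul x))). Qed.

Lemma cl_cl f g x : cl f (comul (cl g (comul x))) = cl (cfun g f) (comul x).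
Proof.
pose L : {linear tens G (tens G G) -> G} := cl f \o (cl g : {linear _ -> _}).
have LE u w : L (u \ot w) = g u *: cl f w
  by transitivity (cl f (cl g (u \ot w))); rewrite // cl_pure linearZ_LR.
have := comulA_apply L x.
rewrite (eq_tlift (b := fun u v => L (u \ot comul v)) (b' := fun u v => g u *: cl f (comul v))) => [e|u v]; last by rewrite -LE.
have -> : cl f (comul (cl g (comul x))) = tlift (fun u v => g u *: cl f (comul v)) (comul x).
  pose D : {linear G -> G} := cl f \o comul.
  rewrite -[LHS]/(D (tlift _ _)) tlift_comp; apply: eq_tlift => u v.
  by rewrite linearZ_LR.
rewrite -e; apply: eq_tlift => u c; rewrite cfunE (tlift_comp L).
by apply: eq_tlift => a b; rewrite LE cl_pure scalerA.
Qed.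

Lemma cr_cl f g x : cr f (comul (cl g (comul x))) = cl g (comul (cr f (comul x))).
Proof.
pose L : {linear tens G (tens G G) -> G} := cr f \o (cl g : {linear _ -> _}).
have LE u w : L (u \ot w) = g u *: cr f w
  by transitivity (cr f (cl g (u \ot w))); rewrite // cl_pure linearZ_LR.
have := comulA_apply L x.
rewrite (eq_tlift (b := fun u v => L (u \ot comul v)) (b' := fun u v => g u *: cr f (comul v))) => [e|u v]; last by rewrite -LE.
transitivity (tlift (fun u v => g u *: cr f (comul v)) (comul x)).
  pose D : {linear G -> G} := cr f \o comul.
  rewrite -[LHS]/(D (tlift _ _)) tlift_comp; apply: eq_tlift => u v.
  by rewrite linearZ_LR.
rewrite -e; pose D : {linear G -> G} := cl g \o comul.
rewrite -[RHS]/(D (tlift _ _)) tlift_comp; apply: eq_tlift => u c.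
rewrite (tlift_comp L) linearZ_LR -[D u]/(tlift (fun a b => g a *: b) (comul u)).
have ls : linear (fun y : G => f c *: y) by move=> k y z; rewrite scalerDr !scalerA mulrC.
rewrite -[RHS]/((mklin ls) _) tlift_comp; apply: eq_tlift => a b.
by rewrite LE cr_pure /= scalerA [in RHS]scalerA mulrC.
Qed.

Lemma cr_cr f g x : cr f (comul (cr g (comul x))) = cr (cfun f g) (comul x).
Proof.
apply: dual_eq => h.
have cc (h' : {scalar G}) x' : h (cr h' (comul x')) = h' (cl h (comul x')) by exact: cl_cr.
by rewrite !cc -cr_cl -cfunE'.
Qed.
End Coassoc.

Section ContractLin.
Variables (K : fieldType) (U V : lmodType K).
Implicit Types x y : tens U V.
Lemma clD (f : {scalar U}) x y : cl f (x + y) = cl f x + cl f y. Proof. exact: linearD. Qed.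
Lemma clZ (f : {scalar U}) c x : cl f (c *: x) = c *: cl f x. Proof. exact: linearZ. Qed.
Lemma crD (f : {scalar V}) x y : cr f (x + y) = cr f x + cr f y. Proof. exact: linearD. Qed.
Lemma crZ (f : {scalar V}) c x : cr f (c *: x) = c *: cr f x. Proof. exact: linearZ. Qed.
End ContractLin.

Lemma cl_span_sub (K : fieldType) (U V : lmodType K) (y : tens U V) :
  subspace (fun e => exists f : {scalar U}, e = cl f y).
Proof.
split.
  have l : scalar (fun _ : U => 0 : K) by move=> c u v; rewrite mulr0 addr0.
  exists (mkscal l); elim/tens_ind: y => [|u v y IH]; first by rewrite linear0.
  by rewrite clD -IH cl_pure scale0r addr0.
move=> c _ _ [f ->] [g ->].
have l : scalar (fun u => c * f u + g u).
  by move=> k u v; rewrite !linearP /= !mulrDr !mulrA [c * k]mulrC addrACA.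
exists (mkscal l); elim/tens_ind: y => [|u v y IH]; first by rewrite ![cl _ 0]linear0 scaler0 addr0.
rewrite !clD scalerDr addrACA IH; congr (_ + _).
by rewrite !cl_pure scalerA -scalerDl.
Qed.

Section FF.
Variables (K : fieldType) (hK : 2%N \notin [pchar K]) (G : supergroupType K) (nG : noeth G).
Variable B : subhopf G.

(** The functions a(g h^-1), and in [rho2] the functions a(g^-1 h). Both preserve B, and on the
    diagonal both reduce to the counit. *)
Definition rho1 : superhom G (tens G G) := pmul (in1 G G) (pinv (in2 G G)).
Definition rho2 : superhom G (tens G G) := pmul (pinv (in1 G G)) (in2 G G).

Lemma pmul_tlift R (f g : superhom G R) a : pmul f g a = tlift (fun x y => f x * g y) (comul a).
Proof. exact: pmulE. Qed.

Lemma rho1E a : rho1 a = tlift (fun x y => x \ot antipode y) (comul a).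
Proof. by rewrite pmul_tlift; apply: eq_tlift => u v; exact: tensM_in12. Qed.
Lemma rho2E a : rho2 a = tlift (fun x y => antipode x \ot y) (comul a).
Proof. by rewrite pmul_tlift; apply: eq_tlift => u v; exact: tensM_in12. Qed.

Let S : {linear G -> G} := mklin antipode_linear.

Lemma rho1B b : B b -> exists2 t : seq (G * G),
  (forall p, p \in t -> B p.1 /\ B p.2) & rho1 b = \sum_(p <- t) p.1 \ot p.2.
Proof.
move=> /shp_comul[t tB e]; exists [seq (p.1, antipode p.2) | p <- t].
  by move=> p /mapP[q /tB [? ?] ->]; split=> //; exact: shp_antipode.
rewrite rho1E e tlift_sum ?big_map //; apply: (@bilin_comp _ _ _ _ _ _ _ idfun S).
exact: pure_bilin.
Qed.
Lemma rho2B b : B b -> exists2 t : seq (G * G),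
  (forall p, p \in t -> B p.1 /\ B p.2) & rho2 b = \sum_(p <- t) p.1 \ot p.2.
Proof.
move=> /shp_comul[t tB e]; exists [seq (antipode p.1, p.2) | p <- t].
  by move=> p /mapP[q /tB [? ?] ->]; split=> //; exact: shp_antipode.
rewrite rho2E e tlift_sum ?big_map //; apply: (@bilin_comp _ _ _ _ _ _ _ S idfun).
exact: pure_bilin.
Qed.
Lemma rho1m : superhom_comp (sprod (idS G) (idS G)) rho1 = punit G G.
Proof. by rewrite pmul_comp pinv_comp sprod_in1 sprod_in2 pmulVr. Qed.
Lemma rho2m : superhom_comp (sprod (idS G) (idS G)) rho2 = punit G G.
Proof. by rewrite pmul_comp pinv_comp sprod_in1 sprod_in2 pmulVl. Qed.

(** If x were outside B^+ M, take [lam] vanishing on B^+ M with lam(x) = 1. The map m |-> lam(m_1)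
    m_2 is B-linear on M and extends, after multiplication by sg and a denominator, to a linear [H].
    Then [Psi] of x_1 \ot S(x_2) is zero because x lies in B^+ K[G], yet equals s sg lam(x), which
    is nonzero. *)
Lemma ff_ideal (M : G -> Prop) : subspace M -> (forall i m, M m -> M (hcomp i m)) ->
  (forall b m, B b -> M m -> M (b * m)) ->
  (forall (f : {scalar G}) m, M m -> M (cr f (comul m))) ->
  forall x, M x -> bgen B (fun=> True) x -> bgen B M x.
Proof.
move=> hM MH MB Mcr x Mx [t [tB xE]]; apply: contrapT => nx.
have [lam [lam0 lamx]] := separation (bgen_sub B M) nx.
have [d [sg [hd Bsg sg0 oddB dom]]] := assoc_elt hK nG B.
pose th m := cl lam (comul m); pose h0 y := cl (lame lam d) (comul y).
have h0E m : M m -> h0 (sg * m) = sg * th m by move=> Mm; exact: (theta_lemma hM MH Mcr lam0 hd Bsg Mm).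
have thr r m : evB B r -> M m -> th (r * m) = r * th m.
  move=> [Br hr] Mm; rewrite /th -(theta_lemma hM MH Mcr lam0 hr Br Mm).
  congr (tlift _ _); apply/funext => u; apply/funext => v; congr (_ *: _).
  by rewrite /= mul1r -linearD hcomp_sum.
have thD a b : th (a + b) = th a + th b by rewrite /th [comul _]linearD; exact: linearD.
pose P0 y := exists2 m, M m & y = sg * m.
have pP : plin B sg P0 h0.
  split.
  - by exists 0; [exact: hM.1|rewrite mulr0].
  - move=> r _ _ hr [m Mm ->] [m' Mm' ->].
    have e : r * (sg * m) + sg * m' = sg * (r * m + m').
      by rewrite mulrDr mulrA (evenC sg hr.2) mulrA.
    have MM : M (r * m + m') by apply: subspaceD => //; apply: MB => //; exact: hr.1.
    split; first by exists (r * m + m').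
    rewrite e h0E // !h0E // thD thr //.
    by rewrite mulrDr !mulrA (evenC sg hr.2).
  - by move=> _ [m _ ->]; exists m.
  - by move=> _ [m Mm ->]; rewrite h0E //; exists (th m).
pose T := [seq ((1 : G), p) | p <- t].
have TB y : y \in T -> B y.2.1 /\ counit y.2.1 = 0.
  by move=> /mapP[p /tB [? ? _] ->].
have [V VP] := Psi_kills hd oddB rho1B rho1m TB.
have [s [P' [h' [hs ss hP' e PV]]]] := plin_exts sg0 dom V pP.
have [W WP WE] := VP P' h' hP' PV.
have [q qM eq] := tens_meml hM (fun f => Mcr f x Mx).
have P'q p : p \in q -> P' (sg * p.1) /\ h' (sg * p.1) = s * (sg * th p.1).
  by move=> pq; rewrite -(h0E _ (qM p pq)); apply: (e (sg * p.1)); exists p.1 => //; exact: qM.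
have [|H HE] := lin_agree (plin_sub hP') (plin_lin hP') (s := W ++ [seq sg * p.1 | p <- q]).
  move=> y; rewrite mem_cat => /orP[/WP //|/mapP[p pq ->]].
  exact: (P'q p pq).1.
have kill : Psi sg H (rho1 x) = 0.
  rewrite xE [rho1 _]linear_sum [LHS]linear_sum big_seq big1 // => p pt.
  transitivity (Psi sg H ((1 \ot 1) * rho1 p.1 * rho1 p.2)).
    by rewrite -tens_one mul1r -[rho1 _ * _]rmorphM.
  apply: (WE H _ (1, p)); last by apply/mapP; exists p.
  by move=> w wW; apply: HE; rewrite mem_cat wW.
(* Here the left legs of the coproduct of x lie in M, where [H] is known; the sum is evaluated by
   [theta_S]. *)
have : Psi sg H (rho1 x) = s * sg.
  rewrite rho1E eq tlift_sum; last by apply: (@bilin_comp _ _ _ _ _ _ _ idfun S); exact: pure_bilin.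
  rewrite linear_sum -[s * sg]mulr1 -[1 in RHS]scale1r -lamx -(theta_S lam) eq tlift_sum; last first.
    exact: (mul_bilin (cl lam \o comul : {linear G -> G}) S).
  rewrite mulr_sumr big_seq [RHS]big_seq; apply: eq_bigr => p pq /=.
  rewrite -[LHS]/(Psi sg H (p.1 \ot antipode p.2)) Psi_pure HE ?(P'q p pq).2 ?mulrA //.
  by rewrite mem_cat (map_f (fun p => sg * p.1)) ?orbT.
by rewrite kill => /esym.
Qed.

Section Coset.
Variables (X : G -> Prop) (hX : subspace X) (XH : forall i x, X x -> X (hcomp i x)).
Hypothesis Xcl : forall (f : {scalar G}) x, X x -> X (cl f (comul x)).
Hypothesis Xq : forall (f : {scalar G}) x, X x -> bgen B (fun=> True) (cl f (comul x) - f x *: 1).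

(** An element of [X] is a fraction with numerator in B, at least after multiplication by sg.
    Otherwise the identity of sg B could be extended by 0 at sg x; applying the extension to the
    coproduct of x, whose right legs are constant modulo B^+ K[G], gives s sg x = 0, which is itself
    such a fraction. *)
Lemma coset_frac d sg x : homog d sg -> B sg -> sg != 0 ->
  (forall b, B b -> homog true b -> b * sg = 0) ->
  (forall r s, evB B r -> evB B s -> r * sg <> 0 -> s * sg <> 0 -> r * s * sg <> 0) ->
  X x -> exists r b, [/\ evB B r, r * sg <> 0, B b & r * (sg * x) = sg * b].
Proof.
move=> hd Bsg sg0 oddB dom Xx; apply: contrapT => nex.
pose P0 y := exists2 b, B b & y = sg * b.
have pP : plin B sg P0 id.
  split.
  - by exists 0; [exact: (shp_sub B).1|rewrite mulr0].
  - move=> r _ _ hr [m Mm ->] [m' Mm' ->]; split=> //.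
    exists (r * m + m'); last by rewrite mulrDr mulrA (evenC sg hr.2) mulrA.
    by apply: subspaceD => //; [exact: shp_sub|apply: shpM => //; exact: hr.1].
  - by move=> _ [m _ ->]; exists m.
  - by move=> _ [m _ ->]; exists m.
have [||r hr [b Bb e]|P1 [h1 [hP1 h1E P1v h1v]]] :=
    plin_ext (v := sg * x) (w := 0) pP _ (evB1 B).
- by exists x.
- by exists 0; rewrite mulr0.
- rewrite mul1r mulr0; have [rs|rs] := pselect (r * sg = 0); first by rewrite mulrA rs mul0r.
  by case: nex; exists r, b.
have hf (f : {scalar G}) : bgen B (fun=> True) (cl f (comul x - x \ot 1)).
  by rewrite linearB /= cl_pure; exact: Xq.
have [t tB te] := tens_memr (bgen_sub B _) hf.
have tP (p : G * G) : exists s : seq (G * G), p \in t ->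
    (forall q, q \in s -> B q.1 /\ counit q.1 = 0) /\ p.2 = \sum_(q <- s) q.1 * q.2.
  have [/tB [s [sB e]]|nt] := boolP (p \in t); last by exists [::].
  by exists s => _; split=> // q /sB [].
have [u uP] := choice tP.
pose T := flatten [seq [seq (p.1, q) | q <- u p] | p <- t].
have TB y : y \in T -> B y.2.1 /\ counit y.2.1 = 0.
  by move=> /flattenP[l /mapP[p pt ->]] /mapP[q qu ->]; have [h _] := uP p pt; exact: h q qu.
have [V VP] := Psi_kills hd oddB rho2B rho2m TB.
have [s [P' [h' [hs ss hP' e PV]]]] := plin_exts sg0 dom V hP1.
have [W WP WE] := VP P' h' hP' PV.
have P1s : P1 sg /\ h1 sg = sg.
  by have := h1E sg; rewrite mul1r; apply; exists 1; rewrite ?mulr1 //; exact: shp1.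
have [|H HE] := lin_agree (plin_sub hP') (plin_lin hP') (s := [:: sg; sg * x] ++ W).
  move=> y; rewrite mem_cat !inE => /orP[/orP[] /eqP ->|/WP //].
    exact: (e _ P1s.1).1.
  exact: (e _ P1v).1.
have Hs : H sg = s * sg by rewrite HE ?mem_head // (e _ P1s.1).2 P1s.2.
have Hx : H (sg * x) = 0.
  by rewrite HE ?(e _ P1v).2 ?h1v ?mulr0 // !inE eqxx orbT.
(* The map u \ot c |-> (u \ot 1) rho2(c) sends the coproduct of x to 1 \ot x, since x_1 S(x_2) \ot
   x_3 collapses. *)
pose Tm : superhom (tens G G) (tens G G) := sprod (in1 G G) rho2.
have TE : superhom_comp Tm (comulS G) = in2 G G.
  by rewrite comul_pmul pmul_comp sprod_in1 sprod_in2 pmulKVl.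
have eT : Tm (comul x) = 1 \ot x.
  by have := congr1 (fun f => shom f x) TE.
have kill : Psi sg H (Tm (\sum_(p <- t) p.1 \ot p.2)) = 0.
  rewrite [Tm _]linear_sum [LHS]linear_sum big_seq big1 // => p pt.
  rewrite -[LHS]/(Psi sg H (Tm (p.1 \ot p.2))) sprod_pure in1E.
  have [_ ->] := uP p pt; rewrite [rho2 _]linear_sum.
  transitivity (Psi sg H (\sum_(q <- u p) (p.1 \ot 1) * rho2 (q.1 * q.2))).
    by congr (Psi sg H _); exact: mulr_sumr.
  rewrite linear_sum big_seq big1 // => q qu.
  have -> : (p.1 \ot 1) * rho2 (q.1 * q.2) = (p.1 \ot 1) * rho2 q.1 * rho2 q.2.
    by rewrite [rho2 _]rmorphM mulrA.
  have := WE H _ (p.1, q); apply.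
    by move=> w wW; apply: HE; rewrite mem_cat wW orbT.
  by apply/flattenP; exists [seq (p.1, q) | q <- u p]; apply: map_f.
have : Psi sg H (Tm (comul x)) = Psi sg H (Tm (x \ot 1)) + Psi sg H (Tm (\sum_(p <- t) p.1 \ot p.2)).
  rewrite -[RHS](linearD (Psi sg H)) -(linearD Tm) -te.
  by congr (Psi sg H (Tm _)); rewrite addrC subrK.
rewrite eT kill addr0 sprod_pure in1E.
have -> : rho2 1 = 1 by exact: rmorph1.
rewrite mulr1 !Psi_pure mulr1 Hs Hx mul0r => hh; apply: nex; exists s, 0; split=> //.
  exact: (shp_sub B).1.
by rewrite mulr0 mulrA.
Qed.

(** The elements of B that multiply all left contractions of x into B form an ideal [J] of B, stable
    under left contractions. It is nonzero, since it contains a common denominator times sg. A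
    nonzero ideal stable in this way contains 1, hence x itself lies in B. *)
Lemma ff_coset_homog i x : homog i x -> X x -> B x.
Proof.
move=> hx Xx; have [d [sg [hd Bsg sg0 oddB dom]]] := assoc_elt hK nG B.
pose E e := exists f : {scalar G}, e = cl f (comul x).
have EX e : E e -> X e by move=> [f ->]; exact: Xcl.
have Ecl (f : {scalar G}) e : E e -> E (cl f (comul e)).
  by move=> [g ->]; exists (cfun g f); rewrite cl_cl.
have EH j e : E e -> E (hcomp j e).
  move=> [f ->]; have [f0 [f1 ->]] := hcomp_cl j f (comul x).
  rewrite -!comul_even; have [ij|ij] := eqVneq j i.
    have -> : hcomp (~~ j) x = 0 by apply: (homog_neq hx); rewrite ij; case: (i).
    by rewrite !linear0 addr0 ij hx; exists f0.
  have -> : hcomp j x = 0 by apply: (homog_neq hx); rewrite eq_sym.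
  have -> : hcomp (~~ j) x = x by have -> : ~~ j = i by case: (i) (j) ij => [] [].
  by rewrite !linear0 add0r; exists f1.
pose J b := B b /\ forall e, E e -> B (e * b).
have Bsub := shp_sub B.
have Jsub : subspace J.
  split; first by split=> [|e _]; rewrite ?mulr0; exact: Bsub.1.
  move=> c y z [By hy] [Bz hz]; split=> [|e Ee]; first exact: Bsub.2.
  by rewrite mulrDr -scalerAr; apply: Bsub.2; [exact: hy|exact: hz].
have Jmul b y : B b -> J y -> J (b * y).
  move=> Bb [By hy]; split; first exact: shpM.
  move=> e Ee; rewrite -(hcomp_sum e) -(hcomp_sum b) !(mulrDl, mulrDr).
  have h k j : B (hcomp k e * (hcomp j b * y)).
    rewrite mulrA (homogZC (homog_hcomp _ _) (homog_hcomp _ _)) -scalerAl.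
    apply: subspaceZ => //; rewrite -mulrA; apply: shpM; first exact: shp_hcomp.
    by apply: hy; apply: EH.
  by do !apply: subspaceD.
have in2E (e : G) : 1 \ot e = tlift (fun u v => (antipode u \ot 1) * comul v) (comul e).
  have := congr1 (fun f => shom f e) (pmulKl (in1 G G) (in2 G G)).
  by rewrite -comul_pmul => /esym; rewrite -[LHS]/(in2 G G e) => ->; rewrite [LHS]pmul_tlift.
have Jcl (g : {scalar G}) b : J b -> J (cl g (comul b)).
  move=> [Bb hb]; split; first exact: shp_cl.
  move=> e Ee; rewrite -(hcomp_sum e) mulrDl.
  have h k : B (hcomp k e * cl g (comul b)).
    have lg : scalar (fun u => g (hcomp false u) + (-1) ^+ k * g (hcomp true u)).
      by move=> c y z; rewrite !linearP /= !mulrDr !mulrA [_ * c]mulrC addrACA.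
    have -> : hcomp k e * cl g (comul b) = cl (mkscal lg) ((1 \ot hcomp k e) * comul b).
      elim/tens_hind: (comul b) => [|i' j' u v z hu hv IH].
        by rewrite !linear0 !mulr0 linear0.
      rewrite mulrDr !clD mulrDr IH; congr (_ + _).
      rewrite (tensM_hom _ _ (homog_hcomp k e) hu) mul1r clZ !cl_pure.
      rewrite -scalerAr scalerA; congr (_ *: _).
      have -> : mkscal lg u = g (hcomp false u) + (-1) ^+ k * g (hcomp true u) by [].
      case: i' hu => hu.
        rewrite (homog_neq (j := false) hu) // hu linear0 add0r andbT mulrA.
        by rewrite -signr_addb addbb mul1r.
      by rewrite (homog_neq (j := true) hu) // hu linear0 mulr0 addr0 andbF mul1r.
    have Eke : E (hcomp k e) by exact: EH.
    (* The identity 1 \ot e = (S(e_1) \ot 1) comul(e_2) replaces the factor on the second leg by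
       products e_2 b, which lie in B. *)
    move: (hcomp k e) Eke => e' Ee'; rewrite in2E.
    have [t tE te] := tens_memr (cl_span_sub (comul x)) (fun f => Ecl f _ Ee').
    rewrite te tlift_sum; last exact: (mul_bilin (in1 G G \o S : {linear G -> tens G G}) comul).
    rewrite mulr_suml linear_sum; apply: subspace_sum_seq => // p pt.
    rewrite -[X in B X]/(cl (mkscal lg) ((antipode p.1 \ot 1) * comul p.2 * comul b)).
    have -> : (antipode p.1 \ot 1) * comul p.2 * comul b = (antipode p.1 \ot 1) * comul (p.2 * b).
      by rewrite comulM tmulE mulrA.
    rewrite (cl_mull (g := mulsc (mkscal lg) (antipode p.1))) //.
    by apply: shp_cl; apply: hb; exact: tE.
  by apply: subspaceD.
have [t tX te] : exists2 t : seq (G * G), (forall p, p \in t -> X p.2) &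
   comul x = \sum_(p <- t) p.1 \ot p.2 by apply: tens_memr => // f; exact: Xcl.
(* A common denominator for the right legs of the coproduct of x. *)
have [r [hr rs rt]] : exists r, [/\ evB B r, r * sg <> 0 &
    forall p k, p \in t -> exists2 b, B b & r * (sg * hcomp k p.2) = sg * b].
  elim: t tX {te} => [|p t IH] tX; first by exists 1; split; [exact: evB1|rewrite mul1r; apply/eqP|].
  have [|r [hr rs rt]] := IH; first by move=> q qt; apply: tX; rewrite inE qt orbT.
  have Xp : X p.2 by apply: tX; exact: mem_head.
  have [r0 [b0 [h0 s0 B0 e0]]] := coset_frac hd Bsg sg0 oddB dom (XH false Xp).
  have [r1 [b1 [h1 s1 B1 e1]]] := coset_frac hd Bsg sg0 oddB dom (XH true Xp).
  exists (r * (r0 * r1)); split; first by apply: evBM => //; exact: evBM.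
    by apply: (dom) => //; [exact: evBM|exact: dom].
  move=> q k; rewrite inE => /orP[/eqP ->|/(rt q k) [b Bb e]].
    case: k; [exists (r * r0 * b1)|exists (r * r1 * b0)].
    - by apply: shpM => //; apply: shpM; [exact: hr.1|exact: h0.1].
    - have -> (z : G) : r * (r0 * r1) * z = r * r0 * (r1 * z).
        by rewrite !mulrA.
      by rewrite e1 [LHS]mulrA (evenC sg (homogM hr.2 h0.2)) !mulrA.
    - by apply: shpM => //; apply: shpM; [exact: hr.1|exact: h1.1].
    have -> (z : G) : r * (r0 * r1) * z = r * r1 * (r0 * z).
      by rewrite (evenC r1 h0.2) !mulrA.
    by rewrite e0 [LHS]mulrA (evenC sg (homogM hr.2 h1.2)) !mulrA.
  exists (r0 * r1 * b); first by apply: shpM => //; apply: shpM; [exact: h0.1|exact: h1.1].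
  have h01 := homogM h0.2 h1.2.
  by rewrite -(evenC r h01) -[LHS]mulrA e [LHS]mulrA (evenC sg h01) !mulrA.
have Jc : J (r * sg).
  split; first by apply: shpM => //; exact: hr.1.
  move=> _ [f ->]; rewrite te linear_sum mulr_suml; apply: subspace_sum_seq => // p pt /=.
  rewrite cl_pure -scalerAl; apply: subspaceZ => //; rewrite -(hcomp_sum p.2) mulrDl.
  have h k : B (hcomp k p.2 * (r * sg)).
    rewrite (homogZC (homog_hcomp _ _) (homogM hr.2 hd)); apply: subspaceZ => //.
    by have [b Bb e] := rt p k pt; rewrite -mulrA e; exact: shpM.
  by apply: subspaceD.
have /separation0[g g1] : r * sg != 0 by apply/eqP.
(* Contracting a nonzero element of [J] by a functional that is 1 on it gives an element with counit
   1; then 1 = S(y_1) y_2 lies in [J]. *)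
have [J1 J11] : exists2 y, J y & counit y = 1.
  exists (cl g (comul (r * sg))); first exact: Jcl.
  have := cl_cr g (counit : {scalar G}) (comul (r * sg)).
  by rewrite -[cr _ _]/(tlift (fun u v => counit v *: u) (comul _)) counitr g1.
move=> y1; have [t' tJ te'] : exists2 t : seq (G * G), (forall p, p \in t -> B p.1 /\ J p.2) &
    comul J1 = \sum_(p <- t) p.1 \ot p.2.
  by apply: tens_memlr => // f; [exact: shp_cr J11.1|exact: Jcl].
have J1' : J 1.
  rewrite -[1]scale1r -y1 -antipodel te' tlift_sum; last exact: (mul_bilin S idfun).
  by apply: subspace_sum_seq => // p /tJ [? ?]; apply: Jmul => //; exact: shp_antipode.
have := J1'.2 x; rewrite mulr1; apply.
by exists (counit : {scalar G}); rewrite -[RHS]/(tlift _ _) counitl.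
Qed.

Lemma ff_coset x : X x -> B x.
Proof.
move=> Xx; rewrite -(hcomp_sum x); apply: subspaceD; first exact: shp_sub.
  by apply: (ff_coset_homog (homog_hcomp false x)); apply: XH.
by apply: (ff_coset_homog (homog_hcomp true x)); apply: XH.
Qed.
End Coset.
End FF.

(** * Commutator chains and the upper central series *)

Section Image.
Variables (K : fieldType) (G Q : supergroupType K) (i : superhom Q G) (hi : hopf_hom i).

Definition img (x : G) : Prop := exists q, x = i q.

Lemma img_sub : subspace img.
Proof.
split; first by exists 0; rewrite linear0.
by move=> c _ _ [p ->] [q ->]; exists (c *: p + q); rewrite linearP.
Qed.
Lemma img1 : img 1. Proof. by exists 1; rewrite rmorph1. Qed.
Lemma imgM a b : img a -> img b -> img (a * b).
Proof. by move=> [p ->] [q ->]; exists (p * q); rewrite rmorphM. Qed.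
Lemma img_hcomp j a : img a -> img (hcomp j a).
Proof. by move=> [p ->]; exists (hcomp j p); rewrite shom_even. Qed.
Lemma img_cr (f : {scalar G}) a : img a -> img (cr f (comul a)).
Proof. by move=> [p ->]; rewrite hi.1 (cr_tmap _ (h := f) (h' := scomp f i)) //; exists (cr (scomp f i) (comul p)). Qed.
Lemma img_cl (f : {scalar G}) a : img a -> img (cl f (comul a)).
Proof. by move=> [p ->]; rewrite hi.1 (cl_tmap _ (h := f) (h' := scomp f i)) //; exists (cl (scomp f i) (comul p)). Qed.
Lemma img_antipode a : img a -> img (antipode a).
Proof. by move=> [p ->]; exists (antipode p); rewrite hopf_antipode. Qed.

Definition img_shopf : subhopf G :=
  SubHopf img_sub img1 imgM img_hcomp img_cr img_cl img_antipode.
End Image.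

Section Commutators.
Variables (K : fieldType) (G : supergroupType K).

Definition pcomm (R : superAlgType K) (n g : superhom G R) : superhom G R :=
  pmul (pinv (pmul g n)) (pmul n g).

Lemma pcomm_comp (R S : superAlgType K) (f : superhom R S) (n g : superhom G R) :
  superhom_comp f (pcomm n g) = pcomm (superhom_comp f n) (superhom_comp f g).
Proof. by rewrite pmul_comp pinv_comp !pmul_comp. Qed.

Lemma pcomm1P (R : superAlgType K) (n g : superhom G R) :
  pcomm n g = punit G R <-> pmul n g = pmul g n.
Proof.
rewrite /pcomm; split=> [e|->]; last by rewrite pmulVl.
by rewrite -[LHS](pmulKVl (pmul g n)) e pmul1r.
Qed.

End Commutators.

Lemma hopf_pcomm (K : fieldType) (A B : supergroupType K) (f : superhom A B)
    (hf : hopf_hom f) (R : superAlgType K) (n g : superhom B R) :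
  superhom_comp (pcomm n g) f = pcomm (superhom_comp n f) (superhom_comp g f).
Proof. by rewrite (hopf_pmul hf) (hopf_pinv hf) !(hopf_pmul hf). Qed.

Lemma quot_ker (K : fieldType) (G : supergroupType K) (N : closedSub G) (Q : quotBy N) a :
  cres N a = 0 <-> idgen (augim (qinc Q)) a.
Proof. exact: (iff_trans (qinc_ker Q a) (iff_sym (idgen_augim (qinc Q) a))). Qed.

Lemma quot_pt (K : fieldType) (G : supergroupType K) (N : closedSub G) (Q : quotBy N)
  (R : superAlgType K) (g : superhom G R) :
  pt_in N g <-> superhom_comp g (qinc Q) = punit Q R.
Proof. exact: (ker_sub_pt (quot_ker Q)). Qed.

(* Chains of sets of functions, descending through the commutators of points;  *)
(* they are an ideal-free substitute for central series.                       *)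
Definition nil_chain (K : fieldType) (G : supergroupType K) (r : nat) (Y : nat -> G -> Prop) :=
  [/\ (forall (R : superAlgType K) (n : superhom G R), kills n (Y 0%N) -> n = punit G R) &
      (forall j, (j < r)%N -> forall (R : superAlgType K) (n g : superhom G R),
        kills n (Y j.+1) -> kills (pcomm n g) (Y j))].

(** Take the ideals of the terms of the upper central series, preceded by the augmentation ideal;
    modulo Z^j, the points of Z^(j+1) are central. *)
Lemma upper_center_chain (K : fieldType) (G : supergroupType K) r (Z : closedSub G) :
  upper_center r Z -> exists Y, nil_chain r Y /\ forall a, Y r a <-> cres Z a = 0.
Proof.
elim=> [{}Z hZ|{}r N M Q C _ [Y [[Y0 YS] YN]] hC NM hM].
  exists (fun j => if j is 0%N then fun a => counit a = 0 else fun a => cres Z a = 0).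
  split=> //; split=> [R n k|[|//] _ R n g k a a0].
    apply: shomP => a; rewrite punitE; apply/eqP; rewrite -subr_eq0.
    have := k (a - counit a *: 1); rewrite !linearB scalarZ /= counit1 mulr1 subrr => /(_ erefl).
    by rewrite linearZ_LR rmorph1 => ->.
  have hn : pt_in Z n by apply/pt_inP.
  have -> : pcomm n g = punit G R.
    by apply/pcomm1P; apply: (central_subP _ (center_central hZ)).
  by rewrite punitE a0 scale0r.
exists (fun j => if j == r.+1 then fun a => cres M a = 0 else Y j); rewrite eqxx; split=> //.
split=> [R n|j]; first by exact: Y0.
rewrite ltnS leq_eqVlt => /orP[/eqP ->|jr] R n g; last first.
  by rewrite eqSS (ltn_eqF jr) ltn_eqF ?(ltn_trans jr) //; exact: (YS j jr R n g).
rewrite eqxx ltn_eqF // => k a /YN aN.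
have hn : central_pt (superhom_comp n (qinc Q)).
  by apply/hC/pt_inP => q /hM; exact: k.
suff /(quot_pt Q) /pt_inP /(_ a aN) : superhom_comp (pcomm n g) (qinc Q) = punit Q R by [].
rewrite (hopf_pcomm (qinc_hopf Q)); apply/pcomm1P.
move/central_ptP: hn => /(_ R (idS R) (superhom_comp g (qinc Q))).
by rewrite superhom_comp1l.
Qed.

(** Commutators with the generic point of G over R \ot K[G] are tested; they determine those with
    the generic point of Q, because R \ot K[Q] injects into R \ot K[G]. *)
Lemma quot_central (K : fieldType) (G Q : supergroupType K) (i : superhom Q G)
    (R : superAlgType K) (n : superhom G R) : hopf_hom i -> injective i ->
  (forall (S : superAlgType K) (f : superhom R S) (g : superhom G S),
     superhom_comp (pcomm (superhom_comp f n) g) i = punit Q S) ->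
  central_pt (superhom_comp n i).
Proof.
move=> hi ij hc; apply/central_pt_generic.
have := hc _ (in1 R G) (in2 R G); rewrite (hopf_pcomm hi) => /pcomm1P.
have e1 : superhom_comp (in1 R G) (superhom_comp n i) =
    superhom_comp (stens (idS R) i) (superhom_comp (in1 R Q) (superhom_comp n i)).
  by rewrite [RHS]superhom_compA stens_in1 superhom_comp1.
have e2 : superhom_comp (in2 R G) i = superhom_comp (stens (idS R) i) (in2 R Q).
  by rewrite stens_in2.
rewrite -superhom_compA e1 e2 -!pmul_comp => e.
apply: shomP => a; have := congr1 (fun f => shom f a) e.
rewrite -[LHS]/(stens (idS R) i _) -[RHS]/(stens (idS R) i _) !stensE.
by apply: tmap_inj.
Qed.

Section NilLemma.
Variables (K : fieldType) (hK : 2%N \notin [pchar K]) (G : supergroupType K) (nG : noeth G).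
Variables (r : nat) (Y : nat -> G -> Prop) (hY : nil_chain r Y).

(** By induction the zero locus of [Y j.+1] lies in Z^(j+1), which is constructed along with its
    quotient: modulo Z^j, a point killing [Y j.+1] has trivial commutators, hence is central. *)
Lemma chain_upper j : (j < r)%N -> exists (N : closedSub G) (Q : quotBy N),
  upper_center j.+1 N /\
  forall (R : superAlgType K) (n : superhom G R), kills n (Y j.+1) -> pt_in N n.
Proof.
have [Y0 YS] := hY.
elim: j => [|j IH] jr.
  have [Z hZ] := center_exists G; exists Z, (center_quot hZ); split; first exact: upper_center1.
  move=> R n k; apply/hZ/central_ptP => S f g; apply/pcomm1P; apply: Y0; apply: YS => //.
  by move=> a ya; rewrite /= k // linear0.
have [N [Q [uN NP]]] := IH (ltnW jr).
have [C hC] := center_exists Q.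
(* The coordinate algebra of Q/C, embedded into K[G]; the kernel of G -> Q/C is the next term of the
   series. *)
pose cC := center_central hC; pose i := superhom_comp (qinc Q) (sinc (coinv_sub cC)).
have hi : hopf_hom i by apply: hopf_comp; [exact: qinc_hopf|exact: sinc_hopf].
have ij : injective i by move=> a b /(@qinc_inj _ _ _ Q) /sinc_inj.
have [M [M0 Mpt]] := ker_sub hi.
exists M, (ker_quot hi ij M0); split.
  apply: (upper_centerS (Q := Q) uN hC) => [a|q].
    move=> /M0 h; apply/(quot_ker Q); apply: idgen_le h.
    - exact: idgen_sub.
    - by move=> b x; exact: idgen_mul.
    - move=> _ [q q0 ->]; apply: idgen_in; exists (sinc (coinv_sub cC) q); last by [].
      exact: (etrans ((sinc_hopf (coinv_sub cC)).2 q) q0).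
  rewrite (center_ker hC) M0; split=> h; last first.
    apply: (@idgen_le _ _ (augim (sinc (coinv_sub cC))) (fun q => idgen (augim i) (qinc Q q))) h.
    - split; first by rewrite linear0; exact: (idgen_sub _).1.
      by move=> c x y hx hy; rewrite linearP; exact: (idgen_sub _).2.
    - by move=> a x hx; rewrite rmorphM; exact: idgen_mul.
    - by move=> _ [b b0 ->]; apply: idgen_in; exists b.
  have hq : bgen (img_shopf hi) (fun=> True) (qinc Q q).
    move/idgen_augim: h => [s [s0 ->]]; apply: subspace_sum_seq; first exact: bgen_sub.
    by move=> p /s0 p0; apply: bgen1 => //; [exists p.1|rewrite hi.2].
  (* That M/N is all of C, and no larger, means that the ideal B^+ K[G] meets K[Q] exactly in B^+
     K[Q]. *)
  have := ff_ideal hK nG (B := img_shopf hi) (M := img (qinc Q)) _ _ _ _ _ hq.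
  case=> [|||||t [tP e]].
  - exact: img_sub.
  - by move=> j' m; exact: img_hcomp.
  - move=> _ m [b ->]; apply: imgM.
    by exists (sinc (coinv_sub cC) b).
  - by move=> f m; apply: (img_cr (qinc_hopf Q)).
  - by exists q.
  have : qinc Q q = qinc Q q by []; rewrite {1}e => {e}.
  suff [z [hz ->]] : exists z, idgen (augim (sinc (coinv_sub cC))) z /\
      \sum_(p <- t) p.1 * p.2 = qinc Q z.
    by move=> /(@qinc_inj _ _ _ Q) <-.
  elim: t tP => [|p t IHt] tP.
    by exists 0; rewrite big_nil linear0; split=> //; exact: (idgen_sub _).1.
  have [|z [hz ez]] := IHt; first by move=> p' pt; apply: tP; rewrite inE pt orbT.
  have [[b eb] p0 [m em]] := tP p (mem_head _ _).
  exists (sinc (coinv_sub cC) b * m + z); split.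
    apply: subspaceD; [exact: idgen_sub| |exact: hz].
    apply/idgen_augim; exists [:: (b, m)]; rewrite big_seq1; split=> // p'.
    by rewrite inE => /eqP ->; rewrite /= -(hi.2 b) -eb.
  by rewrite big_cons ez linearD [in RHS]rmorphM eb em.
move=> R n k; apply/Mpt.
have cn : central_pt (superhom_comp n (qinc Q)).
  apply: (quot_central (qinc_hopf Q) (@qinc_inj _ _ _ Q)) => S f g.
  apply/(quot_pt Q); apply: NP; apply: YS => //.
  by move=> a ya; rewrite /= k // linear0.
move/hC: cn => [m hm]; apply: shomP => b.
have cb : coinv C (sinc (coinv_sub cC) b) := sincP b.
rewrite -[LHS]/(superhom_comp n (qinc Q) (sinc (coinv_sub cC) b)) hm (coinv_cres cb).
rewrite linearZ_LR rmorph1 punitE; congr (_ *: _); exact: (sinc_hopf (coinv_sub cC)).2.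
Qed.

Theorem nil_chain_nilpotent : (0 < r)%N ->
  (forall (R : superAlgType K) (n : superhom G R), kills n (Y r)) -> nilpotent G.
Proof.
case: r hY chain_upper => // s hs cu _ Yr.
have [N [Q [uN NP]]] := cu s (ltnSn s).
exists s.+1, N; split=> // a b e.
by have [n hn] := NP _ (idS G) (Yr _ _); rewrite -[a]/(idS G a) hn e -hn.
Qed.
End NilLemma.

(** * Filtrations of comodules by contractions *)

Section Fsub.
Variables (K : fieldType) (D : supergroupType K) (f : {scalar D}).

Lemma fsub_proof : scalar (fun x : D => f x - f 1 * counit x).
Proof. by move=> c x y; rewrite !linearP /= mulrDr mulrCA opprD addrACA mulrBr. Qed.
Definition fsub : {scalar D} := mkscal fsub_proof.
Lemma fsub1 : fsub 1 = 0. Proof. by rewrite /= counit1 mulr1 subrr. Qed.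
Lemma cr_fsub (M : lmodType K) (x : tens M D) : cr fsub x = cr f x - f 1 *: cr counit x.
Proof.
elim/tens_ind: x => [|u v x IH]; first by rewrite ![cr _ 0]linear0 scaler0 subrr.
by rewrite !crD scalerDr opprD addrACA -IH !cr_pure scalerA -scalerBl.
Qed.
End Fsub.

Section Filtration.
Variables (K : fieldType) (M : lmodType K) (D : supergroupType K) (th : {linear M -> tens M D}).
Implicit Types (P : M -> Prop) (f g : {scalar D}).

(** The elements that reach [P] after any n contractions by functionals vanishing at 1, that is,
    under the n-th power of the augmentation ideal of the dual algebra. For a zero [P] and n = 1
    these are the fixed vectors ([th_fix]). *)
Fixpoint filt P n (m : M) : Prop :=
  if n is n'.+1 then forall f, f 1 = 0 -> filt P n' (cr f (th m)) else P m.

Lemma filt_sub P n : subspace P -> subspace (filt P n).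
Proof.
move=> hP; elim: n => [//|n [h0 hl]]; split=> [f f1|c x y hx hy f f1].
  by rewrite !linear0.
by rewrite !linearP; apply: hl; [exact: hx|exact: hy].
Qed.

Lemma filt_le P P' n : (forall m, P m -> P' m) -> forall m, filt P n m -> filt P' n m.
Proof. by move=> h; elim: n => [//|n IH] m hm f f1; apply: IH; exact: hm. Qed.

Lemma filt_filt P n k m : filt (filt P n) k m -> filt P (k + n) m.
Proof. by elim: k m => [//|k IH] m hm f f1; apply: IH; exact: hm. Qed.

Definition stab P := forall f m, P m -> P (cr f (th m)).

Lemma filt_mono1 P n m : stab P -> filt P n m -> filt P n.+1 m.
Proof.
move=> sP; elim: n m => [|n IH] m hm f f1; first exact: sP.
by apply: IH; exact: hm.
Qed.

Lemma filt_mono P n n' m : stab P -> (n <= n')%N -> filt P n m -> filt P n' m.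
Proof.
move=> sP /subnK <-; elim: (n' - n)%N => [//|k IH] hm.
by rewrite addSn; apply: filt_mono1 => //; exact: IH.
Qed.

Hypothesis thA : forall m,
    tlift (fun x c => tlift (fun u v => u \ot (v \ot c)) (th x)) (th m) = tmap id comul (th m).
Hypothesis th1 : forall m, cr counit (th m) = m.

Lemma thA_apply (W : lmodType K) (L : {linear tens M (tens D D) -> W}) m :
  tlift (fun x c => L (tlift (fun a b => a \ot (b \ot c)) (th x))) (th m) =
  tlift (fun u v => L (u \ot comul v)) (th m).
Proof. by have := congr1 L (thA m); rewrite /tmap !(tlift_comp L). Qed.

(** Coassociativity: contracting twice is contracting once by the convolution product. *)
Lemma th_cr f g m : cr f (th (cr g (th m))) = cr (cfun f g) (th m).
Proof.
pose b := fun (u : D) (v : D) => f u * g v : K^o.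
have lfg : scalar (tlift (fun u v : D => f u * g v : K^o)).
  apply: (@tlift_linear K D D K^o b); split=> [v c u u'|u c v v']; rewrite /b linearP.
    by rewrite mulrDl -mulrA.
  by rewrite mulrDr mulrCA.
pose fg : {scalar tens D D} := mkscal lfg.
have fgp u v : fg (u \ot v) = f u * g v.
  apply: (@tlift_pure K D D K^o b); split=> [v' c x x'|x c x' x'']; rewrite /b linearP.
    by rewrite mulrDl -mulrA.
  by rewrite mulrDr mulrCA.
have LE u w : cr fg (u \ot w) = fg w *: u by rewrite cr_pure.
have := thA_apply (cr fg : {linear tens M (tens D D) -> M}) m.
rewrite (eq_tlift (b := fun u v => cr fg (u \ot comul v)) (b' := fun u v => cfun f g v *: u)) => [e|u v].
  rewrite -[RHS]e; pose T : {linear M -> M} := cr f \o th.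
  rewrite -[LHS]/(T (tlift _ _)) tlift_comp; apply: eq_tlift => x c.
  rewrite linearZ_LR (tlift_comp (cr fg : {linear tens M (tens D D) -> M})).
  rewrite -[T x]/(tlift (fun u v => f v *: u) (th x)).
  have lc : linear (fun y : M => g c *: y) by move=> k y z; rewrite scalerDr !scalerA mulrC.
  rewrite -[LHS]/((mklin lc) _) tlift_comp; apply: eq_tlift => a d.
  rewrite -[RHS]/(cr fg (a \ot (d \ot c))) LE fgp.
  by rewrite -[LHS]/(g c *: (f d *: a)) scalerA mulrC.
rewrite LE cfunE.
have lc : linear (fun y : tens D D => fg y *: u) by move=> k y z; rewrite linearP scalerDl scalerA.
rewrite {1}(tens_sumE (comul v)) -[LHS]/((mklin lc) _) linear_sum {2}[comul v]tens_sumE tlift_sum.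
  by apply: eq_bigr => p _; rewrite -[LHS]/(fg (p.1 \ot p.2) *: u) fgp.
split=> [y c x x'|x c y y']; rewrite linearP /=.
  by rewrite mulrDl -mulrA scalerDl scalerA.
by rewrite mulrDr mulrCA scalerDl scalerA.
Qed.

Lemma cfun1 f g : cfun f g 1 = f 1 * g 1.
Proof. by rewrite /= comul1 cl_pure scalarZ. Qed.

(** The functionals that vanish at 1 form an ideal of the convolution algebra. *)
Lemma filt_stab P n : stab P -> stab (filt P n).
Proof.
case: n => [//|n] sP f m hm g g1; rewrite th_cr; apply: hm.
by rewrite cfun1 g1 mul0r.
Qed.

Lemma th_fix m : (forall f, f 1 = 0 -> cr f (th m) = 0) -> th m = m \ot 1.
Proof.
move=> h; apply: tens_crP => f; rewrite cr_pure.
have := h (fsub f) (fsub1 f).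
by rewrite cr_fsub th1 => /eqP; rewrite subr_eq0 => /eqP.
Qed.

Lemma sub0 : subspace (fun m : M => m = 0).
Proof. by split=> // c x y -> ->; rewrite scaler0 addr0. Qed.
Lemma stab0 : stab (fun m : M => m = 0).
Proof. by move=> f _ ->; rewrite !linear0. Qed.

(** The coefficient map attached to a functional [h] is a comodule morphism into K[D]. *)
Lemma th_cl (h : {scalar M}) f m : cr f (comul (cl h (th m))) = cl h (th (cr f (th m))).
Proof.
apply: dual_eq => g.
rewrite -cfunE' -[LHS](cl_cr h (cfun g f)) -th_cr.
exact: (cl_cr h g).
Qed.
End Filtration.

Lemma hcompD (K : fieldType) (V : superSpaceType K) i (x y : V) :
  hcomp i (x + y) = hcomp i x + hcomp i y. Proof. exact: linearD. Qed.
Lemma hcompZ (K : fieldType) (V : superSpaceType K) i c (x : V) :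
  hcomp i (c *: x) = c *: hcomp i x. Proof. exact: linearZ. Qed.

Section FiltSuper.
Variables (K : fieldType) (M : superSpaceType K) (D : supergroupType K) (th : {linear M -> tens M D}).
Hypothesis th_even : forall i m, th (hcomp i m) = hcomp i (th m).

Lemma cr_hcomp i (f : {scalar D}) (x : tens M D) : cr f (hcomp i x) =
  hcomp i (cr (scomp f (hcomp false : {linear D -> D})) x) +
  hcomp (~~ i) (cr (scomp f (hcomp true : {linear D -> D})) x).
Proof.
elim/tens_ind: x => [|u v x IH]; first by rewrite !linear0 addr0.
rewrite !hcompD hcomp_pure !crD IH !hcompD !cr_pure !hcompZ [RHS]addrACA; congr (_ + _).
by case: i {IH} => //=; rewrite addrC.
Qed.

Lemma filt_hcomp P n i m : subspace P -> (forall i m, P m -> P (hcomp i m)) ->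
  filt th P n m -> filt th P n (hcomp i m).
Proof.
move=> sP hP; elim: n i m => [|n IH] i m hm; first exact: hP.
move=> f f1; rewrite th_even cr_hcomp; apply: subspaceD; first exact: filt_sub.
  by apply: IH; apply: hm; rewrite /= homog1.
by apply: IH; apply: hm; rewrite /= (homog_neq (homog1 D)) // linear0.
Qed.
End FiltSuper.

Section FiltProd.
Variables (K : fieldType) (A : superAlgType K) (D : supergroupType K) (al : superhom A (tens A D)).
Implicit Types (f : {scalar D}) (x y : A).
Variables I J I' J' N : A -> Prop.
Hypotheses (sI : subspace I) (sJ : subspace J) (sI' : subspace I') (sJ' : subspace J') (sN : subspace N).
Hypotheses (hI : stab al I) (hJ : stab al J) (hI' : stab al I') (hJ' : stab al J') (hN : stab al N).
Hypotheses (gI' : forall i y, I' y -> I' (hcomp i y)) (gJ' : forall i y, J' y -> J' (hcomp i y)).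
Hypotheses (JI : forall x y, J x -> I' y -> N (x * y)) (IJ : forall x y, I x -> J' y -> N (x * y)).

Lemma al_split X x : subspace X -> (forall f, f 1 = 0 -> X (cr f (al x))) -> cr counit (al x) = x ->
  exists2 t : seq (A * D), (forall p, p \in t -> X p.1) & al x = x \ot 1 + \sum_(p <- t) p.1 \ot p.2.
Proof.
move=> hX h x1; have [|t tX e] := tens_meml (x := al x - x \ot 1) hX.
  by move=> f; have := h (fsub f) (fsub1 f); rewrite cr_fsub x1 linearB /= cr_pure.
by exists t => //; rewrite -e addrC subrK.
Qed.

Lemma cr_mul X (u v : A) (c d : D) f : subspace X -> (forall k, X (u * hcomp k v)) ->
  X (cr f ((u \ot c) * (v \ot d))).
Proof.
move=> hX h; rewrite -(hcomp_sum v) -(hcomp_sum c) !(pureDl, pureDr) !(mulrDl, mulrDr) !crD.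
have E k l : X (cr f ((u \ot hcomp l c) * (hcomp k v \ot d))).
  rewrite (tensM_hom _ _ (homog_hcomp _ _) (homog_hcomp _ _)) crZ cr_pure.
  by do !apply: subspaceZ.
by do !apply: subspaceD.
Qed.

Hypothesis al1 : forall x, cr counit (al x) = x.
Hypothesis alA : forall m,
    tlift (fun x c => tlift (fun u v => u \ot (v \ot c)) (al x)) (al m) = tmap id comul (al m).

(** The coaction is multiplicative. Write the coactions of x and y as x \ot 1 and y \ot 1 plus terms
    one step deeper; a functional vanishing at 1 kills the product of the leading terms, and every
    other term has lost one step in one of its factors. *)
Lemma filt_mul p q x y : I x -> filt al J p x -> I' y -> filt al J' q y -> filt al N (p + q) (x * y).
Proof.
elim: {p q}(p + q)%N {-2}p {-2}q (erefl (p + q)%N) x y => [|s IH] p q.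
  by case: p => //; case: q => // _ x y _ Jx I'y _; exact: JI.
case: p => [|p] epq x y Ix hx I'y hy.
  by apply: (filt_mono (n := 0)) => //=; exact: JI.
case: q epq hy => [|q] epq hy.
  by apply: (filt_mono (n := 0)) => //=; exact: IJ.
move=> f f1; rewrite -[X in filt _ _ _ X]/(cr f (al (x * y))) (_ : al (x * y) = al x * al y); last exact: rmorphM.
have [||t tX ->] := al_split (X := fun z => I z /\ filt al J p z) _ _ (al1 x).
- split; first by split; [exact: sI.1|exact: (filt_sub _ _ sJ).1].
  by move=> c u v [? ?] [? ?]; split; [exact: sI.2|exact: (filt_sub _ _ sJ).2].
- by move=> g g1; split; [exact: hI|exact: hx].
have sY : subspace (fun z => I' z /\ filt al J' q z).
  split; first by split; [exact: sI'.1|exact: (filt_sub _ _ sJ').1].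
  by move=> c u v [? ?] [? ?]; split; [exact: sI'.2|exact: (filt_sub _ _ sJ').2].
have [|t' tY ->] := al_split (X := fun z => I' z /\ filt al J' q z) sY _ (al1 y).
  by move=> g g1; split; [exact: hI'|exact: hy].
have hf n i z : filt al J' n z -> filt al J' n (hcomp i z).
  by apply: filt_hcomp => // j m; exact: shom_even.
have sF : subspace (filt al N s) by exact: filt_sub.
have epq1 : (p + q.+1)%N = s by move: epq; rewrite addSn => -[].
have epq2 : (p.+1 + q)%N = s by rewrite addSnnS.
have IHs p' q' u v : (p' + q')%N = s -> I u -> filt al J p' u -> I' v -> filt al J' q' v ->
    filt al N s (u * v) by move=> e Iu hu Iv hv; rewrite -{1}e; apply: IH.
rewrite epq1 mulrDl !mulrDr !crD; apply: (subspaceD sF); apply: (subspaceD sF).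
- by rewrite tensMl1 cr_pure f1 scale0r; exact: sF.1.
- rewrite mulr_sumr linear_sum; apply: (@subspace_sum_seq K A _ _ _ _ sF) => // p' /tY [? ?] /=.
  apply: (cr_mul (X := filt al N s)) => // k; apply: (IHs p.+1 q) => //; [exact: gI'|exact: hf].
- rewrite mulr_suml linear_sum; apply: (@subspace_sum_seq K A _ _ _ _ sF) => // p' /tX [? ?] /=.
  apply: (cr_mul (X := filt al N s)) => // k; apply: (IHs p q.+1) => //; [exact: gI'|exact: hf].
rewrite mulr_suml linear_sum; apply: (@subspace_sum_seq K A _ _ _ _ sF) => // p' /tX [? ?] /=.
rewrite mulr_sumr linear_sum; apply: (@subspace_sum_seq K A _ _ _ _ sF) => // p'' /tY [? ?] /=.
apply: (cr_mul (X := filt al N s)) => // k; apply: (IHs p q.+1) => //; [exact: gI'|].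
by apply: hf; exact: filt_mono1.
Qed.
End FiltProd.

(** * Subcomodules of K[G] as supermodules *)

Section SubSM.
Variables (K : fieldType) (G : supergroupType K) (P : G -> Prop).
Hypotheses (sP : subspace P) (hP : forall i m, P m -> P (hcomp i m)).
Hypothesis cP : forall (f : {scalar G}) m, P m -> P (cr f (comul m)).

Definition smpred : {pred G} := fun x => `[< P x >].
Fact smpred_submod : submod_closed smpred.
Proof.
split; first by apply/asboolP; exact: sP.1.
by move=> c x y /asboolP hx /asboolP hy; apply/asboolP; exact: sP.2.
Qed.
HB.instance Definition _ := GRing.isSubmodClosed.Build K G smpred smpred_submod.
Definition smT := {x : G | x \in smpred}.
HB.instance Definition _ := SubChoice.on smT.
HB.instance Definition _ := [SubChoice_isSubLmodule of smT by <:].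

Lemma smTP (b : smT) : P (val b). Proof. exact/asboolP/(valP b). Qed.
Lemma smT_ex a : P a -> exists b : smT, val b = a.
Proof. by move=> /asboolP Sa; exists (Sub a Sa); rewrite SubK. Qed.
Lemma smvalE c (x y : smT) : val (c *: x + y) = c *: val x + val y.
Proof. by rewrite linearP. Qed.
Definition smv : {linear smT -> G} := mklin (f := val : smT -> G) smvalE.

Definition smhcomp i (b : smT) : smT := projT1 (cid (smT_ex (hP i (smTP b)))).
Lemma smhcompE i b : val (smhcomp i b) = hcomp i (val b).
Proof. by rewrite /smhcomp; case: cid. Qed.
Fact smhcomp_linear i : linear (smhcomp i).
Proof. by move=> c x y; apply: val_inj; rewrite smhcompE !smvalE !linearP /= !smhcompE. Qed.
Fact smhcomp_hcomp i j v : smhcomp i (smhcomp j v) = if i == j then smhcomp j v else 0.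
Proof.
by apply: val_inj; rewrite !smhcompE hcomp_hcomp; case: ifP; rewrite ?smhcompE ?linear0.
Qed.
Fact smhcomp_sum v : smhcomp false v + smhcomp true v = v.
Proof. by apply: val_inj; rewrite linearD /= !smhcompE hcomp_sum. Qed.
HB.instance Definition _ := isSuperSpace.Build K smT smhcomp_linear smhcomp_hcomp smhcomp_sum.

Let idG : {linear G -> G} := idfun.
Lemma smv_inj : injective smv. Proof. exact: val_inj. Qed.
Let vi_inj : injective (tmap smv idG).
Proof. by apply: tmap_inj => //; exact: smv_inj. Qed.

Lemma sm_coact_ex (b : smT) : exists y : tens smT G, tmap smv idG y = comul (smv b).
Proof.
have [t tS ->] := tens_meml sP (fun f => cP f (smTP b)).
have [h hE] : exists h : G -> smT, forall a, P a -> smv (h a) = a.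
  have ex a : exists b : smT, P a -> smv b = a.
    have [/smT_ex [c <-]|] := pselect (P a); first by exists c.
    by exists 0.
  by have [h hE] := choice ex; exists h.
exists (\sum_(p <- t) h p.1 \ot p.2); rewrite linear_sum big_seq [RHS]big_seq.
apply: eq_bigr => p /tS S1.
by rewrite -[LHS]/(tmap smv idG (h p.1 \ot p.2)) tmap_pure; congr (_ \ot _); exact: hE.
Qed.
Definition sm_coact (b : smT) : tens smT G := projT1 (cid (sm_coact_ex b)).
Lemma sm_coactE b : tmap smv idG (sm_coact b) = comul (smv b).
Proof. by rewrite /sm_coact; case: cid. Qed.
Fact sm_coact_linear : linear sm_coact.
Proof.
move=> c x y; apply: vi_inj; transitivity (c *: comul (smv x) + comul (smv y)).
  by rewrite [LHS]sm_coactE [smv _]linearP comul_linear.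
by rewrite -!sm_coactE [RHS]linearP.
Qed.
Lemma tmap_smv_even i y : tmap smv idG (hcomp i y) = hcomp i (tmap smv idG y).
Proof.
have tD (x z : tens smT G) : tmap smv idG (x + z) = tmap smv idG x + tmap smv idG z by exact: linearD.
elim/tens_ind: y => [|u v y IH]; first by rewrite !linear0.
rewrite hcompD !tD hcompD IH hcomp_pure tD !tmap_pure hcomp_pure.
by congr (_ \ot _ + _ \ot _ + _); exact: smhcompE.
Qed.
Fact sm_coact_even i b : sm_coact (hcomp i b) = hcomp i (sm_coact b).
Proof.
apply: vi_inj; rewrite tmap_smv_even !sm_coactE -comul_even; congr comul.
exact: smhcompE.
Qed.
Fact sm_coactA a :
  tlift (fun x c => tlift (fun u v => u \ot (v \ot c)) (sm_coact x)) (sm_coact a)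
  = tmap id comul (sm_coact a).
Proof.
pose T := tmap smv (idfun : {linear tens G G -> tens G G}).
have lT : linear T by exact: tmap_linear.
have Ti : injective T by apply: tmap_inj => //; exact: smv_inj.
apply: Ti; rewrite /tmap !(tlift_lin lT).
have := comulA (smv a); rewrite -sm_coactE tlift_tmap; last exact: coassl_bilin.
rewrite tlift_tmap; last exact: coassr_bilin.
move=> e; transitivity (tlift (fun u v => tlift (fun u0 v0 => u0 \ot (v0 \ot v))
    (comul (smv u))) (sm_coact a)).
  apply: eq_tlift => x c; rewrite (tlift_lin lT) -sm_coactE tlift_tmap; last exact: pure3_bilin.
  by apply: eq_tlift => u v; rewrite /T tmap_pure.
by rewrite e; apply: eq_tlift => u v; rewrite /T tmap_pure.
Qed.
Fact sm_coact1 a : tlift (fun x c => counit c *: x) (sm_coact a) = a.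
Proof.
apply: smv_inj; rewrite -[in RHS](counitr (smv a)) -sm_coactE tlift_tmap; last exact: cr_bilin.
by rewrite tlift_comp; apply: eq_tlift => u v; rewrite linearZ_LR.
Qed.
Definition sub_sm : supermodule G :=
  @SuperModule K G smT sm_coact sm_coact_linear sm_coact_even sm_coactA sm_coact1.

Definition ssv : {linear sub_sm -> G} := smv.
Lemma ssvP b : P (ssv b). Proof. exact: smTP. Qed.
Lemma ssv_ex a : P a -> exists b, ssv b = a. Proof. exact: smT_ex. Qed.
Lemma ssv_inj : injective ssv. Proof. exact: smv_inj. Qed.
Lemma ssv_hcomp i b : ssv (hcomp i b) = hcomp i (ssv b). Proof. exact: smhcompE. Qed.
Lemma ssv_coact b : tmap ssv idG (coact b) = comul (ssv b). Proof. exact: sm_coactE. Qed.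
Lemma ssv_cr (f : {scalar G}) b : ssv (cr f (coact b)) = cr f (comul (ssv b)).
Proof. by rewrite -ssv_coact (cr_tmap _ (h := f) (h' := f)). Qed.
End SubSM.

(** * Conilpotent functions and unipotency *)

Section Conil.
Variables (K : fieldType) (G : supergroupType K).
Implicit Types (f g : {scalar G}) (a b : G).

Lemma comulZ c a : comul (c *: a) = c *: comul a. Proof. exact: linearZ. Qed.

(** Stage 1 is K ([cW1P]), and the union [conil] is the largest subcoalgebra with coradical K. It is
    even a Hopf super-subalgebra ([conil_shopf]). *)
Definition cW := filt (comul : {linear G -> tens G G}) (fun a => a = 0).
Definition conil a := exists n, cW n a.

Let comulA' m : tlift (fun x c => tlift (fun u v => u \ot (v \ot c)) (comul x)) (comul m)
  = tmap id comul (comul m) :> tens G (tens G G). Proof. exact: comulA. Qed.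
Let comul1' (m : G) : cr counit (comul m) = m. Proof. exact: counitr. Qed.

Lemma cW_sub n : subspace (cW n). Proof. exact: filt_sub (sub0 _). Qed.
Lemma cW_mono n n' a : (n <= n')%N -> cW n a -> cW n' a. Proof. exact: filt_mono (stab0 _). Qed.
Lemma cW_cr n f a : cW n a -> cW n (cr f (comul a)).
Proof. exact: (filt_stab comulA' (stab0 _)). Qed.
Lemma cW_cl n f a : cW n a -> cW n (cl f (comul a)).
Proof.
elim: n a => [|n IH] a /=; first by move=> ->; rewrite !linear0.
by move=> h g g1; rewrite cr_cl; apply: IH; apply: h.
Qed.
Lemma cW1P a : cW 1 a -> a = counit a *: 1.
Proof.
move=> h; have e := th_fix comul1' h.
by rewrite -{1}(counitl a) -[LHS]/(cl counit (comul a)) e cl_pure.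
Qed.
Lemma cW1 c : cW 1 (c *: 1).
Proof.
move=> f f1; change (cr f (comul (c *: 1)) = 0).
by rewrite comulZ crZ comul1 cr_pure f1 scale0r scaler0.
Qed.
Lemma cW_hcomp n i a : cW n a -> cW n (hcomp i a).
Proof.
apply: filt_hcomp; [exact: comul_even|exact: sub0|by move=> j m ->; rewrite linear0].
Qed.
Lemma cWM p q a b : cW p a -> cW q b -> cW (p + q) (a * b).
Proof.
move=> ha hb; pose T := fun _ : G => True.
have sT : subspace T by [].
have hT : stab (comul : {linear G -> tens G G}) T by [].
have s0 := sub0 G; have h0 := stab0 (comul : {linear G -> tens G G}).
apply: (@filt_mul K G G (comulS G) T (fun x => x = 0) T (fun x => x = 0) (fun x => x = 0)) => //.
- by move=> i y ->; rewrite linear0.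
- by move=> x y -> _; rewrite mul0r.
- by move=> x y _ ->; rewrite mulr0.
Qed.
(** Left and right contractions commute, and the first stage consists of scalars; so left
    contractions lower the filtration too. *)
Lemma cW_clS n f a : f 1 = 0 -> cW n.+1 a -> cW n (cl f (comul a)).
Proof.
move=> f1; elim: n a => [|n IH] a h.
  by rewrite (cW1P h) comulZ clZ comul1 cl_pure f1 scale0r scaler0.
by move=> g g1; rewrite cr_cl; apply: IH; apply: h.
Qed.

Lemma conil_seq (s : seq G) : (forall x, x \in s -> conil x) ->
  exists n, forall x, x \in s -> cW n x.
Proof.
elim: s => [|x s IH] h; first by exists 0%N.
have [|n hn] := IH; first by move=> y ys; apply: h; rewrite inE ys orbT.
have [m hm] := h x (mem_head _ _).
exists (maxn n m) => y; rewrite inE => /orP[/eqP ->|/hn hy].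
  by apply: cW_mono hm; exact: leq_maxr.
by apply: cW_mono hy; exact: leq_maxl.
Qed.

Lemma conil_sub : subspace conil.
Proof.
split; first by exists 0%N.
move=> c x y [n hx] [m hy]; exists (n + m)%N; apply: (cW_sub _).2.
  by apply: cW_mono hx; exact: leq_addr.
by apply: cW_mono hy; exact: leq_addl.
Qed.

Lemma comul_antipode a :
  comul (antipode a) = tlift (fun u v => (1 \ot antipode u) * (antipode v \ot 1)) (comul a).
Proof.
have : superhom_comp (comulS G) (antS G) = pmul (pinv (in2 G G)) (pinv (in1 G G)).
  by rewrite -pinvM -comul_pmul.
by move=> /(congr1 (fun h => shom h a)) e; rewrite [LHS]e [LHS]pmul_tlift.
Qed.

Let S : {linear G -> G} := mklin antipode_linear.
(** The antipode reverses the coproduct up to a sign, which is accounted for by splitting the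
    functional by parity. *)
Lemma cr_comul_antipode f a : exists f0 f1 : {scalar G}, (f 1 = 0 -> f0 1 = 0 /\ f1 1 = 0) /\
  cr f (comul (antipode a)) = antipode (cl f0 (comul a)) +
    (hcomp false (antipode (cl f1 (comul a))) - hcomp true (antipode (cl f1 (comul a)))).
Proof.
pose fi i := scomp (scomp f (hcomp i : {linear G -> G})) S.
exists (fi false), (fi true); split.
  move=> f1; rewrite /fi /= antipode1 homog1 f1.
  by rewrite (homog_neq (homog1 G)) // linear0.
rewrite comul_antipode.
have bl : bilin (fun u v : G => ((1 : G) \ot antipode u) * (antipode v \ot (1 : G))).
  split=> [v c x y|u c x y].
    by rewrite antipode_linear pureDr pureZr mulrDl -scalerAl.
  by rewrite antipode_linear pureDl pureZl mulrDr -scalerAr.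
pose Bt (y : tens G G) := tlift (fun u v : G => ((1 : G) \ot antipode u) * (antipode v \ot (1 : G))) y.
have BD x z : Bt (x + z) = Bt x + Bt z by exact: (linearD (mklin (tlift_linear bl))).
have B0 : Bt 0 = 0 by exact: linear_fun0 (tlift_linear bl).
have Bp u v : Bt (u \ot v) = (1 \ot antipode u) * (antipode v \ot 1) by exact: tlift_pure.
have SD (x z : G) : antipode (x + z) = antipode x + antipode z by exact: (linearD S).
have SZ (c : K) (x : G) : antipode (c *: x) = c *: antipode x.
  exact: (scalable_linear (@antipode_linear K G)).
have S0 : antipode (0 : G) = 0 by exact: (linear0 S).
rewrite -/(Bt (comul a)).
elim/tens_hind: (comul a) => [|i j u v y hu hv IH].
  by rewrite B0 ![cl _ 0]linear0 [cr _ 0]linear0 !S0 ![hcomp _ 0]linear0 subrr addr0.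
rewrite BD crD IH Bp !clD !SD !hcompD opprD.
rewrite [X in _ = _ + X]addrACA [RHS]addrACA; congr (_ + _).
have hSu : homog i (antipode u) by rewrite /homog -antipode_even hu.
have hSv : homog j (antipode v) by rewrite /homog -antipode_even hv.
rewrite (tensM_hom _ _ hSu hSv) mul1r mulr1 crZ cr_pure !cl_pure !SZ !hcompZ /fi /=.
case: i hu hSu => hu hSu.
  rewrite hSu (homog_neq (j := false) hSu) // linear0 scale0r add0r.
  case: j hv hSv => hv hSv; rewrite hSv /= ?(homog_neq (j := false) hSv) ?(homog_neq (j := true) hSv) //.
    by rewrite scaler0 sub0r expr1 scaleN1r.
  by rewrite scaler0 subr0 expr0 scale1r.
rewrite hSu (homog_neq (j := true) hSu) // linear0 !scale0r subrr addr0.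
by rewrite expr0 scale1r.
Qed.

Lemma cW_antipode n a : cW n a -> cW n (antipode a).
Proof.
elim: n a => [|n IH] a h; first by rewrite /= h [antipode 0](linear0 S).
move=> f f1; have [f0 [f2 [/(_ f1) [e0 e2] ->]]] := cr_comul_antipode f a.
have h0 := IH _ (cW_clS e0 h); have h2 := IH _ (cW_clS e2 h).
apply: (subspaceD (cW_sub n)) => //; apply: (subspaceB (cW_sub n)); exact: cW_hcomp.
Qed.

Lemma conil1 : conil 1. Proof. by exists 1%N; rewrite -[1]scale1r; exact: cW1. Qed.
Lemma conilM a b : conil a -> conil b -> conil (a * b).
Proof. by move=> [n ha] [m hb]; exists (n + m)%N; exact: cWM. Qed.
Lemma conil_hcomp i a : conil a -> conil (hcomp i a).
Proof. by move=> [n ha]; exists n; exact: cW_hcomp. Qed.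
Lemma conil_cr f a : conil a -> conil (cr f (comul a)).
Proof. by move=> [n ha]; exists n; exact: cW_cr. Qed.
Lemma conil_cl f a : conil a -> conil (cl f (comul a)).
Proof. by move=> [n ha]; exists n; exact: cW_cl. Qed.
Lemma conil_antipode a : conil a -> conil (antipode a).
Proof. by move=> [n ha]; exists n; exact: cW_antipode. Qed.

Definition conil_shopf : subhopf G := SubHopf conil_sub conil1 conilM conil_hcomp
  conil_cr conil_cl conil_antipode.
End Conil.

Section Coefs.
Variables (K : fieldType) (M : lmodType K) (D : supergroupType K) (th : {linear M -> tens M D}).
Hypothesis thA : forall m,
    tlift (fun x c => tlift (fun u v => u \ot (v \ot c)) (th x)) (th m) = tmap id comul (th m).
Hypothesis th1 : forall m, cr counit (th m) = m.
Notation z := (fun m : M => m = 0).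

Lemma coef_filt n m : (forall h : {scalar M}, cW n (cl h (th m))) -> filt th z n m.
Proof.
elim: n m => [|n IH] m hm /=.
  by rewrite -(th1 m) (tens_cl0 hm) linear0.
move=> f f1; apply: IH => h; rewrite -(th_cl thA); exact: hm.
Qed.

Lemma filt_coef n m (h : {scalar M}) : filt th z n m -> cW n (cl h (th m)).
Proof.
elim: n m => [|n IH] m /= hm; first by rewrite hm !linear0.
move=> f f1; change (cW n (cr f (comul (cl h (th m))))); rewrite (th_cl thA).
by apply: IH; exact: hm.
Qed.

(** Finitely many coefficients occur in the coaction of m, so one stage bounds them all. *)
Lemma conil_filt m : (forall h : {scalar M}, conil (cl h (th m))) -> exists n, filt th z n m.
Proof.
move=> h; have [t tP e] := tens_memr (conil_sub D) h.
have [|n hn] := @conil_seq _ _ [seq p.2 | p <- t]; first by move=> x /mapP[p /tP ? ->].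
exists n; apply: coef_filt => f; rewrite e linear_sum; apply: (subspace_sum_seq (cW_sub D n)) => p pt.
rewrite [X in cW n X]cl_pure; apply: (subspaceZ _ (cW_sub D n)).
by apply: hn; apply: map_f.
Qed.
End Coefs.

Section Fixed.
Variables (K : fieldType) (M : superSpaceType K) (D : supergroupType K) (th : {linear M -> tens M D}).
Hypothesis th_even : forall i m, th (hcomp i m) = hcomp i (th m).
Hypothesis th1 : forall m, cr counit (th m) = m.

Lemma hcomp_neq0 (m : M) : m != 0 -> exists i, hcomp i m != 0.
Proof.
move=> m0; apply: contrapT => h; move/eqP: m0; apply; rewrite -(hcomp_sum m).
have h0 i : hcomp i m = 0 by apply/eqP; apply: contrapT => /negP ?; apply: h; exists i.
by rewrite !h0 addr0.
Qed.

(** Contract as long as a nonzero homogeneous vector survives; the last survivor is annihilated by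
    all further contractions, hence fixed. *)
Lemma fixed_vector n m : m != 0 -> filt th (fun m => m = 0) n m ->
  exists i m', [/\ m' != 0, homog i m' & th m' = m' \ot 1].
Proof.
move=> m0; have [i] := hcomp_neq0 m0; move: (homog_hcomp i m) => hi mi.
have : filt th (fun m => m = 0) n m -> filt th (fun m => m = 0) n (hcomp i m).
  by apply: (filt_hcomp th_even _ (sub0 M)) => j x ->; rewrite linear0.
move=> h /h {h m0}; elim: n i (hcomp i m) hi mi => [|n IH] i x hx x0 /= h.
  by rewrite h eqxx in x0.
have [[f [f1 e]]|nf] := pselect (exists f : {scalar D}, f 1 = 0 /\ cr f (th x) != 0).
  have [j ej] := hcomp_neq0 e; apply: (IH j _ (homog_hcomp j _) ej).
  apply: (filt_hcomp th_even _ (sub0 M)); first by move=> k y ->; rewrite linear0.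
  exact: h.
exists i, x; split=> //; apply: (th_fix th1) => f f1.
by apply/eqP; apply: contrapT => /negP ?; apply: nf; exists f.
Qed.
End Fixed.

HB.instance Definition _ (K : fieldType) (G : supergroupType K) (M : supermodule G) :=
  GRing.isLinear.Build K M (tens M G) *:%R (@coact K G M) (@coact_linear K G M).

(** The line of a homogeneous fixed vector is a subsupermodule, so it exhausts a simple one. *)
Lemma unipotent_fixed (K : fieldType) (G : supergroupType K) :
  (forall M : supermodule G, (exists m : M, m != 0) ->
     exists i (m : M), [/\ m != 0, homog i m & coact m = m \ot 1]) -> unipotent G.
Proof.
move=> h M [/h [i [m [m0 hm e]]] simple].
have Zm c : coact (c *: m) = (c *: m) \ot 1 by rewrite (scalable_linear (@coact_linear K G M)) /= e pureZl.
have [|hP|hP] := simple (fun x => exists c, x = c *: m); last first.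
- by split; [exists m|move=> x; have [c ->] := hP x].
- by have := hP m (ex_intro _ 1 (esym (scale1r m))) => e0; rewrite e0 eqxx in m0.
split; first by exists 0; rewrite scale0r.
- by move=> c _ _ [a ->] [b ->]; exists (c * a + b); rewrite scalerA scalerDl.
- move=> j _ [c ->]; rewrite hcompZ; have [->|ij] := eqVneq j i; first by exists c; rewrite hm.
  by exists 0; rewrite (homog_neq hm) 1?eq_sym // scaler0 scale0r.
- move=> _ [c ->]; exists [:: (c *: m, 1)]; rewrite big_seq1; split=> // p.
  by rewrite inE => /eqP ->; exists c.
Qed.

Theorem conil_unipotent (K : fieldType) (G : supergroupType K) :
  (forall a : G, conil a) -> unipotent G.
Proof.
move=> h; apply: unipotent_fixed => M [m m0].
have [|n hn] := conil_filt (@coactA K G M) (@coact1 K G M) (m := m); first by move=> f; exact: h.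
exact: (fixed_vector (@coact_even K G M) (@coact1 K G M) m0 hn).
Qed.

Section UnipotentConil.
Variables (K : fieldType) (G : supergroupType K) (uG : unipotent G).
Notation P := (@conil K G).

(** The coproduct of x minus x \ot 1 has finitely many left legs, all conilpotent, hence in a common
    stage; x lies one stage higher. *)
Lemma conil_split x : (forall f : {scalar G}, f 1 = 0 -> P (cr f (comul x))) -> P x.
Proof.
move=> h; have [t tP e] := al_split (al := comulS G) (conil_sub G) h (counitr x).
have [|n hn] := @conil_seq _ _ [seq p.1 | p <- t]; first by move=> y /mapP[p /tP ? ->].
exists n.+1 => f f1; change (cW n (cr f (comul x))); rewrite -comulSE e crD cr_pure f1 scale0r add0r.
rewrite linear_sum; apply: (subspace_sum_seq (cW_sub G n)) => p pt.
rewrite [X in cW n X]cr_pure; apply: (subspaceZ _ (cW_sub G n)).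
by apply: hn; apply: map_f.
Qed.

Definition subcomod (S : G -> Prop) := [/\ subspace S, (forall i x, S x -> S (hcomp i x)) &
  (forall (f : {scalar G}) x, S x -> S (cr f (comul x)))].
Let z := (fun x : G => x = 0).

Lemma cr_span_sub (y : tens G G) : subspace (fun e => exists f : {scalar G}, e = cr f y).
Proof.
have [[f0 e0] h] := cl_span_sub (tsw y); split; first by exists f0; rewrite e0 -cr_tsw tswK.
move=> c _ _ [f ->] [g ->]; have [||k ek] := h c (cl f (tsw y)) (cl g (tsw y)).
- by exists f.
- by exists g.
by exists k; rewrite -[in LHS](tswK y) !cr_tsw ek -[in RHS](tswK y) cr_tsw.
Qed.

(** Local finiteness: the right contractions of a form a subcomodule, which lies in the span of the
    left legs of one decomposition of its coproduct. *)
Lemma subcomod_gen i a : homog i a ->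
  exists s S, [/\ subcomod S, (forall x, S x -> spn z s x) & S a].
Proof.
move=> ha; have sz : subspace z by exact: sub0.
exists [seq p.1 | p <- repr (comul a)], (fun e => exists f : {scalar G}, e = cr f (comul a)).
split.
- split; first exact: cr_span_sub.
  + move=> j _ [f ->]; rewrite hcomp_cr -!comul_even; have [ij|ij] := eqVneq j i.
      have -> : hcomp (~~ j) a = 0 by apply: (homog_neq ha); rewrite ij; case: (i).
      by rewrite [comul 0]linear0 [X in _ + X]linear0 addr0 ij ha; eexists.
    have -> : hcomp j a = 0 by apply: (homog_neq ha); rewrite eq_sym.
    have -> : hcomp (~~ j) a = a by have -> : ~~ j = i by case: (i) (j) ij => [] [].
    by rewrite [comul 0]linear0 [X in X + _]linear0 add0r; eexists.
  + by move=> f _ [g ->]; rewrite cr_cr; exists (cfun f g).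
- move=> _ [f ->]; rewrite -[cr f _]/(\sum_(p <- repr (comul a)) f p.2 *: p.1).
  apply: subspace_sum_seq; first exact: spn_subspace.
  move=> p pt.
  apply: subspaceZ; first exact: spn_subspace.
  by apply: spn_in => //; apply: map_f.
- by exists (counit : {scalar G}); rewrite -[LHS]counitr.
Qed.

Variables (S : G -> Prop).
Hypotheses (cS : subcomod S).
Hypothesis Smin : forall T, subcomod T -> (forall x, T x -> S x) ->
  (forall x, T x -> P x) \/ (forall x, S x -> T x).

Lemma cl_hcomp k j (phi : {scalar G}) (y : tens G G) : (forall u, phi (hcomp (~~ k) u) = 0) ->
  cl phi (hcomp j y) = hcomp (j (+) k) (cl phi y).
Proof.
move=> h; elim/tens_ind: y => [|u v y IH]; first by rewrite !linear0.
rewrite hcompD !clD hcompD IH; congr (_ + _); rewrite hcomp_pure clD !cl_pure hcompZ.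
rewrite -[in RHS](hcomp_sum' k u) linearD /= h addr0.
by clear IH; case: k h => /= h; rewrite h scale0r ?addr0 ?add0r ?addbT ?addbF.
Qed.

(** The map x |-> phi(x_1) x_2 is a comodule morphism that vanishes on the conilpotent functions. By
    minimality of [S], its image on [S], if nonzero, is a simple supermodule, hence trivial by
    unipotency: the image consists of scalars. *)
Lemma min_subcomod k (phi : {scalar G}) : (forall x, P x -> phi x = 0) ->
  (forall u, phi (hcomp (~~ k) u) = 0) ->
  forall (f : {scalar G}) x, f 1 = 0 -> S x -> phi (cr f (comul x)) = 0.
Proof.
move=> phiP phik f x f1 Sx; have [sS hS crS] := cS.
have [phiS|phiS] := pselect (forall x, S x -> phi x = 0); first by apply: phiS; exact: crS.
pose L x := cl phi (comul x).
have Lcr (g : {scalar G}) y : cr g (comul (L y)) = L (cr g (comul y)) by exact: cr_cl.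
have LP y : P y -> L y = 0.
  by move=> Py; apply: dual_eq => g; rewrite -[LHS](cl_cr phi g) linear0; apply: phiP; exact: conil_cr.
have LL c y y' : L (c *: y + y') = c *: L y + L y' by rewrite /L comul_linear clD clZ.
pose S' y := exists2 x, S x & y = L x.
have sS' : subspace S'.
  split; first by exists 0; [exact: sS.1|rewrite /L !linear0].
  by move=> c _ _ [y Sy ->] [y' Sy' ->]; exists (c *: y + y'); rewrite ?LL //; exact: sS.2.
have hS' i y : S' y -> S' (hcomp i y).
  move=> [y' Sy' ->]; exists (hcomp (i (+) k) y'); first exact: hS.
  by rewrite /L comul_even (cl_hcomp _ _ phik) -addbA addbb addbF.
have cS' (g : {scalar G}) y : S' y -> S' (cr g (comul y)).
  by move=> [y' Sy' ->]; rewrite Lcr; exists (cr g (comul y')) => //; exact: crS.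
pose SM := sub_sm sS' hS' cS'; pose v : {linear SM -> G} := ssv sS' hS' cS'.
have vi : injective v by exact: ssv_inj.
(* A subsupermodule of the image pulls back to a subcomodule of [S]; by minimality it is
   conilpotent, hence sent to 0, or all of [S]. *)
have simple : simple_supermodule SM.
  split.
    apply: contrapT => h; apply: phiS => y Sy.
    have [|b eb] := ssv_ex sS' hS' cS' (a := L y); first by exists y.
    have b0 : b = 0 by apply/eqP; apply: contrapT => /negP b0; apply: h; exists b.
    have <- : counit (L y) = phi y.
      by rewrite -[LHS](cl_cr phi (counit : {scalar G})); congr (phi _); exact: counitr.
    by rewrite -eb b0 !linear0.
  move=> T' [T0 TL TH TC]; pose T y := S y /\ exists2 b : SM, T' b & v b = L y.
  have cT : subcomod T.
    split.
    - split; first by split; [exact: sS.1|exists 0 => //; rewrite /L !linear0].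
      move=> c y y' [Sy [b Tb eb]] [Sy' [b' Tb' eb']]; split; first exact: sS.2.
      by exists (c *: b + b'); [exact: TL|rewrite LL -eb -eb' linearP].
    - move=> i y [Sy [b Tb eb]]; split; first exact: hS.
      exists (hcomp (i (+) k) b); first exact: TH.
      by rewrite [LHS]ssv_hcomp eb /L comul_even (cl_hcomp _ _ phik).
    - move=> g y [Sy [b Tb eb]]; split; first exact: crS.
      have [t [tT et]] := TC b Tb.
      exists (cr g (coact b)); last by rewrite [LHS]ssv_cr -Lcr -eb.
      rewrite et linear_sum; apply: (subspace_sum_seq (P := T')); first by split.
      by move=> p pt; rewrite [X in T' X]cr_pure; apply: (subspaceZ (P := T')); [split|exact: tT].
  have [y []//|TP|TS] := Smin cT.
    left=> b Tb; have [y Sy ey] := ssvP b; apply: vi.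
    by rewrite [LHS]ey LP ?linear0 //; apply: TP; split=> //; exists b.
  right=> b; have [y Sy ey] := ssvP b; have [_ [b' Tb' eb']] := TS y Sy.
  by have -> : b = b' by apply: vi; rewrite eb'.
have [_ triv] := uG simple.
have [|b eb] := ssv_ex sS' hS' cS' (a := L x); first by exists x.
have := congr1 (tmap v (idfun : {linear G -> G})) (triv b).
rewrite [LHS]ssv_coact [RHS]tmap_pure eb => e.
rewrite [LHS](cl_cr phi f) -/(L x) -(counitl (L x)) -/(cl counit (comul (L x))) e cl_pure.
by rewrite linearZ /= f1 mulr0.
Qed.

Lemma min_subcomod_conil x : S x -> P x.
Proof.
move=> Sx; apply: conil_split => f f1; apply: (subspace_dual (conil_sub G)) => phi phiP.
pose ph k : {scalar G} := scomp phi (hcomp k : {linear G -> G}).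
have h k : ph k (cr f (comul x)) = 0.
  apply: (@min_subcomod k) => // [y Py|u] /=; first by apply: phiP; exact: conil_hcomp.
  by rewrite hcomp_hcomp; case: (k); rewrite linear0.
by rewrite -(hcomp_sum (cr f (comul x))) linearD; move: (h true) (h false) => /= -> ->; rewrite addr0.
Qed.
End UnipotentConil.

(** Choose a spanning list of least length; by [subspace_span] a subcomodule that still leaves [P]
    cannot be smaller. *)
Lemma min_subcomod_ex (K : fieldType) (G : supergroupType K) (P : G -> Prop) (a : G) :
  subspace P -> ~ P a -> exists s S, [/\ subcomod S, (forall x, S x -> spn (fun x => x = 0) s x),
    (exists2 x : G, S x & ~ P x) &
    forall T, subcomod T -> (forall x, T x -> S x) -> (forall x, T x -> P x) \/ (forall x, S x -> T x)].
Proof.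
move=> sP na.
have [i ni] : exists i, ~ P (hcomp i a).
  apply: contrapT => h; apply: na; rewrite -(hcomp_sum a).
  have hP i : P (hcomp i a) by apply: contrapT => ni; apply: h; exists i.
  exact: subspaceD.
pose N n := exists s S, [/\ size s = n, subcomod S, (forall x, S x -> spn (fun x => x = 0) s x) &
   exists2 x : G, S x & ~ P x].
have exN : exists n, `[< N n >].
  have [s [S [cS Ss Sa]]] := subcomod_gen (homog_hcomp i a).
  by exists (size s); apply/asboolP; exists s, S; split=> //; exists (hcomp i a).
have [n /asboolP[s [S [es cS Ss xS]]] nmin] := ex_minnP exN.
exists s, S; split=> // T cT TS.
have [TP|/existsNP[y /not_implyP[Ty ny]]] := pselect (forall x, T x -> P x); first by left.
right=> w Sw.
have sT : subspace T by case: cT.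
have zT x0 : x0 = 0 -> T x0 by move=> ->; exact: sT.1.
have [t [t1 t2 t3]] := subspace_span (sub0 G) sT zT (fun x Tx => Ss x (TS x Tx)).
apply: t3; last exact: Ss.
apply/eqP; rewrite eqn_leq t1 es; apply: nmin; apply/asboolP.
exists t, T; split=> //; first by move=> v /t2.
by exists y.
Qed.

(** A minimal subcomodule that is not conilpotent is trivial modulo [conil], so one more contraction
    brings it into [conil]: a contradiction. *)
Theorem unipotent_conil (K : fieldType) (G : supergroupType K) :
  unipotent G -> forall a : G, conil a.
Proof.
move=> uG a; apply: contrapT => na.
have [s [S [cS Ss [x Sx nx] Smin]]] := min_subcomod_ex (conil_sub G) na.
by apply: nx; exact: (min_subcomod_conil uG cS Smin Sx).
Qed.

(** * From a central extension to nilpotency *)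

Section CommConil.
Variables (K : fieldType) (U : supergroupType K) (R : superAlgType K).

(** Apart from a \ot 1, the coproduct has left legs in stage k, on which [m] is the counit. *)
Lemma pmul_split_l k (m g : superhom U R) a : (forall x, cW k x -> m x = counit x *: 1) ->
  cW k.+1 a -> pmul m g a = m a + g a - counit a *: 1.
Proof.
move=> hm ha; have [t tP e] := al_split (al := comulS U) (cW_sub U k) ha (counitr a).
have e2 : a = counit a *: 1 + \sum_(p <- t) counit p.1 *: p.2.
  rewrite -{1}(counitl a) -[LHS]/(cl counit (comulS U a)) e clD cl_pure; congr (_ + _).
  by rewrite linear_sum; apply: eq_bigr => p _; rewrite [LHS]cl_pure.
have eg : g a = counit a *: 1 + sprod m g (\sum_(p <- t) p.1 \ot p.2).
  rewrite {1}e2 [LHS]linearD; congr (_ + _); first by rewrite [LHS]linearZ rmorph1.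
  rewrite [LHS]linear_sum [RHS]linear_sum big_seq [RHS]big_seq; apply: eq_bigr => p pt.
  rewrite -[RHS]/(sprod m g (p.1 \ot p.2)) sprod_pure hm; last exact: tP.
  by rewrite [LHS]linearZ -scalerAl mul1r.
rewrite -[LHS]/(sprod m g (comulS U a)) e [LHS]linearD eg addrA addrAC addrK; congr (_ + _).
by rewrite -[LHS]/(sprod m g (a \ot 1)) sprod_pure rmorph1 mulr1.
Qed.

Lemma pmul_split_r k (m g : superhom U R) a : (forall x, cW k x -> m x = counit x *: 1) ->
  cW k.+1 a -> pmul g m a = m a + g a - counit a *: 1.
Proof.
move=> hm ha; have [f|t tP e] := tens_memr (x := comul a - 1 \ot a) (cW_sub U k).
  have -> : cl f (comul a - 1 \ot a) = cl (fsub f) (comul a).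
    rewrite -[cl (fsub f) _]cr_tsw cr_fsub !cr_tsw -[cl counit _]/(tlift _ _) counitl.
    by rewrite linearB; congr (_ - _); exact: cl_pure.
  by apply: cW_clS ha; exact: fsub1.
have {}e : comul a = 1 \ot a + \sum_(p <- t) p.1 \ot p.2 by rewrite -e addrC subrK.
have e2 : a = counit a *: 1 + \sum_(p <- t) counit p.2 *: p.1.
  rewrite -{1}(counitr a) -[LHS]/(cr counit (comul a)) e crD cr_pure; congr (_ + _).
  by rewrite linear_sum; apply: eq_bigr => p _; rewrite [LHS]cr_pure.
have eg : g a = counit a *: 1 + sprod g m (\sum_(p <- t) p.1 \ot p.2).
  rewrite {1}e2 [LHS]linearD; congr (_ + _); first by rewrite [LHS]linearZ rmorph1.
  rewrite [LHS]linear_sum [RHS]linear_sum big_seq [RHS]big_seq; apply: eq_bigr => p pt.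
  rewrite -[RHS]/(sprod g m (p.1 \ot p.2)) sprod_pure hm; last exact: tP.
  by rewrite [LHS]linearZ -scalerAr mulr1.
rewrite -[LHS]/(sprod g m (comul a)) e [LHS]linearD eg addrA addrAC addrK; congr (_ + _).
by rewrite -[LHS]/(sprod g m (1 \ot a)) sprod_pure rmorph1 mul1r.
Qed.

(** On stage k + 1 both mg and gm are given by m + g - counit ([pmul_split_l], [pmul_split_r]), so
    the commutator is trivial there. *)
Lemma pcomm_conil k (m g : superhom U R) a : (forall x, cW k x -> m x = counit x *: 1) ->
  cW k.+1 a -> pcomm m g a = counit a *: 1.
Proof.
move=> hm ha; rewrite -(punitE R a) -(pmulVl (pmul g m)).
have [t tP e] := tens_memr (cW_sub U k.+1) (fun f => cW_cl f ha).
rewrite -[LHS]/(sprod (pinv (pmul g m)) (pmul m g) (comul a)).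
rewrite -[RHS]/(sprod (pinv (pmul g m)) (pmul g m) (comul a)) e !linear_sum big_seq [RHS]big_seq.
apply: eq_bigr => p pt; rewrite -[LHS]/(sprod _ _ (p.1 \ot p.2)) -[RHS]/(sprod _ _ (p.1 \ot p.2)).
by rewrite !sprod_pure (pmul_split_l _ hm (tP p pt)) (pmul_split_r _ hm (tP p pt)).
Qed.
End CommConil.

Section BC.
Variables (K L : fieldType) (iota : {rmorphism K -> L}) (G : supergroupType K).

Lemma cond_ab : cond_a iota G -> cond_b iota G.
Proof.
move=> [Z [F [hZ [mF _] [Q uQ]]]]; exists (sub_trans F), Q; split=> //.
move=> R n g [n' hn] a; apply: (center_central hZ).
by exists (superhom_comp n' (cres F)) => b; rewrite hn.
Qed.

(** The chain consists of the stages of the conilpotency filtration of K[U], in decreasing order.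
    Killing the top stage forces a point into the central F; the last stage is zero and is killed by
    every point. *)
Lemma cond_bc (hK : 2%N \notin [pchar K]) : noeth G -> cond_b iota G -> cond_c G.
Proof.
move=> nG [F [U [_ cF uU]]].
have allc := unipotent_conil uU.
have kI : sideal (fun=> True) (fun a => cres F a = 0).
  split=> //.
  - by split; [rewrite linear0|move=> c x y hx hy; rewrite linearP /= hx hy scaler0 addr0].
  - by move=> a x _ hx; rewrite rmorphM /= hx mulr0.
  - by move=> i a ha; rewrite shom_even ha linear0.
have [s sk sg] := nG _ kI.
have tP (x : G) : exists t : seq (U * G), x \in s ->
    (forall p, p \in t -> counit p.1 = 0) /\ x = \sum_(p <- t) qinc U p.1 * p.2.
  have [/sk /(quot_ker U) /idgen_augim [t ht]|_] := boolP (x \in s); last by exists [::].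
  by exists t.
have [t ht] := choice tP.
(* A stage that contains all functions on U occurring in the generators of the ideal of F. *)
have [|n hn] := @conil_seq _ U (flatten [seq [seq p.1 | p <- t x] | x <- s]).
  by move=> x _; exact: allc.
(* Index 0 is the augmentation ideal of G; index j + 1 is stage n - j. So index 1 cuts out F and
   index n + 1 gives no condition. *)
pose Y j (a : G) := if j is j'.+1 then exists u : U, [/\ cW (n - j') u, counit u = 0 & a = qinc U u]
  else counit a = 0.
have mk k R (m : superhom G R) : kills m (fun a => exists u : U, [/\ cW k u, counit u = 0 & a = qinc U u]) ->
    forall x, cW k x -> superhom_comp m (qinc U) x = counit x *: 1.
  move=> km x hx; apply/eqP; rewrite -subr_eq0.
  have -> : superhom_comp m (qinc U) x - counit x *: 1 = superhom_comp m (qinc U) (x - counit x *: 1).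
    by rewrite [RHS]linearB; congr (_ - _); rewrite [RHS]linearZ rmorph1.
  apply/eqP; case: k km hx => [|k] km hx; first by rewrite hx !linear0 scale0r subrr linear0.
  apply: km; exists (x - counit x *: 1); split=> //.
    apply: (subspaceB (cW_sub U _)) => //; apply: (cW_mono (n := 1)) => //; exact: cW1.
  by rewrite linearB scalarZ /= counit1 mulr1 subrr.
apply: (@nil_chain_nilpotent K hK G nG n.+1 Y) => //.
- split=> [R m km|j jn R m g km a].
    apply: shomP => a; rewrite punitE; apply/eqP; rewrite -subr_eq0.
    have := km (a - counit a *: 1); rewrite /Y !linearB scalarZ /= counit1 mulr1 subrr => /(_ erefl).
    by rewrite linearZ_LR rmorph1 => ->.
  case: j jn km => [|j] jn km.
    have hm : pt_in F m.
      apply/pt_inP => x /sg [l [lP ->]]; rewrite linear_sum big_seq big1 // => p /lP [_ ps].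
      transitivity (m p.1 * m p.2); first exact: rmorphM.
      suff -> : m p.2 = 0 by rewrite mulr0.
      have [t0 ->] := ht _ ps; rewrite linear_sum big_seq big1 // => q qt.
      transitivity (m (qinc U q.1) * m q.2); first exact: rmorphM.
      rewrite (km (qinc U q.1)) ?mul0r //; exists q.1; split=> //; last exact: t0.
      rewrite subn0; apply: hn; apply/flattenP; exists [seq p0.1 | p0 <- t p.2]; exact: map_f.
    have -> : pcomm m g = punit G R by apply/pcomm1P; exact: (central_subP _ cF hm).
    by rewrite /Y => a0; rewrite punitE a0 scale0r.
  move=> [u [hu u0 ->]]; rewrite -[LHS]/(superhom_comp (pcomm m g) (qinc U) u).
  rewrite (hopf_pcomm (qinc_hopf U)) (@pcomm_conil _ _ _ (n - j.+1)) ?u0 ?scale0r //; first exact: mk.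
  by rewrite -subSn // subSS.
- by move=> R m a [u [hu _ ->]]; move: hu; rewrite subnn => ->; rewrite !linear0.
Qed.
End BC.

(** * The even part; restriction to closed super-subgroups *)

Section EvenPart.
Variables (K : fieldType) (G : supergroupType K).

Let X (x : G) : Prop := exists y, x = hcomp true y.

Lemma even_part_exists : exists E : closedSub G, is_even_part E.
Proof.
have Xh i x : X x -> idgen X (hcomp i x).
  move=> [y ->]; rewrite hcomp_hcomp; case: eqP => _; first by apply: idgen_in; exists y.
  exact: (idgen_sub X).1.
have X1 x : X x -> counit x = 0 by move=> [y ->]; exact: counit_even.
have XM R (g h : superhom G R) : kills g X -> kills h X -> kills (pmul g h) X.
  move=> kg kh _ [y ->]; rewrite -[LHS]/(sprod g h (comul (hcomp true y))) comul_even.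
  elim/tens_ind: (comul y) => [|u v z IH]; first by rewrite !linear0.
  rewrite hcompD [LHS]linearD; transitivity (0 + 0 : R); last exact: addr0.
  congr (_ + _); last exact: IH.
  rewrite -[LHS]/(sprod g h (hcomp true (u \ot v))) hcomp_pure [LHS]linearD.
  transitivity (g (hcomp false u) * h (hcomp true v) + g (hcomp true u) * h (hcomp false v)).
    by congr (_ + _); exact: sprod_pure.
  by rewrite kh ?(kg (hcomp true u)) ?mulr0 ?mul0r ?addr0 //; eexists.
have XV R (g : superhom G R) : kills g X -> kills (pinv g) X.
  by move=> kg _ [y ->]; rewrite -[LHS]/(g (antipode _)) antipode_even; apply: kg; eexists.
have [E [E0 _]] := closed_of_functor Xh X1 XM XV.
exists E => a; rewrite E0; split=> [[s [sX ->]]|[s ->]].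
  have [h hE] : exists h : G -> G, forall x, X x -> x = hcomp true (h x).
    have ex x : exists y, X x -> x = hcomp true y.
      by have [[y e]|?] := pselect (X x); [exists y|exists 0].
    by have [h hE] := choice ex; exists h.
  exists [seq (p.1, h p.2) | p <- s]; rewrite big_map big_seq [RHS]big_seq.
  by apply: eq_bigr => p /sX /hE {1}->.
exists [seq (p.1, hcomp true p.2) | p <- s]; rewrite big_map; split=> //.
by move=> p /mapP[q _ ->]; eexists.
Qed.

Lemma even_part_even (E : closedSub G) : is_even_part E -> purely_even E.
Proof.
move=> hE e; have [a <-] := cres_surj e; rewrite -shom_even; apply/hE.
by exists [:: (1, a)]; rewrite big_seq1 mul1r.
Qed.
End EvenPart.

Lemma purely_even_surj (K : fieldType) (A B : superAlgType K) (p : superhom A B) :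
  (forall b, exists a, p a = b) -> purely_even A -> purely_even B.
Proof. by move=> ps hA b; have [a <-] := ps b; rewrite -shom_even hA linear0. Qed.

Lemma noeth_surj (K : fieldType) (A B : superAlgType K) (p : superhom A B) :
  (forall b, exists a, p a = b) -> noeth A -> noeth B.
Proof.
move=> ps nA J [sJ _ mJ hJ].
have [|s sJ' sg] := nA (fun a => J (p a)).
  split=> //.
  - split; first by rewrite linear0; exact: sJ.1.
    by move=> c x y hx hy; rewrite linearP; exact: sJ.2.
  - by move=> a x _ hx; rewrite rmorphM; exact: mJ.
  - by move=> i a ha; rewrite shom_even; exact: hJ.
exists [seq p x | x <- s]; first by move=> x /mapP[y /sJ' ? ->].
move=> x; have [a <-] := ps x => /sg [t [tP ->]].
exists [seq (p q.1, p q.2) | q <- t]; rewrite big_map linear_sum; split.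
  by move=> q /mapP[q' /tP [_ ?] ->]; split=> //; exact: map_f.
by apply: eq_bigr => q _; exact: rmorphM.
Qed.

Lemma algebraic_surj (K : fieldType) (A B : supergroupType K) (p : superhom A B) :
  (forall b, exists a, p a = b) -> algebraic A -> algebraic B.
Proof.
move=> ps [s hs]; exists [seq p x | x <- s] => P Ps P1 PD PM PZ b.
have [a <-] := ps b; apply: (hs (fun a => P (p a))).
- by move=> x xs; apply: Ps; exact: map_f.
- by rewrite rmorph1.
- by move=> x y hx hy; rewrite linearD; exact: PD.
- by move=> x y hx hy; rewrite rmorphM; exact: PM.
- by move=> c x hx; rewrite linearZ_LR; exact: PZ.
Qed.

Lemma chain_sub (K : fieldType) (G : supergroupType K) (E : closedSub G) r Y :
  nil_chain r Y -> nil_chain r (fun j (e : E) => exists2 a, Y j a & e = cres E a).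
Proof.
move=> [Y0 YS].
have kk R (n : superhom E R) j : kills n (fun e => exists2 a, Y j a & e = cres E a) ->
    kills (superhom_comp n (cres E)) (Y j).
  by move=> k a Ya; apply: k; exists a.
split=> [R n /kk /Y0 e|j jr R n g /kk k _ [a Ya ->]].
  apply: shomP => b; have [a <-] := cres_surj b.
  rewrite -[LHS]/(superhom_comp n (cres E) a) e !punitE; congr (_ *: _).
  by rewrite (cres_hopf E).2.
rewrite -[LHS]/(superhom_comp (pcomm n g) (cres E) a) (hopf_pcomm (cres_hopf E)).
exact: (YS j jr R _ (superhom_comp g (cres E)) k).
Qed.

Lemma chain_nilpotent (K : fieldType) (hK : 2%N \notin [pchar K]) (G : supergroupType K) r Y :
  noeth G -> (0 < r)%N -> nil_chain r Y -> (forall a : G, Y r a -> a = 0) -> nilpotent G.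
Proof.
move=> nG r0 hY Yr; apply: (nil_chain_nilpotent hK nG hY r0) => R n a /Yr ->.
by rewrite linear0.
Qed.

Lemma nilpotent_chain (K : fieldType) (G : supergroupType K) : nilpotent G ->
  exists r Y, [/\ (0 < r)%N, nil_chain r Y & forall a : G, Y r a -> a = 0].
Proof.
move=> [r [Z [uZ iZ]]]; have [Y [hY YZ]] := upper_center_chain uZ.
exists r, Y; split=> //; first by case: uZ.
by move=> a /YZ e; apply: iZ; rewrite e linear0.
Qed.

(** * Conjugation by a group that maps to G *)

Section AdQ.
Variables (K : fieldType) (G D : supergroupType K) (q : superhom G D) (hq : hopf_hom q).

(** The coaction of D on K[G] through conjugation by the images of its points in G. *)
Definition adq : superhom G (tens G D) := superhom_comp (stens (idS G) q) (ad G).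

Lemma adq_pconj : adq = pconj (in1 G D) (superhom_comp (in2 G D) q).
Proof. exact: ad_id. Qed.

Lemma adq_cr (f : {scalar D}) x : cr f (adq x) = cr (scomp f q) (ad G x).
Proof. by rewrite -[adq x]/(stens (idS G) q (ad G x)) stensE (cr_tmap _ (h := f) (h' := scomp f q)). Qed.
Lemma adq_cl (f : {scalar G}) x : cl f (adq x) = q (cl f (ad G x)).
Proof. by rewrite -[adq x]/(stens (idS G) q (ad G x)) stensE (cl_tmap _ (h := f) (h' := f)). Qed.

Lemma sprod_adq (R : superAlgType K) (x : superhom G R) (d : superhom D R) :
  superhom_comp (sprod x d) adq = pconj x (superhom_comp d q).
Proof. by rewrite adq_pconj pconj_comp sprod_in1 superhom_compA sprod_in2. Qed.

Lemma adq_counit x : cr counit (adq x) = x.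
Proof.
have h : superhom_comp (sprod (idS G) (punit D G)) adq = idS G.
  by rewrite sprod_adq (hopf_punit hq) pconj1.
transitivity (sprod (idS G) (punit D G) (adq x)); last exact: (congr1 (fun h => shom h x) h).
rewrite sprodE; apply: eq_tlift => u v; rewrite punitE.
by rewrite -scalerAr mulr1.
Qed.

(** Conjugation by a product is iterated conjugation ([pconjM]), read at generic points. *)
Lemma adq_coassoc x :
  tlift (fun u c => tlift (fun a b => a \ot (b \ot c)) (adq u)) (adq x) = tmap id comul (adq x).
Proof.
pose T := tens G (tens D D); pose x0 : superhom G T := in1 G (tens D D).
pose d1 : superhom D T := superhom_comp (in2 G (tens D D)) (in1 D D).
pose d2 : superhom D T := superhom_comp (in2 G (tens D D)) (in2 D D).
pose h := superhom_comp (sprod x0 d1) adq.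
transitivity (superhom_comp (sprod h d2) adq x).
  rewrite -[RHS]/(sprod h d2 (adq x)) sprodE; apply: eq_tlift => u c.
  rewrite -[h u]/(sprod x0 d1 (adq u)) sprodE tliftMr; apply: eq_tlift => a b.
  have -> : x0 a * d1 b = a \ot (b \ot 1) by exact: tensM_in12.
  by rewrite [RHS]tensMr1 -[X in _ = _ \ot X]/((b \ot 1) * (1 \ot c)) tensM_in12.
rewrite sprod_adq /h sprod_adq -pconjM -(hopf_pmul hq).
have -> : pmul d1 d2 = superhom_comp (in2 G (tens D D)) (comulS D).
  by rewrite comul_pmul pmul_comp.
rewrite -sprod_adq -[LHS]/(sprod _ _ (adq x)) sprodE.
by apply: eq_tlift => u v; exact: tensM_in12.
Qed.
End AdQ.

(** * Extension of scalars to a larger field *)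

Definition resc (K L : fieldType) (iota : {rmorphism K -> L}) (W : lmodType L) : Type := W.

Section Rescale.
Variables (K L : fieldType) (iota : {rmorphism K -> L}) (W : lmodType L).
HB.instance Definition _ := GRing.Zmodule.on (resc iota W).
Definition resc_scale (c : K) (w : resc iota W) : resc iota W := iota c *: (w : W).
Fact resc_scaleA c d w : resc_scale c (resc_scale d w) = resc_scale (c * d) w.
Proof. by rewrite /resc_scale scalerA rmorphM. Qed.
Fact resc_scale1 : left_id 1 resc_scale.
Proof. by move=> w; rewrite /resc_scale rmorph1 scale1r. Qed.
Fact resc_scaleDr : right_distributive resc_scale +%R.
Proof. by move=> c v w; exact: scalerDr. Qed.
Fact resc_scaleDl w : {morph resc_scale^~ w : c d / c + d}.
Proof. by move=> c d; rewrite /resc_scale rmorphD; exact: scalerDl. Qed.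
HB.instance Definition _ := GRing.Zmodule_isLmodule.Build K (resc iota W)
  resc_scaleA resc_scale1 resc_scaleDr resc_scaleDl.
End Rescale.

Definition extf (K L : fieldType) (iota : {rmorphism K -> L}) : Type := L.

Section ExtField.
Variables (K L : fieldType) (iota : {rmorphism K -> L}).
Notation Lk := (extf iota).
HB.instance Definition _ := GRing.Field.on Lk.
Definition extf_scale (c : K) (x : Lk) : Lk := iota c * x.
Fact extf_scaleA c d w : extf_scale c (extf_scale d w) = extf_scale (c * d) w.
Proof. by rewrite /extf_scale mulrA rmorphM. Qed.
Fact extf_scale1 : left_id 1 extf_scale.
Proof. by move=> w; rewrite /extf_scale rmorph1 mul1r. Qed.
Fact extf_scaleDr : right_distributive extf_scale +%R.
Proof. by move=> c v w; exact: mulrDr. Qed.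
Fact extf_scaleDl w : {morph extf_scale^~ w : c d / c + d}.
Proof. by move=> c d; rewrite /extf_scale rmorphD; exact: mulrDl. Qed.
HB.instance Definition _ := GRing.Zmodule_isLmodule.Build K Lk
  extf_scaleA extf_scale1 extf_scaleDr extf_scaleDl.
Fact extf_scaleAl c (x y : Lk) : c *: (x * y) = (c *: x) * y. Proof. exact: mulrA. Qed.
HB.instance Definition _ := GRing.Lmodule_isLalgebra.Build K Lk extf_scaleAl.
Fact extf_scaleAr c (x y : Lk) : c *: (x * y) = x * (c *: y). Proof. exact: mulrCA. Qed.
HB.instance Definition _ := GRing.Lalgebra_isAlgebra.Build K Lk extf_scaleAr.
Definition extf_hcomp (i : bool) (x : Lk) : Lk := if i then 0 else x.
Fact extf_hcomp_linear i : linear (extf_hcomp i).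
Proof. by case: i => c x y //=; rewrite /extf_hcomp scaler0 addr0. Qed.
Fact extf_hcomp_hcomp i j v : extf_hcomp i (extf_hcomp j v) = if i == j then extf_hcomp j v else 0.
Proof. by case: i; case: j. Qed.
Fact extf_hcomp_sum v : extf_hcomp false v + extf_hcomp true v = v. Proof. exact: addr0. Qed.
HB.instance Definition _ := isSuperSpace.Build K Lk extf_hcomp_linear extf_hcomp_hcomp extf_hcomp_sum.
Fact extf_hcomp1 : hcomp false (1 : Lk) = 1. Proof. by []. Qed.
Fact extf_hcompM i j (a b : Lk) : hcomp (i (+) j) (hcomp i a * hcomp j b) = hcomp i a * hcomp j b.
Proof. by case: i; case: j; rewrite /hcomp /= /extf_hcomp ?mulr0 ?mul0r. Qed.
Fact extf_supercomm i j (a b : Lk) :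
  hcomp i a * hcomp j b = (-1) ^+ (i && j) * (hcomp j b * hcomp i a).
Proof. by case: i; case: j; rewrite /hcomp /= /extf_hcomp ?mulr0 ?mul0r ?mulr0 // mul1r mulrC. Qed.
HB.instance Definition _ := isSuperComAlgebra.Build K Lk extf_hcomp1 extf_hcompM extf_supercomm.
End ExtField.

(** L \ot_K A, with L viewed as the purely even K-superalgebra [extf]. A fresh name carries the
    L-structure, apart from the K-structure of the tensor product. *)
Definition bext (K L : fieldType) (iota : {rmorphism K -> L}) (A : supergroupType K) : Type :=
  tens (extf iota) A.

Section BaseExt.
Variables (K L : fieldType) (iota : {rmorphism K -> L}) (A : supergroupType K).
Notation Lk := (extf iota).
Notation B := (bext iota A).
Notation T := (tens Lk A).

HB.instance Definition _ := GRing.NzRing.copy B T.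
Definition bsc (c : L) (x : B) : B := ((c : Lk) \ot (1 : A) : T) * (x : T).
Fact bsc_A c d w : bsc c (bsc d w) = bsc (c * d) w.
Proof. by rewrite /bsc mulrA tensMl1. Qed.
Fact bsc_1 : left_id 1 bsc. Proof. by move=> x; rewrite /bsc -tens_one mul1r. Qed.
Fact bsc_Dr : right_distributive bsc +%R. Proof. by move=> c x y; exact: mulrDr. Qed.
Fact bsc_Dl w : {morph bsc^~ w : c d / c + d}.
Proof. by move=> c d; rewrite /bsc pureDl; exact: mulrDl. Qed.
HB.instance Definition _ := GRing.Zmodule_isLmodule.Build L B bsc_A bsc_1 bsc_Dr bsc_Dl.
Fact bsc_Al c (x y : B) : c *: (x * y) = (c *: x) * y. Proof. exact: mulrA. Qed.
HB.instance Definition _ := GRing.Lmodule_isLalgebra.Build L B bsc_Al.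
Lemma c1_even (c : Lk) : homog false (c \ot (1 : A) : T).
Proof. by apply: (homog_pure (i := false) (j := false)); [|exact: homog1]. Qed.
Fact bsc_Ar c (x y : B) : c *: (x * y) = x * (c *: y).
Proof.
change (((c : Lk) \ot (1 : A)) * ((x : T) * (y : T)) = (x : T) * (((c : Lk) \ot (1 : A)) * (y : T))).
by rewrite mulrA (evenC _ (c1_even c)) mulrA.
Qed.
HB.instance Definition _ := GRing.Lalgebra_isAlgebra.Build L B bsc_Ar.
Definition bhcomp (i : bool) (x : B) : B := hcomp i (x : T).
Fact bhcomp_linear i : linear (bhcomp i).
Proof.
move=> c x y; rewrite /bhcomp [LHS](hcompD (V := T)); congr (_ + _).
exact: (hcompMl i _ (c1_even c)).
Qed.
Fact bhcomp_hcomp i j v : bhcomp i (bhcomp j v) = if i == j then bhcomp j v else 0.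
Proof. exact: (hcomp_hcomp (s := T)). Qed.
Fact bhcomp_sum v : bhcomp false v + bhcomp true v = v.
Proof. exact: (hcomp_sum (s := T)). Qed.
HB.instance Definition _ := isSuperSpace.Build L B bhcomp_linear bhcomp_hcomp bhcomp_sum.
Fact bhcomp1 : hcomp false (1 : B) = 1. Proof. exact: (hcomp1 (s := T)). Qed.
Fact bhcompM i j (a b : B) : hcomp (i (+) j) (hcomp i a * hcomp j b) = hcomp i a * hcomp j b.
Proof. exact: (hcompM (s := T)). Qed.
Fact bsupercomm i j (a b : B) :
  hcomp i a * hcomp j b = (-1) ^+ (i && j) * (hcomp j b * hcomp i a).
Proof. exact: (supercomm (s := T)). Qed.
HB.instance Definition _ := isSuperComAlgebra.Build L B bhcomp1 bhcompM bsupercomm.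

Definition bj (a : A) : B := in2 Lk A a.
Lemma bjD a b : bj (a + b) = bj a + bj b. Proof. exact: pureDr. Qed.
Lemma bjZ c a : bj (c *: a) = iota c *: bj a.
Proof.
rewrite /bj -[RHS]/(((iota c : Lk) \ot (1 : A)) * ((1 : Lk) \ot a)) tensMl1 mulr1.
by rewrite in2E pureZr -pureZl; congr (_ \ot _); exact: mulr1.
Qed.
Lemma bjM a b : bj (a * b) = bj a * bj b. Proof. exact: rmorphM. Qed.
Lemma bj1 : bj 1 = 1. Proof. by []. Qed.
Lemma bj0 : bj 0 = 0. Proof. exact: pure0r. Qed.
Lemma bj_hcomp i a : bj (hcomp i a) = hcomp i (bj a). Proof. exact: (shom_even (in2 Lk A) i a). Qed.
Lemma bjB a b : bj (a - b) = bj a - bj b. Proof. exact: pureBr. Qed.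
HB.instance Definition _ := GRing.isZmodMorphism.Build A B bj bjB.
HB.instance Definition _ := GRing.isMonoidMorphism.Build A B bj (bj1, bjM).

Lemma bext_pure (c : Lk) (a : A) : c \ot a = (c : L) *: bj a :> B.
Proof. by rewrite -[RHS]/(((c : Lk) \ot (1 : A)) * ((1 : Lk) \ot a)) tensMl1 mulr1. Qed.

Lemma bext_ind (P : B -> Prop) : P 0 -> (forall c a x, P x -> P (c *: bj a + x)) -> forall x, P x.
Proof. by move=> P0 PD x; apply: (tens_ind (P := P)) => // u v y Py; rewrite bext_pure; apply: PD. Qed.

Lemma bext_ext (W : lmodType L) (f g : B -> W) : linear f -> linear g ->
  (forall a, f (bj a) = g (bj a)) -> f =1 g.
Proof.
move=> lf lg e; apply: bext_ind => [|c a x IH]; first by rewrite (linear_fun0 lf) (linear_fun0 lg).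
by rewrite lf lg e IH.
Qed.

Definition semilin (W : lmodType L) (f : A -> W) := forall c a b, f (c *: a + b) = iota c *: f a + f b.

Lemma bj_semilin : semilin bj. Proof. by move=> c a b; rewrite bjD bjZ. Qed.

(** The L-linear extension of a semilinear map. The target is viewed over K through [resc], so that
    [tlift] applies. *)
Definition sext (W : lmodType L) (f : A -> W) (x : B) : W :=
  tlift (fun (c : Lk) (a : A) => ((c : L) *: f a : resc iota W)) x.

Section Sext.
Variables (W : lmodType L) (f : A -> W) (hf : semilin f).
Lemma sext_bilin : bilin (fun (c : Lk) (a : A) => ((c : L) *: f a : resc iota W)).
Proof.
split=> [a k c d|c k a b].
  by rewrite [LHS]scalerDl; congr (_ + _); rewrite -[RHS]/(iota k *: (c *: f a)) scalerA.
rewrite hf [LHS]scalerDr; congr (_ + _).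
by rewrite -[RHS]/(iota k *: (c *: f a)) !scalerA mulrC.
Qed.
Lemma sext_j a : sext f (bj a) = f a.
Proof. by rewrite [LHS](tlift_pure _ _ sext_bilin) scale1r. Qed.
Lemma sextD x y : sext f (x + y) = sext f x + sext f y.
Proof. exact: (linearD (mklin (tlift_linear sext_bilin))). Qed.
Lemma sext_linear : linear (sext f).
Proof.
move=> c x y; rewrite sextD; congr (_ + _).
elim/(tens_ind (U := Lk) (V := A)): x => [|d a x IH].
  by rewrite scaler0 [sext f 0](linear_fun0 (tlift_linear sext_bilin)) scaler0.
rewrite scalerDr !sextD IH scalerDr; congr (_ + _).
rewrite -[c *: _]/(((c : Lk) \ot (1 : A)) * (d \ot a)) tensMl1.
have p (k : Lk) (b : A) : sext f (k \ot b) = (k : L) *: f b by exact: (tlift_pure _ _ sext_bilin).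
by rewrite !p scalerA.
Qed.
End Sext.

(** The canonical map from A \ot_K A to B \ot_L B, which transports the comultiplication. *)
Definition jj (y : tens A A) : tens B B :=
  tlift (fun u v => (bj u \ot bj v : resc iota (tens B B))) y.
Lemma jj_bilin : bilin (fun u v => (bj u \ot bj v : resc iota (tens B B))).
Proof.
split=> [v c u u'|u c v v']; rewrite bj_semilin.
  by rewrite [LHS]pureDl; congr (_ + _); exact: pureZl.
by rewrite [LHS]pureDr; congr (_ + _); exact: pureZr.
Qed.
Lemma jjD x y : jj (x + y) = jj x + jj y.
Proof. exact: (linearD (mklin (tlift_linear jj_bilin))). Qed.
Lemma jjZ c x : jj (c *: x) = iota c *: jj x.
Proof. exact: (scalable_linear (tlift_linear jj_bilin)). Qed.
Lemma jj_pure u v : jj (u \ot v) = bj u \ot bj v.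
Proof. exact: (tlift_pure _ _ jj_bilin). Qed.
Lemma jj0 : jj 0 = 0. Proof. exact: (linear_fun0 (tlift_linear jj_bilin)). Qed.

Lemma jj_hcomp i y : jj (hcomp i y) = hcomp i (jj y).
Proof.
elim/tens_ind: y => [|u v y IH]; first by rewrite !(linear0, jj0).
rewrite hcompD !jjD hcompD IH; congr (_ + _).
by rewrite hcomp_pure jjD !jj_pure hcomp_pure !bj_hcomp.
Qed.

Lemma jjM x y : jj (x * y) = jj x * jj y.
Proof.
elim/tens_hind: x => [|i j u v x hu hv IH]; first by rewrite mul0r jj0 mul0r.
rewrite mulrDl !jjD mulrDl IH; congr (_ + _).
elim/tens_hind: y {IH} => [|k l u' v' y hu' hv' IHy]; first by rewrite mulr0 jj0 mulr0.
rewrite mulrDr !jjD mulrDr IHy; congr (_ + _).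
have hb b m : homog b m -> homog b (bj m) by move=> e; rewrite /homog -bj_hcomp e.
rewrite (tensM_hom _ _ hv hu') jjZ !jj_pure (tensM_hom _ _ (hb _ _ hv) (hb _ _ hu')) !bjM.
by rewrite rmorphXn rmorphN1.
Qed.

Lemma jj_tlift (W : lmodType L) (b : B -> B -> W) y : bilin b ->
  tlift b (jj y) = tlift (fun u v => (b (bj u) (bj v) : resc iota W)) y.
Proof.
move=> bb; have bb' : bilin (fun u v => (b (bj u) (bj v) : resc iota W)).
  split=> [v c u u'|u c v v']; rewrite bj_semilin; first exact: bb.1.
  exact: bb.2.
elim/tens_ind: y => [|u v y IH].
  by rewrite jj0 (linear_fun0 (tlift_linear bb)) (linear_fun0 (tlift_linear bb')).
rewrite jjD [LHS](linearD (mklin (tlift_linear bb))) [RHS](linearD (mklin (tlift_linear bb'))).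
congr (_ + _); last exact: IH.
by rewrite jj_pure [LHS](tlift_pure _ _ bb) [RHS](tlift_pure _ _ bb').
Qed.

Lemma jjc_semilin : semilin (fun a => jj (comul a)).
Proof. by move=> c a b; rewrite comul_linear jjD jjZ. Qed.
Lemma ic_semilin : @semilin L^o (fun a => iota (counit a)).
Proof. by move=> c a b; rewrite counit_linear rmorphD rmorphM. Qed.
Lemma ja_semilin : semilin (fun a => bj (antipode a)).
Proof. by move=> c a b; rewrite antipode_linear bj_semilin. Qed.

Definition bcomul : B -> tens B B := sext (fun a => jj (comul a)).
Definition bcounit : B -> L := @sext L^o (fun a => iota (counit a)).
Definition bantipode : B -> B := sext (fun a => bj (antipode a)).
Fact bcomul_linear : linear bcomul. Proof. exact: sext_linear jjc_semilin. Qed.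
Fact bcounit_linear : scalar bcounit. Proof. exact: (sext_linear ic_semilin). Qed.
Fact bantipode_linear : linear bantipode. Proof. exact: sext_linear ja_semilin. Qed.
Lemma bcomulE a : bcomul (bj a) = jj (comul a). Proof. exact: (sext_j jjc_semilin). Qed.
Lemma bcounitE a : bcounit (bj a) = iota (counit a). Proof. exact: (sext_j ic_semilin). Qed.
Lemma bantipodeE a : bantipode (bj a) = bj (antipode a). Proof. exact: (sext_j ja_semilin). Qed.
Let cl' : {linear B -> tens B B} := mklin bcomul_linear.
Let cu' : {scalar B} := mkscal bcounit_linear.
Let an' : {linear B -> B} := mklin bantipode_linear.
Let hl i : {linear B -> B} := hcomp i.
Let hl2 i : {linear tens B B -> tens B B} := hcomp i.

Fact bcomul_even i (a : B) : bcomul (hcomp i a) = hcomp i (bcomul a).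
Proof.
apply: (@bext_ext _ (cl' \o hl i) (hl2 i \o cl')) => [||b]; [exact: linearP|exact: linearP|].
by rewrite /= -bj_hcomp !bcomulE comul_even jj_hcomp.
Qed.
Fact bcounit_even (a : B) : bcounit (hcomp true a) = 0.
Proof.
elim/bext_ind: a => [|c a x IH]; first by rewrite linear0 [LHS](linear0 cu').
rewrite hcompD hcompZ bcounit_linear IH addr0 -bj_hcomp bcounitE counit_even rmorph0 mulr0 //.
Qed.
Fact bantipode_even i (a : B) : bantipode (hcomp i a) = hcomp i (bantipode a).
Proof.
apply: (@bext_ext _ (an' \o hl i) (hl i \o an')) => [||b]; [exact: linearP|exact: linearP|].
by rewrite /= -bj_hcomp !bantipodeE antipode_even bj_hcomp.
Qed.
Fact bcomul1 : bcomul 1 = 1 \ot 1.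
Proof. by rewrite -bj1 bcomulE comul1 jj_pure. Qed.
Fact bcomulM (a b : B) : bcomul (a * b) = tmul (bcomul a) (bcomul b).
Proof.
rewrite tmulE; elim/bext_ind: a => [|c a x IH]; first by rewrite mul0r [bcomul 0](linear0 cl') mul0r.
rewrite mulrDl -scalerAl !bcomul_linear IH mulrDl -scalerAl; congr (_ *: _ + _).
elim/bext_ind: b {IH} => [|d b y IH]; first by rewrite mulr0 [bcomul 0](linear0 cl') mulr0.
rewrite mulrDr -scalerAr !bcomul_linear IH mulrDr -scalerAr; congr (_ *: _ + _).
by rewrite -bjM !bcomulE comulM tmulE jjM.
Qed.
Fact bcounit1 : bcounit 1 = 1. Proof. by rewrite -bj1 bcounitE counit1 rmorph1. Qed.
Fact bcounitM (a b : B) : bcounit (a * b) = bcounit a * bcounit b.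
Proof.
elim/bext_ind: a => [|c a x IH]; first by rewrite mul0r [bcounit 0](linear0 cu') mul0r.
rewrite mulrDl -scalerAl !bcounit_linear IH mulrDl -mulrA; congr (_ * _ + _).
elim/bext_ind: b {IH} => [|d b y IH]; first by rewrite mulr0 [bcounit 0](linear0 cu') mulr0.
rewrite mulrDr -scalerAr !bcounit_linear IH mulrDr mulrCA; congr (_ * _ + _).
by rewrite -bjM !bcounitE counitM rmorphM.
Qed.

Definition j3 (y : tens A (tens A A)) : tens B (tens B B) :=
  tlift (fun u w => (bj u \ot jj w : resc iota (tens B (tens B B)))) y.
Lemma j3_bilin : bilin (fun u w => (bj u \ot jj w : resc iota (tens B (tens B B)))).
Proof.
split=> [v c u u'|u c v v']; rewrite ?bj_semilin ?jjD ?jjZ.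
  by rewrite [LHS]pureDl; congr (_ + _); exact: pureZl.
by rewrite [LHS]pureDr; congr (_ + _); exact: pureZr.
Qed.
Let j3l : {linear tens A (tens A A) -> resc iota (tens B (tens B B))} := mklin (tlift_linear j3_bilin).

Fact bcomulA a :
  tlift (fun x c => tlift (fun u v => u \ot (v \ot c)) (bcomul x)) (bcomul a)
  = tlift (fun x y => x \ot bcomul y) (bcomul a).
Proof.
have bl : bilin (fun (x c : B) => tlift (fun u v => u \ot (v \ot c)) (cl' x)) by exact: coassl_bilin.
have br : bilin (fun (x y : B) => x \ot cl' y) by exact: coassr_bilin.
apply: (@bext_ext _ (mklin (tlift_linear bl) \o cl') (mklin (tlift_linear br) \o cl')) => [||b].
- exact: linearP.
- exact: linearP.
rewrite -[LHS]/(tlift _ (bcomul (bj b))) -[RHS]/(tlift _ (bcomul (bj b))) bcomulE !jj_tlift //.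
transitivity (j3l (tlift (fun x c => tlift (fun u v => u \ot (v \ot c)) (comul x)) (comul b))).
  rewrite (tlift_comp j3l); apply: (@eq_tlift K A A (resc iota _)) => x c.
  rewrite -[LHS]/(tlift (fun u v => u \ot (v \ot bj c)) (bcomul (bj x))) bcomulE jj_tlift; last exact: pure3_bilin.
  rewrite (tlift_comp j3l); apply: (@eq_tlift K A A (resc iota _)) => u v.
  by rewrite [RHS](tlift_pure _ _ j3_bilin) jj_pure.
rewrite comulA (tlift_comp j3l); apply: (@eq_tlift K A A (resc iota _)) => x y.
by rewrite [LHS](tlift_pure _ _ j3_bilin) -[RHS]/(bj x \ot bcomul (bj y)) bcomulE.
Qed.

Let jl : {linear A -> resc iota B} := @mklin K A (resc iota B) bj bj_semilin.

Fact bcounitl a : tlift (fun x y => bcounit x *: y) (bcomul a) = a.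
Proof.
have bl : bilin (fun (x y : B) => cu' x *: y) by exact: scale_bilinl.
apply: (@bext_ext _ (mklin (tlift_linear bl) \o cl') idfun) => [||b]; [exact: linearP|by []|].
rewrite -[LHS]/(tlift _ (bcomul (bj b))) bcomulE jj_tlift //.
transitivity (jl (tlift (fun x y => counit x *: y) (comul b))); last by rewrite counitl.
rewrite (tlift_comp jl).
by apply: (@eq_tlift K A A (resc iota _)) => u v; rewrite -[cu' _]/(bcounit (bj u)) bcounitE linearZ_LR.
Qed.
Fact bcounitr a : tlift (fun x y => bcounit y *: x) (bcomul a) = a.
Proof.
have bl : bilin (fun (x y : B) => cu' y *: x) by exact: cr_bilin.
apply: (@bext_ext _ (mklin (tlift_linear bl) \o cl') idfun) => [||b]; [exact: linearP|by []|].
rewrite -[LHS]/(tlift _ (bcomul (bj b))) bcomulE jj_tlift //.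
transitivity (jl (tlift (fun x y => counit y *: x) (comul b))); last by rewrite counitr.
rewrite (tlift_comp jl).
by apply: (@eq_tlift K A A (resc iota _)) => u v; rewrite -[cu' _]/(bcounit (bj v)) bcounitE linearZ_LR.
Qed.
Lemma unit_linear : linear (fun x : B => cu' x *: (1 : B)).
Proof. by move=> c x y; rewrite linearP scalerDl scalerA. Qed.
Fact bantipodel a : tlift (fun x y => bantipode x * y) (bcomul a) = bcounit a *: 1.
Proof.
have bl : bilin (fun (x y : B) => an' x * y) by exact: (mul_bilin an' idfun).
apply: (@bext_ext _ (mklin (tlift_linear bl) \o cl') (fun x => cu' x *: 1)) => [||b]; [exact: linearP|exact: unit_linear|].
rewrite -[LHS]/(tlift _ (bcomul (bj b))) bcomulE jj_tlift // -[cu' _]/(bcounit (bj b)) bcounitE -bj1 -bjZ.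
rewrite -antipodel -[RHS]/(jl (tlift _ _)) (tlift_comp jl).
by apply: (@eq_tlift K A A (resc iota _)) => u v; rewrite -[an' _]/(bantipode (bj u)) bantipodeE -bjM.
Qed.
Fact bantipoder a : tlift (fun x y => x * bantipode y) (bcomul a) = bcounit a *: 1.
Proof.
have bl : bilin (fun (x y : B) => x * an' y) by exact: (mul_bilin idfun an').
apply: (@bext_ext _ (mklin (tlift_linear bl) \o cl') (fun x => cu' x *: 1)) => [||b]; [exact: linearP|exact: unit_linear|].
rewrite -[LHS]/(tlift _ (bcomul (bj b))) bcomulE jj_tlift // -[cu' _]/(bcounit (bj b)) bcounitE -bj1 -bjZ.
rewrite -antipoder -[RHS]/(jl (tlift _ _)) (tlift_comp jl).
by apply: (@eq_tlift K A A (resc iota _)) => u v; rewrite -[an' _]/(bantipode (bj v)) bantipodeE -bjM.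
Qed.
HB.instance Definition _ := isSuperHopf.Build L B bcomul_linear bcounit_linear
  bantipode_linear bcomul_even bcounit_even bantipode_even bcomul1 bcomulM
  bcounit1 bcounitM bcomulA bcounitl bcounitr bantipodel bantipoder.

Lemma comul_bj a : comul (bj a) = jj (comul a) :> tens B B. Proof. exact: bcomulE. Qed.
Lemma counit_bj a : counit (bj a) = iota (counit a). Proof. exact: bcounitE. Qed.

Theorem bext_base : base_extension iota (bj : {rmorphism A -> B}).
Proof.
split.
- by move=> c a; exact: bjZ.
- exact: bj_hcomp.
- by move=> a; rewrite [LHS]comul_bj.
- exact: counit_bj.
move=> W f hf; have hf' : semilin f by [].
exists (mklin (sext_linear hf')) => [a|h' e]; first exact: (sext_j hf').
by apply: bext_ext => [||a]; [exact: linearP|exact: linearP|rewrite e [RHS](sext_j hf')].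
Qed.
End BaseExt.

Lemma eq_cr (K : fieldType) (U V : lmodType K) (f g : V -> K) (x : tens U V) :
  f =1 g -> cr f x = cr g x.
Proof. by move=> e; apply: eq_tlift => u v; rewrite e. Qed.

Lemma crB (K : fieldType) (U V : lmodType K) (f : {scalar V}) (x y : tens U V) :
  cr f (x - y) = cr f x - cr f y.
Proof. exact: linearB. Qed.

(** * Eigenvectors, and Jordan decomposition of functions on commutative groups *)

Section Eigen.
Variables (L : fieldType) (hL : GRing.closed_field_axiom L) (V : lmodType L).
Variables (T : {linear V -> V}) (X : V -> Prop) (sX : subspace X) (s : V) (vs : seq V).
Hypothesis hs : ~ X s.
Hypothesis hv : forall i, spn (fun x => x = 0) vs (iter i T s).

(** The vector p(T) s. *)
Definition act (p : {poly L}) := \sum_(i < size p) p`_i *: iter i T s.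

Lemma actE (p : {poly L}) n : (size p <= n)%N -> act p = \sum_(i < n) p`_i *: iter i T s.
Proof.
move=> pn; rewrite /act (big_ord_widen n (fun i => p`_i *: iter i T s) pn) big_mkcond /=.
apply: eq_bigr => i _; case: ltnP => // h.
by rewrite nth_default // scale0r.
Qed.

Lemma act_factor (q : {poly L}) c : act (q * ('X - c%:P)) = T (act q) - c *: act q.
Proof.
have hn : (size (q * ('X - c%:P))%R <= (size q).+1)%N.
  by apply: leq_trans (size_polyMleq _ _) _; rewrite size_XsubC addn2.
rewrite (actE hn) (actE (leqnSn (size q))).
transitivity (\sum_(i < (size q).+1) (q * 'X)`_i *: iter i T s - c *: \sum_(i < (size q).+1) q`_i *: iter i T s).
  rewrite scaler_sumr -sumrB; apply: eq_bigr => i _.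
  by rewrite scalerA -scalerBl mulrBr coefB [in X in _ - X]mulrC coefCM.
congr (_ - _); rewrite big_ord_recl coefMX /= scale0r add0r big_ord_recr /= nth_default // scale0r addr0.
by rewrite linear_sum; apply: eq_bigr => i _; rewrite coefMX /= linearZ_LR.
Qed.

(** The n + 1 first iterates lie in the span of n vectors, so their coordinate matrix has a nonzero
    left kernel. *)
Lemma act_dep : exists2 p : {poly L}, p != 0 & act p = 0.
Proof.
pose n := size vs.
have hc i : exists c : nat -> L, iter i T s = \sum_(j < n) c j *: vs`_j.
  by have [p [c [-> ->]]] := hv i; exists c; rewrite add0r.
have [c hc'] := choice hc.
pose M : 'M[L]_(n.+1, n) := \matrix_(i, j) c i j.
have : kermx M != 0 by rewrite kermx_eq0 /row_free ltn_eqF // ltnS rank_leq_col.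
case/rowV0Pn => u /sub_kermxP uM u0.
pose p := \poly_(i < n.+1) u 0 (inord i).
exists p.
  apply: contraNneq u0 => p0; apply/eqP/rowP => i; rewrite mxE.
  have := congr1 (fun q : {poly L} => q`_i) p0; rewrite coef_poly ltn_ord coef0.
  by rewrite inord_val.
rewrite (actE (size_poly _ _)).
transitivity (\sum_(i < n.+1) \sum_(j < n) (u 0 i * M i j) *: vs`_j).
  apply: eq_bigr => i _; rewrite coef_poly ltn_ord inord_val hc' scaler_sumr.
  by apply: eq_bigr => j _; rewrite scalerA mxE.
rewrite exchange_big big1 // => j _; rewrite -scaler_suml.
have := congr1 (fun A : 'rV_n => A 0 j) uM; rewrite !mxE => ->.
by rewrite scale0r.
Qed.

Lemma poly_root (p : {poly L}) : (1 < size p)%N -> exists c, root p c.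
Proof.
move=> sp; pose n := (size p).-1; have n0 : (0 < n)%N by rewrite /n; case: (size p) sp => [|[]].
have sE : size p = n.+1 by rewrite /n prednK // (ltn_trans _ sp).
have l0 : p`_n != 0 by rewrite /n -lead_coefE lead_coef_eq0 -size_poly_gt0 (ltn_trans _ sp).
have [x e] := hL (fun i => - (p`_i / p`_n)) n0.
exists x; rewrite /root horner_coef sE big_ord_recr /= e mulr_sumr -big_split big1 //= => i _.
by rewrite !mulrA mulrN mulrCA divff // mulr1 mulNr subrr.
Qed.

(** Take p nonzero of least size with p(T) s in [X]. It has a root c, and for p = q (X - c) the
    vector q(T) s lies outside [X] and is an eigenvector modulo [X]. *)
Lemma eigen_mod : exists c w, [/\ exists p, w = act p, ~ X w & X (T w - c *: w)].
Proof.
pose N n := exists p : {poly L}, [/\ size p = n, p != 0 & X (act p)].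
have exN : exists n, `[< N n >].
  have [p p0 e] := act_dep; exists (size p); apply/asboolP; exists p; split=> //.
  by rewrite e; exact: sX.1.
have [n /asboolP[p [es p0 Xp]] nmin] := ex_minnP exN.
have sp : (1 < size p)%N.
  rewrite ltnNge; apply/negP => sp1; apply: hs.
  have : size p == 1%N by rewrite eqn_leq sp1 lt0n size_poly_eq0.
  case/size_poly1P => c c0 pc; move: Xp; rewrite pc /act size_polyC c0 big_ord1 coefC /=.
  by move=> /(subspaceZ c^-1 sX); rewrite scalerA mulVf // scale1r.
have [c /factor_theorem [q pq]] := poly_root sp.
have q0 : q != 0 by apply: contraNneq p0 => q0; rewrite pq q0 mul0r.
exists c, (act q); split; [by exists q| |by rewrite -act_factor -pq].
move=> Xq; have : (n <= size q)%N by apply: nmin; apply/asboolP; exists q.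
by rewrite -es pq size_Mmonic ?monicXsubC // size_XsubC addn2 /= ltnn.
Qed.
End Eigen.

Section Decomp.
Variables (L : fieldType) (hL : GRing.closed_field_axiom L) (H : supergroupType L).
Hypothesis evH : purely_even H.
Hypothesis cocom : forall (f : {scalar H}) a, cl f (comul a) = cr f (comul a).
Implicit Types (f : {scalar H}) (g b x : H).
Notation Rt f x := (cr f (comul x)).

Lemma even_id (a : H) : hcomp false a = a.
Proof. by rewrite -[RHS]hcomp_sum evH addr0. Qed.

Lemma Rt_comm f f' x : Rt f (Rt f' x) = Rt f' (Rt f x).
Proof.
rewrite !cr_cr; apply: eq_cr => y; rewrite cfunE'.
by rewrite -[RHS]/(f (cl f' (comul y))) cocom.
Qed.

Lemma RtB f x y : Rt f (x - y) = Rt f x - Rt f y.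
Proof. exact: (linearB (cr f \o comul : {linear H -> H})). Qed.

Lemma Rt_grouplike f g b : grouplike g -> Rt f (g * b) = g * cr (mulsc f g) (comul b).
Proof.
move=> [eg _]; rewrite comulM tmulE eg.
elim/tens_ind: (comul b) => [|u v y IH]; first by rewrite mulr0 ![cr _ 0]linear0 mulr0.
rewrite mulrDr !crD mulrDr IH; congr (_ + _).
have hg : homog false g by exact: even_id.
rewrite (tensM_hom _ _ hg (even_id u : homog false u)) expr0 scale1r !cr_pure.
by rewrite scalerAr.
Qed.

Lemma grouplike1 : grouplike (1 : H).
Proof. by split; [exact: comul1|exact: counit1]. Qed.
Lemma grouplikeV g : grouplike g -> antipode g * g = 1 /\ g * antipode g = 1.
Proof.
move=> [eg e1].
have := antipodel g; have := antipoder g; rewrite eg e1 scale1r.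
rewrite (tlift_pure _ _ (mul_bilin idfun (mklin antipode_linear : {linear H -> H}))) => ->.
by rewrite (tlift_pure _ _ (mul_bilin (mklin antipode_linear : {linear H -> H}) idfun)) => ->.
Qed.
Lemma grouplikeM g g' : grouplike g -> grouplike g' -> grouplike (g * g').
Proof.
move=> [eg e1] [eg' e1']; split; last by rewrite counitM e1 e1' mulr1.
have hg : homog false g by exact: even_id.
rewrite comulM tmulE eg eg' (tensM_hom _ _ hg (even_id g' : homog false g')).
by rewrite expr0 scale1r.
Qed.
Lemma grouplike_antipode g : grouplike g -> grouplike (antipode g).
Proof.
move=> hg; have [v1 v2] := grouplikeV hg; case: hg => eg e1; split; last first.
  by have := congr1 counit v1; rewrite counitM e1 mulr1 counit1.
have u1 : comul (antipode g) * comul g = 1 by rewrite -tmulE -comulM v1 comul1.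
have h (a : H) : homog false a := even_id a.
have u2 : (g \ot g) * (antipode g \ot antipode g) = 1.
  by rewrite (tensM_hom _ _ (h _) (h _)) expr0 scale1r v2.
by rewrite -[LHS]mulr1 -u2 mulrA -eg u1 mul1r.
Qed.

(** Sums of products of a grouplike element from [gs] with a conilpotent one: functions on a product
    of a diagonalizable and a unipotent group. *)
Definition gspan (gs : seq H) x := exists s : seq (H * H),
  (forall p, p \in s -> p.1 \in gs /\ conil p.2) /\ x = \sum_(p <- s) p.1 * p.2.

Lemma gspan_sub gs : subspace (gspan gs).
Proof.
split; first by exists [::]; rewrite big_nil.
move=> c x y [s [sP ->]] [t [tP ->]].
exists ([seq (p.1, c *: p.2) | p <- s] ++ t); split.
  move=> p; rewrite mem_cat => /orP[/mapP[q /sP [? ?] ->]|/tP //].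
  by split=> //; apply: (subspaceZ _ (conil_sub H)).
rewrite big_cat big_map scaler_sumr; congr (_ + _); apply: eq_bigr => p _ /=.
by rewrite scalerAr.
Qed.
Lemma gspan1 gs g b : g \in gs -> conil b -> gspan gs (g * b).
Proof. by move=> hg hb; exists [:: (g, b)]; rewrite big_seq1; split=> // p; rewrite inE => /eqP ->. Qed.
Lemma gspan_Rt gs f x : (forall g, g \in gs -> grouplike g) -> gspan gs x -> gspan gs (Rt f x).
Proof.
move=> hg [s [sP ->]]; rewrite linear_sum linear_sum.
apply: (subspace_sum_seq (gspan_sub gs)) => p /sP [pg pb].
rewrite [X in gspan _ X](_ : _ = Rt f (p.1 * p.2)) // (Rt_grouplike _ _ (hg _ pg)).
by apply: gspan1 => //; exact: conil_cr.
Qed.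
Lemma gspan_le gs gs' x : {subset gs <= gs'} -> gspan gs x -> gspan gs' x.
Proof. by move=> h [s [sP ->]]; exists s; split=> // p /sP [/h]. Qed.
Lemma gspan_cons g gs x : gspan (g :: gs) x -> exists b r, [/\ conil b, gspan gs r & x = g * b + r].
Proof.
move=> [s [sP ->]]; elim: s sP => [|p s IH] sP.
  by exists 0, 0; rewrite big_nil mulr0 addr0; split=> //; [exact: (conil_sub H).1|exact: (gspan_sub gs).1].
have [|b [r [hb hr e]]] := IH; first by move=> q qs; apply: sP; rewrite inE qs orbT.
rewrite big_cons e; have [] := sP p (mem_head _ _); rewrite inE => /orP[/eqP pg|pg] pb.
  exists (p.2 + b), r; split=> //; first exact: (subspaceD (conil_sub H)).
  by rewrite pg mulrDr addrA.
exists b, (p.1 * p.2 + r); split=> //; last by rewrite addrCA.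
by apply: (subspaceD (gspan_sub gs)) => //; exact: gspan1.
Qed.

Section Inv.
Variables (f0 : {scalar H}) (g : H) (hg : grouplike g) (fg : f0 g = 1).

(** As f0(g) = 1, contraction by [f0] acts on g b as the identity plus a map that lowers the stage
    of b. Hence it is invertible there ([Rt_inv]) and reflects membership in stable subspaces
    ([Rt_mem]). *)
Lemma Rt_unip n b : cW n.+1 b -> exists2 b1, cW n b1 & Rt f0 (g * b) = g * b + g * b1.
Proof.
move=> hb; exists (cr (fsub (mulsc f0 g)) (comul b)); first by apply: hb; exact: fsub1.
rewrite Rt_grouplike // -mulrDr cr_fsub [mulsc f0 g 1]/= mulr1 fg scale1r.
by rewrite -[cr counit _]/(tlift _ _) counitr addrC subrK.
Qed.

Lemma Rt_inv n b : cW n b -> exists2 b', conil b' & Rt f0 (g * b') = g * b.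
Proof.
elim: n b => [|n IH] b hb.
  by exists 0; [exact: (conil_sub H).1|rewrite hb mulr0 [comul 0]linear0 [LHS]linear0].
have [b1 hb1 e] := Rt_unip hb; have [b' cb' e'] := IH _ hb1.
exists (b - b'); first by apply: (subspaceB (conil_sub H)) => //; exists n.+1.
by rewrite mulrBr RtB e e' addrK.
Qed.

Lemma Rt_mem W n b : subspace W -> (forall f x, W x -> W (Rt f x)) -> cW n b ->
  W (Rt f0 (g * b)) -> W (g * b).
Proof.
move=> sW hW; elim: n b => [|n IH] b hb; first by rewrite hb mulr0 => _; exact: sW.1.
have [b1 hb1 e] := Rt_unip hb => h; have h2 : W (Rt f0 (g * b1)).
  have e2 : g * b1 = Rt f0 (g * b) - g * b by rewrite e addrC addKr.
  by rewrite e2 RtB; apply: subspaceB => //; exact: hW.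
have h3 := IH _ hb1 h2.
have -> : g * b = Rt f0 (g * b) - g * b1 by rewrite e addrK.
exact: subspaceB.
Qed.
End Inv.

Definition decomp x := exists2 gs, (forall g, g \in gs -> grouplike g) & gspan gs x.

Lemma decomp_sub : subspace decomp.
Proof.
split; first by exists [::] => //; exact: (gspan_sub _).1.
move=> c x y [gs hgs hx] [gs' hgs' hy]; exists (gs ++ gs').
  by move=> g; rewrite mem_cat => /orP[/hgs|/hgs'].
apply: (gspan_sub _).2.
  by apply: gspan_le hx => g; rewrite mem_cat => ->.
by apply: gspan_le hy => g; rewrite mem_cat => ->; rewrite orbT.
Qed.
Lemma decomp_Rt f x : decomp x -> decomp (Rt f x).
Proof. by move=> [gs hgs hx]; exists gs => //; exact: gspan_Rt. Qed.
Lemma decompM g x : grouplike g -> decomp x -> decomp (g * x).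
Proof.
move=> hg [gs hgs [s [sP ->]]]; exists [seq g * g' | g' <- gs].
  by move=> _ /mapP[g' /hgs ? ->]; exact: grouplikeM.
rewrite mulr_sumr; apply: (subspace_sum_seq (gspan_sub _)) => p /sP [pg pb].
by rewrite mulrA; apply: gspan1 => //; exact: map_f.
Qed.

(** Separation of generalized eigenspaces. For g other than 1 choose [f0] with f0(1) = 0 and f0(g) =
    1; subtracting a suitable g b' removes the g-part from the contraction of x by [f0], and since
    contractions commute, from all of them. This eliminates the list one element at a time. *)
Lemma split_one gs x : (forall g, g \in gs -> grouplike g) ->
  (forall f, f 1 = 0 -> gspan (1 :: gs) (Rt f x)) -> decomp x.
Proof.
elim: gs x => [|g gs IH] x hgs hx.
  have cx : conil x.
    apply: conil_split => f /hx /gspan_cons [b [r [cb [s [sP ->]] ->]]].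
    rewrite mul1r big_seq big1 ?addr0 // => p /sP [].
    by rewrite in_nil.
  exists [:: 1]; first by move=> g; rewrite inE => /eqP ->; exact: grouplike1.
  by rewrite -[x]mul1r; apply: gspan1 => //; exact: mem_head.
have hg : grouplike g by apply: hgs; exact: mem_head.
have hgs' g' : g' \in gs -> grouplike g' by move=> h; apply: hgs; rewrite inE h orbT.
have [g1|g1] := eqVneq g 1.
  apply: IH => // f /hx; apply: gspan_le => g'; rewrite g1 !inE.
  by case: eqP.
have s1 : subspace (fun y : H => exists c, y = c *: 1).
  split; first by exists 0; rewrite scale0r.
  by move=> c _ _ [a ->] [b ->]; exists (c * a + b); rewrite scalerDl scalerA.
have [|f0 [f01 f0g]] := separation (v := g) s1.
  move=> [c e]; have := hg.2; rewrite e scalarZ /= counit1 mulr1 => c1.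
  by move/eqP: g1; apply; rewrite e c1 scale1r.
have f1 : f0 1 = 0 by apply: f01; exists 1; rewrite scale1r.
pose W := gspan (1 :: gs); have sW : subspace W by exact: gspan_sub.
have gW g' : g' \in 1 :: gs -> grouplike g'.
  by rewrite inE => /orP[/eqP ->|/hgs' //]; exact: grouplike1.
have hW f y : W y -> W (Rt f y) by exact: gspan_Rt.
have spl y : gspan [:: 1, g & gs] y -> exists b r, [/\ conil b, W r & y = g * b + r].
  move=> h; apply: gspan_cons; apply: gspan_le h => g'.
  by rewrite !inE orbCA.
have [b [r [[n cb] Wr e]]] := spl _ (hx f0 f1).
have [b' cb' e'] := Rt_inv hg f0g cb.
have dgb : decomp (g * b').
  by exists [:: g]; [move=> g'; rewrite inE => /eqP -> //|apply: gspan1 => //; exact: mem_head].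
suff : decomp (x - g * b') by move=> h; rewrite -(subrK (g * b') x); exact: (subspaceD decomp_sub).
have Tx : Rt f0 (x - g * b') = r by rewrite RtB e e' addrC addKr.
apply: IH => // f ff.
have [|u [r' [[m cu] Wr' eu]]] := spl (Rt f (x - g * b')).
  rewrite RtB; apply: (subspaceB (gspan_sub _)); first exact: hx.
  apply: gspan_Rt; first by move=> g'; rewrite inE => /orP[/eqP ->|/hgs //]; exact: grouplike1.
  by apply: gspan1 => //; rewrite !inE eqxx orbT.
rewrite eu; apply: (subspaceD sW) => //; apply: (Rt_mem hg f0g sW hW cu).
have -> : g * u = Rt f (x - g * b') - r' by rewrite eu addrK.
by rewrite (RtB f0); apply: (subspaceB sW); [rewrite Rt_comm Tx; exact: hW|exact: hW].
Qed.

(** Otherwise take a minimal subcomodule [S] outside the decomposable functions. Contractions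
    commute and have eigenvectors, so modulo [decomp] they act on [S] by scalars; these scalars come
    from a grouplike g. After division by g, contractions vanishing at 1 land in [decomp], and
    [split_one] gives a contradiction. *)
Theorem grouplike_decomp x : decomp x.
Proof.
apply: contrapT => nx; have sX := decomp_sub.
have [vs [S [cS Sv [s0 S0 ns0] Smin]]] := min_subcomod_ex sX nx.
have [sS hS crS] := cS.
(* The vectors on which the contraction acts by an eigenvalue, modulo [decomp], form a subcomodule;
   by minimality it is all of [S]. *)
have schur f : exists c, forall y, S y -> decomp (Rt f y - c *: y).
  pose T : {linear H -> H} := cr f \o comul.
  have ST i : S (iter i T s0) by elim: i => [//|i IH]; exact: crS.
  have [c [w [[p wp] nw Xw]]] := eigen_mod hL sX ns0 (fun i => Sv _ (ST i)).
  have Sw : S w by rewrite wp; apply: subspace_sum => // i _; apply: subspaceZ.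
  exists c; have [||h|h] := Smin (fun y => S y /\ decomp (Rt f y - c *: y)).
  - split.
    + split; first by split; [exact: sS.1|rewrite [comul 0]linear0 [cr _ 0]linear0 scaler0 subrr; exact: sX.1].
      move=> k y y' [Sy hy] [Sy' hy']; split; first exact: sS.2.
      have -> : Rt f (k *: y + y') - c *: (k *: y + y') =
          k *: (Rt f y - c *: y) + (Rt f y' - c *: y').
        by rewrite comul_linear crD crZ !scalerDr scalerN opprD addrACA !scalerA mulrC.
      exact: sX.2.
    + move=> i y [Sy hy]; split; first exact: hS.
      by case: i; [rewrite evH|rewrite even_id] => //; rewrite [comul 0]linear0 [cr _ 0]linear0 scaler0 subrr; exact: sX.1.
    + move=> f' y [Sy hy]; split; first exact: crS.
      have -> : Rt f (Rt f' y) - c *: Rt f' y = Rt f' (Rt f y - c *: y).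
        by rewrite Rt_comm RtB comulZ crZ.
      exact: decomp_Rt.
  - by move=> y [].
  - by case: nw; exact: h.
  - by move=> y /h [].
have [phi [phiX phi1]] := separation sX ns0.
(* The pairing of g with a functional f is the scalar by which f acts; multiplicativity of these
   scalars makes g grouplike. *)
pose g := cl phi (comul s0).
have gE f : f g = phi (Rt f s0) by rewrite (cl_cr phi f).
have key f y : S y -> decomp (Rt f y - f g *: y).
  move=> Sy; have [c hc] := schur f; suff -> : f g = c by exact: hc.
  rewrite gE; have := phiX _ (hc s0 S0); rewrite linearB [phi (_ *: _)]linearZ /= phi1 mulr1.
  by move=> /eqP; rewrite subr_eq0 => /eqP.
have hg : grouplike g.
  split; last by rewrite gE -[cr counit _]/(tlift _ _) counitr.
  apply: tens_crP => f'; rewrite cr_pure; apply: dual_eq => f.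
  rewrite -cfunE' gE -cr_cr [RHS]linearZ /=.
  have := phiX _ (decomp_Rt f (key f' s0 S0)).
  rewrite RtB comulZ crZ linearB [phi (_ *: _)]linearZ /= => /eqP; rewrite subr_eq0 => /eqP ->.
  by rewrite -gE.
apply: ns0; have [v1 v2] := grouplikeV hg.
rewrite -[s0]mul1r -v2 -mulrA; apply: decompM => //.
have hx f : f 1 = 0 -> decomp (Rt f (antipode g * s0)).
  move=> f1; rewrite (Rt_grouplike _ _ (grouplike_antipode hg)); apply: decompM; first exact: grouplike_antipode.
  by have := key (mulsc f (antipode g)) s0 S0; rewrite /= v1 f1 scale0r subr0.
have [t tP e] := al_split (al := comulS H) sX hx (counitr _).
have [gs [hgs tgs]] : exists gs, (forall g, g \in gs -> grouplike g) /\
    forall p, p \in t -> gspan gs p.1.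
  elim: t tP {e} => [|p t IH] tP; first by exists [::].
  have [|gs [hgs h]] := IH; first by move=> q qt; apply: tP; rewrite inE qt orbT.
  have [gs' hgs' h'] := tP p (mem_head _ _); exists (gs' ++ gs); split.
    by move=> g'; rewrite mem_cat => /orP[/hgs'|/hgs].
  move=> q; rewrite inE => /orP[/eqP ->|/h hq].
    by apply: gspan_le h' => g'; rewrite mem_cat => ->.
  by apply: gspan_le hq => g'; rewrite mem_cat => ->; rewrite orbT.
apply: (split_one hgs) => f f1; rewrite -comulSE e crD cr_pure f1 scale0r add0r linear_sum.
apply: (subspace_sum_seq (gspan_sub _)) => p pt; rewrite [X in gspan _ X]cr_pure.
apply: (subspaceZ _ (gspan_sub _)); apply: gspan_le (tgs p pt) => g'.
by rewrite inE => ->; rewrite orbT.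
Qed.
End Decomp.

(** * Groups of multiplicative type; existence of the multiplicative part *)

Section MultConil.
Variables (K L : fieldType) (iota : {rmorphism K -> L}) (D : supergroupType K).

Section Ext.
Variables (B : supergroupType L) (j : {rmorphism D -> B}) (hj : base_extension iota j).

(** A functional with value 1 at a - b extends to an L-linear one by the universal property. *)
Lemma base_inj : injective j.
Proof.
have [jZ _ _ _ jU] := hj; move=> a b e; apply/eqP; rewrite -subr_eq0; apply/negP => /negP ab.
have [phi phi1] := separation0 ab.
have [|h hE _] := jU L^o (fun x => iota (phi x)).
  by move=> c x y; rewrite linearP rmorphD rmorphM.
have := hE (a - b); rewrite phi1 rmorph1 rmorphB e subrr linear0 => /esym/eqP.
by rewrite oner_eq0.
Qed.

Lemma conil_base n (a : D) : cW n a -> cW n (j a).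
Proof.
have [jZ _ jC _ _] := hj.
have jl : forall c x y, j (c *: x + y) = iota c *: j x + j y by move=> c x y; rewrite rmorphD jZ.
have bJ : bilin (fun u v => (j u \ot j v : resc iota (tens B B))).
  split=> [v c u u'|u c v v']; rewrite jl.
    by rewrite [LHS]pureDl; congr (_ + _); exact: pureZl.
  by rewrite [LHS]pureDr; congr (_ + _); exact: pureZr.
pose J : {linear tens D D -> resc iota (tens B B)} := mklin (tlift_linear bJ).
have JE x : comul (j x) = J (comul x) :> tens B B by rewrite jC.
have Jp u v : J (u \ot v) = j u \ot j v by exact: (tlift_pure _ _ bJ).
elim: n a => [|n IH] a ha; first by rewrite /= ha rmorph0.
have [t tP e] := al_split (al := comulS D) (cW_sub D n) ha (counitr a).
move=> f f1; change (cW n (cr f (comul (j a)))).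
have -> : comul (j a) = j a \ot 1 + \sum_(p <- t) j p.1 \ot j p.2 :> tens B B.
  rewrite JE -comulSE e [LHS](linearD J) Jp rmorph1; congr (_ + _).
  by rewrite [LHS](linear_sum J); apply: eq_bigr => p _; exact: Jp.
rewrite crD cr_pure f1 scale0r add0r linear_sum.
apply: (subspace_sum_seq (cW_sub B n)) => p /tP hp; rewrite [X in cW n X]cr_pure.
by apply: (subspaceZ _ (cW_sub B n)); exact: IH.
Qed.

(** Induct on the number of grouplikes in b. Contraction [T] by a functional with f(1) = 0 and f(g)
    = 1 makes T b - b shorter, hence a scalar by induction; so T(T b) = T b. As [T] is nilpotent on
    conilpotent elements, T b = 0 and b is a scalar. *)
Lemma diag_conil (b : B) : conil b -> Defs.diagonalizable B -> exists c, b = c *: 1.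
Proof.
move=> cb /(_ b) [s [sP e]].
elim: (size s) {-2}s (leqnn (size s)) b cb sP e => {s} [|n IHn] [|[c g] s] // ss b cb sP e; try by exists 0; rewrite e big_nil scale0r.
have IH := IHn s ss.
have sP' p : p \in s -> grouplike p.2 by move=> ps; apply: sP; rewrite inE ps orbT.
have [eg g1] : grouplike g := sP _ (mem_head _ _).
move: e; rewrite big_cons /= => e; have [gE|gN] := eqVneq g 1.
  have [||d ed] := IH (b - c *: 1) _ sP'.
  - apply: (subspaceB (conil_sub B)) => //; exists 1%N; exact: cW1.
  - by rewrite e gE addrC addKr.
  by exists (c + d); rewrite scalerDl -ed addrC subrK.
have s1 : subspace (fun y : B => exists c, y = c *: 1).
  split; first by exists 0; rewrite scale0r.
  by move=> k _ _ [x ->] [y ->]; exists (k * x + y); rewrite scalerDl scalerA.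
have [|f [f01 fg]] := separation (v := g) s1.
  move=> [k ek]; move: g1; rewrite ek scalarZ /= counit1 mulr1 => k1.
  by move/eqP: gN; apply; rewrite ek k1 scale1r.
have f1 : f 1 = 0 by apply: f01; exists 1; rewrite scale1r.
pose T : {linear B -> B} := cr f \o comul.
have TD (x y : B) : T (x + y) = T x + T y by exact: linearD.
have TZ (k : L) (x : B) : T (k *: x) = k *: T x by exact: linearZ_LR.
have TS (l : seq (L * B)) : T (\sum_(p <- l) p.1 *: p.2) = \sum_(p <- l) T (p.1 *: p.2) by exact: linear_sum.
have Tg h : grouplike h -> T h = f h *: h by move=> [eh _]; rewrite /T /= eh cr_pure.
have TE : T b - b = \sum_(p <- [seq (p.1 * (f p.2 - 1), p.2) | p <- s]) p.1 *: p.2.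
  rewrite big_map e TD TZ Tg // fg scale1r opprD addrACA subrr add0r.
  rewrite TS -sumrB big_seq [RHS]big_seq; apply: eq_bigr => p ps.
  by rewrite TZ (Tg _ (sP' p ps)) scalerA /= mulrBr mulr1 scalerBl.
have sP2 p : p \in [seq (p.1 * (f p.2 - 1), p.2) | p <- s] -> grouplike p.2.
  by move=> /mapP[q /sP' ? ->].
have sz : (size [seq ((p.1 * (f p.2 - 1))%R, p.2) | p <- s] <= n)%N by rewrite size_map.
have cT : conil (T b - b) by apply: (subspaceB (conil_sub B)) => //; exact: conil_cr.
have [k ek] := IHn _ sz _ cT sP2 TE.
have Tb : T (T b) = T b.
  have {1}-> : T b = b + k *: 1 by rewrite -ek addrC subrK.
  by rewrite TD TZ (Tg 1) ?f1 ?scale0r ?scaler0 ?addr0 //; split; [exact: comul1|exact: counit1].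
have [m hm] : conil (T b) by exact: conil_cr.
have T0 : T b = 0.
  by elim: m hm => [//|m IHm] hm; apply: IHm; rewrite -Tb; exact: hm.
by exists (- k); rewrite scaleNr -ek T0 sub0r opprK.
Qed.
End Ext.

(** After extension of scalars the function is conilpotent on a diagonalizable group, hence a
    scalar. This is the rigidity that turns unipotent actions of such groups into trivial ones. *)
Lemma mult_conil (a : D) : mult_type iota D -> conil a -> a = counit a *: 1.
Proof.
move=> [_ _ [B [j [hj dB]]]] [n ha].
have [|c ec] := diag_conil (b := j a) _ dB; first by exists n; exact: (conil_base hj).
have [jZ _ _ jc _] := hj; apply: (base_inj hj).
rewrite jZ rmorph1 ec; congr (_ *: _).
by have := congr1 counit ec; rewrite jc scalarZ /= counit1 mulr1.
Qed.
End MultConil.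

Section MultPart.
Variables (K L : fieldType) (iota : {rmorphism K -> L}) (hL : algebraic_closure iota).
Variables (H : supergroupType K) (evH : purely_even H) (aH : algebraic H).
Hypothesis comH : forall (R : superAlgType K) (f g : superhom H R), pmul f g = pmul g f.
Notation B := (bext iota H).

Lemma tsw_comul (a : H) : tsw (comul a) = comul a.
Proof.
have : pmul (in2 H H) (in1 H H) = comulS H by rewrite comH comul_pmul.
move/(congr1 (fun h => shom h a)) => e; rewrite -[RHS]e [RHS]pmul_tlift.
apply: eq_tlift => u v; rewrite in1E in2E.
have h (x : H) : homog false x by rewrite /homog -[RHS]hcomp_sum evH addr0.
by rewrite (tensM_hom _ _ (h u) (h v)) expr0 scale1r mul1r mulr1.
Qed.

Lemma bext_even : purely_even B.
Proof.
elim/bext_ind => [|c a x IH]; first by rewrite linear0.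
by rewrite hcompD hcompZ IH addr0 -bj_hcomp evH bj0 scaler0.
Qed.

Lemma tsw_jj y : tsw (jj iota y) = jj iota (tsw y) :> tens B B.
Proof.
elim/(tens_ind (U := H) (V := H)): y => [|u v y IH]; first by rewrite linear0 jj0 linear0.
rewrite (linearD (@tsw K H H)) !jjD [LHS](linearD (@tsw L B B)); congr (_ + _); last exact: IH.
by rewrite jj_pure [LHS]tsw_pure [X in jj _ X]tsw_pure jj_pure.
Qed.

Lemma bext_cocom (f : {scalar B}) (a : B) : cl f (comul a) = cr f (comul a).
Proof.
elim/bext_ind: a => [|c a x IH]; first by rewrite [comul 0]linear0 !linear0.
rewrite comul_linear clD clZ crD crZ IH; congr (_ *: _ + _).
by rewrite comul_bj -cr_tsw tsw_jj tsw_comul.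
Qed.

Definition fext (f : {scalar H}) (x : B) : L := @sext K L iota H L^o (fun a => iota (f a)) x.
Lemma fext_semilin (f : {scalar H}) : @semilin K L iota H L^o (fun a => iota (f a)).
Proof. by move=> c a b; rewrite linearP rmorphD rmorphM. Qed.
Lemma fext_linear (f : {scalar H}) : scalar (fext f).
Proof. exact: (sext_linear (fext_semilin f)). Qed.
Definition fextL f : {scalar B} := mkscal (fext_linear f).
Lemma fext_bj f a : fextL f (bj iota a) = iota (f a).
Proof. exact: (sext_j (fext_semilin f)). Qed.

Lemma cr_fext f y : cr (fextL f) (jj iota y) = bj iota (cr f y).
Proof.
elim/(tens_ind (U := H) (V := H)): y => [|u v y IH]; first by rewrite jj0 !linear0 bj0.
by rewrite jjD !crD bjD IH jj_pure !cr_pure fext_bj bjZ.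
Qed.

(** Contracting the L-leg by a K-linear functional commutes with contractions by functionals
    extended from H. *)
Lemma conil_bext n (x : B) (phi : {scalar extf iota}) : cW n x -> cW n (cl phi x).
Proof.
elim: n x => [|n IH] x hx; first by rewrite hx; exact: (linear0 (cl phi)).
move=> f f1; change (cW n (cr f (comul (cl phi x)))).
have -> : cr f (comul (cl phi x)) = cl phi (cr (fextL f) (comul x)).
  have key (c : L) (a : H) (y : B) : cl phi (c *: bj iota a + y) = phi c *: a + cl phi y.
    by rewrite -bext_pure [LHS](clD phi) cl_pure.
  elim/bext_ind: x {hx} => [|c a x IHx].
    by rewrite [cl phi 0](linear0 (cl phi)) ![comul 0]linear0 [cr f 0]linear0 [cr _ 0]linear0 [RHS](linear0 (cl phi)).
  by rewrite key comul_linear crD crZ IHx comul_linear crD crZ comul_bj cr_fext key.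
by apply: IH; apply: hx; rewrite /= -bj1 [LHS]fext_bj f1 rmorph0.
Qed.

(** F is the kernel of H -> H/F, where H/F has the conilpotent functions as its coordinate algebra
    and is thus unipotent. Over the algebraic closure each function is a sum of products of
    grouplikes with conilpotent functions, and the latter restrict to scalars on F; so F becomes
    diagonalizable. *)
Theorem mult_part_exists : exists F : closedSub H, is_mult_part iota F.
Proof.
pose C := conil_shopf H; pose i := sinc C; have hi : hopf_hom i by exact: sinc_hopf.
have ij : injective i by exact: sinc_inj.
have [F [F0 _]] := ker_sub hi; pose Q := ker_quot hi ij F0.
exists F; split; last first.
  exists Q; apply: conil_unipotent => q.
  have [n hn] : conil (i q) := sincP q; exists n; elim: n q hn => [|n IH] q hn.
    by apply: (ij); rewrite linear0; exact: hn.
  move=> f f1; have [f' ef] := scalar_extend (i := i) f ij.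
  apply: (IH); rewrite (_ : i _ = cr f' (comul (i q))); last first.
    by rewrite hi.1 (cr_tmap _ (h := f') (h' := f)).
  by apply: hn; rewrite -(rmorph1 i) ef.
have pC b : conil b -> cres F b = counit b *: 1.
  move=> cb; apply/eqP; rewrite -subr_eq0.
  have -> : cres F b - counit b *: 1 = cres F (b - counit b *: 1).
    by rewrite [RHS]linearB; congr (_ - _); rewrite [RHS]linearZ rmorph1.
  apply/eqP/F0/idgen_in; have [|q eq] := @sinc_ex _ _ C (b - counit b *: 1).
    apply: (subspaceB (conil_sub H)) => //; apply: (subspaceZ _ (conil_sub H)); exact: conil1.
  exists q; last by rewrite -eq.
  by rewrite -(hi.2 q) [sinc C q]eq linearB scalarZ /= counit1 mulr1 subrr.
split; first exact: purely_even_surj (@cres_surj _ _ F) evH.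
  exact: algebraic_surj (@cres_surj _ _ F) aH.
exists (bext iota F), (@bj K L iota F : {rmorphism F -> bext iota F}); split; first exact: bext_base.
pose p : superhom H F := cres F.
have bps : @semilin K L iota H (bext iota F) (fun a => bj iota (p a)).
  by move=> c a b; rewrite linearP bjD bjZ.
pose bp : {linear B -> bext iota F} := mklin (sext_linear bps).
have bpj a : bp (bj iota a) = bj iota (p a) by exact: (sext_j bps).
have bpL c x y : bp (c *: x + y) = c *: bp x + bp y by exact: linearP.
have bp0 : bp 0 = 0 by exact: linear0.
have bpM x y : bp (x * y) = bp x * bp y.
  elim/bext_ind: x => [|c a x IH]; first by rewrite mul0r bp0 mul0r.
  rewrite mulrDl -scalerAl !bpL IH mulrDl -scalerAl; congr (_ *: _ + _).
  elim/bext_ind: y {IH} => [|d b y IH]; first by rewrite mulr0 bp0 mulr0.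
  rewrite mulrDr -scalerAr !bpL IH mulrDr -scalerAr; congr (_ *: _ + _).
  by rewrite -bjM !bpj -bjM; congr (bj iota _); exact: rmorphM.
have bpcu x : counit (bp x) = counit x.
  elim/bext_ind: x => [|c a x IH]; first by rewrite bp0 !linear0.
  by rewrite bpL !counit_linear IH bpj !counit_bj (cres_hopf F).2.
have bpjj y : tmap bp bp (jj iota y) = jj iota (tmap p p y).
  elim/(tens_ind (U := H) (V := H)): y => [|u v y IH].
    by rewrite jj0 [LHS](linear0 (tmap bp bp)) (linear0 (tmap p p)) jj0.
  rewrite jjD [LHS](linearD (tmap bp bp)) (linearD (tmap p p)) jjD; congr (_ + _); last exact: IH.
  rewrite jj_pure [LHS](tmap_pure bp bp) !bpj -jj_pure; congr (jj iota _).
  exact: (esym (tmap_pure p p u v)).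
have bpco x : comul (bp x) = tmap bp bp (comul x).
  apply: (@bext_ext _ _ _ _ _ (comul \o bp : {linear B -> _}) (tmap bp bp \o comul : {linear B -> _})).
  - exact: linearP.
  - exact: linearP.
  move=> a; rewrite -[LHS]/(comul (bp (bj iota a))) -[RHS]/(tmap bp bp (comul (bj iota a))).
  by rewrite bpj !comul_bj bpjj (cres_hopf F).1.
have bpconil x : conil x -> exists k, bp x = k *: 1.
  move=> [n hx]; have sk : subspace (fun y : bext iota F => exists k, y = k *: 1).
    split; first by exists 0; rewrite scale0r.
    by move=> c _ _ [a ->] [b ->]; exists (c * a + b); rewrite scalerDl scalerA.
  have hphi (phi : {scalar extf iota}) : conil (cl phi x) by exists n; exact: conil_bext.
  have [t tP ->] := tens_memr (conil_sub H) hphi.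
  elim: t tP => [|[c h] t IH] tP; first by exists 0; rewrite big_nil bp0 scale0r.
  have [|k ek] := IH; first by move=> q qt; apply: tP; rewrite inE qt orbT.
  exists ((c : L) * iota (counit h) + k); rewrite big_cons scalerDl -scalerA -ek.
  rewrite [LHS](linearD bp); congr (_ + _).
  transitivity ((c : L) *: bp (bj iota h)); last by rewrite bpj (pC h (tP _ (mem_head _ _))) bjZ.
  by rewrite -[RHS]addr0 -[X in _ + X]bp0 -bpL addr0 -bext_pure.
have bpsurj b : exists x, bp x = b.
  elim/bext_ind: b => [|c f y [x <-]]; first by exists 0.
  by have [a <-] := cres_surj f; exists (c *: bj iota a + x); rewrite bpL bpj.
move=> b; have [x <-] := bpsurj b.
have [gs hgs [s [sP ->]]] := grouplike_decomp hL.1 bext_even bext_cocom x.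
elim: s sP => [|q s IH] sP; first by exists [::]; rewrite !big_nil bp0.
have [|t [tP et]] := IH; first by move=> q' qs; apply: sP; rewrite inE qs orbT.
have [/hgs [g1 g2] /bpconil [k ek]] := sP q (mem_head _ _).
exists ((k, bp q.1) :: t); split.
  move=> q'; rewrite inE => /orP[/eqP -> /=|/tP //].
  by split; [rewrite bpco g1 [LHS](tmap_pure bp bp)|rewrite bpcu].
rewrite !big_cons -et [LHS](linearD bp); congr (_ + _).
by rewrite [LHS]bpM ek -scalerAr mulr1.
Qed.
End MultPart.

(** * From nilpotency to trivial action on the odd tangent space *)

Section FiltCoefGen.
Variables (K : fieldType) (M : lmodType K) (D : supergroupType K) (th : {linear M -> tens M D}).
Hypothesis thA : forall m,
    tlift (fun x c => tlift (fun u v => u \ot (v \ot c)) (th x)) (th m) = tmap id comul (th m).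

(** A functional that vanishes on [P] does not see where the contractions end, so the coefficients
    it defines are conilpotent. *)
Lemma filt_coef_mod (P : M -> Prop) n m (h : {scalar M}) : stab th P -> (forall x, P x -> h x = 0) ->
  filt th P n m -> cW n (cl h (th m)).
Proof.
move=> sP hP; elim: n m => [|n IH] m /= hm.
  by apply: dual_eq => f; rewrite -cl_cr linear0; apply: hP; exact: sP.
move=> f f1; change (cW n (cr f (comul (cl h (th m))))); rewrite (th_cl thA).
by apply: IH; exact: hm.
Qed.
End FiltCoefGen.

Section Square.
Variables (K : fieldType) (G : supergroupType K).

Definition aug2 (x : G) := exists s : seq (G * G),
  (forall p, p \in s -> counit p.1 = 0 /\ counit p.2 = 0) /\ x = \sum_(p <- s) p.1 * p.2.

Lemma aug2_sub : subspace aug2.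
Proof.
split; first by exists [::]; rewrite big_nil.
move=> c x y [s [sP ->]] [t [tP ->]].
exists ([seq (c *: p.1, p.2) | p <- s] ++ t); split.
  move=> p; rewrite mem_cat => /orP[/mapP[q /sP [q1 q2] ->]|/tP //].
  by rewrite /= scalarZ /= q1 mulr0.
rewrite big_cat big_map scaler_sumr; congr (_ + _); apply: eq_bigr => p _ /=.
by rewrite scalerAl.
Qed.
Lemma aug2_in a b : counit a = 0 -> counit b = 0 -> aug2 (a * b).
Proof. by move=> a0 b0; exists [:: (a, b)]; rewrite big_seq1; split=> // p; rewrite inE => /eqP ->. Qed.
Lemma aug2_mul a x : aug2 x -> aug2 (a * x).
Proof.
move=> [s [sP ->]]; rewrite mulr_sumr; apply: (subspace_sum_seq aug2_sub) => p /sP [p1 p2].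
by rewrite mulrA; apply: aug2_in => //; rewrite counitM p1 mulr0.
Qed.
Lemma counit_hcomp0 i (a : G) : counit a = 0 -> counit (hcomp i a) = 0.
Proof. by rewrite counit_hcomp; case: i. Qed.
Lemma aug2_hcomp i x : aug2 x -> aug2 (hcomp i x).
Proof.
move=> [s [sP ->]]; rewrite linear_sum; apply: (subspace_sum_seq aug2_sub) => p /sP [p1 p2].
rewrite -(hcomp_sum p.1) mulrDl [X in aug2 X]linearD /= !(hcompMl _ _ (homog_hcomp _ _)).
by apply: (subspaceD aug2_sub); apply: aug2_in; exact: counit_hcomp0.
Qed.
Lemma aug2_counit x : aug2 x -> counit x = 0.
Proof.
by move=> [s [sP ->]]; rewrite linear_sum big_seq big1 // => p /sP [p1 _]; rewrite /= counitM p1 mul0r.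
Qed.
End Square.

Section Agree.
Variables (K : fieldType) (G : supergroupType K) (R : superAlgType K) (Y : R -> Prop).
Hypothesis Yh : forall i y, Y y -> Y (hcomp i y).

(** Equality after multiplication by [Y]. In the application [Y] is the image of the augmentation
    ideal in a ring where its square is zero. *)
Definition agree (h h' : superhom G R) := forall y v, Y y -> y * h v = y * h' v.

Lemma agree_mul h1 h2 h1' h2' : agree h1 h1' -> agree h2 h2' -> agree (pmul h1 h2) (pmul h1' h2').
Proof.
move=> a1 a2 y v Yy.
have b1 : bilin (fun x z : G => h1 x * h2 z) by exact: mul_bilin.
have key (w w' : G) : y * (h1 w * h2 w') = y * (h1' w * h2' w').
  rewrite mulrA a1 // mulrA; set z := h1' w.
  have c k l : hcomp k y * hcomp l z * h2 w' = hcomp k y * hcomp l z * h2' w'.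
    rewrite (homogZC (homog_hcomp k y) (homog_hcomp l z)) -!scalerAl -!mulrA a2 //; exact: Yh.
  by rewrite -(hcomp_sum y) -(hcomp_sum z) !(mulrDl, mulrDr) !c.
rewrite !pmul_tlift !tliftMl; apply: eq_tlift => u w; exact: key.
Qed.
End Agree.

Lemma pconj_pcomm (K : fieldType) (G : supergroupType K) (R : superAlgType K) (n g : superhom G R) :
  pconj n g = pmul n (pcomm n g).
Proof. by rewrite /pconj /pcomm pinvM -!pmulA pmulKVl. Qed.

Section Trivial.
Variables (K : fieldType) (G : supergroupType K) (r : nat) (Y : nat -> G -> Prop).
Hypotheses (hY : nil_chain r Y) (Yr : forall a : G, Y r a -> a = 0).

(** The ideal of all functions that vanish on the zero locus of [Y j]. *)
Definition chX j (x : G) := forall (R : superAlgType K) (n : superhom G R), kills n (Y j) -> n x = 0.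

Lemma chX_sub j : subspace (chX j).
Proof.
split; first by move=> R n _; exact: linear0.
by move=> c x y hx hy R n k; rewrite linearP /= (hx R n k) (hy R n k) scaler0 addr0.
Qed.

Lemma punit_kills j R : (j <= r)%N -> kills (punit G R) (Y j).
Proof.
have [_ YS] := hY; move=> jr; rewrite -(subKn jr); elim: (r - j)%N (leq_subr j r) => [|k IH] kr.
  by rewrite subn0 => a /Yr ->; exact: linear0.
have e : (r - k.+1).+1 = (r - k)%N by rewrite subnSK.
have lt : (r - k.+1 < r)%N by rewrite -subSn // subSS leq_subr.
have := YS _ lt R (punit G R) (punit G R); rewrite e => /(_ (IH (ltnW kr))).
by rewrite /pcomm pmulVl.
Qed.

Lemma chX_counit j x : (j <= r)%N -> chX j x -> counit x = 0.
Proof.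
move=> jr hx; have := hx G (punit G G) (@punit_kills j G jr); rewrite punitE => e.
by have := congr1 counit e; rewrite scalarZ /= counit1 mulr1 linear0.
Qed.

Definition chJ j (x : G) := exists a b, [/\ chX j a, aug2 b & x = a + b].

Lemma chJ_sub j : subspace (chJ j).
Proof.
split; first by exists 0, 0; rewrite addr0; split=> //; [exact: (chX_sub j).1|exact: (aug2_sub G).1].
move=> c _ _ [a [b [ha hb ->]]] [a' [b' [ha' hb' ->]]]; exists (c *: a + a'), (c *: b + b').
by rewrite scalerDr addrACA; split=> //; [exact: (chX_sub j).2|exact: (aug2_sub G).2].
Qed.

Section Step.
Variables (j : nat) (jr : (j < r)%N).

Lemma chJ_mul a x : chJ j.+1 x -> chJ j.+1 (a * x).
Proof.
move=> [b [c [hb hc ->]]]; exists (a * b), (a * c); rewrite mulrDr; split=> //; last exact: aug2_mul.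
by move=> R n k; rewrite rmorphM /= (hb R n k) mulr0.
Qed.
Lemma chJ_hcomp i x : chJ j.+1 x -> chJ j.+1 (hcomp i x).
Proof.
move=> [b [c [hb hc ->]]]; exists (hcomp i b), (hcomp i c); rewrite hcompD; split=> //; last exact: aug2_hcomp.
by move=> R n k; rewrite shom_even (hb R n k) linear0.
Qed.
Lemma chJ1 : ~ chJ j.+1 1.
Proof.
move=> [b [c [hb hc e]]]; have := congr1 counit e.
rewrite counit1 linearD /= (chX_counit jr hb) (aug2_counit hc) addr0 => /eqP.
by rewrite oner_eq0.
Qed.
Let J : superideal G := SuperIdeal (chJ_sub j.+1) chJ_mul chJ_hcomp chJ1.
Let p0 : superhom G (squot J) := spi J.
Let n : superhom G (tens (squot J) G) := superhom_comp (in1 (squot J) G) p0.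
Let g : superhom G (tens (squot J) G) := in2 (squot J) G.

(** Over K[G] / (chX(j+1) + (K[G]^+)^2) the tautological point n is infinitesimal and kills
    [Y j.+1], so c = [n, g] kills x. Conjugating n gives n c, and to first order x(n c) = x(n) +
    x(c) - counit(x); so x takes the same value at n and at its conjugate. *)
Lemma chX_ad (f : {scalar G}) x : chX j x -> chJ j.+1 (cr f (ad G x - x \ot 1)).
Proof.
move=> hx; pose c := pcomm n g.
have nJ a : chJ j.+1 a -> n a = 0.
  by move=> /(spi0 J) e; rewrite -[LHS]/(in1 _ G (p0 a)) e linear0.
have nk : kills n (Y j.+1).
  move=> a Ya; apply: nJ; exists a, 0; rewrite addr0; split=> //; last exact: (aug2_sub G).1.
  by move=> R m; apply.
have cx : c x = 0 by apply: hx; exact: (hY.2 j jr).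
pose Y0 y := exists2 a, counit a = 0 & y = n a.
have Y0h i y : Y0 y -> Y0 (hcomp i y).
  by move=> [a a0 ->]; exists (hcomp i a); [exact: counit_hcomp0|rewrite shom_even].
have nB u : n (u - counit u *: 1) = n u - punit G _ u.
  by rewrite [LHS]linearB; congr (_ - _); rewrite [LHS]linearZ rmorph1 punitE.
have a1 : agree Y0 n (punit G _).
  move=> _ v [a a0 ->]; apply/eqP; rewrite -subr_eq0; apply/eqP.
  rewrite -mulrBr -nB; transitivity (n (a * (v - counit v *: 1))); first by rewrite [RHS]rmorphM.
  apply: nJ; exists 0, (a * (v - counit v *: 1)); rewrite add0r; split=> //.
    exact: (chX_sub _).1.
  by apply: aug2_in => //; rewrite linearB scalarZ /= counit1 mulr1 subrr.
have a2 : agree Y0 (pinv n) (punit G _).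
  move=> y v Yy; rewrite -[LHS]/(y * n (antipode v)) a1 //; congr (_ * _).
  exact: (congr1 (fun h => shom h v) (pinv1 G _)).
have ac : agree Y0 c (punit G _).
  have : agree Y0 (pmul (pmul (pinv n) (pinv g)) (pmul n g))
      (pmul (pmul (punit G _) (pinv g)) (pmul (punit G _) g)).
    by apply: agree_mul => //; apply: agree_mul.
  by rewrite !pmul1l pmulVl -pinvM.
have e : pconj n g x = n x.
  rewrite pconj_pcomm pmul_tlift.
  have x0 : counit x = 0 by apply: chX_counit hx; exact: ltnW.
  (* The error (n(u) - counit u)(c(v) - counit v) vanishes because n is infinitesimal ([ac]). *)
  transitivity (tlift (fun u v => n u * punit G _ v + punit G _ u * c v - punit G _ u * punit G _ v) (comul x)).
    apply: eq_tlift => u v; apply/eqP; rewrite -subr_eq0; apply/eqP.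
    transitivity (n (u - counit u *: 1) * (c v - punit G _ v)).
      rewrite nB.
      by rewrite mulrBl !mulrBr -[RHS]addrA -opprD; congr (_ - _); rewrite addrA.
    rewrite mulrBr ac ?subrr //; exists (u - counit u *: 1) => //.
    by rewrite linearB scalarZ /= counit1 mulr1 subrr.
  transitivity (pmul n (punit G _) x + pmul (punit G _) c x - pmul (punit G _) (punit G _) x).
    by rewrite !pmul_tlift /tlift /teval -big_split -sumrB.
  by rewrite pmul1r !pmul1l cx punitE x0 scale0r addr0 subr0.
have e2 : superhom_comp (stens p0 (idS G)) (ad G) = pconj n g.
  by rewrite pconj_comp stens_in1 stens_in2 superhom_comp1.
apply/(spi0 J); rewrite -/p0.
have -> : p0 (cr f (ad G x - x \ot 1)) = cr f (stens p0 (idS G) (ad G x - x \ot 1)).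
  by rewrite stensE (cr_tmap _ (h := f) (h' := f)).
rewrite linearB -[X in cr f (X - _)]/(superhom_comp (stens p0 (idS G)) (ad G) x) e2 e.
by rewrite -[X in _ - X]/(stens p0 (idS G) (x \ot 1)) stens_pure rmorph1 subrr linear0.
Qed.
End Step.

Variables (D : supergroupType K) (q : superhom G D) (hq : hopf_hom q).

Lemma adq_aug (f : {scalar D}) a : counit a = 0 -> counit (cr f (adq q a)) = 0.
Proof.
move=> a0; rewrite [LHS](cl_cr (counit : {scalar G}) f) [cl _ _](_ : _ = 0) ?linear0 //.
have e : superhom_comp (sprod (punit G D) (idS D)) (adq q) = punit G D.
  rewrite sprod_adq superhom_comp1l /pconj -(punit_comp G (idS D)) superhom_comp1l.
  by rewrite pmul1r pmulVl.
transitivity (punit G D a); last by rewrite punitE a0 scale0r.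
rewrite -e -[RHS]/(sprod (punit G D) (idS D) (adq q a)) sprodE; apply: eq_tlift => u v.
by rewrite punitE -scalerAl mul1r.
Qed.

Lemma stab_aug2 : stab (adq q) (@aug2 K G).
Proof.
move=> f _ [s [sP ->]]; rewrite [X in cr f X]linear_sum [cr f _]linear_sum.
apply: (subspace_sum_seq (aug2_sub G)) => p /sP [p1 p2].
change (aug2 (cr f (adq q (p.1 * p.2)))).
have -> : adq q (p.1 * p.2) = adq q p.1 * adq q p.2 by exact: rmorphM.
have sn : subspace (fun x : G => counit x = 0).
  by split; [exact: linear0|move=> c x y hx hy; rewrite linearP /= hx hy mulr0 addr0].
have [t tP ->] := tens_meml sn (fun f => adq_aug f p1).
have [t' tP' ->] := tens_meml sn (fun f => adq_aug f p2).
rewrite mulr_suml linear_sum; apply: (subspace_sum_seq (aug2_sub G)) => y /tP y0.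
change (aug2 (cr f ((y.1 \ot y.2) * \sum_(p0 <- t') p0.1 \ot p0.2))).
rewrite mulr_sumr linear_sum; apply: (subspace_sum_seq (aug2_sub G)) => z /tP' z0.
apply: (cr_mul _ _ _ (aug2_sub G)) => k.
by apply: aug2_in => //; exact: counit_hcomp0.
Qed.

(** Each step of the chain costs one contraction; at its end only the square of the augmentation
    ideal is left. *)
Lemma chX_filt k : (k <= r)%N -> forall x, chX (r - k) x -> filt (adq q) (@aug2 K G) k x.
Proof.
elim: k => [|k IH] kr x hx /=.
  have -> : x = 0 by apply: (hx G (idS G)) => a; rewrite subn0 => /Yr ->; exact: linear0.
  exact: (aug2_sub G).1.
move=> f f1; have lt : (r - k.+1 < r)%N by rewrite -subSn // subSS leq_subr.
have := chX_ad lt (scomp f q) hx; rewrite crB cr_pure /= rmorph1 f1 scale0r subr0 -adq_cr.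
rewrite subnSK // => -[a [b [ha hb e]]]; rewrite [X in filt _ _ _ X]e.
apply: (subspaceD (filt_sub _ _ (aug2_sub G))); first by apply: IH => //; exact: ltnW.
by apply: (filt_mono (n := 0)) => //; exact: stab_aug2.
Qed.

(** The action of D on the cotangent space is unipotent by [chX_filt], so the coefficients are
    conilpotent, hence scalar as D is of multiplicative type. *)
Lemma ad_trivial (L : fieldType) (iota : {rmorphism K -> L}) (v : {scalar G}) a :
  mult_type iota D -> (forall x, aug2 x -> v x = 0) -> cl v (adq q a) = v a *: 1.
Proof.
move=> mD v2.
have main x : counit x = 0 -> cl v (adq q x) = v x *: 1.
  move=> x0; have hx : chX (r - r) x.
    rewrite subnn => R n /(hY.1) ->; by rewrite punitE x0 scale0r.
  have := filt_coef_mod (adq_coassoc hq) stab_aug2 v2 (chX_filt (leqnn r) hx) => hc.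
  rewrite (mult_conil mD (ex_intro _ r hc)); congr (_ *: _).
  by rewrite -[LHS](cl_cr v (counit : {scalar D})) adq_counit.
transitivity (cl v (adq q (a - counit a *: 1)) + cl v (adq q (counit a *: 1))).
  by rewrite -clD -(linearD (adq q)) subrK.
rewrite main; last by rewrite linearB scalarZ /= counit1 mulr1 subrr.
have -> : adq q (counit a *: 1) = counit a *: (1 \ot 1) by rewrite [LHS]linearZ rmorph1.
rewrite clZ cl_pure scalerA -scalerDl; congr (_ *: _).
by rewrite linearB [v (_ *: _)]scalarZ /= subrK.
Qed.
End Trivial.

Lemma lie_odd_aug2 (K : fieldType) (G : supergroupType K) (v : G -> K) (hv : lie_odd v) x :
  aug2 x -> v x = 0.
Proof.
have [vs _ vM] := hv; move=> [s [sP ->]]; rewrite -[v]/(mkscal vs : G -> K) linear_sum big_seq big1 // => p /sP [p1 p2].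
by rewrite /= vM p1 p2 mulr0 mul0r addr0.
Qed.

(** Functions on D are even, so no sign arises in bringing the conjugation into the shape of
    [ad_pairing]. *)
Lemma adq_tlift (K : fieldType) (G D : supergroupType K) (q : superhom G D) (hq : hopf_hom q) a :
  purely_even D -> adq q a = tlift (fun x y => tlift (fun u w =>
    u \ot (q (antipode x) * q w)) (comul y)) (comul a).
Proof.
move=> evD; rewrite adq_pconj /pconj -pmulA pmul_tlift; apply: eq_tlift => x y.
rewrite pmul_tlift tliftMl; apply: eq_tlift => u w.
have h z : homog false (in2 G D z).
  by rewrite /homog -shom_even; congr (in2 _ _ _); rewrite -[RHS]hcomp_sum evD addr0.
have -> : pinv (superhom_comp (in2 G D) q) x = in2 G D (q (antipode x)) by [].
rewrite mulrA (evenC _ (h _)) -mulrA -[X in _ * (_ * X)]/(in2 G D (q w)) -rmorphM.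
exact: tensM_in12.
Qed.

Lemma ker_rho_sub (K L : fieldType) (iota : {rmorphism K -> L}) (G : supergroupType K)
    (E : closedSub G) (F : closedSub E) : mult_type iota F ->
  (forall (v : {scalar G}) a, (forall x, aug2 x -> v x = 0) ->
     cl v (adq (superhom_comp (cres F) (cres E)) a) = v a *: 1) -> sub_ker_rho F.
Proof.
move=> mF h R g _ [n hn] v hv a; have [vs _ _] := hv.
pose q : superhom G F := superhom_comp (cres F) (cres E).
have hq : hopf_hom q by apply: hopf_comp; exact: cres_hopf.
have evF : purely_even F by case: mF.
have e := h (mkscal vs) a (lie_odd_aug2 hv); have := congr1 n e.
rewrite linearZ_LR rmorph1 => <-; rewrite -/q (adq_tlift hq a evF).
rewrite (tlift_comp (cl (mkscal vs) : {linear tens G F -> F})) (tlift_comp n).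
apply: eq_tlift => x y.
rewrite (tlift_comp (cl (mkscal vs) : {linear tens G F -> F})) (tlift_comp n).
apply: eq_tlift => u w.
rewrite -[RHS]/(n (cl (mkscal vs) (u \ot (q (antipode x) * q w)))) cl_pure [RHS]linearZ_LR.
rewrite !hn -(hopf_antipode (cres_hopf E)); congr (_ *: _).
by rewrite [RHS]rmorphM.
Qed.

Theorem cond_cd (K L : fieldType) (iota : {rmorphism K -> L}) (G : supergroupType K)
    (hK : 2%N \notin [pchar K]) (hL : algebraic_closure iota) : algebraic G ->
  cond_c G -> cond_d iota G.
Proof.
move=> aG nG; have noG := hilbert_basis aG.
have [r [Y [r0 hY Yr]]] := nilpotent_chain nG.
have [E hE] := even_part_exists G; exists E.
have noE : noeth E := noeth_surj (@cres_surj _ _ E) noG.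
have evE := even_part_even hE.
split=> //.
  apply: (chain_nilpotent hK noE r0 (chain_sub E hY)) => _ [a /Yr -> ->]; exact: linear0.
have [Z hZ] := center_exists E.
have evZ : purely_even Z := purely_even_surj (@cres_surj _ _ Z) evE.
have aZ : algebraic Z := algebraic_surj (@cres_surj _ _ Z) (algebraic_surj (@cres_surj _ _ E) aG).
have comZ (R : superAlgType K) (f g : superhom Z R) : pmul f g = pmul g f.
  have := central_subP (superhom_comp g (cres Z)) (center_central hZ) (pt_in_cres f).
  rewrite -!(hopf_pmul (cres_hopf Z)) => e; apply: shomP => b; have [a <-] := cres_surj b.
  exact: (congr1 (fun h => shom h a) e).
have [F mF] := mult_part_exists hL evZ aZ comZ.
exists Z, F; split=> //; have [mtF _] := mF.
apply: (ker_rho_sub (F := sub_trans F) mtF) => v a v2.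
by apply: (ad_trivial hY Yr _ _ mtF v2); apply: hopf_comp; [exact: (cres_hopf (sub_trans F))|exact: cres_hopf].
Qed.

(** * Powers of the ideal generated by the odd elements *)

Section TriBasis.
Variables (K : fieldType) (V : lmodType K) (P : V -> Prop) (sP : subspace P).

(** A basis modulo [P] with triangular dual functionals: each one is 1 on its own vector and
    vanishes on [P] and on the vectors after it. *)
Fixpoint tri (t : seq (V * {scalar V})) : Prop :=
  if t is (y, f) :: t' then
    [/\ f y = 1, (forall x, spn P [seq p.1 | p <- t'] x -> f x = 0) & tri t']
  else True.

Lemma tri_basis s : exists t, [/\ tri t, (forall x, spn P s x -> spn P [seq p.1 | p <- t] x) &
  forall y, y \in [seq p.1 | p <- t] -> y \in s].
Proof.
elim: s => [|y s [t [tt ts tm]]]; first by exists [::].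
have tm' z : z \in [seq p.1 | p <- t] -> z \in y :: s by move=> /tm h; rewrite inE h orbT.
have [yt|yt] := pselect (spn P [seq p.1 | p <- t] y).
  exists t; split=> // x /(spn_cons P y s x) [c /ts h].
  rewrite -(subrK (c *: y) x); apply: (subspaceD (spn_subspace _ sP)) => //.
  exact: (subspaceZ _ (spn_subspace _ sP)).
have [f [f0 f1]] := separation (spn_subspace _ sP) yt.
exists ((y, f) :: t); split=> // [x /(spn_cons P y s x) [c /ts h]|z].
  by apply/spn_cons; exists c.
by rewrite inE => /orP[/eqP ->|/tm' //]; rewrite mem_head.
Qed.
End TriBasis.

Section OddPowers.
Variables (K : fieldType) (hK : 2%N \notin [pchar K]) (A : superAlgType K).

(** The k-th power of the ideal generated by the odd elements. *)
Fixpoint Ip k (x : A) : Prop := if k is k'.+1 then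
    exists t : seq (A * A), (forall p, p \in t -> homog true p.1 /\ Ip k' p.2) /\
      x = \sum_(p <- t) p.1 * p.2
  else True.

Lemma Ip_sub k : subspace (Ip k).
Proof.
case: k => [//|k]; split; first by exists [::]; rewrite big_nil.
move=> c x y [s [sP ->]] [t [tP ->]].
exists ([seq (c *: p.1, p.2) | p <- s] ++ t); split.
  move=> p; rewrite mem_cat => /orP[/mapP[q /sP [q1 q2] ->]|/tP //].
  by split=> //; exact: homogZ.
rewrite big_cat big_map scaler_sumr; congr (_ + _); apply: eq_bigr => p _ /=.
by rewrite scalerAl.
Qed.
Lemma Ip_in k a b : homog true a -> Ip k b -> Ip k.+1 (a * b).
Proof. by move=> ha hb; exists [:: (a, b)]; rewrite big_seq1; split=> // p; rewrite inE => /eqP ->. Qed.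
Lemma Ip_mul k a x : Ip k x -> Ip k (a * x).
Proof.
elim: k a x => [//|k IH] a x [t [tP ->]]; rewrite mulr_sumr.
apply: (subspace_sum_seq (Ip_sub k.+1)) => p /tP [p1 p2].
rewrite mulrA -(hcomp_sum a) mulrDl !(homogZC (homog_hcomp _ a) p1) mulrDl -!scalerAl -!mulrA.
by apply: (subspaceD (Ip_sub k.+1)); apply: (subspaceZ _ (Ip_sub k.+1)); apply: Ip_in => //; exact: IH.
Qed.
Lemma Ip_mulr k a x : Ip k x -> Ip k (x * a).
Proof.
elim: k x => [//|k IH] x [t [tP ->]]; rewrite mulr_suml.
apply: (subspace_sum_seq (Ip_sub k.+1)) => p /tP [p1 p2].
by rewrite -mulrA; apply: Ip_in => //; exact: IH.
Qed.
Lemma Ip_hcomp k i x : Ip k x -> Ip k (hcomp i x).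
Proof.
elim: k i x => [//|k IH] i x [t [tP ->]]; rewrite linear_sum.
apply: (subspace_sum_seq (Ip_sub k.+1)) => p /tP [p1 p2] /=.
by rewrite (hcompMl _ _ p1); apply: Ip_in => //; exact: IH.
Qed.
Lemma Ip_mono1 k x : Ip k.+1 x -> Ip k x.
Proof.
by move=> [t [tP ->]]; apply: (subspace_sum_seq (Ip_sub k)) => p /tP [_ h]; exact: Ip_mul.
Qed.
Lemma IpM k l x y : Ip k x -> Ip l y -> Ip (k + l) (x * y).
Proof.
elim: k x => [|k IH] x; first by move=> _; exact: Ip_mul.
move=> [t [tP ->]] hy; rewrite mulr_suml.
apply: (subspace_sum_seq (Ip_sub _)) => p /tP [p1 p2].
by rewrite -mulrA; apply: Ip_in => //; exact: IH.
Qed.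
Lemma Ip_odd x : homog true x -> Ip 1 x.
Proof. by move=> h; rewrite -[x]mulr1; exact: Ip_in. Qed.

Definition tw1 (x : A) := hcomp false x - hcomp true x.
Lemma tw1K x : tw1 (tw1 x) = x.
Proof.
rewrite /tw1 !linearB /= !hcomp_hcomp /= subr0 oppr0 sub0r opprK.
by rewrite hcomp_sum.
Qed.
Lemma Ip_tw k x : Ip k x -> Ip k (tw1 x).
Proof. by move=> h; apply: (subspaceB (Ip_sub k)); exact: Ip_hcomp. Qed.

Fixpoint mon (S : seq A) k (x : A) : Prop := if k is k'.+1 then
    exists t : seq (A * A), (forall p, p \in t -> p.1 \in S /\ mon S k' p.2) /\
      x = \sum_(p <- t) p.1 * p.2
  else True.

Lemma mon_sub S k : (forall y, y \in S -> homog true y) -> subspace (mon S k).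
Proof.
move=> hS; elim: k => [//|k IH]; split; first by exists [::]; rewrite big_nil.
move=> c x y [s [sP ->]] [t [tP ->]].
exists ([seq (p.1, c *: p.2) | p <- s] ++ t); split.
  move=> p; rewrite mem_cat => /orP[/mapP[q /sP [q1 q2] ->]|/tP //].
  by split=> //; exact: subspaceZ.
rewrite big_cat big_map scaler_sumr; congr (_ + _); apply: eq_bigr => p _ /=.
by rewrite scalerAr.
Qed.
Lemma mon_in S k a b : a \in S -> mon S k b -> mon S k.+1 (a * b).
Proof. by move=> ha hb; exists [:: (a, b)]; rewrite big_seq1; split=> // p; rewrite inE => /eqP ->. Qed.
Lemma mon_Ip S k x : (forall y, y \in S -> homog true y) -> mon S k x -> Ip k x.
Proof.
move=> hS; elim: k x => [//|k IH] x [t [tP ->]]; exists t; split=> // p /tP [? ?].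
by split; [exact: hS|exact: IH].
Qed.
Lemma mon_mul S k a x : (forall y, y \in S -> homog true y) -> mon S k x -> mon S k (a * x).
Proof.
move=> hS; elim: k a x => [//|k IH] a x [t [tP ->]]; rewrite mulr_sumr.
apply: (subspace_sum_seq (mon_sub _ hS)) => p /tP [p1 p2].
rewrite mulrA -(hcomp_sum a) mulrDl !(homogZC (homog_hcomp _ a) (hS _ p1)) mulrDl -!scalerAl -!mulrA.
by apply: (subspaceD (mon_sub _ hS)); apply: (subspaceZ _ (mon_sub _ hS)); apply: mon_in => //; exact: IH.
Qed.
(** Anticommute the factors g to the front; since g^2 = 0, at most one survives. *)
Lemma mon_cons g S k x : homog true g -> (forall y, y \in S -> homog true y) -> mon (g :: S) k.+1 x ->
  exists a b, [/\ mon S k.+1 a, mon S k b & x = a + g * b].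
Proof.
move=> hg hS; elim: k x => [|k IH] x [t [tP ->]].
all: have s1 j := mon_sub j hS.
all: elim: t tP => [|p t IHt] tP; first (by exists 0, 0; rewrite big_nil mulr0 addr0; split=> //; exact: (s1 _).1).
all: have [|a [b [ha hb e]]] := IHt; first (by move=> q qt; apply: tP; rewrite inE qt orbT).
all: have [] := tP p (mem_head _ _); rewrite big_cons e inE.
  move=> /orP[/eqP -> _|ps _].
    by exists a, (p.2 + b); split=> //; rewrite mulrDr addrCA.
  by exists (p.1 * p.2 + a), b; split=> //; [apply: (subspaceD (s1 _)) => //; exact: mon_in|rewrite addrA].
move=> pg /IH [a' [b' [ha' hb' ->]]]; case/orP: pg => [/eqP ->|ps].
  exists a, (a' + b); split=> //; first exact: (subspaceD (s1 _)).
  by rewrite mulrDr mulrA odd_sq // mul0r addr0 mulrDr addrCA.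
exists (p.1 * a' + a), (- (p.1 * b') + b); split.
- by apply: (subspaceD (s1 _)) => //; exact: mon_in.
- by apply: (subspaceD (s1 _)) => //; apply: (subspaceN (s1 _)); exact: mon_in.
rewrite !mulrDr mulrN !mulrA (homogZC hg (hS _ ps)) expr1 scaleN1r mulNr opprK.
by rewrite -!addrA; congr (_ + _); rewrite addrCA.
Qed.
Lemma mon_nil S k x : (forall y, y \in S -> homog true y) -> (size S < k)%N -> mon S k x -> x = 0.
Proof.
elim: S k x => [|g S IH] [|k] x hS //.
  by move=> _ [t [tP ->]]; rewrite big_seq big1 // => p /tP [].
have hS' y : y \in S -> homog true y by move=> h; apply: hS; rewrite inE h orbT.
rewrite ltnS => sk /(mon_cons (hS g (mem_head _ _)) hS') [a [b [ha hb ->]]].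
have sk' : (size S < k.+1)%N by exact: ltnW.
by rewrite (IH k.+1 a hS' sk' ha) (IH k b hS' sk hb) mulr0 addr0.
Qed.
End OddPowers.

Section OddDer.
Variables (K : fieldType) (hK : 2%N \notin [pchar K]) (G : supergroupType K).

Lemma lie_oddM (v : {scalar G}) a b : lie_odd v -> v (a * b) = v a * counit b + counit a * v b.
Proof. by case. Qed.

(** The contraction x |-> x_1 v(x_2) is the invariant odd vector field of v; [tw1] is the sign by
    which it passes b. *)
Lemma Rv_mul (v : {scalar G}) a b : lie_odd v ->
  cr v (comul (a * b)) = cr v (comul a) * tw1 b + a * cr v (comul b).
Proof.
move=> hv; have [_ v0 _] := hv; rewrite comulM tmulE.
have tE : tw1 b = cr counit (hcomp false (comul b)) - cr counit (hcomp true (comul b)).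
  by rewrite -!comul_even -[cr _ _]/(tlift _ _) counitr -[cr _ (comul (hcomp true b))]/(tlift _ _) counitr.
have bE : cr v (comul b) = cr v (comul b) by [].
have aE : a = cr counit (comul a) by rewrite -[RHS]/(tlift _ _) counitr.
have [tb tbE] : exists tb : tens G G -> G, forall y, tb y = cr counit (hcomp false y) - cr counit (hcomp true y).
  by exists (fun y => cr counit (hcomp false y) - cr counit (hcomp true y)).
have tbD p y : tb (p + y) = tb p + tb y by rewrite !tbE !hcompD !crD opprD addrACA.
rewrite tE {3}aE -tbE; elim/tens_hind: (comul a) => [|i j u w x hu hw IH].
  by rewrite mul0r [cr v 0]linear0 [cr counit 0]linear0 !mul0r addr0.
rewrite mulrDl !crD IH !mulrDl addrACA; congr (_ + _).
elim/tens_hind: (comul b) => [|k l u' w' y hu' hw' IHy].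
  by rewrite mulr0 tbE ![hcomp _ 0]linear0 [cr v 0]linear0 [cr counit 0]linear0 subrr !mulr0 addr0.
rewrite mulrDr !crD IHy tbD !mulrDr [RHS]addrACA; congr (_ + _).
have -> : tb (u' \ot w') = counit w' *: ((-1) ^+ k *: u').
  rewrite tbE !hcomp_pure !crD !cr_pure /= !counit_hcomp !scale0r addr0 add0r.
  case: (k) hu' => hu'; rewrite hu' ?(homog_neq (j := false) hu') ?(homog_neq (j := true) hu') //.
    by rewrite expr1 scaler0 sub0r scaleN1r scalerN.
  by rewrite expr0 scaler0 subr0 scale1r.
rewrite (tensM_hom _ _ hw hu') crZ !cr_pure (lie_oddM _ _ hv) -!scalerAl -!scalerAr !scalerA -scalerDl; congr (_ *: _).
have [hj|hj] : j = true \/ j = false by case: (j); [left|right].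
  rewrite hj /= in hw *; have -> : counit w = 0 by rewrite -hw counit_even.
  by rewrite !mul0r !addr0 mulrC mulrA.
rewrite hj /= in hw *; have -> : v w = 0 by rewrite -hw v0.
by rewrite expr0 mul1r !mul0r !add0r.
Qed.

End OddDer.

Section Ideal.
Variables (K : fieldType) (hK : 2%N \notin [pchar K]) (A : superAlgType K) (nA : noeth A).

Lemma odd_gens : exists gs : seq A, (forall g, g \in gs -> homog true g) /\
  forall k x, Ip k x -> mon gs k x.
Proof.
have [s sI sg] : exists2 s : seq A, (forall x, x \in s -> Ip 1 x) & (forall x, Ip 1 x -> lgen (fun=> True) s x).
  by apply: nA; split=> // [|a x _|i a]; [exact: Ip_sub|exact: Ip_mul|exact: Ip_hcomp].
have [gs [hg sgs]] : exists gs : seq A, (forall g, g \in gs -> homog true g) /\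
    (forall x, x \in s -> mon gs 1 x).
  elim: s sI {sg} => [|y s IH] sI; first by exists [::].
  have [|gs [hg sgs]] := IH; first by move=> x xs; apply: sI; rewrite inE xs orbT.
  have [t [tP ty]] := sI y (mem_head _ _).
  have mono (l l' : seq A) x : (forall z, z \in l -> z \in l') -> mon l 1 x -> mon l' 1 x.
    by move=> ll [u [uP ->]]; exists u; split=> // p /uP [h _]; split=> //; exact: ll.
  exists ([seq p.1 | p <- t] ++ gs); split.
    by move=> g; rewrite mem_cat => /orP[/mapP[p /tP [h _] ->]|/hg].
  move=> x; rewrite inE => /orP[/eqP ->|/sgs h]; last first.
    by apply: mono h => z zs; rewrite mem_cat zs orbT.
  exists t; split=> // p pt; split=> //.
  by rewrite mem_cat; apply/orP; left; apply/mapP; exists p.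
have s1 j := mon_sub j hg.
have g1 x : Ip 1 x -> mon gs 1 x.
  move=> /sg [t [tP ->]]; apply: (subspace_sum_seq (s1 1%N)) => p /tP [_ /sgs h].
  exact: mon_mul.
exists gs; split=> //; elim=> [//|k IH] x [t [tP ->]].
apply: (subspace_sum_seq (s1 k.+1)) => p /tP [p1 p2].
have [u [uP ->]] := g1 _ (Ip_odd p1); rewrite mulr_suml.
apply: (subspace_sum_seq (s1 k.+1)) => w /uP [w1 _].
by rewrite -mulrA; apply: mon_in => //; apply: mon_mul => //; exact: IH.
Qed.

(** The ideal has finitely many odd generators, and a product of more of them than there are repeats
    one. *)
Lemma odd_nilpotent : exists N, forall x : A, Ip N x -> x = 0.
Proof.
have [gs [hg h]] := odd_gens; exists (size gs).+1 => x /h.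
exact: (mon_nil hK hg (leqnn _)).
Qed.
End Ideal.

(** * Invariant odd derivations detect powers of the odd ideal *)

Section Dagger.
Variables (K : fieldType) (hK : 2%N \notin [pchar K]) (G : supergroupType K) (nG : noeth G).
Variables (E : closedSub G) (hE : is_even_part E).
Notation pi := (cres E).
Notation ev := (hcomp false).
Notation od := (hcomp true).

Lemma pi_Ip x : pi x = 0 <-> Ip 1 x.
Proof.
split=> [/hE [s ->]|].
  apply: (subspace_sum_seq (@Ip_sub K G 1)) => p _.
  by apply: Ip_mul; apply: Ip_odd; exact: homog_hcomp.
move=> [t [tP ->]]; rewrite rmorph_sum big_seq big1 // => p /tP [p1 _].
have e : pi p.1 = 0 by rewrite -p1 shom_even (even_part_even hE).
by transitivity (pi p.1 * pi p.2); [exact: rmorphM|rewrite e mul0r].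
Qed.
Lemma even_E (e : E) : od e = 0.
Proof. exact: (even_part_even hE). Qed.
Lemma pi_od x : pi (od x) = 0.
Proof. by rewrite shom_even even_E. Qed.
Lemma pi_ev x : pi (ev x) = pi x.
Proof. have e : pi (ev x + od x) = pi (ev x) + pi (od x) by exact: rmorphD.
by rewrite -[x in RHS](hcomp_sum x) e pi_od addr0. Qed.

Lemma Rv_hcomp (v : {scalar G}) i x : lie_odd v ->
  cr v (comul (hcomp i x)) = hcomp (~~ i) (cr v (comul x)).
Proof.
move=> [_ v0 _]; rewrite comul_even; elim/tens_hind: (comul x) => [|j k u w y hu hw IH].
  by rewrite ![hcomp _ 0]linear0 [cr _ 0]linear0 [hcomp _ 0]linear0.
rewrite hcompD !crD IH hcompD; congr (_ + _).
rewrite hcomp_pure crD !cr_pure hcompZ.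
have e0 : v (od w) = v w.
  rewrite -[w in RHS](hcomp_sum w); have -> : v (ev w + od w) = v (ev w) + v (od w) by exact: linearD.
  by rewrite v0 add0r.
by clear IH; case: i; rewrite /= e0 v0 scale0r ?addr0 ?add0r.
Qed.

(** The analogue of the Maurer-Cartan form g^-1 dg, odd functions modulo [Ip 2] playing the part of
    one-forms. *)
Definition omega (x : G) : G := tlift (fun u w : G => antipode (ev u) * od w) (comul x).
Let Sev : {linear G -> G} := mklin antipode_linear \o (ev : {linear G -> G}).
Lemma omega_bilin : bilin (fun u w : G => antipode (ev u) * od w).
Proof. exact: (mul_bilin Sev (od : {linear G -> G})). Qed.
Let om : {linear tens G G -> G} := mklin (tlift_linear omega_bilin).
Lemma omegaE x : omega x = om (comul x). Proof. by []. Qed.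
Lemma om_pure u w : om (u \ot w) = antipode (ev u) * od w.
Proof. exact: tlift_pure omega_bilin. Qed.
Lemma omegaD x y : omega (x + y) = omega x + omega y.
Proof. by rewrite !omegaE linearD; exact: linearD. Qed.
Lemma omegaZ c x : omega (c *: x) = c *: omega x.
Proof. by rewrite !omegaE linearZ; exact: linearZ. Qed.

Lemma om_homog y : homog true (om y).
Proof.
elim/tens_ind: y => [|u w y IH]; first by rewrite linear0; exact: homog0.
rewrite linearD; apply: homogD => //; rewrite om_pure.
by rewrite -[true]/(false (+) true); apply: homogM; [rewrite antipode_even|]; exact: homog_hcomp.
Qed.

Lemma om_ev y : om (hcomp false y) = 0.
Proof.
elim/tens_hind: y => [|i j u w y hu hw IH]; first by rewrite !linear0.
rewrite hcompD linearD IH addr0 hcomp_pure linearD !om_pure !hcomp_hcomp /=.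
by rewrite mulr0 linear0 mul0r addr0.
Qed.
Lemma omega_od x : omega x = omega (od x).
Proof. by rewrite -[x in LHS](hcomp_sum x) omegaD [omega (ev x)]omegaE comul_even om_ev add0r. Qed.

(** Invariance of the form: evaluating it on the vector field of v gives the constant v(x). By the
    derivation rule only the term S(x_1) x_2 v(x_3) survives on E, and the antipode collapses it. *)
Lemma Rv_omega (v : {scalar G}) x : lie_odd v -> pi (cr v (comul (omega x))) = v x *: 1.
Proof.
move=> hv.
pose L : {linear tens G (tens G G) -> E} := mklin (tlift_linear
  (mul_bilin (pi \o mklin antipode_linear : {linear G -> E}) (pi \o (cr v : {linear tens G G -> G}) : {linear tens G G -> E}))).
have LE u y : L (u \ot y) = pi (antipode u) * pi (cr v y).
  by apply: (@tlift_pure K G (tens G G)); exact: (mul_bilin (pi \o mklin antipode_linear : {linear G -> E}) (pi \o (cr v : {linear tens G G -> G}))).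
have step y : pi (cr v (comul (om y))) = tlift (fun u w => L (u \ot comul w)) y.
  have bl : bilin (fun u w => L (u \ot comul w)).
    apply: bilinP => [w|u] c a b.
      by rewrite -[RHS]linearP; congr (L _); rewrite pureDl pureZl.
    by rewrite -[RHS]linearP; congr (L _); rewrite -pureZr -pureDr; congr (_ \ot _); exact: linearP.
  pose Tl : {linear tens G G -> E} := mklin (tlift_linear bl).
  change (pi (cr v (comul (om y))) = Tl y).
  elim/tens_ind: y => [|u w y IH]; first by rewrite !linear0.
  transitivity (pi (cr v (comul (om (u \ot w)))) + pi (cr v (comul (om y)))).
    by rewrite [om _]linearD [comul _]linearD [cr v _]linearD; exact: rmorphD.
  transitivity (Tl (u \ot w) + Tl y); last by rewrite -linearD.
  rewrite IH; congr (_ + _); transitivity (L (u \ot comul w)); last by symmetry; exact: tlift_pure.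
  rewrite LE.
  rewrite om_pure Rv_mul //.
  transitivity (pi (cr v (comul (antipode (ev u)))) * pi (tw1 (od w)) + pi (antipode (ev u)) * pi (cr v (comul (od w)))).
    by rewrite -!rmorphM; exact: rmorphD.
  have -> : pi (tw1 (od w)) = 0 by rewrite /tw1 !hcomp_hcomp /= sub0r; transitivity (- pi (od w)); [exact: rmorphN|rewrite pi_od oppr0].
  by rewrite mulr0 add0r Rv_hcomp // antipode_even !pi_ev.
rewrite step -comulA_apply.
transitivity (tlift (fun u c => (counit u * v c) *: (1 : E)) (comul x)); last first.
  rewrite -cfunE; congr (_ *: _); change (v (cl counit (comul x)) = v x).
  by rewrite -[cl _ _]/(tlift _ _) counitl.
apply: eq_tlift => u c; rewrite -[counit u]/(counit u) mulrC -scalerA.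
have <- : pi (tlift (fun a b => antipode a * b) (comul u)) = counit u *: 1.
  by rewrite antipodel linearZ rmorph1.
have b1 : bilin (fun a b : G => antipode a * b).
  exact: (mul_bilin (mklin (@antipode_linear K G)) (idfun : {linear G -> G})).
have b2 : bilin (fun a b : G => a \ot (b \ot c)) by exact: pure3_bilin.
elim/tens_ind: (comul u) => [|a b y IH].
  by rewrite [tlift _ 0](linear_fun0 (tlift_linear b2)) [tlift _ 0](linear_fun0 (tlift_linear b1)) !linear0 ?scaler0.
rewrite -[a \ot b]scale1r (tlift_linear b2) (tlift_linear b1) !scale1r [L (_ + _)]linearD [pi (_ + _)]rmorphD scalerDr IH; congr (_ + _).
rewrite !tlift_pure // LE cr_pure linearZ rmorphM /= scalerAr.
by [].
Qed.

Lemma Ip2_odd (a b : G) : homog true a -> homog true b -> Ip 2 (a * b).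
Proof. by move=> ha hb; apply: Ip_in => //; exact: Ip_odd. Qed.

Let s2 := @Ip_sub K G 2.
(** The same sum without the projections is the counit; the discarded terms are of odd total degree
    or products of two odd elements. *)
Lemma kappa (x : G) : Ip 2 (tlift (fun u w : G => ev u * antipode (ev w)) (comul x) - counit x *: 1).
Proof.
have b1 : bilin (fun a b : G => a * antipode b).
  exact: (mul_bilin (idfun : {linear G -> G}) (mklin (@antipode_linear K G))).
have b2 : bilin (fun u w : G => ev u * antipode (ev w)) by exact: (mul_bilin (ev : {linear G -> G}) Sev).
have -> : counit x *: 1 = ev (tlift (fun a b : G => a * antipode b) (comul x)).
  by rewrite antipoder linearZ /= homog1.
elim/tens_ind: (comul x) => [|u w y IH].
  by rewrite [tlift _ 0](linear_fun0 (tlift_linear b2)) [tlift _ 0](linear_fun0 (tlift_linear b1)) linear0 subrr; exact: s2.1.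
rewrite -[u \ot w]scale1r (tlift_linear b2) (tlift_linear b1) !scale1r hcompD opprD addrACA.
apply: (subspaceD s2) => //; rewrite !tlift_pure //.
rewrite -{2}(hcomp_sum u) -{2}(hcomp_sum w) [antipode (_ + _)]linearD /= mulrDl !mulrDr !hcompD.
have h0 (z : G) : homog false (ev z) by exact: homog_hcomp.
have h1 (z : G) : homog true (od z) by exact: homog_hcomp.
have a0 (z : G) : homog false (antipode (ev z)) by rewrite /homog -antipode_even h0.
have a1 (z : G) : homog true (antipode (od z)) by rewrite /homog -antipode_even h1.
rewrite (homogM (h0 _) (a0 _)) (homogM (h1 _) (a1 _)).
rewrite (homog_neq (j := false) (homogM (h0 u) (a1 w))) // (homog_neq (j := false) (homogM (h1 u) (a0 w))) //.
rewrite addr0 add0r opprD addNKr; apply: (subspaceN s2); exact: Ip2_odd.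
Qed.

Lemma kappa' (x : G) : Ip 2 (tlift (fun u w : G => antipode (ev u) * ev w) (comul x) - counit x *: 1).
Proof.
have b1 : bilin (fun a b : G => antipode a * b).
  exact: (mul_bilin (mklin (@antipode_linear K G)) (idfun : {linear G -> G})).
have b2 : bilin (fun u w : G => antipode (ev u) * ev w) by exact: (mul_bilin Sev (ev : {linear G -> G})).
have -> : counit x *: 1 = ev (tlift (fun a b : G => antipode a * b) (comul x)).
  by rewrite antipodel linearZ /= homog1.
elim/tens_ind: (comul x) => [|u w y IH].
  by rewrite [tlift _ 0](linear_fun0 (tlift_linear b2)) [tlift _ 0](linear_fun0 (tlift_linear b1)) linear0 subrr; exact: s2.1.
rewrite -[u \ot w]scale1r (tlift_linear b2) (tlift_linear b1) !scale1r hcompD opprD addrACA.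
apply: (subspaceD s2) => //; rewrite !tlift_pure //.
rewrite -{2}(hcomp_sum u) -{2}(hcomp_sum w) [antipode (_ + _)]linearD /= mulrDl !mulrDr !hcompD.
have h0 (z : G) : homog false (ev z) by exact: homog_hcomp.
have h1 (z : G) : homog true (od z) by exact: homog_hcomp.
have a0 (z : G) : homog false (antipode (ev z)) by rewrite /homog -antipode_even h0.
have a1 (z : G) : homog true (antipode (od z)) by rewrite /homog -antipode_even h1.
rewrite (homogM (a0 _) (h0 _)) (homogM (a1 _) (h1 _)).
rewrite (homog_neq (j := false) (homogM (a0 u) (h1 w))) // (homog_neq (j := false) (homogM (a1 u) (h0 w))) //.
rewrite addr0 add0r opprD addNKr; apply: (subspaceN s2); exact: Ip2_odd.
Qed.

Definition omgen (x : G) := exists t : seq (G * G), Ip 2 (x - \sum_(p <- t) p.1 * omega p.2).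

Lemma omgen_sub : subspace omgen.
Proof.
split; first by exists [::]; rewrite big_nil subr0; exact: s2.1.
move=> c x y [s hs] [t ht]; exists ([seq (c *: p.1, p.2) | p <- s] ++ t).
rewrite big_cat big_map /= opprD addrACA; apply: (subspaceD s2) => //.
have -> : \sum_(p <- s) c *: p.1 * omega p.2 = c *: \sum_(p <- s) p.1 * omega p.2.
  by rewrite scaler_sumr; apply: eq_bigr => p _; rewrite scalerAl.
by rewrite -scalerBr; exact: (subspaceZ _ s2).
Qed.

(** Modulo [Ip 2], l is recovered as x_1 omega(x_2) from its coproduct, by [kappa]: the invariant
    forms generate all odd functions. *)
Lemma odd_omgen l : omgen (od l).
Proof.
have bO : bilin (fun u x : G => ev u * omega x).
  apply: (mul_bilin (ev : {linear G -> G}) (om \o (comul : {linear G -> tens G G}))).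
pose L : {linear tens G (tens G G) -> G} := mklin (tlift_linear (mul_bilin (ev : {linear G -> G}) om)).
have LE u y : L (u \ot y) = ev u * om y by apply: (@tlift_pure K G (tens G G)); exact: (mul_bilin (ev : {linear G -> G}) om).
have e1 : tlift (fun u x : G => ev u * omega x) (comul l) =
    tlift (fun u c => L (tlift (fun a b => a \ot (b \ot c)) (comul u))) (comul l).
  by rewrite comulA_apply; apply: eq_tlift => u v; rewrite LE.
have e2 (y : tens G G) c : L (tlift (fun a b => a \ot (b \ot c)) y) = tlift (fun a b : G => ev a * antipode (ev b)) y * od c.
  rewrite tlift_comp tliftMr; apply: eq_tlift => a b; by rewrite LE om_pure mulrA.
have e3 : Ip 2 (tlift (fun u x : G => ev u * omega x) (comul l) - od l).
  have -> : od l = tlift (fun u c : G => counit u *: od c) (comul l).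
    by rewrite -[l in LHS]counitl tlift_comp; apply: eq_tlift => u c; rewrite linearZ.
  have -> : tlift (fun u x : G => ev u * omega x) (comul l) =
      tlift (fun u c : G => tlift (fun a b : G => ev a * antipode (ev b)) (comul u) * od c) (comul l).
    by rewrite e1; apply: eq_tlift => u c; exact: e2.
  change (Ip 2 (\sum_(p <- repr (comul l)) tlift (fun a b : G => ev a * antipode (ev b)) (comul p.1) * od p.2
    - \sum_(p <- repr (comul l)) counit p.1 *: od p.2)).
  rewrite -sumrB; apply: (subspace_sum_seq s2) => p _.
  rewrite -[od p.2 in X in _ - X]mul1r scalerAl -mulrBl.
  by apply: Ip_mulr; exact: kappa.
exists [seq (ev p.1, p.2) | p <- repr (comul l)]; rewrite big_map -opprB.
by apply: (subspaceN s2).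
Qed.

(** Modulo [Ip 2] the form of a b factors as counit(a) omega(b), by [kappa']. *)
Lemma omega_dec (a b : G) : homog false a -> counit a = 0 -> homog true b -> Ip 2 (omega (a * b)).
Proof.
move=> ha a0 hb; rewrite omegaE comulM tmulE.
pose Ka (y : tens G G) : G := tlift (fun u w : G => antipode (ev u) * ev w) y.
have bK : bilin (fun u w : G => antipode (ev u) * ev w) by exact: (mul_bilin Sev (ev : {linear G -> G})).
suff key : Ip 2 (om (comul a * comul b) - Ka (comul a) * om (comul b)).
  rewrite -(subrK (Ka (comul a) * om (comul b)) (om _)); apply: (subspaceD s2) => //.
  by apply: Ip_mulr; have := kappa' a; rewrite a0 scale0r subr0.
have ca : homog false (comul a) by rewrite /homog -comul_even ha.
have cb : homog true (comul b) by rewrite /homog -comul_even hb.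
have KD x y : Ka (x + y) = Ka x + Ka y by exact: (linearD (mklin (tlift_linear bK))).
have omD x y : om (x + y) = om x + om y by exact: linearD.
move: (comul a) ca => x; elim/homog_tens_ind => [|i u w {}x hu hw IHx].
  have -> : Ka 0 = 0 by exact: (linear_fun0 (tlift_linear bK)).
  by rewrite !mul0r linear0 subrr; exact: s2.1.
rewrite KD !mulrDl omD opprD addrACA; apply: (subspaceD s2) => //.
move: (comul b) cb => y; elim/homog_tens_ind => [|j u' w' {}y hu' hw' IHy].
  by rewrite !mulr0 linear0 mulr0 subrr; exact: s2.1.
rewrite mulrDr !omD mulrDr opprD addrACA; apply: (subspaceD s2) => //.
rewrite (tensM_hom _ _ hw hu') [om (_ *: _)]linearZ !om_pure /Ka tlift_pure //.
case: i hu hw => /= hu hw.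
  rewrite (homog_neq (j := false) hw) // mulr0 mul0r subr0; apply: (subspaceZ _ s2).
  case: j hu' hw' => /= hu' hw'.
    rewrite (homogM hu hu') antipodeM -mulrA; apply: (@IpM K G 1 1).
      by apply: Ip_odd; rewrite /homog -antipode_even hu.
    by apply: Ip_mulr; apply: Ip_odd; rewrite /homog -antipode_even hu'.
  by rewrite (homog_neq (j := false) (homogM hu hu')) // linear0 mul0r; exact: s2.1.
case: j hu' hw' => /= hu' hw'; rewrite expr0 scale1r.
  rewrite (homog_neq (j := false) (homogM hu hu')) // (homog_neq (j := true) hw') // linear0 mul0r !mulr0 subrr.
  exact: s2.1.
rewrite (homogM hu hu') (homogM hw hw') hu hw hu' hw' antipodeM.
have -> : antipode u * antipode u' * (w * w') = antipode u * w * (antipode u' * w').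
  by rewrite -!mulrA; congr (_ * _); rewrite !mulrA; congr (_ * _); rewrite (evenC _ hw).
by rewrite subrr; exact: s2.1.
Qed.

(** The augmentation ideal of the even part times the odd part. Functionals on the odd part that
    vanish on it give odd derivations ([gen2_lie]), while [omega] of it is negligible
    ([gen2_omega]). *)
Definition gen2 (x : G) := exists s : seq (G * G),
  (forall p, p \in s -> [/\ homog false p.1, counit p.1 = 0 & homog true p.2]) /\ x = \sum_(p <- s) p.1 * p.2.
Lemma gen2_sub : subspace gen2.
Proof.
split; first by exists [::]; rewrite big_nil.
move=> c x y [s [sP ->]] [t [tP ->]]; exists ([seq (p.1, c *: p.2) | p <- s] ++ t); split.
  move=> p; rewrite mem_cat => /orP[/mapP[q /sP [q1 q2 q3] ->]|/tP //].
  by split=> //; exact: homogZ.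
rewrite big_cat big_map scaler_sumr; congr (_ + _); apply: eq_bigr => p _ /=.
by rewrite scalerAr.
Qed.
Lemma gen2_in (a b : G) : homog false a -> counit a = 0 -> homog true b -> gen2 (a * b).
Proof. by move=> *; exists [:: (a, b)]; rewrite big_seq1; split=> // p; rewrite inE => /eqP ->. Qed.
Lemma gen2_omega x : gen2 x -> Ip 2 (omega x).
Proof.
move=> [t [tP ->]].
have -> : omega (\sum_(p <- t) p.1 * p.2) = \sum_(p <- t) omega (p.1 * p.2).
  by rewrite omegaE !linear_sum.
by apply: (subspace_sum_seq s2) => p /tP [? ? ?]; exact: omega_dec.
Qed.

Lemma gen2_lie (f : {scalar G}) : (forall x, gen2 x -> f x = 0) ->
  exists v : {scalar G}, lie_odd v /\ forall x, v x = f (od x).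
Proof.
move=> f0; exists (scomp f (od : {linear G -> G})); split=> //; split=> [c x y|x|a b].
- exact: linearP.
- by rewrite /= hcomp_hcomp /= linear0.
have h0 (z : G) : homog false (ev z) by exact: homog_hcomp.
have h1 (z : G) : homog true (od z) by exact: homog_hcomp.
have red (c d : G) : f (ev c * od d) = counit c * f (od d).
  have : gen2 ((ev c - counit c *: 1) * od d).
    apply: gen2_in => //.
      by rewrite /homog hcompD [hcomp _ (- _)]linearN /= hcompZ homog1 h0.
    by rewrite linearB /= scalarZ /= counit1 mulr1 counit_hcomp subrr.
  move=> /f0; rewrite mulrBl linearB /= -scalerAl mul1r scalarZ /= => /eqP.
  by rewrite subr_eq0 => /eqP.
rewrite /= -{1}(hcomp_sum a) -{1}(hcomp_sum b) mulrDl !mulrDr !hcompD.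
rewrite (homogM (h0 a) (h1 b)) (homogM (h1 a) (h0 b)).
rewrite (homog_neq (j := true) (homogM (h0 a) (h0 b))) // (homog_neq (j := true) (homogM (h1 a) (h1 b))) //.
rewrite add0r addr0 -(evenC (od a) (h0 b)) linearD /= !red.
by rewrite addrC [X in X + _ = _]mulrC.
Qed.

Lemma Rv_Ip (v : {scalar G}) k x : lie_odd v -> Ip k.+1 x -> Ip k (cr v (comul x)).
Proof.
move=> hv; elim: k x => [//|k IH] x [t [tP ->]].
rewrite !linear_sum; apply: (subspace_sum_seq (@Ip_sub K G k.+1)) => p /tP [p1 p2].
change (Ip k.+1 (cr v (comul (p.1 * p.2)))); rewrite Rv_mul //.
apply: (subspaceD (@Ip_sub K G k.+1)).
  by apply: Ip_mul; exact: Ip_tw.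
by apply: Ip_in => //; exact: IH.
Qed.

Lemma Rv_mon (v : {scalar G}) (S : seq G) k x : lie_odd v ->
  (forall y, y \in S -> homog true y) -> (forall y, y \in S -> Ip 1 (cr v (comul y))) ->
  mon S k x -> Ip k (cr v (comul x)).
Proof.
move=> hv hS vS; elim: k x => [//|k IH] x [t [tP ->]].
rewrite !linear_sum; apply: (subspace_sum_seq (@Ip_sub K G k.+1)) => p /tP [p1 p2].
change (Ip k.+1 (cr v (comul (p.1 * p.2)))); rewrite Rv_mul //.
apply: (subspaceD (@Ip_sub K G k.+1)).
  rewrite -add1n; apply: IpM; first exact: vS.
  by apply: Ip_tw; exact: (mon_Ip hS p2).
by apply: Ip_in; [exact: hS|exact: IH].
Qed.

Definition dec (ys : seq G) k (x : G) := exists m r, [/\ mon ys k m, Ip k.+1 r & x = m + r].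

Lemma dec_sub ys k : (forall y, y \in ys -> homog true y) -> subspace (dec ys k).
Proof.
move=> hys; have sm := mon_sub k hys; have si := @Ip_sub K G k.+1.
split; first by exists 0, 0; rewrite addr0; split=> //; [exact: sm.1|exact: si.1].
move=> c x y [m [r [hm hr ->]]] [m' [r' [hm' hr' ->]]]; exists (c *: m + m'), (c *: r + r').
by split; [exact: sm.2|exact: si.2|rewrite scalerDr addrACA].
Qed.

(** If [xs] spans the odd part modulo [gen2], the forms omega(x) generate the odd ideal modulo its
    square; multiply k of them. *)
Lemma dec_all (xs : seq G) : (forall x, x \in xs -> homog true x) ->
  (forall x, spn gen2 xs (od x)) -> forall k x, Ip k x -> dec [seq omega x | x <- xs] k x.
Proof.
move=> hxs spx; set ys := [seq omega x | x <- xs].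
have hys y : y \in ys -> homog true y by move=> /mapP[p _ ->]; exact: om_homog.
have dom x : dec ys 1 (omega x).
  rewrite omega_od; apply: (spn_le (Q := fun z => dec ys 1 (omega z))) (spx x) => [|z hz|y yx].
  - split; first by rewrite omegaE !linear0; exact: (dec_sub 1 hys).1.
    by move=> c a b ha hb; rewrite omegaD omegaZ; exact: (dec_sub 1 hys).2.
  - by exists 0, (omega z); rewrite add0r; split=> //; [exact: (mon_sub 1 hys).1|exact: gen2_omega].
  exists (omega y), 0; rewrite addr0; split=> //; last exact: (@Ip_sub K G 2).1.
  by rewrite -[omega y]mulr1; apply: mon_in => //; exact: map_f.
have d1 x : dec ys 1 (od x).
  have [t ht] := odd_omgen x.
  rewrite -(subrK (\sum_(p <- t) p.1 * omega p.2) (od x)); apply: (subspaceD (dec_sub 1 hys)).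
    by exists 0, (od x - \sum_(p <- t) p.1 * omega p.2); rewrite add0r; split=> //; exact: (mon_sub 1 hys).1.
  apply: (subspace_sum_seq (dec_sub 1 hys)) => p _; have [m [r [hm hr ->]]] := dom p.2.
  by exists (p.1 * m), (p.1 * r); rewrite mulrDr; split=> //; [exact: mon_mul|exact: Ip_mul].
elim=> [|k IH] x; first by exists x, 0; rewrite addr0; split=> //; exact: (@Ip_sub K G 1).1.
move=> [t [tP ->]]; apply: (subspace_sum_seq (dec_sub k.+1 hys)) => p /tP [p1 p2].
have [m [r [[u [uP me]] hr pe]]] := d1 p.1; rewrite -p1 pe me mulrDl.
apply: (subspaceD (dec_sub k.+1 hys)); last first.
  exists 0, (r * p.2); rewrite add0r; split=> //; first exact: (mon_sub k.+1 hys).1.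
  exact: (@IpM K G 2 k).
rewrite mulr_suml; apply: (subspace_sum_seq (dec_sub k.+1 hys)) => w /uP [w1 _].
rewrite -mulrA; have [m' [r' [hm' hr' ->]]] := IH (w.2 * p.2) (Ip_mul _ p2).
exists (w.1 * m'), (w.1 * r'); rewrite mulrDr; split=> //; first exact: mon_in.
by apply: Ip_in => //; exact: hys.
Qed.

(** Write l as a + omega(x) b plus higher terms. The derivation dual to x is 1 on omega(x) and 0 on
    the other forms, modulo the odd ideal; applied to l it returns b up to sign, so b lies one power
    deeper. Thus omega(x) b joins the remainder and x leaves the list. *)
Lemma dagger_tri k (t : seq (G * {scalar G})) : tri gen2 t ->
  (forall y, y \in [seq p.1 | p <- t] -> homog true y) ->
  forall l, dec [seq omega x | x <- [seq p.1 | p <- t]] k.+1 l ->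
    (forall v : {scalar G}, lie_odd v -> Ip k.+1 (cr v (comul l))) -> Ip k.+2 l.
Proof.
elim: t => [|[x f] t IH].
  move=> _ _ l [m [r [hm hr ->]]] _.
  by rewrite (mon_nil hK _ _ hm) // add0r.
move=> [fx ft tt] ht l [m [r [hm hr ->]]] hl.
have hx : homog true x by apply: ht; rewrite mem_head.
have ht' y : y \in [seq p.1 | p <- t] -> homog true y by move=> h; apply: ht; rewrite inE h orbT.
set S := [seq omega x | x <- [seq p.1 | p <- t]] in IH.
have hS y : y \in S -> homog true y by move=> /mapP[p _ ->]; exact: om_homog.
have [v [hv ve]] : exists v : {scalar G}, lie_odd v /\ forall x, v x = f (od x).
  by apply: gen2_lie => z hz; apply: ft; exact: spn_base.
have vS y : y \in S -> Ip 1 (cr v (comul y)).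
  move=> /mapP[z zt ->]; apply/pi_Ip; rewrite Rv_omega // ve (ht' _ zt) ft ?scale0r //.
  exact: (spn_in gen2_sub).
have [a [b [ha hb me]]] := mon_cons hK (om_homog _ : homog true (omega x)) hS hm.
have si j := @Ip_sub K G j.
have RD (y z : G) : cr v (comul (y + z)) = cr v (comul y) + cr v (comul z).
  by rewrite [comul _]linearD crD.
have vy : Ip 1 (cr v (comul (omega x)) - 1).
  apply/pi_Ip; transitivity (pi (cr v (comul (omega x))) - pi 1); first exact: rmorphB.
  by rewrite Rv_omega // ve hx fx scale1r rmorph1 subrr.
have hbI : Ip k.+1 b.
  rewrite -(tw1K b); apply: Ip_tw.
  have e : cr v (comul (m + r)) = cr v (comul a) + cr v (comul r) + omega x * cr v (comul b)
      + (cr v (comul (omega x)) - 1) * tw1 b + tw1 b.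
    rewrite me !RD Rv_mul // mulrBl mul1r -[RHS]addrA subrK -!addrA; congr (_ + _).
    by rewrite addrCA [RHS]addrCA; congr (_ + _); rewrite addrC.
  set O := (X in X + tw1 b) in e.
  have hO : Ip k.+1 O.
    apply: (subspaceD (si _)); last by apply: (@IpM K G 1 k) => //; apply: Ip_tw; exact: (mon_Ip hS hb).
    apply: (subspaceD (si _)); last by apply: Ip_in; [exact: om_homog|exact: (Rv_mon hv hS vS hb)].
    by apply: (subspaceD (si _)); [exact: (Rv_mon hv hS vS ha)|exact: (Rv_Ip hv hr)].
  have -> : tw1 b = cr v (comul (m + r)) - O by rewrite [RHS]addrC e addKr.
  by apply: (subspaceB (si _)) => //; exact: hl.
apply: (IH tt ht') => //; exists a, (r + omega x * b); split=> //.
  by apply: (subspaceD (si _)) => //; apply: Ip_in => //; exact: om_homog.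
by rewrite me -addrA; congr (_ + _); rewrite addrC.
Qed.

(** Choose odd generators that are triangular modulo [gen2]. Their forms generate, and the dual odd
    derivations peel them off one by one. *)
Theorem dagger k l : Ip k.+1 l -> (forall v : {scalar G}, lie_odd v -> Ip k.+1 (cr v (comul l))) ->
  Ip k.+2 l.
Proof.
have [gs [hgs gsm]] := odd_gens nG.
have [t [tt tspn tgs]] := tri_basis gen2_sub gs.
have spx (x : G) : spn gen2 gs (od x).
  have [u [uP e]] : mon gs 1 (od x) by apply: gsm; apply: Ip_odd; exact: homog_hcomp.
  have ss := spn_subspace gs gen2_sub.
  rewrite -(homog_hcomp true x : od (od x) = _) e linear_sum; apply: (subspace_sum_seq ss) => p /uP [p1 _].
  have hp := hgs _ p1.
  rewrite /= (hcompMl _ _ hp) /= -(evenC p.1 (homog_hcomp false p.2)).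
  rewrite -[hcomp _ _](subrK (counit p.2 *: 1)) mulrDl -scalerAl mul1r.
  apply: (subspaceD ss); last by apply: (subspaceZ _ ss); exact: (spn_in gen2_sub).
  apply: spn_base; apply: gen2_in => //.
    by rewrite /homog hcompD [hcomp _ (- _)]linearN /= hcompZ homog1 homog_hcomp.
  by rewrite linearB /= scalarZ /= counit1 mulr1 counit_hcomp subrr.
have hxs y : y \in [seq p.1 | p <- t] -> homog true y by move=> /tgs /hgs.
move=> hl; apply: (dagger_tri tt hxs).
by apply: (dec_all hxs) hl => x; exact: tspn.
Qed.
End Dagger.

(** * The multiplicative part of the center of the even part is central in G *)

Section StepA.
Variables (K L : fieldType) (iota : {rmorphism K -> L}) (hK : 2%N \notin [pchar K]).
Variables (G : supergroupType K) (nG : noeth G) (E : closedSub G) (hE : is_even_part E).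
Variables (F : closedSub E) (cF : central_sub F) (mF : mult_type iota F) (rF : sub_ker_rho F).
Notation pi := (cres E).
Let q : superhom G F := superhom_comp (cres F) (cres E).

Lemma q_hopf : hopf_hom q.
Proof. exact: (hopf_comp (cres_hopf F) (cres_hopf E)). Qed.

Let T := tens (tens E G) F.
Let p1 : superhom G T := superhom_comp (superhom_comp (in1 (tens E G) F) (in1 E G)) pi.
Let p2 : superhom G T := superhom_comp (in1 (tens E G) F) (in2 E G).
Let p3 : superhom G T := superhom_comp (in2 (tens E G) F) q.

(** Conjugating xy by F leaves x unchanged for x in E, because F is central in E. *)
Lemma conj_split a : superhom_comp (stens (superhom_comp (stens pi (idS G)) (comulS G)) (idS F)) (adq q) a =
  tlift (fun x y => in1 (tens E G) F (in1 E G (pi x)) * stens (in2 E G) (idS F) (adq q y)) (comul a).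
Proof.
have e1 : superhom_comp (stens (superhom_comp (stens pi (idS G)) (comulS G)) (idS F)) (adq q) =
    pconj (pmul p1 p2) p3.
  have ex : superhom_comp (in1 (tens E G) F) (superhom_comp (stens pi (idS G)) (comulS G)) = pmul p1 p2.
    rewrite superhom_compA /pmul; congr (superhom_comp _ _).
    apply: sprod_unique; rewrite -superhom_compA ?stens_in1 ?stens_in2 ?sprod_in1 ?sprod_in2 superhom_compA //.
    by rewrite superhom_comp1.
  transitivity (pconj (superhom_comp (in1 (tens E G) F) (superhom_comp (stens pi (idS G)) (comulS G)))
     (superhom_comp (superhom_comp (in2 (tens E G) F) (idS F)) q)); first exact: sprod_adq.
  by rewrite ex superhom_comp1.
have c13 : pmul p1 p3 = pmul p3 p1.
  have -> : p1 = superhom_comp (superhom_comp (in1 (tens E G) F) (in1 E G)) pi by [].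
  have -> : p3 = superhom_comp (superhom_comp (in2 (tens E G) F) (cres F)) pi.
    by rewrite /p3 /q superhom_compA.
  rewrite -!(hopf_pmul (cres_hopf E)); congr (superhom_comp _ _).
  by symmetry; apply: (central_subP _ cF); exact: pt_in_cres.
have e2 : pconj (pmul p1 p2) p3 = pmul p1 (pconj p2 p3).
  have cV : pmul (pinv p3) p1 = pmul p1 (pinv p3).
    by apply: (@pmul_injl K G T p3); rewrite pmulKVl pmulA -c13 pmulKr.
  by rewrite /pconj !pmulA cV.
rewrite e1 e2 pmul_tlift; apply: eq_tlift => x y; congr (_ * _).
transitivity (pconj (superhom_comp (in1 (tens E G) F) (in2 E G))
   (superhom_comp (superhom_comp (in2 (tens E G) F) (idS F)) q) y); first by rewrite superhom_comp1.
by rewrite -sprod_adq.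
Qed.

Lemma ker_rho_cl (v : {scalar G}) a : lie_odd v -> cl v (adq q a) = v a *: 1.
Proof.
move=> hv; have [evF _ _] := mF.
have := rF (R := F) (g := cres F) evF _ hv a.
rewrite (adq_tlift q_hopf _ evF) => <-; last first.
  by exists (idS F).
rewrite tlift_comp; apply: eq_tlift => x y; rewrite tlift_comp; apply: eq_tlift => u w.
rewrite -[LHS]/(cl v (u \ot (q (antipode x) * q w))) cl_pure; congr (_ *: (_ * _)).
by congr (cres F _); exact: (hopf_antipode (cres_hopf E)).
Qed.

Lemma pi_adq (f : {scalar F}) a : pi (cr f (adq q a)) = f 1 *: pi a.
Proof.
rewrite -(cr_tmap (g := idS F) pi (h := f) (h' := f)) // -stensE.
have -> : stens pi (idS F) (adq q a) = in1 E F (pi a); last by rewrite in1E cr_pure.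
rewrite -[LHS]/(superhom_comp _ (adq q) a) sprod_adq superhom_comp1 pconj_fix //.
have -> : superhom_comp (in2 E F) q = superhom_comp (superhom_comp (in2 E F) (cres F)) pi.
  by rewrite /q superhom_compA.
rewrite -!(hopf_pmul (cres_hopf E)); congr (superhom_comp _ _).
by symmetry; apply: (central_subP _ cF); exact: pt_in_cres.
Qed.

(** Contract [conj_split] by v and f. As F fixes v ([ker_rho_cl]), the second factor contributes a
    multiple of f(1) = 0. *)
Lemma pi_Rv_adq (v : {scalar G}) (f : {scalar F}) a : lie_odd v -> f 1 = 0 ->
  pi (cr v (comul (cr f (adq q a)))) = 0.
Proof.
move=> hv f1.
pose LL : {linear T -> E} := (cr v : {linear tens E G -> E}) \o (cr f : {linear T -> tens E G}).
have := congr1 LL (conj_split a).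
have -> : LL (superhom_comp (stens (superhom_comp (stens pi (idS G)) (comulS G)) (idS F)) (adq q) a) =
    pi (cr v (comul (cr f (adq q a)))).
  rewrite -[LHS]/(cr v (cr f (stens (superhom_comp (stens pi (idS G)) (comulS G)) (idS F) (adq q a)))).
  rewrite stensE (cr_tmap (g := idS F) _ (h := f) (h' := f)) //.
  change (cr v (stens pi (idS G) (comul (cr f (adq q a)))) = pi (cr v (comul (cr f (adq q a))))); rewrite stensE.
  by rewrite (cr_tmap (g := idS G) pi (h := v) (h' := v)).
move=> ->; rewrite tlift_comp.
transitivity (tlift (fun _ _ : G => (0 : E)) (comul a)); last first.
  by rewrite /tlift /teval big1.
apply: eq_tlift => x y.
have key (w : tens G F) : LL (in1 (tens E G) F (in1 E G (pi x)) * stens (in2 E G) (idS F) w) = f (cl v w) *: pi x.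
  elim/tens_ind: w => [|u d w IH]; first by rewrite !linear0 mulr0 linear0 ?scale0r.
  rewrite [stens _ _ (_ + _)]linearD mulrDr [LL (_ + _)]linearD IH clD [f (_ + _)]linearD scalerDl; congr (_ + _).
  transitivity (LL (((pi x \ot 1) \ot 1 : T) * ((1 \ot u) \ot d))).
    by congr (LL (_ * _)); exact: stens_pure.
  rewrite tensMl1 tensM_in12.
  rewrite -[LL _]/(cr v (cr f ((pi x \ot u) \ot d))) cr_pure crZ cr_pure cl_pure scalerA.
  by rewrite scalarZ /= mulrC.
by rewrite key ker_rho_cl // scalarZ /= f1 mulr0 scale0r.
Qed.

Lemma stepA_Ip2 (f : {scalar F}) a : f 1 = 0 -> Ip 2 (cr f (adq q a)).
Proof.
move=> f1; apply: (dagger hK nG hE (k := 0)) => [|v hv]; apply/(pi_Ip hE).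
  by rewrite pi_adq f1 scale0r.
exact: pi_Rv_adq.
Qed.

Lemma stab_Ip k : stab (adq q) (@Ip K G k).
Proof.
elim: k => [//|k IH] f x [t [tP ->]]; have sI := @Ip_sub K G k.+1.
change (Ip k.+1 (cr f (adq q (\sum_(p <- t) p.1 * p.2)))).
have -> : cr f (adq q (\sum_(p <- t) p.1 * p.2)) = \sum_(p <- t) cr f (adq q (p.1 * p.2)).
  exact: (linear_sum ((cr f : {linear tens G F -> G}) \o adq q : {linear G -> G})).
apply: (subspace_sum_seq sI) => p /tP [a1 a2].
rewrite [adq q _]rmorphM.
have h1 (g : {scalar F}) : Ip 1 (cr g (adq q p.1)).
  by apply/(pi_Ip hE); rewrite pi_adq (pi_Ip hE _).2 ?scaler0 //; exact: Ip_odd.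
have [s sP es] := tens_meml (@Ip_sub K G 1) h1.
have [s' sP' es'] := tens_meml (@Ip_sub K G k) (fun g => IH g _ a2).
suff : Ip k.+1 (cr f ((\sum_(p <- s) p.1 \ot p.2) * (\sum_(p <- s') p.1 \ot p.2))) by rewrite -es -es'.
rewrite (tens_mull_sum _ erefl) linear_sum; apply: (subspace_sum_seq sI) => u /sP hu.
rewrite /= (tens_mulr_sum _ erefl) linear_sum; apply: (subspace_sum_seq sI) => w /sP' hw.
by apply: cr_mul => // j; apply: (@IpM K G 1 k) => //; exact: Ip_hcomp.
Qed.

(** In degree 0, F acts trivially on K[E]. In degree 1, one contraction leads into [Ip 2], by
    [dagger]. Higher powers follow by multiplicativity ([filt_mul]). *)
Lemma stepA_filt k a : Ip k a -> filt (adq q) (@Ip K G k.+1) k.+1 a.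
Proof.
elim: k a => [|k IH] a.
  by move=> _ f f1; apply: Ip_mono1; exact: stepA_Ip2.
move=> [t [tP ->]]; apply: (subspace_sum_seq (filt_sub _ _ (@Ip_sub K G k.+2))) => p /tP [a1 a2].
rewrite -(add1n k.+1).
apply: (@filt_mul K G F (adq q) (@Ip K G 1) (@Ip K G 2) (@Ip K G k) (@Ip K G k.+1)) => //.
all: try exact: Ip_sub.
all: try exact: stab_Ip.
all: try by move=> *; exact: Ip_hcomp.
- by move=> x y hx hy; exact: (@IpM K G 2 k).
- by move=> x y hx hy; exact: (@IpM K G 1 k.+1).
- exact: adq_counit q_hopf.
- exact: Ip_odd.
- by move=> f f1; exact: stepA_Ip2.
- exact: IH.
Qed.

(** The odd ideal is nilpotent, so F acts unipotently on all of K[G]; its coefficients are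
    conilpotent, hence scalars by [mult_conil]. *)
Lemma adq_triv a : adq q a = a \ot 1.
Proof.
have [N hN] := odd_nilpotent hK nG.
have [n hn] : exists n, filt (adq q) (@Ip K G N) n a.
  elim: N {hN} => [|N [n hn]]; first by exists 0%N.
  exists (n + N.+1)%N; apply: filt_filt; apply: filt_le hn; exact: stepA_filt.
apply: tens_clP => h; rewrite cl_pure.
have := filt_coef (adq_coassoc q_hopf) h (filt_le hN hn).
move=> hc; rewrite (mult_conil mF (ex_intro _ n hc)); congr (_ *: _).
by rewrite -cl_cr (adq_counit q_hopf).
Qed.

Theorem stepA : central_sub (sub_trans F).
Proof.
move=> R n g [n0 hn] a.
have e : n = superhom_comp n0 q by apply: shomP => x; exact: hn.
rewrite -!pmulE; suff -> : pmul n g = pmul g n by [].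
symmetry; apply: pconj_fixV; rewrite e -sprod_adq; apply: shomP => x.
by rewrite -[LHS]/(sprod g n0 (adq q x)) adq_triv sprod_pure rmorph1 mulr1.
Qed.
End StepA.

(** * Krull intersection for commutative Hopf algebras without idempotents *)

Lemma counit_antipode (K : fieldType) (G : supergroupType K) (a : G) : counit (antipode a) = counit a.
Proof.
have := congr1 (fun g : superhom G G => counit (g a)) (pinv1 G G).
rewrite -[LHS]/(counit (punit G G (antipode a))) !punitE !scalarZ /= counit1 !mulr1.
by [].
Qed.

Lemma cr_eq0 (K : fieldType) (U V : lmodType K) (f : {scalar V}) (y : tens U V) :
  (forall v, f v = 0) -> cr f y = 0.
Proof. by move=> f0; apply: dual_eq => h; rewrite cl_cr f0 linear0. Qed.

Section BilDesc.
Variables (K : fieldType) (A : superAlgType K) (P Q : superideal A).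
(** Such a bilinear map descends to the two quotients; the tensor becomes zero there, as all its
    contractions do. *)
Lemma bil_desc (W : lmodType K) (b : A -> A -> W) (y : tens A A) : bilin b ->
  (forall u v, P u -> b u v = 0) -> (forall u v, Q v -> b u v = 0) ->
  (forall f : {scalar A}, (forall x, Q x -> f x = 0) -> P (cr f y)) -> tlift b y = 0.
Proof.
move=> bb bP bQ hy.
have bDl u u' v : b (u + u') v = b u v + b u' v by rewrite -[u]scale1r bb.1 !scale1r.
have bDr u v v' : b u (v + v') = b u v + b u v' by rewrite -[v]scale1r bb.2 !scale1r.
have e u v : b (repr (spi P u)) (repr (spi Q v)) = b u v.
  rewrite -(subrK u (repr (spi P u))) -(subrK v (repr (spi Q v))) bDl bP ?add0r; last exact: repr_qpi.
  by rewrite bDr bQ ?add0r //; exact: repr_qpi.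
pose b' (x : squot P) (z : squot Q) := b (repr x) (repr z).
have bb' : bilin b'.
  split=> [z c x x'|x c z z'].
    have [u <-] := spi_surj x; have [u' <-] := spi_surj x'; have [v <-] := spi_surj z.
    have -> : c *: spi P u + spi P u' = spi P (c *: u + u') by rewrite [RHS]linearP.
    by rewrite /b' !e bb.1.
  have [u <-] := spi_surj z; have [u' <-] := spi_surj z'; have [v <-] := spi_surj x.
  have -> : c *: spi Q u + spi Q u' = spi Q (c *: u + u') by rewrite [RHS]linearP.
  by rewrite /b' !e bb.2.
transitivity (tlift b' (tmap (spi P) (spi Q) y)).
  by rewrite tlift_tmap //; apply: eq_tlift => u v; rewrite /b' e.
suff -> : tmap (spi P) (spi Q) y = 0 by exact: (linear_fun0 (tlift_linear bb')).
apply: tens_cr0 => h; rewrite (cr_tmap (spi P) (h' := scomp h (spi Q))) //.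
by apply/spi0; apply: hy => x /spi0 hx; change (h (spi Q x) = 0); rewrite hx linear0.
Qed.
End BilDesc.

Section Krull.
Variables (K : fieldType) (D : supergroupType K) (evD : purely_even D).

Lemma evh (x : D) : homog false x.
Proof. exact: even_id. Qed.
Lemma evmC (x y : D) : x * y = y * x.
Proof. by apply: evenC; exact: evh. Qed.

(** The k-th power of the augmentation ideal m; [zN] is the intersection of all of them. *)
Fixpoint Np k (x : D) : Prop := if k is k'.+1 then
    exists t : seq (D * D), (forall p, p \in t -> counit p.1 = 0 /\ Np k' p.2) /\
      x = \sum_(p <- t) p.1 * p.2
  else True.

Lemma Np_sub k : subspace (Np k).
Proof.
case: k => [//|k]; split; first by exists [::]; rewrite big_nil.
move=> c x y [s [sP ->]] [t [tP ->]].
exists ([seq (c *: p.1, p.2) | p <- s] ++ t); split.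
  move=> p; rewrite mem_cat => /orP[/mapP[q /sP [q1 q2] ->]|/tP //].
  by rewrite /= scalarZ /= q1 mulr0.
rewrite big_cat big_map scaler_sumr; congr (_ + _); apply: eq_bigr => p _ /=.
by rewrite scalerAl.
Qed.
Lemma Np_in k (a b : D) : counit a = 0 -> Np k b -> Np k.+1 (a * b).
Proof. by move=> ha hb; exists [:: (a, b)]; rewrite big_seq1; split=> // p; rewrite inE => /eqP ->. Qed.
Lemma Np_mul k (a x : D) : Np k x -> Np k (a * x).
Proof.
case: k => [//|k] [t [tP ->]]; rewrite mulr_sumr.
apply: (subspace_sum_seq (Np_sub k.+1)) => p /tP [p1 p2].
by rewrite mulrA; apply: Np_in => //; rewrite counitM p1 mulr0.
Qed.
Lemma Np_antipode k x : Np k x -> Np k (antipode x).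
Proof.
elim: k x => [//|k IH] x [t [tP ->]]; rewrite linear_sum.
apply: (subspace_sum_seq (Np_sub k.+1)) => p /tP [p1 p2] /=; rewrite antipodeM.
by apply: Np_in; [rewrite counit_antipode|exact: IH].
Qed.
Lemma Np1P x : Np 1 x <-> counit x = 0.
Proof.
split=> [[t [tP ->]]|h]; last by rewrite -[x]mulr1; exact: Np_in.
by rewrite linear_sum big_seq big1 // => p /tP [p1 _] /=; rewrite counitM p1 mul0r.
Qed.
Lemma NpM k l x y : Np k x -> Np l y -> Np (k + l) (x * y).
Proof.
elim: k x => [|k IH] x; first by move=> _; exact: Np_mul.
move=> [t [tP ->]] hy; rewrite mulr_suml.
apply: (subspace_sum_seq (Np_sub _)) => p /tP [p1 p2].
by rewrite -mulrA; apply: Np_in => //; exact: IH.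
Qed.
Lemma Np_hcomp k i x : Np k x -> Np k (hcomp i x).
Proof. by case: i => h; [rewrite evD; exact: (Np_sub k).1|rewrite evh]. Qed.

Definition zN x := forall k, Np k x.
Lemma zN_sub : subspace zN.
Proof. by split=> [k|c x y hx hy k]; [exact: (Np_sub k).1|exact: (Np_sub k).2]. Qed.
Lemma zN_mul a x : zN x -> zN (a * x).
Proof. by move=> h k; exact: Np_mul. Qed.
Lemma zN_hcomp i x : zN x -> zN (hcomp i x).
Proof. by move=> h k; exact: Np_hcomp. Qed.
Lemma zN1 : ~ zN 1.
Proof. by move/(_ 1%N)/Np1P; rewrite counit1 => /eqP; rewrite oner_eq0. Qed.

Lemma monE_sub (S : seq D) k : subspace (mon S k).
Proof.
elim: k => [//|k IH]; split; first by exists [::]; rewrite big_nil.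
move=> c x y [s [sP ->]] [t [tP ->]].
exists ([seq (p.1, c *: p.2) | p <- s] ++ t); split.
  move=> p; rewrite mem_cat => /orP[/mapP[q /sP [q1 q2] ->]|/tP //].
  by split=> //; exact: subspaceZ.
rewrite big_cat big_map scaler_sumr; congr (_ + _); apply: eq_bigr => p _ /=.
by rewrite scalerAr.
Qed.
Lemma monE_mul (S : seq D) k a x : mon S k x -> mon S k (a * x).
Proof.
elim: k a x => [//|k IH] a x [t [tP ->]]; rewrite mulr_sumr.
apply: (subspace_sum_seq (monE_sub S k.+1)) => p /tP [p1 p2].
by rewrite mulrA (evmC a) -mulrA; apply: mon_in => //; exact: IH.
Qed.
(** Among a + b factors either a equal y or b come from the rest of the list. *)
Lemma mon_split y (S : seq D) n x : mon (y :: S) n x -> forall a b, (a + b <= n)%N ->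
  exists c d, mon S b d /\ x = y ^+ a * c + d.
Proof.
elim: n x => [|n IH] x.
  move=> _ [|a] [|b] //; exists x, 0; by rewrite expr0 mul1r addr0.
move=> [t [tP ->]] [|a] b.
  by exists (\sum_(p <- t) p.1 * p.2), 0; rewrite expr0 mul1r addr0; split=> //; exact: (monE_sub S b).1.
case: b => [|b] hab; first by exists 0, (\sum_(p <- t) p.1 * p.2); rewrite mulr0 add0r.
have sP : subspace (fun x => exists c d, mon S b.+1 d /\ x = y ^+ a.+1 * c + d).
  split; first by exists 0, 0; rewrite mulr0 addr0; split=> //; exact: (monE_sub S b.+1).1.
  move=> k u v [c [d [hd ->]]] [c' [d' [hd' ->]]]; exists (k *: c + c'), (k *: d + d').
  split; first exact: (monE_sub S b.+1).2.
  by rewrite scalerDr mulrDr -scalerAr addrACA.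
apply: (subspace_sum_seq sP) => p /tP [p1 p2].
have h1 : (a + b.+1 <= n)%N by move: hab; rewrite addSn ltnS.
have h2 : (a.+1 + b <= n)%N by rewrite addSnnS.
move: p1; rewrite inE => /orP[/eqP ->|ps].
  have [c [d [hd ->]]] := IH _ p2 _ _ h1; exists c, (y * d); split; first exact: monE_mul.
  by rewrite mulrDr mulrA -exprS.
have [c [d [hd ->]]] := IH _ p2 _ _ h2; exists (p.1 * c), (p.1 * d); split; first exact: mon_in.
by rewrite mulrDr mulrA (evmC p.1) -mulrA.
Qed.
Lemma mon_pigeon (M : D -> Prop) (S : seq D) : subspace M -> (forall a x, M x -> M (a * x)) ->
  (forall y, y \in S -> exists m, M (y ^+ m)) -> exists k, forall x, mon S k x -> M x.
Proof.
move=> sM mM; elim: S => [|y S IH] hS.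
  exists 1%N => x [t [tP ->]]; rewrite big_seq big1 => [|p /tP [] //]; exact: sM.1.
have [|k hk] := IH; first by move=> z zS; apply: hS; rewrite inE zS orbT.
have [m hm] := hS y (mem_head _ _); exists (m + k)%N => x /mon_split /(_ m k (leqnn _)) [c [d [hd ->]]].
by apply: (subspaceD sM); [rewrite evmC; exact: mM|exact: hk].
Qed.

Section Noeth.
Hypothesis nD : noeth D.

Lemma Np_gens : exists S : seq D, (forall y, y \in S -> counit y = 0) /\ forall k x, Np k x -> mon S k x.
Proof.
have [S SI Sg] : exists2 s : seq D, (forall x, x \in s -> Np 1 x) & (forall x, Np 1 x -> lgen (fun=> True) s x).
  by apply: nD; split=> // [|a x _|i a]; [exact: Np_sub|exact: Np_mul|exact: Np_hcomp].
exists S; split; first by move=> y /SI /Np1P.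
elim=> [//|k IH] x [t [tP ->]].
apply: (subspace_sum_seq (monE_sub S k.+1)) => p /tP [/Np1P /Sg [u [uP ->]] p2]; rewrite mulr_suml.
apply: (subspace_sum_seq (monE_sub S k.+1)) => w /uP [_ w2].
rewrite (evmC w.1) -mulrA; apply: mon_in => //; apply: monE_mul; exact: IH.
Qed.

Lemma sideal_even (I : D -> Prop) : subspace I -> (forall a x, I x -> I (a * x)) -> sideal (fun=> True) I.
Proof.
move=> sI mI; split=> // [a x _|i a]; first exact: mI.
by case: i => h; [rewrite evD; exact: sI.1|rewrite evh].
Qed.

(* Herstein's proof of Krull's intersection theorem: an ideal maximal among *)
(* those meeting (x) in x n contains a power of n. *)
Lemma herstein x : zN x -> exists2 n, counit n = 0 & x = x * n.
Proof.
move=> zx.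
pose F (I : D -> Prop) := [/\ subspace I, (forall a y, I y -> I (a * y)),
  (forall n, counit n = 0 -> I (x * n)) &
  (forall w, I (x * w) -> exists2 n, counit n = 0 & x * w = x * n)].
have [M [sM mM xM Mx] Mmax] : exists2 M, F M & forall I, F I -> (forall y, M y -> I y) -> forall y, I y -> M y.
  apply: (noeth_max nD) => [I [sI mI _ _]|]; first exact: sideal_even.
  exists (fun y => exists2 n, counit n = 0 & y = x * n); split.
  - split; first by exists 0; rewrite ?linear0 ?mulr0.
    move=> c y z [n n0 ->] [n' n0' ->]; exists (c *: n + n'); last by rewrite mulrDr scalerAr.
    by rewrite linearD /= scalarZ /= n0 n0' mulr0 addr0.
  - move=> a y [n n0 ->]; exists (a * n); first by rewrite counitM n0 mulr0.
    by rewrite mulrA (evmC a) -mulrA.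
  - by move=> n n0; exists n.
  - by [].
(* The ascending ideals (M : y^m) become stationary at some m0; then M plus the multiples of y^m0
   still belongs to [F], so it is M by maximality. *)
have pw y : counit y = 0 -> exists m, M (y ^+ m).
  move=> y0; pose U b := exists m, M (b * y ^+ m).
  have Umono b m m' : (m <= m')%N -> M (b * y ^+ m) -> M (b * y ^+ m').
    by move=> /subnK <- h; rewrite addnC exprD mulrA evmC; exact: mM.
  have sU : subspace U.
    split; first by exists 0%N; rewrite mul0r; exact: sM.1.
    move=> c a b [m hm] [m' hm']; exists (maxn m m'); rewrite mulrDl -scalerAl.
    by apply: sM.2; [apply: Umono hm; exact: leq_maxl|apply: Umono hm'; exact: leq_maxr].
  have mU a b : U b -> U (a * b) by move=> [m h]; exists m; rewrite -mulrA; exact: mM.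
  have [s sI sg] := nD (sideal_even sU mU).
  have [m0 hm0] : exists m0, forall b, b \in s -> M (b * y ^+ m0).
    elim: s sI {sg} => [|b s IH] sI; first by exists 0%N.
    have [|m hm] := IH; first by move=> z zs; apply: sI; rewrite inE zs orbT.
    have [m' hm'] := sI b (mem_head _ _); exists (maxn m m') => z; rewrite inE => /orP[/eqP ->|/hm h].
      by apply: Umono hm'; exact: leq_maxr.
    by apply: Umono h; exact: leq_maxl.
  have hU b : U b -> M (b * y ^+ m0).
    move=> /sg [t [tP ->]]; rewrite mulr_suml; apply: (subspace_sum_seq sM) => p /tP [_ h].
    by rewrite -mulrA; apply: mM; exact: hm0.
  exists m0; pose I z := exists a b, M a /\ z = a + b * y ^+ m0.
  have IM z : M z -> I z by move=> hz; exists z, 0; rewrite mul0r addr0.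
  apply: (Mmax I) => //; last by exists 0, 1; rewrite mul1r add0r; split=> //; exact: sM.1.
  split.
  - split; first by apply: IM; exact: sM.1.
    move=> c z z' [a [b [ha ->]]] [a' [b' [ha' ->]]]; exists (c *: a + a'), (c *: b + b').
    by split; [exact: sM.2|rewrite scalerDr mulrDl -scalerAl addrACA].
  - move=> c z [a [b [ha ->]]]; exists (c * a), (c * b); split; first exact: mM.
    by rewrite mulrDr mulrA.
  - by move=> n n0; apply: IM; exact: xM.
  - move=> w [a [b [ha e]]]; apply: Mx; rewrite e; apply: (subspaceD sM) => //; apply: hU.
    exists m0.+1; rewrite exprS mulrA (evmC b) -mulrA.
    have -> : y * (b * y ^+ m0) = x * (y * w) - y * a.
      by rewrite [x * _]mulrA (evmC x y) -mulrA e mulrDr addrC addKr.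
    apply: (subspaceB sM); last exact: mM.
    by apply: xM; rewrite counitM y0 mul0r.
have [S [S0 hS]] := Np_gens.
have [k hk] : exists k, forall z, mon S k z -> M z.
  by apply: mon_pigeon => // y /S0; exact: pw.
have [|n n0 e] := Mx 1; first by rewrite mulr1; apply: hk; apply: hS; exact: zx.
by exists n; rewrite // -e mulr1.
Qed.

End Noeth.

Section Functionals.
Lemma cr_mul_even (f : {scalar D}) (a b : D) (y : tens D D) :
  cr f ((a \ot b) * y) = a * cr (mulsc f b) y.
Proof.
elim/tens_ind: y => [|u w y IH]; first by rewrite mulr0 !linear0 mulr0.
rewrite mulrDr !crD IH mulrDr; congr (_ + _).
by rewrite (tensM_hom _ _ (evh b) (evh u)) expr0 scale1r !cr_pure -scalerAr.
Qed.
Lemma cr_mulr_even (f : {scalar D}) (z : D) (y : tens D D) : cr f (y * (z \ot 1)) = cr f y * z.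
Proof.
elim/tens_ind: y => [|u w y IH]; first by rewrite mul0r !linear0 mul0r.
rewrite mulrDl !crD IH mulrDl; congr (_ + _).
by rewrite (tensM_hom _ _ (evh w) (evh z)) expr0 scale1r mulr1 !cr_pure scalerAl.
Qed.

(** The coproduct of a factor p in m is p \ot 1 plus terms with right leg in m. The first keeps p on
    the left; the others use up one of the powers of m killed by f. *)
Lemma Np_Rf m : forall (f : {scalar D}), (forall x, Np m x -> f x = 0) ->
  forall k x, Np (m + k) x -> Np k (cr f (comul x)).
Proof.
elim: m => [|m IHm] f f0; first by move=> k x _; rewrite cr_eq0 => [|v]; [exact: (Np_sub k).1|exact: f0].
elim=> [//|k IH] x; rewrite addSn addnS => -[t [tP ->]].
rewrite [comul _]linear_sum [cr f _]linear_sum; apply: (subspace_sum_seq (Np_sub k.+1)) => p /tP [p1 p2].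
change (Np k.+1 (cr f (comul (p.1 * p.2)))); rewrite comulM tmulE.
have [s sP e] : exists2 s : seq (D * D), (forall q, q \in s -> counit q.2 = 0) &
    comul p.1 - p.1 \ot 1 = \sum_(q <- s) q.1 \ot q.2.
  apply: (tens_memr (Q := fun x : D => counit x = 0)) => [|g].
    split; first exact: linear0.
    by move=> c a b a0 b0; rewrite linearD /= scalarZ /= a0 b0 mulr0 addr0.
  rewrite -cl_cr crB cr_pure /= counit1 scale1r -[cr _ (comul _)]/(tlift _ _) counitr subrr; exact: linear0.
rewrite -(subrK (p.1 \ot 1) (comul p.1)) mulrDl crD; apply: (subspaceD (Np_sub k.+1)).
  rewrite e (tens_mull_sum _ erefl) linear_sum; apply: (subspace_sum_seq (Np_sub k.+1)) => q /sP q2.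
  change (Np k.+1 (cr f ((q.1 \ot q.2) * comul p.2))); rewrite cr_mul_even; apply: Np_mul; apply: IHm => [w hw|]; last by rewrite addnS.
  by apply: f0; exact: Np_in.
rewrite cr_mul_even; apply: Np_in => //.
have -> : cr (mulsc f 1) (comul p.2) = cr f (comul p.2) by apply: eq_cr => w /=; rewrite mul1r.
by apply: IH; rewrite addSn.
Qed.

Lemma zN_Rf (f : {scalar D}) x : (forall x, zN x -> f x = 0) -> zN x -> zN (cr f (comul x)).
Proof.
move=> f0 zx; apply: (subspace_dual zN_sub) => phi phi0; rewrite cl_cr; apply: f0 => k.
apply: (subspace_dual (Np_sub k)) => g g0; rewrite -cl_cr; apply: phi0 => m.
by apply: (Np_Rf g0); exact: zx.
Qed.

Definition annz (j : D) := forall z, zN z -> j * z = 0.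
Lemma annz_sub : subspace annz.
Proof.
split=> [z _|c x y hx hy z hz]; first by rewrite mul0r.
by rewrite mulrDl -scalerAl hx // hy // scaler0 addr0.
Qed.
Lemma annz_mul a x : annz x -> annz (a * x).
Proof. by move=> h z hz; rewrite -mulrA h // mulr0. Qed.
Lemma annz_hcomp i x : annz x -> annz (hcomp i x).
Proof. by case: i => h; [rewrite evD; exact: annz_sub.1|rewrite evh]. Qed.

Let Z : superideal D := SuperIdeal zN_sub zN_mul zN_hcomp zN1.

(** Write z \ot 1 as comul(z_1)(1 \ot S(z_2)). Multiplied by the coproduct of j and contracted by f,
    a term with z_1 in [zN] dies because j annihilates it, and one with z_2 in [zN] because f
    does. *)
Lemma annz_Rf (f : {scalar D}) j : (forall x, zN x -> f x = 0) -> annz j -> annz (cr f (comul j)).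
Proof.
move=> f0 hj z hz.
have e : tlift (fun u w : D => comul u * (1 \ot antipode w)) (comul z) = z \ot 1 :> tens D D.
  by rewrite -in1E -(pmulKr (in1 D D) (in2 D D)) -comul_pmul pmul_tlift.
rewrite -cr_mulr_even -e tliftMl tlift_comp.
have fS (w : D) : zN w -> forall y : tens D D, cr f (y * (1 \ot antipode w)) = 0.
  move=> hw y; elim/tens_ind: y => [|a b y IH]; first by rewrite mul0r linear0.
  rewrite mulrDl crD IH addr0 tensMr1 cr_pure f0 ?scale0r //.
  by apply: zN_mul => k; exact: Np_antipode.
apply: (@bil_desc K D Z Z) => //.
- split=> [w c u u'|u c w w'].
    by rewrite [comul (c *: u + u')]linearP mulrDl -scalerAl mulrDr -scalerAr linearP.
  by rewrite [antipode _]linearP pureDr pureZr !mulrDr -!scalerAr linearP.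
- move=> u v hu; rewrite mulrA -[comul j * comul u]tmulE -comulM hj // linear0 mul0r; exact: linear0.
- by move=> u v hv; rewrite mulrA; exact: fS.
- by move=> g g0; exact: zN_Rf.
Qed.

(** Expand 1 = counit(s) as s_1 S(s_2). A functional that vanishes on [annz] and on [zN] kills this
    sum: contractions of comul(s) by functionals vanishing on [zN] stay in [annz]. *)
Lemma annz_comax s : annz s -> counit s = 1 -> exists j z, [/\ annz j, zN z & 1 = j + z].
Proof.
move=> hs s1; have [h1|n1] := pselect (annz 1); first by exists 1, 0; rewrite addr0; split=> //; exact: zN_sub.1.
pose J : superideal D := SuperIdeal annz_sub annz_mul annz_hcomp n1.
have sP : subspace (fun x => exists j z, [/\ annz j, zN z & x = j + z]).
  split; first by exists 0, 0; rewrite addr0; split=> //; [exact: annz_sub.1|exact: zN_sub.1].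
  move=> c x y [j [z [hj hz ->]]] [j' [z' [hj' hz' ->]]]; exists (c *: j + j'), (c *: z + z').
  by split; [exact: annz_sub.2|exact: zN_sub.2|rewrite scalerDr addrACA].
apply: (subspace_dual sP) => phi phi0.
have -> : 1 = tlift (fun u w : D => u * antipode w) (comul s) by rewrite antipoder s1 scale1r.
have bm : bilin (fun u w : D => u * antipode w).
  exact: (mul_bilin (idfun : {linear D -> D}) (mklin (@antipode_linear K D))).
rewrite (@tlift_lin K D D D K^o phi); last by move=> c x y; exact: linearP.
apply: (@bil_desc K D J Z K^o (fun u w : D => phi (u * antipode w))).
- split=> [w c u u'|u c w w']; first by rewrite bm.1; exact: linearP.
  by rewrite bm.2; exact: linearP.
- move=> u v hu; apply: phi0; exists (u * antipode v), 0; rewrite addr0; split=> //; last exact: zN_sub.1.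
  by rewrite evmC; exact: annz_mul.
- move=> u v hv; apply: phi0; exists 0, (u * antipode v); rewrite add0r; split=> //; first exact: annz_sub.1.
  by apply: zN_mul => k; exact: Np_antipode.
- by move=> f f0; exact: annz_Rf.
Qed.
End Functionals.

(** By [herstein] an element s with counit 1 annihilates the finitely generated ideal [zN]. So 1 = j
    + z with j in its annihilator and z in it; then z is an idempotent of counit 0, hence 0, and 1
    annihilates [zN]. *)
Theorem krull (nD : noeth D) : (forall e : D, e * e = e -> e = 0 \/ e = 1) -> forall x, zN x -> x = 0.
Proof.
move=> noidem.
have [xs xI xg] := nD _ (sideal_even zN_sub zN_mul).
have [s s1 hs] : exists2 s : D, counit s = 1 & forall x, x \in xs -> s * x = 0.
  elim: xs xI {xg} => [|x xs IH] xI; first by exists 1; rewrite ?counit1.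
  have [|s s1 hs] := IH; first by move=> z zs; apply: xI; rewrite inE zs orbT.
  have [n n0 e] := herstein nD (xI x (mem_head _ _)).
  exists (s * (1 - n)); first by rewrite counitM s1 mul1r linearB /= counit1 n0 subr0.
  move=> z; rewrite inE => /orP[/eqP ->|/hs h]; last by rewrite (evmC s) -mulrA h mulr0.
  by rewrite -mulrA mulrBl mul1r (evmC n) -e subrr mulr0.
have hz : annz s.
  move=> z /xg [t [tP ->]]; rewrite mulr_sumr big_seq big1 // => p /tP [_ /hs h].
  by rewrite mulrA (evmC s) -mulrA h mulr0.
have [j [z [hj hzz e]]] := annz_comax hz s1.
have zz : z * z = z by rewrite -[RHS]mul1r e mulrDl hj // add0r.
have z0 : z = 0.
  have [//|z1] := noidem z zz; have := hzz 1%N; rewrite z1 => /Np1P; rewrite counit1 => /eqP.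
  by rewrite oner_eq0.
by move=> x hx; rewrite -[x]mul1r e z0 addr0 hj.
Qed.
End Krull.

(** * Unipotency of the even part modulo the multiplicative part of its center *)

Section ConilMaps.
Variables (K : fieldType) (Q G : supergroupType K) (i : superhom Q G) (hi : hopf_hom i).
Lemma cr_hopf (f : {scalar G}) q : cr f (comul (i q)) = i (cr (scomp f i) (comul q)).
Proof. by rewrite hi.1 (cr_tmap (g := i) i (h := f) (h' := scomp f i)). Qed.
Lemma cl_hopf (f : {scalar G}) q : cl f (comul (i q)) = i (cl (scomp f i) (comul q)).
Proof. by rewrite hi.1 (cl_tmap (f := i) i (h := f) (h' := scomp f i)). Qed.
Lemma cW_img n q : cW n q -> cW n (i q).
Proof.
elim: n q => [|n IH] q; first by move=> hq; change (q = 0) in hq; change (i q = 0); rewrite hq linear0.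
move=> hq f f1; change (cW n (cr f (comul (i q)))); rewrite cr_hopf; apply: IH; apply: hq.
by rewrite /= rmorph1.
Qed.
Lemma cW_inc n q : injective i -> cW n (i q) -> cW n q.
Proof.
move=> ij; elim: n q => [|n IH] q.
  by move=> hq; change (i q = 0) in hq; change (q = 0); apply: ij; rewrite hq linear0.
move=> hq f f1; have [g ge] := scalar_extend f ij.
have g1 : g 1 = 0 by rewrite -(rmorph1 i) ge.
have h : cW n (cr g (comul (i q))) := hq g g1.
apply: IH; have -> : i (cr f (comul q)) = cr g (comul (i q)).
  by rewrite cr_hopf; congr (i _); apply: eq_cr => u /=; rewrite ge.
exact: h.
Qed.
End ConilMaps.

Section Idempotents.
Variables (K : fieldType) (D : supergroupType K) (evD : purely_even D) (nD : noeth D).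
(** If u were nonzero, a maximal proper ideal containing 1 - u would be a prime that does not
    contain u. *)
Lemma idem_prime (u : D) : u * u = u -> (forall P, prime_ideal P -> P u) -> u = 0.
Proof.
move=> uu hu; have [//|u0] := pselect (u = 0).
pose F (I : D -> Prop) := [/\ subspace I, (forall a x, I x -> I (a * x)), ~ I 1 & I (1 - u)].
have [M [sM mM nM Mu] Mmax] : exists2 M, F M & forall I, F I -> (forall x, M x -> I x) -> forall x, I x -> M x.
  apply: (noeth_max nD) => [I [sI mI _ _]|]; first exact: (sideal_even evD).
  exists (fun x => exists w, x = w * (1 - u)); split; last by exists 1; rewrite mul1r.
  - split; first by exists 0; rewrite mul0r.
    by move=> c x y [w ->] [w' ->]; exists (c *: w + w'); rewrite mulrDl scalerAl.
  - by move=> a x [w ->]; exists (a * w); rewrite mulrA.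
  - move=> [w e]; apply: u0; rewrite -[u]mul1r {1}e -mulrA mulrBl mul1r uu subrr mulr0.
    by [].
have pM : prime_ideal M.
  have MD a b : M a -> M b -> M (a + b) by exact: subspaceD.
  split; [exact: sM.1|exact: MD|by move=> a b; exact: mM|exact: nM|].
  move=> a b hab; have [|na] := pselect (M a); [by left|right].
  have [I1|nI] := pselect (exists m c, M m /\ 1 = m + c * a).
    have [m [c [hm e]]] := I1; rewrite -[b]mul1r e mulrDl -mulrA; apply: (subspaceD sM); last exact: mM.
    by rewrite (evmC evD); exact: mM.
  case: na; apply: (Mmax (fun x => exists m c, M m /\ x = m + c * a)).
  - split=> //.
    + split; first by exists 0, 0; rewrite mul0r addr0; split=> //; exact: sM.1.
      move=> k x y [m [c [hm ->]]] [m' [c' [hm' ->]]]; exists (k *: m + m'), (k *: c + c').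
      by split; [exact: sM.2|rewrite scalerDr mulrDl -scalerAl addrACA].
    + move=> k x [m [c [hm ->]]]; exists (k * m), (k * c); split; first exact: mM.
      by rewrite mulrDr mulrA.
    + by exists (1 - u), 0; rewrite mul0r addr0.
  - by move=> x hx; exists x, 0; rewrite mul0r addr0.
  - by exists 0, 1; rewrite mul1r add0r; split=> //; exact: sM.1.
by case: nM; rewrite -(subrK u 1); apply: (subspaceD sM) => //; exact: hu.
Qed.
(** The closed sets of e and 1 - e are disjoint and cover the spectrum, so one of the two
    idempotents lies in all primes. *)
Lemma connected_idem : spec_connected D -> forall e : D, e * e = e -> e = 0 \/ e = 1.
Proof.
move=> cD e ee.
have e1 : e * (1 - e) = 0 by rewrite mulrBr mulr1 ee subrr.
have ee' : (1 - e) * (1 - e) = 1 - e by rewrite mulrBl mul1r e1 subr0.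
have [P [P0 PD PM P1 PP]|P [P0 PD PM P1 PP] [hS hT]|h|h] := cD (fun x => x = e) (fun x => x = 1 - e).
- have : P (e * (1 - e)) by rewrite e1.
  by move=> /PP [h|h]; [left|right] => x ->.
- by apply: P1; rewrite -(subrK e 1); apply: PD; [exact: hT|exact: hS].
- by left; apply: idem_prime => // P /h; apply.
- right; apply/eqP; rewrite eq_sym -subr_eq0; apply/eqP.
  by apply: idem_prime => // P /h; apply.
Qed.
End Idempotents.

(** [connected] provides some copy of the even part; all copies have the same kernel, so its
    idempotents can be compared with those of [E]. *)
Lemma even_part_idem (K : fieldType) (G : supergroupType K) (nG : noeth G) (E : closedSub G) :
  is_even_part E -> connected G -> forall e : E, e * e = e -> e = 0 \/ e = 1.
Proof.
move=> hE [E' [hE' cE']] e ee.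
have ker a : cres E a = 0 -> cres E' a = 0 by move=> /hE h; apply/hE'.
have ker' a : cres E' a = 0 -> cres E a = 0 by move=> /hE' h; apply/hE.
have [g ge] := superhom_lift (@cres_surj K G E) ker.
have gE a : g (cres E a) = cres E' a by rewrite -ge.
have gi x : g x = 0 -> x = 0 by have [a <-] := cres_surj x; rewrite gE; exact: ker'.
have nE' : noeth E' := noeth_surj (@cres_surj K G E') nG.
have [|h|h] := connected_idem (even_part_even hE') nE' cE' (e := g e).
- by rewrite -rmorphM ee.
- by left; exact: gi.
- right; apply/eqP; rewrite -subr_eq0; apply/eqP; apply: gi.
  by transitivity (g e - g 1); [exact: rmorphB|rewrite h rmorph1 subrr].
Qed.

Section CoinvLemmas.
Variables (K : fieldType) (G : supergroupType K) (N : closedSub G).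
Lemma couE a : cou N a = tmap (idfun : {linear G -> G}) (cres N) (comul a).
Proof. by rewrite /cou pmul_tlift; apply: eq_tlift => x y; exact: tensM_in12. Qed.
Lemma cr_cou (f : {scalar N}) a : cr f (cou N a) = cr (scomp f (cres N)) (comul a).
Proof. by rewrite couE (cr_tmap (g := cres N) _ (h := f) (h' := scomp f (cres N))). Qed.
Lemma cl_cou (f : {scalar G}) a : cl f (cou N a) = cres N (cl f (comul a)).
Proof. by rewrite couE (cl_tmap (f := idfun) _ (h := f) (h' := f)). Qed.
Lemma coinv_cres_cl (f : {scalar G}) a : coinv N a -> cres N (cl f (comul a)) = f a *: 1.
Proof. by move=> h; rewrite -cl_cou h cl_pure. Qed.
Lemma coinvP a : (forall f : {scalar N}, cr (scomp f (cres N)) (comul a) = f 1 *: a) -> coinv N a.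
Proof. by move=> h; apply: tens_crP => f; rewrite cr_cou h cr_pure. Qed.
Lemma coinv_cr_cres (f : {scalar N}) a : coinv N a -> cr (scomp f (cres N)) (comul a) = f 1 *: a.
Proof. by move=> h; rewrite -cr_cou h cr_pure. Qed.
Lemma cr_fsub_cres (f : {scalar N}) a : cr (scomp f (cres N)) (comul a) =
  cr (scomp (fsub f) (cres N)) (comul a) + f 1 *: a.
Proof.
have hw (h : {scalar G}) : h a = counit (cl h (comul a)).
  by rewrite -(cl_cr h (counit : {scalar G})) -[cr _ _]/(tlift _ _) counitr.
apply: dual_eq => h; rewrite [h (_ + _)]linearD [h (_ *: _)]scalarZ !cl_cr /= hw.
by rewrite (cres_hopf N).2 subrK.
Qed.
Lemma coinvP0 a : (forall f : {scalar N}, f 1 = 0 -> cr (scomp f (cres N)) (comul a) = 0) -> coinv N a.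
Proof. by move=> h; apply: coinvP => f; rewrite cr_fsub_cres h ?add0r //; exact: fsub1. Qed.
End CoinvLemmas.

Lemma coinv_res (K : fieldType) (G : supergroupType K) (H : closedSub G) (N : closedSub H) a :
  coinv (sub_trans N) a -> coinv N (cres H a).
Proof.
move=> ha; apply: coinvP => f; rewrite (cr_hopf (cres_hopf H)) -[RHS]linearZ; congr (cres H _).
by rewrite -(coinv_cr_cres (N := sub_trans N) f ha); exact: eq_cr.
Qed.

(** By [ff_coset] the F-invariant functions come from the unipotent quotient Q. *)
Lemma quot_coinv_conil (K : fieldType) (hK : 2%N \notin [pchar K]) (Z : supergroupType K) (nZ : noeth Z)
    (F : closedSub Z) (cF : central_sub F) (Q : quotBy F) (uQ : unipotent Q) z : coinv F z -> conil z.
Proof.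
move=> hz; have [q ->] : img (qinc Q) z.
  apply: (ff_coset hK nZ (B := img_shopf (qinc_hopf Q)) (X := coinv F)) hz => //.
  - exact: coinv_subspace.
  - exact: coinv_hcomp.
  - exact: coinv_cl.
  move=> f x hx.
  have e0 : cres F (cl f (comul x) - f x *: 1) = 0.
    transitivity (cres F (cl f (comul x)) - cres F (f x *: 1)); first exact: rmorphB.
    by rewrite coinv_cres_cl // [cres F (_ *: _)]linearZ rmorph1 subrr.
  have [s [sP ->]] := (qinc_ker Q _).1 e0.
  apply: (subspace_sum_seq (bgen_sub _ _)) => p /sP p1; apply: bgen1 => //; first by exists p.1.
  by rewrite (qinc_hopf Q).2.
have [n hn] := unipotent_conil uQ q; exists n; exact: (cW_img (qinc_hopf Q)).
Qed.

Lemma center_comm (K : fieldType) (G : supergroupType K) (Z : closedSub G) (hZ : is_center Z)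
  (R : superAlgType K) (f g : superhom Z R) : pmul f g = pmul g f.
Proof.
have := central_subP (superhom_comp g (cres Z)) (center_central hZ) (pt_in_cres f).
rewrite -!(hopf_pmul (cres_hopf Z)) => e; apply: shomP => z; have [a <-] := cres_surj z.
by rewrite -[LHS]/(superhom_comp (pmul f g) (cres Z) a) e.
Qed.

Section ConilMod.
Variables (K : fieldType) (E : supergroupType K).
Lemma conil_cl0 (phi : {scalar E}) y : (forall x : E, conil x -> phi x = 0) -> conil y -> cl phi (comul y) = 0.
Proof. by move=> p0 hy; apply: dual_eq => f; rewrite -cl_cr linear0; apply: p0; exact: conil_cr. Qed.
Lemma conil_of_coefs n (a : E) : (forall phi : {scalar E}, (forall x : E, conil x -> phi x = 0) ->
  cW n (cl phi (comul a))) -> conil a.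
Proof.
elim: n a => [|n IH] a h.
  apply: (subspace_dual (conil_sub E)) => phi p0.
  have e : cl phi (comul a) = 0 by exact: (h phi p0).
  by rewrite -[a]counitr -[tlift _ _]/(cr counit (comul a)) cl_cr e linear0.
apply: conil_split => f f1; apply: IH => phi p0; rewrite -cr_cl; exact: (h phi p0 f f1).
Qed.
(** The coefficients in question span a finite-dimensional space, so they lie in one stage, and
    [conil_of_coefs] applies. *)
Lemma conil_coefs (a : E) : (forall phi : {scalar E}, (forall x : E, conil x -> phi x = 0) ->
  conil (cl phi (comul a))) -> conil a.
Proof.
move=> h; pose S e := exists phi : {scalar E}, (forall x : E, conil x -> phi x = 0) /\ e = cl phi (comul a).
have s0 := sub0 E.
have sS : subspace S.
  split.
    have sc : scalar (fun _ : E => 0 : K) by move=> c u v; rewrite mulr0 addr0.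
    exists (mkscal sc); split=> //.
    by symmetry; apply: dual_eq => f; rewrite -cl_cr linear0.
  move=> c x y [p [p0 ->]] [p' [p0' ->]].
  have sc : scalar (fun z => c * p z + p' z).
    by move=> k u v; rewrite !linearP /= !mulrDr addrACA mulrCA.
  exists (mkscal sc); split=> [x0 h0 /=|]; first by rewrite p0 // p0' // mulr0 addr0.
  apply: dual_eq => f; transitivity (c * f (cl p (comul a)) + f (cl p' (comul a))).
    by rewrite [LHS]linearD /= scalarZ.
  by rewrite -!cl_cr.
have [t' [_ St' _]] : exists t', [/\ (size t' <= size [seq p.2 | p <- repr (comul a)])%N,
   (forall x, S x <-> spn (fun x => x = 0) t' x) & size t' = size [seq p.2 | p <- repr (comul a)] ->
      forall x, spn (fun x => x = 0) [seq p.2 | p <- repr (comul a)] x -> S x].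
  apply: (subspace_span s0 sS); first by move=> x ->; exact: sS.1.
  move=> x [phi [_ ->]]; rewrite [X in spn _ _ (cl phi X)]tens_sumE linear_sum.
  apply: (subspace_sum_seq (spn_subspace _ s0)) => p pr; rewrite [X in spn _ _ X]cl_pure.
  by apply: (subspaceZ _ (spn_subspace _ s0)); apply: (spn_in s0); exact: map_f.
have [|n hn] := @conil_seq _ E t'.
  by move=> x /(spn_in s0) /St' [phi [p0 ->]]; exact: h.
apply: (@conil_of_coefs n) => phi p0.
have /St' : S (cl phi (comul a)) by exists phi.
by apply: spn_le => [|x ->|y yt]; [exact: cW_sub|exact: (cW_sub E n).1|exact: hn].
Qed.
End ConilMod.

Section CenterConil.
Variables (K : fieldType) (hK : 2%N \notin [pchar K]) (E : supergroupType K) (evE : purely_even E).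
Variables (nE : noeth E) (r : nat) (Y : nat -> E -> Prop).
Hypotheses (hY : nil_chain r Y) (Yr : forall a : E, Y r a -> a = 0).
Hypothesis noidem : forall e : E, e * e = e -> e = 0 \/ e = 1.

Lemma idS_hopf : hopf_hom (idS E).
Proof.
split=> // a; rewrite -[RHS](stensE (idS E) (idS E)) -[RHS]/(superhom_comp (stens (idS E) (idS E)) (comulS E) a).
have -> : stens (idS E) (idS E) = idS (tens E E); last by rewrite superhom_comp1l.
by apply: sprod_unique; rewrite ?stens_in1 ?stens_in2 superhom_comp1 superhom_comp1l.
Qed.
Let al := adq (idS E).

Lemma stab_Np k : stab al (@Np K E k).
Proof.
elim: k => [//|k IH] f x [t [tP ->]].
have sI := @Np_sub K E k.+1.
change (Np k.+1 (cr f (al (\sum_(p <- t) p.1 * p.2)))).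
have -> : cr f (al (\sum_(p <- t) p.1 * p.2)) = \sum_(p <- t) cr f (al (p.1 * p.2)).
  exact: (linear_sum ((cr f : {linear tens E E -> E}) \o al : {linear E -> E})).
apply: (subspace_sum_seq sI) => p /tP [a1 a2].
rewrite [al _]rmorphM.
have h1 (g : {scalar E}) : Np 1 (cr g (al p.1)) by apply/Np1P; apply: adq_aug.
have [s sP es] := tens_meml (@Np_sub K E 1) h1.
have [s' sP' es'] := tens_meml (@Np_sub K E k) (fun g => IH g _ a2).
suff : Np k.+1 (cr f ((\sum_(p <- s) p.1 \ot p.2) * (\sum_(p <- s') p.1 \ot p.2))) by rewrite -es -es'.
rewrite (tens_mull_sum _ erefl) linear_sum; apply: (subspace_sum_seq sI) => u /sP hu.
rewrite /= (tens_mulr_sum _ erefl) linear_sum; apply: (subspace_sum_seq sI) => w /sP' hw.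
by apply: (cr_mul (A := E) (D := E)) => // j; apply: (@NpM K E 1 k) => //; exact: (Np_hcomp evE).
Qed.

(** On the cotangent space m/m^2 the chain gives unipotency in r steps; powers follow by
    multiplicativity. The extra step serves the case k = 0, where one contraction lands in m. *)
Lemma Np_filt k a : Np k a -> filt al (@Np K E k.+1) (k * r).+1 a.
Proof.
elim: k a => [|k IH] a.
  move=> _ f f1; change (Np 1 (cr f (al a))); rewrite -(subrK (counit a *: 1) a).
  have -> : cr f (al (a - counit a *: 1 + counit a *: 1)) = cr f (al (a - counit a *: 1)) + counit a *: cr f (al 1).
    have -> : al (a - counit a *: 1 + counit a *: 1) = al (a - counit a *: 1) + counit a *: al 1.
      by rewrite [LHS]linearD; congr (_ + _); exact: linearZ.
    by rewrite crD crZ.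
  rewrite [al 1]rmorph1 [cr f 1](cr_pure f 1 1) f1 scale0r scaler0 addr0; apply/Np1P.
  by apply: adq_aug; rewrite linearB scalarZ /= counit1 mulr1 subrr.
move=> [t [tP ->]]; apply: (subspace_sum_seq (filt_sub _ _ (@Np_sub K E k.+2))) => p /tP [a1 a2].
have -> : ((k.+1 * r).+1 = r + (k * r).+1)%N by rewrite mulSn addnS.
apply: (@filt_mul K E E al (@Np K E 1) (@Np K E 2) (@Np K E k) (@Np K E k.+1)) => //.
all: try exact: Np_sub.
all: try exact: stab_Np.
all: try by move=> *; exact: (Np_hcomp evE).
all: try exact: (adq_counit idS_hopf).
all: try exact: (adq_coassoc idS_hopf).
- by move=> x y hx hy; exact: (@NpM K E 2 k).
- by move=> x y hx hy; exact: (@NpM K E 1 k.+1).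
- exact/Np1P.
- have hx : chX Y (r - r) p.1.
    by rewrite subnn => R n /(hY.1) ->; rewrite punitE a1 scale0r.
  have hf : filt al (@aug2 K E) r p.1 by apply: (chX_filt hY) hx.
  apply: filt_le hf => x [s [sP ->]].
  by apply: (subspace_sum_seq (@Np_sub K E 2)) => u /sP [u1 u2]; apply: Np_in => //; exact/Np1P.
- exact: IH.
Qed.

(** A functional that vanishes on m^k sees only the quotient by m^k, on which E acts unipotently by
    conjugation. *)
Lemma ad_conil k (f : {scalar E}) a : (forall x, Np k x -> f x = 0) -> conil (cl f (ad E a)).
Proof.
move=> f0; have [n hn] : exists n, filt al (@Np K E k) n a.
  elim: k {f0} => [|N [n hn]]; first by exists 0%N.
  exists (n + (N * r).+1)%N; apply: filt_filt; apply: filt_le hn; exact: Np_filt.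
exists n; have := filt_coef_mod (adq_coassoc idS_hopf) (@stab_Np k) f0 hn.
by rewrite /= adq_cl.
Qed.

Variables (Z : closedSub E) (hZ : is_center Z).
Let cZ := center_central hZ.

(** Let [sB] be the conilpotent Z-invariant functions and N the subgroup they define. Conjugation by
    N is trivial modulo every m^k, as its coefficients there lie in [sB]; by [krull] it is trivial,
    so N lies in Z. Hence Z-invariant functions are constant modulo the ideal of N, and [ff_coset]
    puts them into [sB]. *)
Lemma center_coinv_conil x : coinv Z x -> conil x.
Proof.
pose B := @SubHopf K E (fun x => conil x /\ coinv Z x).
have [sB [hB1 hB2]] : exists B : subhopf E, (forall x, B x -> conil x /\ coinv Z x) /\ (forall x, conil x -> coinv Z x -> B x).
  unshelve (eexists (B _ _ _ _ _ _ _); split=> //).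
  - split; first by split; [exact: (conil_sub E).1|exact: (coinv_subspace Z).1].
    by move=> c a b [? ?] [? ?]; split; [exact: (conil_sub E).2|exact: (coinv_subspace Z).2].
  - by split; [exact: conil1|exact: coinv1].
  - by move=> a b [? ?] [? ?]; split; [exact: conilM|exact: coinvM].
  - by move=> i a [? ?]; split; [exact: conil_hcomp|exact: coinv_hcomp].
  - by move=> f a [? ?]; split; [exact: conil_cr|exact: (coinv_cr cZ)].
  - by move=> f a [? ?]; split; [exact: conil_cl|exact: coinv_cl].
  - by move=> a [? ?]; split; [exact: conil_antipode|exact: (coinv_antipode cZ)].
have [N [N0 Npt]] := ker_sub (sinc_hopf sB).
have cN : central_pt (cres N).
  have e : pconj (in1 E N) (superhom_comp (in2 E N) (cres N)) = in1 E N.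
    rewrite -ad_id; apply: shomP => a; rewrite -[LHS]/(stens (idS E) (cres N) (ad E a)) stensE in1E.
    apply: tens_crP => h; apply/eqP; rewrite -subr_eq0; apply/eqP; apply: (krull evE nE noidem) => k.
    apply: (subspace_dual (@Np_sub K E k)) => f f0.
    have hb : cres N (cl f (ad E a)) = f a *: 1.
      have : sB (cl f (ad E a)) by apply: hB2; [exact: (ad_conil _ f0)|exact: (ad_coinv cZ)].
      move=> /sinc_ex [b eb].
      have hN : superhom_comp (cres N) (sinc sB) = punit _ N.
        by apply/Npt; exists (idS N).
      have := congr1 (fun g : superhom _ N => g b) hN; rewrite -[LHS]/(cres N (sinc sB b)) eb punitE => ->.
      rewrite -(sinc_hopf sB).2 eb; congr (_ *: _).
      have {2}-> : a = cr counit (ad E a).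
        have {1}<- := adq_counit idS_hopf a; rewrite (adq_cr (idS E)).
        by apply: eq_cr.
      by rewrite cl_cr.
    transitivity (f (cr h (tmap (idS E) (cres N) (ad E a))) - f (cr h (a \ot 1))); first exact: linearB.
    have -> : f (cr h (tmap (idS E) (cres N) (ad E a))) = f a * h 1.
      rewrite cl_cr (_ : cl f _ = f a *: 1) ?scalarZ //.
      by rewrite -hb; exact: (cl_tmap (f := idS E) (cres N) (h := f) (h' := f)).
    by rewrite cr_pure scalarZ /= mulrC subrr.
  apply/central_ptP => S f h.
  have := congr1 (superhom_comp (sprod h f)) (pconj_fixV e).
  rewrite !pmul_comp !superhom_compA sprod_in1 sprod_in2 => ->.
  by [].
have [m hm] := (hZ (cres N)).2 cN.
move=> hx; apply: (proj1 (hB1 x _)).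
apply: (ff_coset hK nE (B := sB) (X := coinv Z)) hx => //.
- exact: coinv_subspace.
- exact: coinv_hcomp.
- exact: coinv_cl.
move=> f y hy.
have : cres N (cl f (comul y) - f y *: 1) = 0.
  rewrite hm; transitivity (m (cres Z (cl f (comul y)) - f y *: cres Z 1)).
    congr (m _); transitivity (cres Z (cl f (comul y)) - cres Z (f y *: 1)); first exact: rmorphB.
    by congr (_ - _); exact: linearZ.
  by rewrite coinv_cres_cl // rmorph1 subrr linear0.
move=> /N0 [s [sP ->]]; apply: (subspace_sum_seq (bgen_sub _ _)) => p /sP [b b0 ->].
by rewrite (evmC evE); apply: bgen1 => //; exact: sincP.
Qed.

Variables (F : closedSub Z) (Q : quotBy F) (uQ : unipotent Q).

(** Restricted to Z, the left contractions of x are F-invariant, hence conilpotent, so Z acts on x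
    unipotently. Induct on the number of steps: once the contractions along Z are conilpotent, the
    coefficients of x modulo [conil] are Z-invariant, hence conilpotent by [center_coinv_conil];
    then so is x by [conil_coefs]. *)
Lemma mult_coinv_conil x : coinv (sub_trans F) x -> conil x.
Proof.
have cF : central_sub F by move=> R n g _ a; rewrite -!pmulE (center_comm hZ n g).
have cFE : central_sub (sub_trans F).
  move=> R n g [m hm]; apply: cZ; exists (superhom_comp m (cres F)) => a; exact: hm.
have nZ : noeth Z := noeth_surj (@cres_surj K E Z) nE.
have key n a : coinv (sub_trans F) a -> (forall phi : {scalar E}, cW n (cres Z (cl phi (comul a)))) -> conil a.
  elim: n a => [|n IH] a ha hc.
    suff -> : a = 0 by exact: (conil_sub E).1.
    apply: dual_eq => phi; rewrite -[a]counitr -[tlift _ _]/(cr counit (comul a)) cl_cr linear0.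
    have e : cres Z (cl phi (comul a)) = 0 by exact: hc.
    by rewrite -[LHS]/(counit (cl phi (comul a))) -(cres_hopf Z).2 e linear0.
  have st (f : {scalar Z}) : f 1 = 0 -> conil (cr (scomp f (cres Z)) (comul a)).
    move=> f1; apply: IH => [|phi]; first exact: (coinv_cr cFE).
    rewrite -cr_cl -(cr_hopf (cres_hopf Z)); exact: (hc phi f f1).
  apply: conil_coefs => phi p0; apply: center_coinv_conil; apply: coinvP => f.
  rewrite cr_cl.
  have e : cl phi (comul (cr (scomp (fsub f) (cres Z)) (comul a))) = 0.
    by apply: conil_cl0 => //; apply: st; exact: fsub1.
  rewrite cr_fsub_cres addrC.
  transitivity (f 1 *: cl phi (comul a) + cl phi (comul (cr (scomp (fsub f) (cres Z)) (comul a)))).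
    exact: (linearP ((cl phi : {linear tens E E -> E}) \o (comul : {linear E -> tens E E}) : {linear E -> E})).
  by rewrite e addr0.
move=> hx; have hcx (phi : {scalar E}) : coinv (sub_trans F) (cl phi (comul x)) by exact: coinv_cl.
have [s sP e] := tens_memr (coinv_subspace (sub_trans F)) hcx.
have [|n hn] := @conil_seq _ Z [seq cres Z p.2 | p <- s].
  by move=> y /mapP[p /sP ps ->]; apply: (quot_coinv_conil hK nZ cF uQ); exact: coinv_res.
apply: (key n) => // phi; rewrite e [cl phi _]linear_sum [cres Z _]linear_sum; apply: (subspace_sum_seq (cW_sub Z n)) => p ps.
change (cW n (cres Z (cl phi (p.1 \ot p.2)))); rewrite cl_pure [cres Z _]linearZ.
have hp2 : cW n (cres Z p.2) by apply: hn; apply/mapP; exists p.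
exact: (subspaceZ (phi p.1) (cW_sub Z n) hp2).
Qed.
End CenterConil.

(** * Odd derivations on vectors fixed by the even part: an Engel argument *)

Section OddDist.
Variables (K : fieldType) (hK : 2%N \notin [pchar K]) (G : supergroupType K).
Variables (E : closedSub G) (hE : is_even_part E).
Notation pi := (cres E).
Let evE := even_part_even hE.
Let al := adq pi.

Lemma lie_odd1 (v : {scalar G}) : lie_odd v -> v 1 = 0.
Proof. by move=> [_ v0 _]; rewrite -(homog1 G : hcomp false 1 = 1) v0. Qed.

Lemma lie_lin c (v w u : {scalar G}) : lie_odd v -> lie_odd w -> (forall x, u x = c * v x + w x) -> lie_odd u.
Proof.
move=> [_ v0 vM] [_ w0 wM] ue; split=> [k x y|x|a b]; first exact: linearP.
  by rewrite ue v0 w0 mulr0 addr0.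
by rewrite !ue vM wM !mulrDr !mulrDl addrACA !mulrA [counit a * c]mulrC.
Qed.

Lemma evh' (e : E) : homog false e.
Proof. by rewrite /homog -[RHS](hcomp_sum e) evE addr0. Qed.

Lemma tensM_even (u w : G) (d e : E) : (u \ot d) * (w \ot e) = (u * w) \ot (d * e) :> tens G E.
Proof.
by rewrite -{1}(hcomp_sum w) pureDl mulrDr !(tensM_hom _ _ (evh' d) (homog_hcomp _ w)) !expr0 !scale1r
  -pureDl -mulrDr hcomp_sum.
Qed.

Lemma pmul_coinv (R : superAlgType K) (X : superhom G R) (h : superhom E R) c : coinv E c ->
  pmul X (superhom_comp h pi) c = X c.
Proof.
move=> hc; have -> : pmul X (superhom_comp h pi) c = sprod X h (cou E c).
  have -> : pmul X (superhom_comp h pi) = superhom_comp (sprod X h) (cou E); last by [].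
  by rewrite /cou pmul_comp sprod_in1 superhom_compA sprod_in2.
by rewrite hc sprod_pure rmorph1 mulr1.
Qed.

(** For a function invariant under right translation by E, conjugation reduces to left translation
    by the inverse. *)
Lemma adq_coinv_cr (v : {scalar G}) (f f' : {scalar E}) c : coinv E c -> (forall x, f' x = f (antipode x)) ->
  v (cr f' (al c)) = v (cl (scomp f pi) (comul c)).
Proof.
move=> hc fe; congr (v _).
have -> : al c = tlift (fun x y : G => y \ot pi (antipode x)) (comul c).
  rewrite /al adq_pconj /pconj (pmul_coinv _ (in2 G E) hc) pmul_tlift; apply: eq_tlift => x y.
  transitivity ((1 \ot pi (antipode x)) * (y \ot 1) : tens G E); first by [].
  by rewrite tensM_even mul1r mulr1.
rewrite tlift_comp -[RHS]/(tlift _ _); apply: eq_tlift => x y; rewrite -[LHS]/(cr f' (y \ot pi (antipode x))) cr_pure fe.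
by rewrite (hopf_antipode (cres_hopf E)) antipodeK.
Qed.

Lemma counit_adq (f : {scalar E}) b : f (cl counit (al b)) = counit b * f 1.
Proof.
rewrite -cl_cr -{1}(subrK (counit b *: 1) b).
have -> : al (b - counit b *: 1 + counit b *: 1) = al (b - counit b *: 1) + counit b *: al 1.
  by rewrite [LHS]linearD; congr (_ + _); exact: linearZ.
have gD x c : counit (x + c *: (f 1 *: 1)) = counit x + c * f 1 :> K.
  by rewrite linearD /= !scalarZ /= counit1 mulr1.
rewrite crD crZ [al 1]rmorph1 [cr f 1](cr_pure f 1 1).
transitivity (counit (cr f (al (b - counit b *: 1))) + counit b * f 1); first exact: gD.
by rewrite adq_aug ?add0r // linearB scalarZ /= counit1 mulr1 subrr.
Qed.

(** The action on v, through conjugation by E, of a functional on K[E]. *)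
Definition vf (v : {scalar G}) (f : {scalar E}) : {scalar G} :=
  scomp v ((cr f : {linear tens G E -> G}) \o al : {linear G -> G}).
Lemma vfE v f x : vf v f x = v (cr f (al x)). Proof. by []. Qed.

Lemma lie_vf (v : {scalar G}) (f : {scalar E}) : lie_odd v -> lie_odd (vf v f).
Proof.
move=> hv; have [_ v0 _] := hv; split=> [k x y|x|a b]; first exact: linearP.
  rewrite vfE shom_even cr_hcomp [X in v (_ + hcomp _ X)]cr_eq0 => [|e]; last by rewrite /= evE linear0.
  by rewrite linear0 addr0 v0.
have key (y z : tens G E) : v (cr f (y * z)) =
    v (cr f (y * (1 \ot cl counit z))) + v (cr f ((1 \ot cl counit y) * z)).
  elim/tens_ind: y => [|u d y IH].
    by rewrite !mul0r [cl _ 0]linear0 pure0r mul0r [cr f 0]linear0 [v 0]linear0 addr0.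
  rewrite !mulrDl clD pureDr mulrDl !crD ![v (_ + _)]linearD IH addrACA; congr (_ + _).
  elim/tens_ind: z {IH} => [|w e z IH].
    by rewrite !mulr0 [cl _ 0]linear0 pure0r mulr0 [cr f 0]linear0 [v 0]linear0 addr0.
  rewrite !mulrDr clD pureDr mulrDr !crD ![v (_ + _)]linearD IH addrACA; congr (_ + _).
  rewrite !cl_pure !tensM_even mulr1 mul1r -scalerAr -scalerAl !cr_pure !scalarZ /= (lie_oddM u w hv).
  by ring.
have ce x : cl counit (al x) = counit x *: 1.
  by apply: dual_eq => g; rewrite counit_adq scalarZ.
rewrite !vfE [al _]rmorphM key !ce.
have -> : (1 : G) \ot (counit b *: 1 : E) = counit b *: 1 by rewrite pureZr.
have -> : (1 : G) \ot (counit a *: 1 : E) = counit a *: 1 by rewrite pureZr.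
by rewrite -scalerAr -scalerAl mulr1 mul1r !crZ !scalarZ /= mulrC.
Qed.

(** The odd derivations annihilated by n such actions with functionals vanishing at 1; the
    filtration expresses that E acts unipotently on V. *)
Fixpoint Vf n (v : {scalar G}) : Prop := if n is n'.+1 then
    lie_odd v /\ forall f : {scalar E}, f 1 = 0 -> Vf n' (vf v f)
  else lie_odd v /\ forall x, v x = 0.
Lemma Vf_lie n v : Vf n v -> lie_odd v.
Proof. by case: n => [|n] []. Qed.
Lemma Vf_lin n c (v w u : {scalar G}) : Vf n v -> Vf n w -> (forall x, u x = c * v x + w x) -> Vf n u.
Proof.
elim: n v w u => [|n IH] v w u [hv v0] [hw w0] ue; split; try exact: (lie_lin hv hw ue).
  by move=> x; rewrite ue v0 w0 mulr0 addr0.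
by move=> f f1; apply: (IH _ _ _ (v0 f f1) (w0 f f1)) => x; rewrite !vfE ue.
Qed.

Lemma filt_inner (P : G -> Prop) n (f : {scalar E}) x : f 1 = 0 -> filt al P n.+1 x ->
  filt al (fun y => P (cr f (al y))) n x.
Proof.
move=> f1; elim: n x => [|n IH] x hx; first exact: hx.
by move=> g g1; apply: IH; exact: (hx g g1).
Qed.

Lemma lie_gens (s : seq G) : (forall P : G -> Prop, (forall a, a \in s -> P a) -> P 1 ->
    (forall a b, P a -> P b -> P (a + b)) -> (forall a b, P a -> P b -> P (a * b)) ->
    (forall c a, P a -> P (c *: a)) -> forall a, P a) ->
  forall v : {scalar G}, lie_odd v -> (forall x, x \in s -> v x = 0) -> forall x, v x = 0.
Proof.
move=> hs v hv vs; apply: hs => //; first exact: lie_odd1.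
- by move=> a b ha hb; rewrite linearD /= ha hb addr0.
- by move=> a b ha hb; rewrite lie_oddM // ha hb mul0r mulr0 addr0.
- by move=> c a ha; rewrite scalarZ /= ha mulr0.
Qed.

Lemma Vf_all (s : seq G) n : (forall v : {scalar G}, lie_odd v -> (forall x, x \in s -> v x = 0) -> forall x, v x = 0) ->
  (forall x, x \in s -> filt al (fun y => y = 0) n x) -> forall v : {scalar G}, lie_odd v -> Vf n v.
Proof.
move=> hs hn v hv.
have {hn} : forall x, x \in s -> filt al (fun y => v y = 0) n x.
  by move=> x /hn; apply: filt_le => y ->; rewrite linear0.
elim: n v hv => [|n IH] v hv hn; first by split=> //; exact: hs.
split=> // f f1; apply: IH; first exact: lie_vf.
by move=> x /hn /(filt_inner f1).
Qed.

(** The anticommutator D of v and w is an even derivation at the unit, so it factors through K[E];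
    there an E-invariant function is constant, and D kills constants. *)
Lemma anticomm (v w : {scalar G}) c : lie_odd v -> lie_odd w -> coinv E c ->
  v (cr w (comul c)) + w (cr v (comul c)) = 0.
Proof.
move=> hv hw hc; have [_ v0 _] := hv; have [_ w0 _] := hw.
pose D x := v (cr w (comul x)) + w (cr v (comul x)).
have vtw (u : {scalar G}) b : lie_odd u -> u (tw1 b) = - u b.
  move=> [_ u0 _]; rewrite -[b in RHS](hcomp_sum b) /tw1 [u (_ - _)]linearB [u (_ + _)]linearD /= u0.
  by rewrite sub0r add0r.
have ceps (u : {scalar G}) x : counit (cr u (comul x)) = u x.
  by rewrite [LHS](cl_cr (counit : {scalar G}) u) -[cl _ _]/(tlift _ _) counitl.
have ctw b : counit (tw1 b) = counit b.
  by rewrite /tw1 linearB /= !counit_hcomp subr0.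
have half (u t : {scalar G}) a b : lie_odd u -> lie_odd t ->
    u (cr t (comul (a * b))) = u (cr t (comul a)) * counit b - t a * u b + (u a * t b + counit a * u (cr t (comul b))).
  move=> hu ht; rewrite Rv_mul // [u (_ + _)]linearD /= !lie_oddM // ctw vtw // !ceps mulrN.
  by [].
have DM a b : D (a * b) = D a * counit b + counit a * D b.
  rewrite /D !half //; by ring.
have Dod x : D (hcomp true x) = 0 by rewrite /D !Rv_hcomp // v0 w0 addr0.
have DB x y : D (x - y) = D x - D y.
  by rewrite /D -!cfunE' !linearB /= opprD addrACA.
have D0 : D 0 = 0 by rewrite -(subrr 0) DB subrr.
have DZ k x : D (k *: x) = k * D x.
  by rewrite /D -!cfunE' !scalarZ mulrDr.
have DN x : D (- x) = - D x by rewrite -sub0r DB D0 sub0r.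
have DI x : pi x = 0 -> D x = 0.
  move=> /hE [s ->]; elim: s => [|p s IH]; first by rewrite big_nil.
  rewrite big_cons -[X in D (_ + X)]opprK DB DM Dod counit_even mulr0 mulr0 addr0 sub0r.
  by rewrite DN opprK IH.
have D1 : D 1 = 0 by rewrite -(homog1 G : hcomp false 1 = 1) /D !Rv_hcomp //= comul1 !cr_pure !lie_odd1 // !scale0r !linear0 addr0.
have pc : pi c = counit c *: 1.
  by rewrite -(coinv_cres_cl (counit : {scalar G}) hc) -[cl _ _]/(tlift _ _) counitl.
have Dc : D (c - counit c *: 1) = 0.
  apply: DI; transitivity (pi c - pi (counit c *: 1)); first exact: rmorphB.
  by rewrite pc [pi (_ *: _)]linearZ rmorph1 subrr.
by change (D c = 0); move: Dc; rewrite DB DZ D1 mulr0 subr0.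
Qed.
End OddDist.

Section Engel.
Variables (K : fieldType) (hK : 2%N \notin [pchar K]) (G : supergroupType K) (aG : algebraic G).
Variables (E : closedSub G) (hE : is_even_part E) (F : closedSub E).
Hypothesis cG : central_sub (sub_trans F).
Hypothesis hF : forall x : E, coinv F x -> conil x.
Notation pi := (cres E).
Let B := coinv_sub cG.
Let nG : noeth G := hilbert_basis aG.
Let evE := even_part_even hE.

Variables (M : supermodule (subT B)).

(** The matrix coefficients of M in K[G]; M is a module over G/F, hence over G. [Tm] is the action
    of functionals on M, and [efix] expresses that E fixes m. *)
Definition cf (phi : {scalar M}) (m : M) : G := sinc B (cl phi (coact m)).
Definition Tm (f : {scalar G}) (m : M) : M := cr (scomp f (sinc B)) (coact m).
Definition efix (m : M) := forall phi, coinv E (cf phi m).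

Lemma Tm_cf (f : {scalar G}) (phi : {scalar M}) m : phi (Tm f m) = f (cf phi m).
Proof. exact: cl_cr. Qed.
Lemma cf_Tm (f : {scalar G}) (phi : {scalar M}) m : cf phi (Tm f m) = cr f (comul (cf phi m)).
Proof.
rewrite /cf (cr_hopf (sinc_hopf B)); congr (sinc B _).
by rewrite (th_cl (@coactA K _ M)).
Qed.
Lemma Tm_eq m m' : (forall phi : {scalar M}, phi m = phi m') -> m = m'.
Proof. exact: dual_eq. Qed.
Lemma Tm_lin c (f g h : {scalar G}) m : (forall x, h x = c * f x + g x) -> Tm h m = c *: Tm f m + Tm g m.
Proof. by move=> e; apply: Tm_eq => phi; rewrite linearP /= !Tm_cf e. Qed.
Lemma cf_counit (phi : {scalar M}) m : counit (cf phi m) = phi m.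
Proof. by rewrite -[LHS](Tm_cf (counit : {scalar G})); congr (phi _); rewrite -[RHS]coact1; apply: eq_cr => x; rewrite -(sinc_hopf B).2. Qed.
Lemma cf0 (phi : {scalar M}) : cf phi 0 = 0. Proof. by rewrite /cf !linear0. Qed.
Lemma Tm0 (f : {scalar G}) : Tm f 0 = 0. Proof. by rewrite /Tm !linear0. Qed.

Lemma coinv_piE (phi : {scalar M}) m : conil (pi (cf phi m)).
Proof. by apply: hF; apply: coinv_res; exact: (sincP (cl phi (coact m))). Qed.

Lemma Tm_hcomp (v : {scalar G}) i j m : (forall x, v (hcomp (~~ i) x) = 0) ->
  Tm v (hcomp j m) = hcomp (i (+) j) (Tm v m).
Proof.
move=> v0; rewrite /Tm coact_even.
have e k (y : tens M (subT B)) : cr (scomp v (sinc B)) (hcomp k y) = hcomp (i (+) k) (cr (scomp v (sinc B)) y).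
  elim/tens_hind: y => [|a b u w y hu hw IH]; first by rewrite ![hcomp _ 0]linear0 [cr _ 0]linear0 [hcomp _ 0]linear0.
  rewrite hcompD !crD IH hcompD; congr (_ + _).
  have sv l x : scomp v (sinc B) (hcomp l x) = v (hcomp l (sinc B x)) by congr (v _); exact: shom_even.
  have sw x : scomp v (sinc B) x = v (sinc B x) by [].
  rewrite hcomp_pure crD !cr_pure hcompZ !sv sw.
  have vi x : v (hcomp i x) = v x.
    by rewrite -[in RHS](hcomp_sum' i x) [v (_ + _)]linearD /= v0 addr0.
  by clear IH; case: i v0 vi => v0 vi; case: k; rewrite /= ?v0 ?vi ?scale0r ?add0r ?addr0.
exact: e.
Qed.

Lemma efixP m : (forall f : {scalar E}, f 1 = 0 -> Tm (scomp f pi) m = 0) -> efix m.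
Proof. by move=> h phi; apply: coinvP0 => f f1; rewrite -cf_Tm h // cf0. Qed.

(** The coefficients restricted to E are conilpotent; contract along E until nothing further
    survives. *)
Lemma efix_ex n (m : M) : m != 0 -> (forall phi, cW n (pi (cf phi m))) ->
  exists i m', [/\ m' != 0, homog i m' & efix m'].
Proof.
elim: n m => [|n IH] m m0 hm.
  case/eqP: m0; apply: Tm_eq => phi; rewrite linear0 -cf_counit -(cres_hopf E).2.
  have -> : pi (cf phi m) = 0 by exact: hm.
  exact: linear0.
have [[f [f1 fm]]|nf] := pselect (exists f : {scalar E}, f 1 = 0 /\ Tm (scomp f pi) m <> 0).
  apply: (IH (Tm (scomp f pi) m)) => [|phi]; first exact/eqP.
  by rewrite cf_Tm -(cr_hopf (cres_hopf E)); exact: (hm phi f f1).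
have [i mi] := hcomp_neq0 m0; exists i, (hcomp i m); split=> //; first exact: homog_hcomp.
apply: efixP => f f1; rewrite (Tm_hcomp (i := false)).
  have [->|hn] := pselect (Tm (scomp f pi) m = 0); first exact: linear0.
  by case: nf; exists f.
by move=> x; rewrite /= shom_even evE linear0.
Qed.

(** Since E fixes m, acting by E on v m amounts to acting on v alone. *)
Lemma Tm_conj (v : {scalar G}) (f : {scalar E}) m : efix m ->
  Tm (scomp f pi) (Tm v m) = Tm (vf v (scomp f (mklin (@antipode_linear K E)))) m.
Proof.
move=> hm; apply: Tm_eq => phi; rewrite !Tm_cf cf_Tm vfE.
rewrite (adq_coinv_cr hE v (f := f) (hm phi)) //.
by rewrite -!cl_cr.
Qed.

Lemma Tm_anti (v w : {scalar G}) m : lie_odd v -> lie_odd w -> efix m ->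
  Tm v (Tm w m) = - Tm w (Tm v m).
Proof.
move=> hv hw hm; apply: Tm_eq => phi; rewrite linearN /= !Tm_cf !cf_Tm.
apply/eqP; rewrite -addr_eq0; apply/eqP.
exact: (anticomm hE hv hw (hm phi)).
Qed.

Lemma Tm_sq (v : {scalar G}) m : lie_odd v -> efix m -> Tm v (Tm v m) = 0.
Proof. by move=> hv hm; apply: (eq_opp0 hK); exact: Tm_anti. Qed.

(** The Engel induction climbs the filtration [Vf]: at level i the vector is annihilated by its i-th
    stage. *)
Definition lvl i (m : M) := [/\ m != 0, exists j, homog j m, efix m & forall v : {scalar G}, Vf E i v -> Tm v m = 0].

(** E moves [u] into the stage below, which kills m; hence u m is again fixed by E. The derivations
    that kill m still kill u m, by anticommutation. *)
Lemma lvl_Tm i (u : {scalar G}) m : Vf E i.+1 u -> lvl i m -> Tm u m <> 0 -> lvl i (Tm u m).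
Proof.
move=> hu [m0 [j hj] em Vm] um; have lu := Vf_lie hu; split; first exact/eqP.
- exists (true (+) j); have [_ u0 _] := lu; rewrite /homog -(Tm_hcomp (i := true)) ?hj //.
- apply: efixP => f f1; rewrite Tm_conj //; apply: Vm; apply: hu.2.
  by rewrite /= antipode1.
- move=> w hw; rewrite Tm_anti //; last exact: Vf_lie hw.
  by rewrite Vm // Tm0 oppr0.
Qed.

(** A derivation is determined by its values on generators, so they are treated one by one. If some
    [u] vanishes on the earlier entries but not on [x], replace m by u m unless that is zero; then
    [u] kills the new vector because its square is zero, and multiples of [u] correct the value at
    [x]. *)
Lemma lvl_list i (t : seq G) (m : M) : lvl i m -> exists2 m', lvl i m' &
  forall v : {scalar G}, Vf E i.+1 v -> exists v' : {scalar G}, [/\ Vf E i.+1 v', Tm v' m' = 0 &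
    forall x, x \in t -> v x = v' x].
Proof.
move=> hm; elim: t => [|x t [m' hm' IH]].
  exists m => // v hv; have sc : scalar (fun _ : G => 0 : K) by move=> c x y; rewrite mulr0 addr0.
  have e0 y : mkscal sc y = -1 * v y + v y by rewrite mulN1r addNr.
  exists (mkscal sc); split=> //; first exact: (Vf_lin hv hv e0).
  by rewrite (Tm_lin m e0) scaleN1r addNr.
have [[u [hu ut ux]]|nu] := pselect (exists u : {scalar G}, [/\ Vf E i.+1 u, forall y, y \in t -> u y = 0 & u x <> 0]); last first.
  exists m' => // v /[dup] hv /IH [v' [hv' vm e]]; exists v'; split=> // y; rewrite inE => /orP[/eqP ->|/e //].
  have sc : scalar (fun y => -1 * v' y + v y) by move=> c a b; rewrite !linearP /=; rewrite !mulrDr addrACA mulrCA.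
  apply/eqP; rewrite -subr_eq0; apply/eqP.
  have [//|h] := pselect (v x - v' x = 0); case: nu; exists (mkscal sc); split.
  - exact: (Vf_lin hv' hv).
  - by move=> z zt /=; rewrite (e z zt) mulN1r addNr.
  - by rewrite /= mulN1r addrC.
have lu := Vf_lie hu; have [m0 hj em Vm] := hm'.
have [m2 hm2 m2P] : exists2 m2, lvl i m2 & forall w : {scalar G}, lie_odd w -> (Tm w m' = 0 \/ w = u) -> Tm w m2 = 0.
  have [um|um] := pselect (Tm u m' = 0); first by exists m' => // w _ [|->].
  exists (Tm u m'); first exact: lvl_Tm.
  by move=> w lw [wm|->]; [rewrite Tm_anti // wm Tm0 oppr0|exact: Tm_sq].
exists m2 => // v /[dup] hv /IH [v' [hv' vm e]].
pose k := (v x - v' x) / u x.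
have sc : scalar (fun y => k * u y + v' y) by move=> c a b; rewrite !linearP /=; rewrite !mulrDr addrACA mulrCA.
exists (mkscal sc); split.
- exact: (Vf_lin hu hv').
- rewrite (@Tm_lin k u v') // m2P //; last by right.
  by rewrite m2P ?scaler0 ?addr0 //; [exact: Vf_lie hv'|left].
- move=> y; rewrite inE => /orP[/eqP ->|yt] /=; last by rewrite ut // mulr0 add0r e.
  by rewrite /k divfK ?subrK //; exact/eqP.
Qed.

Lemma gens_filt (s : seq G) : exists n, forall x, x \in s -> filt (adq pi) (fun y => y = 0) n x.
Proof.
elim: s => [|x s [n IH]]; first by exists 0%N.
have [n' hn'] : exists n, filt (adq pi) (fun y => y = 0) n x.
  apply: (conil_filt (adq_coassoc (cres_hopf E)) (adq_counit (cres_hopf E))) => f; rewrite [cl f _]adq_cl.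
  by apply: hF; apply: coinv_res; exact: (ad_coinv cG).
exists (maxn n n') => y; rewrite inE => /orP[/eqP ->|/IH h].
  by apply: filt_mono hn'; [exact: stab0|exact: leq_maxr].
by apply: filt_mono h; [exact: stab0|exact: leq_maxl].
Qed.

Lemma coefs_conil m0 : exists k, forall phi, cW k (pi (cf phi m0)).
Proof.
pose th := tmap (idfun : {linear M -> M}) (superhom_comp pi (sinc B)) (coact m0).
have thE (phi : {scalar M}) : cl phi th = pi (cf phi m0).
  exact: (cl_tmap (f := idfun) _ (h := phi) (h' := phi)).
have hth (phi : {scalar M}) : conil (cl phi th) by rewrite thE; exact: coinv_piE.
have [t tP e] := tens_memr (conil_sub E) hth.
have [|k hk] := @conil_seq _ E [seq p.2 | p <- t]; first by move=> x /mapP[p /tP ? ->].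
exists k => phi; rewrite -thE e linear_sum; apply: (subspace_sum_seq (cW_sub E k)) => p pt.
rewrite [X in cW k X]cl_pure; apply: (subspaceZ _ (cW_sub E k)).
by apply: hk; exact: map_f.
Qed.

Lemma lvl_all n (s : seq G) m1 : (forall v : {scalar G}, lie_odd v -> (forall x, x \in s -> v x = 0) -> forall x, v x = 0) ->
  m1 != 0 -> (exists j, homog j m1) -> efix m1 -> exists m, lvl n m.
Proof.
move=> gens m1n hj em; elim: n => [|i [m hm]].
  exists m1; split=> //.
  by move=> v [_ v0]; apply: Tm_eq => phi; rewrite Tm_cf v0 linear0.
have [m' [? ? ? ?] h] := lvl_list s hm; exists m'; split=> // v hv.
have [v' [hv' vm e]] := h v hv; rewrite -[RHS]vm; apply: Tm_eq => phi; rewrite !Tm_cf.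
have sc : scalar (fun y => -1 * v' y + v y) by move=> c a b; rewrite !linearP /=; rewrite !mulrDr addrACA mulrCA.
have lsc : lie_odd (mkscal sc) by apply: (lie_lin (Vf_lie hv') (Vf_lie hv)).
have z0 x : x \in s -> mkscal sc x = 0 by move=> xs /=; rewrite e // mulN1r addNr.
by have := gens _ lsc z0 (cf phi m') => /= /eqP; rewrite mulN1r addrC subr_eq0 => /eqP.
Qed.

(** A coefficient minus its constant value lies in the odd ideal, as E fixes m, and is annihilated
    by all odd derivations; by [dagger] it lies in every power of this ideal, hence is zero. *)
Lemma fixed_of_lvl m : efix m -> (forall v : {scalar G}, lie_odd v -> Tm v m = 0) -> coact m = m \ot 1.
Proof.
move=> emm Vm; apply: tens_clP => phi; rewrite cl_pure; apply: (@sinc_inj K G B).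
transitivity (phi m *: (1 : G)); last by rewrite [RHS]linearZ rmorph1.
change (cf phi m = phi m *: 1); apply/eqP; rewrite -subr_eq0; apply/eqP.
have [N hN] := odd_nilpotent hK nG; apply: hN.
have I1 : Ip 1 (cf phi m - phi m *: 1).
  apply/(pi_Ip hE); transitivity (pi (cf phi m) - pi (phi m *: 1)); first exact: rmorphB.
  have pc : pi (cf phi m) = counit (cf phi m) *: 1.
    by rewrite -(coinv_cres_cl (counit : {scalar G}) (emm phi)) -[cl _ _]/(tlift _ _) counitl.
  transitivity (pi (cf phi m) - phi m *: 1).
    by congr (_ - _); rewrite [LHS]linearZ rmorph1.
  by rewrite pc cf_counit subrr.
have R0 (v : {scalar G}) : lie_odd v -> cr v (comul (cf phi m - phi m *: 1)) = 0.
  move=> hv; transitivity (cr v (comul (cf phi m)) - phi m *: cr v (comul 1)).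
    rewrite -[RHS]/(cr v (comul (cf phi m)) - phi m *: cr v (comul 1)) -crZ -crB; congr (cr v _).
    by rewrite [LHS]linearB; congr (_ - _); exact: linearZ.
  rewrite -cf_Tm Vm //.
  by rewrite cf0 comul1 cr_pure lie_odd1 // scale0r scaler0 subrr.
have Ik k' : Ip k'.+1 (cf phi m - phi m *: 1).
  elim: k' => [//|k' IH]; apply: (dagger hK nG hE IH) => v hv; rewrite R0 //.
  exact: (@Ip_sub K G k'.+1).1.
by case: N => [|N] //; exact: Ik.
Qed.

Lemma engel_fixed : (exists m : M, m != 0) -> exists i (m : M), [/\ m != 0, homog i m & coact m = m \ot 1].
Proof.
move=> [m0 m0n]; have [s hs] := aG.
have [n hn] := gens_filt s.
have gens := lie_gens hs.
have Vall := Vf_all hE gens hn.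
have [k hk] := coefs_conil m0.
have [j [m1 [m1n hj em]]] := efix_ex m0n hk.
have [m [mn [i hi] emm Vm]] := lvl_all n gens m1n (ex_intro _ j hj) em.
by exists i, m; split=> //; apply: fixed_of_lvl => // v hv; apply: Vm; exact: Vall.
Qed.
End Engel.

Theorem engel (K : fieldType) (hK : 2%N \notin [pchar K]) (G : supergroupType K) (aG : algebraic G)
    (E : closedSub G) (hE : is_even_part E) (F : closedSub E) (cG : central_sub (sub_trans F)) :
  (forall x : E, coinv F x -> conil x) -> unipotent (subT (coinv_sub cG)).
Proof. by move=> hF; apply: unipotent_fixed => M; exact: (engel_fixed hK aG hE hF). Qed.

(** * Integrals on groups of multiplicative type and averaging *)

Section Lambda.
Variables (K L : fieldType) (iota : {rmorphism K -> L}) (F : supergroupType K).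

Section Diag.
Variables (B : supergroupType L) (dB : Defs.diagonalizable B).

(** Independence of 1 from the other grouplikes: a contraction that kills 1 and fixes one grouplike
    of the relation shortens it. *)
Lemma nontriv_span (s : seq (L * B)) c : (forall p, p \in s -> grouplike p.2 /\ p.2 <> 1) ->
  \sum_(p <- s) p.1 *: p.2 = c *: 1 -> c *: 1 = 0 :> B.
Proof.
elim: (size s) {-2}s (leqnn (size s)) => {s} [|n IHn] [|[a g] s] // ss hs e; try by rewrite -e big_nil.
have s1 : subspace (fun y : B => exists c, y = c *: 1).
  split; first by exists 0; rewrite scale0r.
  by move=> k _ _ [x ->] [y ->]; exists (k * x + y); rewrite scalerDl scalerA.
have [[eg g1] gN] := hs _ (mem_head _ _).
have [|f [f01 fg]] := separation (v := g) s1.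
  move=> [k ek]; move: g1; rewrite /= ek scalarZ /= counit1 mulr1 => k1.
  by apply: gN; rewrite /= ek k1 scale1r.
have f1 : f 1 = 0 by apply: f01; exists 1; rewrite scale1r.
pose T : {linear B -> B} := cr f \o comul.
have TD (x y : B) : T (x + y) = T x + T y by exact: linearD.
have TZ (k : L) (x : B) : T (k *: x) = k *: T x by exact: linearZ_LR.
have TS (l : seq (L * B)) : T (\sum_(p <- l) p.1 *: p.2) = \sum_(p <- l) T (p.1 *: p.2) by exact: linear_sum.
have Tg h : grouplike h -> T h = f h *: h by move=> [eh _]; rewrite /T /= eh cr_pure.
have T1 : T (c *: 1) = 0.
  by rewrite TZ (Tg 1) ?f1 ?scale0r ?scaler0 //; split; [exact: comul1|exact: counit1].
apply: (IHn [seq (p.1 * (1 - f p.2), p.2) | p <- s]); first by rewrite size_map.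
  by move=> p /mapP[r rs ->] /=; apply: hs; rewrite inE rs orbT.
have h : c *: 1 - T (c *: 1) = c *: 1 by rewrite T1 subr0.
rewrite -[RHS]h -e big_cons TD TZ Tg // fg scale1r opprD addrACA subrr add0r big_map TS -sumrB.
rewrite big_seq [RHS]big_seq; apply: eq_bigr => p ps.
have [hp _] : grouplike p.2 /\ p.2 <> 1 by apply: hs; rewrite inE ps orbT.
by rewrite TZ Tg // scalerA /= mulrBr mulr1 scalerBl.
Qed.

Lemma coef1_ex : exists e : {scalar B}, e 1 = 1 /\ forall g, grouplike g -> g <> 1 -> e g = 0.
Proof.
pose P (x : B) := exists s : seq (L * B), (forall p, p \in s -> grouplike p.2 /\ p.2 <> 1) /\ x = \sum_(p <- s) p.1 *: p.2.
have sP : subspace P.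
  split; first by exists [::]; rewrite big_nil.
  move=> c x y [s [hs ->]] [t [ht ->]]; exists ([seq (c * p.1, p.2) | p <- s] ++ t); split.
    by move=> p; rewrite mem_cat => /orP[/mapP[q /hs hq ->]|/ht].
  by rewrite big_cat big_map scaler_sumr; congr (_ + _); apply: eq_bigr => p _; rewrite /= scalerA.
have nP : ~ P 1.
  move=> [s [hs e]]; have := @nontriv_span s 1 hs; rewrite scale1r => /(_ (esym e)) /eqP.
  by rewrite oner_eq0.
have [e [e0 e1]] := separation sP nP; exists e; split=> // g gg g1; apply: e0.
by exists [:: (1, g)]; rewrite big_seq1 scale1r; split=> // p; rewrite inE => /eqP ->.
Qed.

Variables (e : {scalar B}) (e1 : e 1 = 1) (e0 : forall g, grouplike g -> g <> 1 -> e g = 0).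

Lemma coef1_int b : cr e (comul b) = e b *: 1.
Proof.
have [s [hs ->]] := dB b; rewrite !linear_sum scaler_suml big_seq [RHS]big_seq.
apply: eq_bigr => p /hs hp; have [hc _] := hp; rewrite /= [comul _]linearZ [cr e (_ *: _)]linearZ /= hc cr_pure scalarZ /= -scalerA; congr (_ *: _).
have [->//|n1] := pselect (p.2 = 1); by rewrite e0 // !scale0r.
Qed.

(** Multiplying by the inverse of a grouplike g moves the coefficient of g to 1, so all coefficients
    vanish. *)
Lemma coef1_nondeg (evB : purely_even B) b : (forall b', e (b * b') = 0) -> b = 0.
Proof.
have [s [hs ->]] := dB b => h.
have hz (g : B) : grouplike g -> \sum_(p <- s | p.2 == g) p.1 = 0.
  move=> hg; rewrite -[RHS](h (antipode g)) mulr_suml linear_sum /=.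
  rewrite big_mkcond /= big_seq [RHS]big_seq; apply: eq_bigr => p /hs hp.
  rewrite -scalerAl scalarZ /=; case: eqP => [->|ng].
    by rewrite (grouplikeV hg).2 e1 mulr1.
  have gg : grouplike (p.2 * antipode g).
    by apply: grouplikeM => //; apply: grouplike_antipode.
  have ne : p.2 * antipode g <> 1.
    by move=> e'; apply: ng; rewrite -[p.2]mulr1 -(grouplikeV hg).1 mulrA e' mul1r.
  by rewrite (e0 gg ne) mulr0.
have : forall t : seq B, (forall p, p \in s -> p.2 \in t) -> uniq t -> (forall g, g \in t -> grouplike g) ->
    \sum_(p <- s) p.1 *: p.2 = \sum_(g <- t) (\sum_(p <- s | p.2 == g) p.1) *: g.
  move=> t ht ut _; transitivity (\sum_(p <- s) \sum_(g <- t | p.2 == g) p.1 *: g).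
    rewrite big_seq [RHS]big_seq; apply: eq_bigr => p /ht pt.
    rewrite -big_filter (_ : [seq g <- t | p.2 == g] = [:: p.2]) ?big_seq1 //.
    by rewrite -[RHS](filter_pred1_uniq ut pt); apply: eq_filter => g; rewrite eq_sym.
  rewrite (exchange_big_dep predT) //=; apply: eq_bigr => g _.
  by rewrite scaler_suml.
move=> /(_ (undup [seq p.2 | p <- s])) ->.
- by rewrite big_seq big1 // => g; rewrite mem_undup => /mapP[p /hs hp ->]; rewrite hz // scale0r.
- by move=> p ps; rewrite mem_undup; exact: map_f.
- exact: undup_uniq.
- by move=> g; rewrite mem_undup => /mapP[p /hs hp ->].
Qed.
End Diag.

(** Over L the coefficient of 1 is a nondegenerate integral. Composed with the K-linear functionals
    on L it gives a family of integrals over K that is still jointly nondegenerate. *)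
Lemma integrals : mult_type iota F -> exists Lam : {scalar F} -> Prop,
  (forall lam : {scalar F}, Lam lam -> forall c, cr lam (comul c) = lam c *: 1) /\
  (forall c, (forall (lam : {scalar F}), Lam lam -> forall d, lam (c * d) = 0) -> c = 0).
Proof.
move=> [evF _ [B [j [hj dB]]]]; have [e [e1 e0]] := coef1_ex B.
have [jZ jh jc jeps juniv] := hj.
(* The odd projection of [B] vanishes on the image of [F], so it is zero by uniqueness in the
   universal property. *)
have evB : purely_even B.
  have zs : forall (k : K) (a b : F), (0 : B) = iota k *: 0 + 0 by move=> k a b; rewrite scaler0 addr0.
  have l0 : linear (fun b : B => 0 : B) by move=> k x y; rewrite scaler0 addr0.
  have [h _ hu] := juniv B (fun=> 0) zs => b.
  have := hu (hcomp true) (fun a => etrans (esym (jh true a)) (etrans (congr1 j (evF a)) (rmorph0 j))) b.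
  by rewrite -(hu (mklin l0) (fun a => erefl)).
have lsc (p : {scalar extf iota}) : scalar (fun c : F => p (e (j c) : extf iota)).
  move=> k x y; rewrite rmorphD jZ [e (_ + _)]linearD /= [e (_ *: _)]scalarZ /=.
  by rewrite -[iota k * _]/(k *: (e (j x) : extf iota)) [p (_ + _)]linearD /= scalarZ.
exists (fun lam => exists p, lam = mkscal (lsc p)); split.
  move=> lam [p ->] c; apply: dual_eq => phi; rewrite cl_cr scalarZ /=.
  have phs : forall k a b, iota (phi (k *: a + b)) = iota k *: (iota (phi a) : L^o) + iota (phi b).
    by move=> k a b; rewrite linearP rmorphD rmorphM.
  have [ph hph _] := juniv L^o (fun a => iota (phi a)) phs.
  have hsum : ph (cr e (comul (j c))) = \sum_(u <- repr (comul c)) iota (phi u.1) * e (j u.2).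
    rewrite jc; transitivity (\sum_(u <- repr (comul c)) ph (cr e (j u.1 \ot j u.2))).
      by rewrite [cr e _]linear_sum; exact: linear_sum.
    by apply: eq_bigr => u _; rewrite cr_pure [ph _]linearZ hph mulrC.
  have hint : ph (cr e (comul (j c))) = e (j c) * iota (phi 1).
    by rewrite (coef1_int dB e0) [ph _]linearZ -(rmorph1 j) hph.
  have pD (x y : L) : p (x + y : extf iota) = p x + p y by exact: (linearD p).
  have pS (r : seq (F * F)) (g : F * F -> L) : p (\sum_(u <- r) g u : extf iota) = \sum_(u <- r) p (g u : extf iota).
    by exact: (linear_sum p).
  have pZ k (x : L) : p (iota k * x : extf iota) = k * p x by exact: (scalarZ p k x).
  transitivity (p (\sum_(u <- repr (comul c)) iota (phi u.1) * e (j u.2) : extf iota)).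
    rewrite pS [X in cl phi X]tens_sumE linear_sum.
    transitivity (\sum_(u <- repr (comul c)) mkscal (lsc p) (cl phi (u.1 \ot u.2))); first exact: (linear_sum (mkscal (lsc p))).
    by apply: eq_bigr => u _; rewrite cl_pure scalarZ /= pZ.
  transitivity (p (iota (phi 1) * e (j c) : extf iota)); last by rewrite pZ mulrC.
  by congr (p _); rewrite [RHS]mulrC -hint hsum.
move=> c hc; apply: (base_inj hj); rewrite rmorph0; apply: (coef1_nondeg dB e1 e0 evB) => b'.
have key d : e (j c * j d) = 0.
  rewrite -rmorphM; apply: (@dual_eq K (extf iota)) => p; rewrite linear0.
  by rewrite -(hc (mkscal (lsc p)) (ex_intro _ p erefl) d).
pose f (d : F) : L^o := e (j c * j d).
have fs : forall k a b, f (k *: a + b) = iota k *: f a + f b.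
  by move=> k a b; rewrite /f rmorphD jZ mulrDr -scalerAr [e (_ + _)]linearD /= scalarZ.
have [h _ hu] := juniv L^o f fs.
have l1 : linear (fun b : B => e (j c * b) : L^o) by move=> k x y; rewrite mulrDr -scalerAr [e (_ + _)]linearD /= scalarZ.
have l0 : linear (fun b : B => 0 : L^o) by move=> k x y; rewrite scaler0 addr0.
have := hu (mklin l1) (fun a => erefl) b'.
have := hu (mklin l0) (fun a => esym (key a)) b'.
by move=> /= <-.
Qed.
End Lambda.

Section KerMult.
Variables (K : fieldType) (G : supergroupType K) (N : closedSub G) (cN : central_sub N) (evN : purely_even N).
Variable Lam : {scalar N} -> Prop.
Hypothesis Lint : forall lam : {scalar N}, Lam lam -> forall c, cr lam (comul c) = lam c *: 1.
Hypothesis Lnon : forall c, (forall (lam : {scalar N}), Lam lam -> forall d, lam (c * d) = 0) -> c = 0.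
Let B := coinv_sub cN.
Notation q := (cres N).

(** Averaging over N by an integral produces N-invariant functions. *)
Lemma avg_coinv (lam : {scalar N}) a : Lam lam -> coinv N (cr (scomp lam q) (comul a)).
Proof.
move=> hl; apply: coinvP => f; rewrite cr_cr; apply: dual_eq => h; rewrite scalarZ !cl_cr /=.
change (lam (q (cl (scomp f q) (comul (cl h (comul a))))) = f 1 * lam (q (cl h (comul a)))).
rewrite -(cl_hopf (cres_hopf N)) -cl_cr Lint // scalarZ /= mulrC.
by [].
Qed.

Lemma q_od x : q (hcomp true x) = 0.
Proof. by rewrite shom_even evN. Qed.
Lemma cr_mul1l (f : {scalar G}) (x : G) (z : tens G G) : cr f ((x \ot 1) * z) = x * cr f z.
Proof.
elim/tens_ind: z => [|u w z IH]; first by rewrite mulr0 !linear0 mulr0.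
by rewrite mulrDr !crD IH mulrDr; congr (_ + _); rewrite tensMl1 !cr_pure scalerAr.
Qed.
Lemma cr_mul2l (lam : {scalar N}) (phi : {scalar G}) (y : G) (z : tens G G) :
  phi (cr (scomp lam q) ((1 \ot y) * z)) = lam (q (cl phi z) * q y).
Proof.
have hom k (x : G) : homog k x -> phi (cr (scomp lam q) ((1 \ot x) * z)) = lam (q (cl phi z) * q x).
  move=> hx; elim/tens_hind: z => [|i j a b z ha hb IH]; first by rewrite mulr0 !linear0 mul0r !linear0.
  rewrite mulrDr crD [phi (_ + _)]linearD IH clD [q (_ + _)]rmorphD mulrDl [lam (_ + _)]linearD; congr (_ + _).
  rewrite (tensM_hom _ _ hx ha) crZ cr_pure cl_pure mul1r /= [q (_ *: _)]linearZ -scalerAl !scalarZ /= rmorphM.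
  case: k hx => hx; last by rewrite expr0 mul1r mulrC (evmC evN).
  have qx : q x = 0 by rewrite -hx q_od.
  have e1 : lam (q x * q b) = 0 by rewrite qx mul0r linear0.
  have e2 : lam (q b * q x) = 0 by rewrite qx mulr0 linear0.
  by rewrite e1 e2 mul0r !mulr0.
rewrite -[y](hcomp_sum y) pureDr mulrDl crD [phi (_ + _)]linearD [q (_ + _)]rmorphD mulrDr [lam (_ + _)]linearD.
by congr (_ + _); exact: (hom _ _ (homog_hcomp _ y)).
Qed.

(** If a vanishes on N, every average of w a is an invariant function of counit 0, so it lies in
    B^+. A functional [phi] killing B^+ K[G] therefore satisfies lam(q(phi(a_1) a_2) q(y)) = 0 for
    all y and all integrals; nondegeneracy gives q(phi(a_1) a_2) = 0, and the counit gives phi(a) =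
    0. *)
Theorem ker_mult a : q a = 0 <-> idgen (augim (sinc B)) a.
Proof.
split; last exact: coinv_in_ker.
move=> qa; apply: (subspace_dual (idgen_sub _)) => phi phi0.
have main (lam : {scalar N}) y : Lam lam -> lam (q (cl phi (comul a)) * q y) = 0.
  move=> hl.
  pose avg x := cr (scomp lam q) (comul x).
  pose L1 (u w : G) : K := phi (antipode u * avg (w * a)).
  have bl : bilin (W := K^o) L1.
    split=> [w c u u'|u c w w']; rewrite /L1 /avg.
      by rewrite [antipode _]linearP mulrDl -scalerAl; exact: linearP.
    by rewrite mulrDl -scalerAl [comul _]linearP [cr _ _]linearP mulrDr -scalerAr; exact: linearP.
  have e1 u w : L1 u w = 0.
    have hb : coinv N (avg (w * a)) by exact: avg_coinv.
    have [b eb] := sinc_ex (S := B) hb.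
    have ev0 : counit (avg (w * a)) = 0.
      rewrite /avg [LHS](cl_cr (counit : {scalar G})) -[cl _ _]/(tlift _ _) counitl; change (lam (q (w * a)) = 0);
        have -> : q (w * a) = q w * q a by exact: rmorphM.
      by rewrite qa mulr0 linear0.
    apply: phi0; exists [:: (antipode u, avg (w * a))]; rewrite big_seq1; split=> // p; rewrite inE => /eqP -> /=.
    by exists b => //; rewrite -(sinc_hopf B).2 eb.
  have e2 : tlift (W := K^o) L1 (comul y) = lam (q (cl phi (comul a)) * q y).
    (* The identity 1 \ot y = (S(y_1) \ot 1) comul(y_2) rewrites the integral as a sum of multiples
       of averages of y_2 a. *)
    rewrite -cr_mul2l -in2E -(pmulKl (in1 G G) (in2 G G)) -comul_pmul pmul_tlift tliftMr tlift_comp.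
    rewrite (@tlift_lin K G G G K^o phi); last by move=> c x x'; exact: linearP.
    apply: eq_tlift => u w; rewrite /L1 /avg comulM tmulE -cr_mul1l mulrA.
    by [].
  by rewrite -e2 /tlift /teval big1 // => p _; exact: e1.
have : q (cl phi (comul a)) = 0.
  by apply: Lnon => lam hl d; have [y <-] := cres_surj d; exact: main.
move=> /(congr1 counit); rewrite (cres_hopf N).2 linear0 -cl_cr -[cr _ _]/(tlift _ _) counitr.
by [].
Qed.
End KerMult.

(** * The equivalence for connected supergroups *)

Theorem cond_da (K L : fieldType) (iota : {rmorphism K -> L}) (G : supergroupType K)
    (hK : 2%N \notin [pchar K]) : algebraic G -> connected G -> cond_d iota G -> cond_a iota G.
Proof.
move=> aG conn [E [hE nilE [Z [F [hZ [mF [Q uQ]] rF]]]]].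
have nG := hilbert_basis aG.
have nE : noeth E := noeth_surj (@cres_surj K G E) nG.
have evE := even_part_even hE.
have [r [Y [r0 hY Yr]]] := nilpotent_chain nilE.
have noidem := even_part_idem nG hE conn.
have cFE : central_sub (sub_trans F).
  move=> R n g [m hm]; apply: (center_central hZ); exists (superhom_comp m (cres F)) => a; exact: hm.
have hF x : coinv (sub_trans F) x -> conil x.
  exact: (mult_coinv_conil hK evE nE hY Yr noidem hZ uQ).
pose FG : closedSub G := sub_trans (sub_trans F).
have cG : central_sub FG := stepA hK nG hE cFE mF rF.
have uB : unipotent (subT (coinv_sub cG)) := engel hK aG hE hF.
set B := coinv_sub cG in uB.
have [Lam [l1 l2]] := integrals mF.
have evF : purely_even FG by case: mF.
have kerF : forall a, cres FG a = 0 <-> idgen (augim (sinc B)) a := ker_mult cG evF l1 l2.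
have [Z' hZ'] := center_exists G.
(* F is central in G, so its inclusion factors through the center Z'; this makes F a closed
   super-subgroup F' of Z'. *)
have [n hn] : pt_in Z' (cres FG).
  by apply/hZ'; apply: (central_sub_pt cG); exists (idS FG).
have nh : hopf_hom n.
  split=> z; have [a <-] := cres_surj z; rewrite -hn; last by rewrite (cres_hopf FG).2 (cres_hopf Z').2.
  rewrite (cres_hopf FG).1 (cres_hopf Z').1; symmetry.
  have := tmap_comp (f := cres Z') (g := cres Z') (f' := n) (g' := n) _ _ _ _ (comul a).
  move=> h; etransitivity; first by apply: h => c x y; exact: linearP.
  by apply: eq_tlift => x y; rewrite /= -!hn.
have ns (b : FG) : exists z, n z = b.
  by have [a <-] := cres_surj b; exists (cres Z' a); rewrite -hn.
pose F' : closedSub Z' := ClosedSub nh ns.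
(* The functions on G/F restricted to Z' are those on Z'/F'; they inherit conilpotency, so F' is the
   multiplicative part of Z'. *)
pose B' := img_shopf (hopf_comp (cres_hopf Z') (sinc_hopf B)).
have B'_ex (b : subT B') : exists b0 : subT B, sinc B' b = cres Z' (sinc B b0).
  by have [b0 ->] := sincP b; exists b0.
have N' z : cres F' z = 0 <-> idgen (augim (sinc B')) z.
  split.
    have [a <-] := cres_surj z; rewrite -[cres F' _]hn => /kerF [s [sP ->]]; rewrite linear_sum.
    apply: (subspace_sum_seq (idgen_sub _)) => p /sP [b b0 eb].
    change (idgen (augim (sinc B')) (cres Z' (p.1 * p.2))); rewrite rmorphM; apply: idgen_mul; apply: idgen_in.
    have [b' eb'] : exists b' : subT B', sinc B' b' = cres Z' (sinc B b) by apply: sinc_ex; exists b.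
    exists b'; last by rewrite eb eb'.
    by rewrite -(sinc_hopf B').2 eb' (cres_hopf Z').2 (sinc_hopf B).2.
  move=> [s [sP ->]]; rewrite linear_sum big_seq big1 // => p /sP [b b0 eb].
  have [b1 e1] := B'_ex b.
  have e0 : n p.2 = 0.
    rewrite eb e1 -hn (coinv_cres (sincP b1 : coinv FG (sinc B b1))) -(cres_hopf Z').2 -e1 (sinc_hopf B').2 b0.
    by rewrite scale0r.
  by change (n (p.1 * p.2) = 0); transitivity (n p.1 * n p.2); [exact: rmorphM|rewrite e0 mulr0].
have u' : unipotent (ker_quot (sinc_hopf B') (@sinc_inj _ _ _) N').
  apply: conil_unipotent => b; have [b0 e] := B'_ex b.
  have [k hk] := unipotent_conil uB b0; exists k.
  apply: (cW_inc (sinc_hopf B') (@sinc_inj _ _ B')); rewrite e.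
  by apply: (cW_img (cres_hopf Z')); exact: (cW_img (sinc_hopf B)).
have N0 a : cres (sub_trans F') a = 0 <-> idgen (augim (sinc B)) a.
  by rewrite -kerF -[cres (sub_trans F') a]/(n (cres Z' a)) -hn.
exists Z', F'; split=> //; first by split=> //; exists (ker_quot (sinc_hopf B') (@sinc_inj _ _ _) N').
by exists (ker_quot (sinc_hopf B) (@sinc_inj _ _ _) N0).
Qed.

Theorem theorem7p4 (K : fieldType) (hK : 2%N \notin [pchar K])
    (Kbar : fieldType) (iota : {rmorphism K -> Kbar}) (hKbar : algebraic_closure iota)
    (G : supergroupType K) (hG : algebraic G) :
  [/\ (cond_a iota G -> cond_b iota G),
      (cond_b iota G -> cond_c G),
      (cond_c G -> cond_d iota G) &
      (connected G ->
        [/\ (cond_a iota G <-> cond_b iota G),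
            (cond_b iota G <-> cond_c G) &
            (cond_c G <-> cond_d iota G)])].
Proof.
have da := @cond_da K Kbar iota G hK hG.
have ab : cond_a iota G -> cond_b iota G by exact: cond_ab.
have bc : cond_b iota G -> cond_c G by exact: (cond_bc hK (hilbert_basis hG)).
have cd : cond_c G -> cond_d iota G by exact: (cond_cd hK hKbar hG).
split=> // conn; have {}da := da conn.
by split; split; auto.
Qed.
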